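(* Let $\mathfrak c$ be the real contact algebra of degree $n=1$ and $\mathfrak m$ the core with $\mathfrak m^{-2}=\mathfrak c^{-2}$, $\mathfrak m^{-1}=\mathfrak c^{-1}$, $\mathfrak m^{0(10)}=\mathfrak M^{0(10)}$, $\mathfrak m^{1(10)}=\mathfrak M^{1(10)}$, $\mathfrak m^{p(10)}=0$ for $p\ge2$. There exists a maximal model $\mathfrak g$ of type $\mathfrak m$ and it is unique up to isomorphism. It is given by the $8$-dimensional $\mathbb Z$-graded Lie subalgebra $\mathfrak g=\bigoplus_{p\in\mathbb Z}\mathfrak g^p$ of $\mathfrak c$ with components $$\mathfrak g^p=\begin{cases}0 & \text{for all } p<-2\text{ and }p>1,\\ \mathfrak c^p & \text{for } p=-2,-1,\\ \operatorname{Re}\langle E,M,\overline M\rangle & \text{for }p=0,\\ \operatorname{Re}\langle N,\overline N\rangle & \text{for }p=1,\end{cases}$$ where $M=z^2+z\bar z\in\mathfrak u^0$ and $N=z^3+2z^2\bar z+z\bar z^2-3iz-3i\bar z\in\mathfrak u^1$. The associated terms of the Freeman sequence are $$\mathfrak q_{-1}=\mathfrak q=\langle z,E,M,N\rangle,\quad \mathfrak q_0=\langle E,M,N\rangle,\quad \mathfrak q_1=\langle E,N\rangle,\quad \mathfrak q_2=\mathfrak q\cap\overline{\mathfrak q}=\langle E\rangle.$$ Moreover there is a $7$-dimensional $3$-nondegenerate homogeneous CR manifold $G/G_o$, $Lie(G)=\mathfrak g$, $Lie(G_o)=\mathbb RE$ (with CR algebra $(\mathfrak g,\mathfrak q)$),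 which is globally defined.
   Context: **Contact algebra.** Hats denote complexification and $\langle\cdots\rangle$ complex span; $\operatorname{Re}$ denotes the real points of a conjugation-invariant subspace of $\widehat{\mathfrak c}$. $\mathfrak c=\bigoplus_{p\ge-2}\mathfrak c^p$ is the maximal transitive prolongation of the Heisenberg algebra $\mathfrak c^{-2}\oplus\mathfrak c^{-1}$, $\mathfrak c^{-2}=\langle e^{-2}\rangle_{\mathbb R}$, $\mathfrak c^{-1}=\langle e_1,e_2\rangle_{\mathbb R}$, $[v,w]=B(v,w)e^{-2}$, $B(e_1,e_2)=1$ (i.e. the maximal graded Lie algebra with this negative part in which $X\in\mathfrak c^p$, $p\ge0$, $[X,\mathfrak c^{-1}]=0$ imply $X=0$). $E\in\mathfrak c^0$ is the grading element ($[E,X]=pX$ on $\mathfrak c^p$). Put $\mathfrak k^p=\{X\in\mathfrak c^p:[X,\mathfrak c^{-2}]=0\}$; $\mathfrak k^p\simeq S^{p+2}(\mathfrak c^{-1})$ for $p\ge-1$, with $$[v_1\cdots v_{p+2},\,w_1\cdots w_{q+2}]=\sum_{i,j}B(v_i,w_j)\,v_1\cdots\widehat{v_i}\cdots v_{p+2}\,w_1\cdots\widehat{w_j}\cdots w_{q+2}$$ (commutative symmetric products; here the hat means omission). $\mathfrak c^0=\mathfrak k^0\oplus\mathbb RE$ and $\mathfrak c^1=\mathfrak k^1\oplus\mu^1(\mathfrak c^{-1})$, where $\mu^1(X)\in\mathfrak c^1$, for $X\in\mathfrak c^{-1}$, is the element determined by $[\mu^1(X),e^{-2}]=X$ and $[\mu^1(X),v]=-\tfrac12B(X,v)E+\tfrac12Xv$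 for $v\in\mathfrak c^{-1}$ ($Xv\in S^2(\mathfrak c^{-1})=\mathfrak k^0$). Let $\mathfrak J\in\mathfrak k^0$ be the complex structure $\mathfrak Je_1=-e_2$, $\mathfrak Je_2=e_1$ of $\mathfrak c^{-1}$, and $z=\frac12(e_1-i\mathfrak Je_1)$, $\bar z$ its conjugate, a basis of $\widehat{\mathfrak c}^{-1}$ with $[z,\bar z]=-\frac i2e^{-2}$. In the expressions for $M$ and $N$, monomials of degree 2 (resp. 3) in $z,\bar z$ denote elements of $\widehat{\mathfrak k}^0$ (resp. $\widehat{\mathfrak k}^1$), and the linear terms $z,\bar z$ occurring in $N$ stand for $\mu^1(z),\mu^1(\bar z)\in\widehat{\mathfrak c}^1$. $\operatorname{ad}(\mathfrak J)$ is diagonalizable on $\widehat{\mathfrak c}^p$ with eigenvalues $im$, $m\in\mathbb Z$, $|m|\le p+2$. For $p\ge-1$, $\mathfrak M^{p(10)}$ is the eigenspace of eigenvalue $i(p+2)$ and $\mathfrak u^p$ is the sum of all eigenspaces of eigenvalue different from $-i(p+2)$; $\mathfrak u=\bigoplus_{p\ge-1}\mathfrak u^p$. $\operatorname{Aut}(\mathfrak c,\mathfrak J)$ is the group of graded automorphisms of $\mathfrak c$ commuting with $\operatorname{ad}(\mathfrak J)$. For a core, $\mathfrak m^p=\operatorname{Re}(\mathfrak m^{p(10)}\oplus\overline{\mathfrak m^{p(10)}})$ for $p\ge0$. **Models.** A model of type $\mathfrak m$ is a $\mathbb Z$-graded Lie subalgebra $\mathfrak g=\bigoplus\mathfrak g^p$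 of $\mathfrak c$ such that (i) $\mathfrak g^p=\mathfrak c^p$ for all $p<0$; (ii) $E\in\mathfrak g^0$; (iii) $\widehat{\mathfrak g}^p=(\widehat{\mathfrak g}^p\cap\mathfrak u^p)+(\widehat{\mathfrak g}^p\cap\overline{\mathfrak u}^p)$ for all $p\ge0$; (iv) the projection $\pi_{\mathfrak M^{p(10)}}:\widehat{\mathfrak c}^p\to\mathfrak M^{p(10)}$ along the other $\operatorname{ad}(\mathfrak J)$-eigenspaces satisfies $\pi_{\mathfrak M^{p(10)}}(\widehat{\mathfrak g}^p\cap\mathfrak u^p)=\mathfrak m^{p(10)}$ for all $p\ge0$. Models $\mathfrak g,\mathfrak g'$ are isomorphic if $\mathfrak g'=g\cdot\mathfrak g$ for some $g\in\operatorname{Aut}(\mathfrak c,\mathfrak J)$. A model not contained in any other model is called maximal. **Associated CR algebra and CR manifold.** $\mathfrak q=\widehat{\mathfrak g}\cap\mathfrak u$, $\mathfrak g_o=\mathfrak g\cap\mathfrak q$; the Freeman sequence is $\mathfrak q_{-1}=\mathfrak q$, $\mathfrak q_p=\{Z\in\mathfrak q_{p-1}:[Z,\overline{\mathfrak q}]\subset\mathfrak q_{p-1}+\overline{\mathfrak q}\}$. $(\mathfrak g,\mathfrak q)$ determines a germ of locally homogeneous CR manifold (a distribution $\mathcal D$ with complex structure $\mathcal J$ on its fibres and involutive $+i$-eigenbundle $\mathcal D^{10}$) with tangent space $\mathfrak g/\mathfrak g_o$ and $\mathcal D^{10}|_x\simeq\mathfrak q/(\mathfrak q\cap\overline{\mathfrak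 q})$; it is globally defined if it is realized on $G/G_o$ with $G_o$ closed in $G$. A CR manifold is $k$-nondegenerate if, with $\mathcal F^{10}_{-1}=\mathcal D^{10}$ and sections of $\mathcal F_p^{10}$ ($p\ge0$) given by $\{X\in\underline{\mathcal F}^{10}_{p-1}:[X,\underline{\mathcal D}^{01}]=0\bmod\underline{\mathcal F}^{10}_{p-1}\oplus\underline{\mathcal D}^{01}\}$ (underlining denotes sections, $\mathcal D^{01}=\overline{\mathcal D^{10}}$), one has $\mathcal F^{10}_{p}\neq0$ for $-1\le p\le k-2$ and $\mathcal F^{10}_{k-1}=0$. *)

(* Defs.v *)
From HB Require Import structures.
From mathcomp Require Import all_boot all_order all_algebra.
From mathcomp Require Import all_classical all_reals all_analysis.
From mathcomp.real_closed Require Import complex.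

Set Implicit Arguments.
Unset Strict Implicit.
Unset Printing Implicit Defensive.

Import Order.TTheory GRing.Theory Num.Theory numFieldNormedType.Exports.

Local Open Scope classical_set_scope.
Local Open Scope ring_scope.

Definition setsum (V : zmodType) (S T : set V) : set V :=
  [set x + y | x in S & y in T].

Section LinearAlgebra.
Variables (K : nzRingType) (V : lmodType K).

Definition subspace (S : set V) : Prop :=
  S 0 /\ forall (a : K) (x y : V), S x -> S y -> S (a *: x + y).

Definition lspan (S : set V) : set V :=
  [set v | exists (n : nat) (a : 'I_n -> K) (x : 'I_n -> V),
     (forall i, S (x i)) /\ v = \sum_i a i *: x i].

Definition basis_of (n : nat) (b : 'I_n -> V) (S : set V) : Prop :=
  lspan (range b) = S /\
  forall a : 'I_n -> K, \sum_i a i *: b i = 0 -> forall i, a i = 0.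

Definition has_dim (S : set V) (n : nat) : Prop :=
  exists b : 'I_n -> V, basis_of b S.

End LinearAlgebra.

Section Complexification.
Variables (R : realType) (V : lmodType R).

(* The pair (a, b) stands for a + i b. *)
Definition cplx : Type := (V * V)%type.

HB.instance Definition _ := GRing.Zmodule.copy cplx (V * V)%type.

Definition cscale (k : R[i]) (u : cplx) : cplx :=
  (complex.Re k *: u.1 - complex.Im k *: u.2,
   complex.Re k *: u.2 + complex.Im k *: u.1).

Fact cscaleA (a b : R[i]) (u : cplx) :
  cscale a (cscale b u) = cscale (a * b) u.
Proof.
case: a b u => [a a'] [b b'] [x y]; congr pair => /=;
  rewrite !(scalerBl, scalerDl, scalerBr, scalerDr, scalerA).
- by rewrite opprD opprD -!addrA; congr (_ + _); rewrite addrA addrC.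
- by rewrite -!addrA; congr (_ + _); rewrite addrA addrC.
Qed.

Fact cscale1 (u : cplx) : cscale 1 u = u.
Proof. by case: u => x y; rewrite /cscale /= !scale1r !scale0r subr0 addr0. Qed.

Fact cscaleDr : right_distributive cscale +%R.
Proof.
by move=> a [x y] [x' y']; congr pair => /=;
  rewrite !scalerDr ?opprD addrACA.
Qed.

Fact cscaleDl (u : cplx) : {morph cscale^~ u : a b / a + b}.
Proof.
move=> [a a'] [b b']; case: u => [x y]; congr pair => /=;
  by rewrite !scalerDl ?opprD addrACA.
Qed.

HB.instance Definition _ := GRing.Zmodule_isLmodule.Build R[i] cplx
  cscaleA cscale1 cscaleDr cscaleDl.

Definition cincl (x : V) : cplx := (x, 0).
Definition cconj (u : cplx) : cplx := (u.1, - u.2).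
Definition hat (S : set V) : set cplx := [set u | S u.1 /\ S u.2].
Definition Repart (W : set cplx) : set V := [set x | W (cincl x)].
Definition ci : R[i] := Complex 0 1.
Definition cspan (S : set cplx) : set cplx := @lspan R[i] cplx S.

(* C-bilinear extension of a real bilinear operation. *)
Definition cext2 (f : V -> V -> V) (u v : cplx) : cplx :=
  (f u.1 v.1 - f u.2 v.2, f u.1 v.2 + f u.2 v.1).

(* C-multilinear extension of an operation on finite lists of vectors. *)
Fixpoint cextseq_rec (f : seq V -> V) (acc : seq V) (us : seq cplx) : cplx :=
  if us is u :: us' then
    cextseq_rec f (rcons acc u.1) us' + ci *: cextseq_rec f (rcons acc u.2) us'
  else cincl (f acc).
Definition cextseq (f : seq V -> V) (us : seq cplx) : cplx :=
  cextseq_rec f [::] us.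

End Complexification.

Arguments ci {R}.

(* C-linear extension of a real linear map. *)
Definition cmap (R : realType) (V W : lmodType R) (f : V -> W) (u : cplx V) :
  cplx W := (f u.1, f u.2).

Record gradedLie (R : realType) := GradedLie {
  gl_car :> lmodType R;
  lbr : gl_car -> gl_car -> gl_car;
  gcomp : int -> set gl_car;
  lbrDl : forall (a : R) x y w, lbr (a *: x + y) w = a *: lbr x w + lbr y w;
  lbrDr : forall (a : R) x y w, lbr w (a *: x + y) = a *: lbr w x + lbr w y;
  lbrxx : forall x, lbr x x = 0;
  lbrJ : forall x y w, lbr x (lbr y w) + lbr y (lbr w x) + lbr w (lbr x y) = 0;
  gcomp_sub : forall p, subspace (gcomp p);
  gcomp_span : lspan (\bigcup_p gcomp p) = setT;
  gcomp_free : forall (s : seq int) (f : int -> gl_car), uniq s ->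
    (forall p, gcomp p (f p)) -> \sum_(p <- s) f p = 0 ->
    forall p, p \in s -> f p = 0;
  gcomp_br : forall p q x y, gcomp p x -> gcomp q y -> gcomp (p + q) (lbr x y)
}.

Arguments gcomp {R} g p _.

Section ContactAlgebra.
Variable R : realType.

(* f0, f1, f2 play the roles of e^{-2}, e_1, e_2. *)
Definition heisenberg_negative (h : gradedLie R) (f0 f1 f2 : h) : Prop :=
  [/\ forall p : int, p < -2 -> gcomp h p = [set 0],
      basis_of (fun _ : 'I_1 => f0) (gcomp h (-2)),
      basis_of (fun i : 'I_2 => if i == ord0 then f1 else f2) (gcomp h (-1)) &
      lbr f1 f2 = f0].

Definition transitive_graded (h : gradedLie R) : Prop :=
  forall (p : int) (X : h), 0 <= p -> gcomp h p X ->
    (forall v, gcomp h (-1) v -> lbr X v = 0) -> X = 0.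

Definition graded_hom (h h' : gradedLie R) (f : {linear h -> h'}) : Prop :=
  (forall p x, gcomp h p x -> gcomp h' p (f x)) /\
  (forall x y, f (lbr x y) = lbr (f x) (f y)).

(* The maximal transitive prolongation of the Heisenberg algebra: every
   transitive graded Lie algebra with the same negative part embeds into it,
   compatibly with the identification of the negative parts. *)
Record contactAlgebra := ContactAlgebra {
  ca_lie :> gradedLie R;
  em2 : ca_lie;
  e1 : ca_lie;
  e2 : ca_lie;
  ca_neg : heisenberg_negative em2 e1 e2;
  ca_trans : transitive_graded ca_lie;
  ca_max : forall (h : gradedLie R) (f0 f1 f2 : h),
    heisenberg_negative f0 f1 f2 -> transitive_graded h ->
    exists f : {linear h -> ca_lie},
      [/\ graded_hom f, injective f, f f0 = em2, f f1 = e1 & f f2 = e2]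
}.

Arguments em2 : clear implicits.
Arguments e1 : clear implicits.
Arguments e2 : clear implicits.

Variable c : contactAlgebra.

Notation ch := (cplx c).
Definition cbr : ch -> ch -> ch := cext2 (@lbr R c).

Definition grading_element (E : c) : Prop :=
  gcomp c 0 E /\ forall (p : int) X, gcomp c p X -> lbr E X = p%:~R *: X.

Definition kcomp (p : int) : set c :=
  gcomp c p `&` [set X | forall Y, gcomp c (-2) Y -> lbr X Y = 0].

(* Only the values of B on c^{-1} matter; B(e_1, e_2) = 1 follows from
   [e_1, e_2] = e^{-2}. *)
Definition is_symplectic_form (B : c -> c -> R) : Prop :=
  forall v w, gcomp c (-1) v -> gcomp c (-1) w -> lbr v w = B v w *: em2 c.

Definition omit (T : Type) (i : nat) (s : seq T) : seq T :=
  take i s ++ drop i.+1 s.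

Definition in_cm1 (vs : seq c) : Prop := forall v, v \in vs -> gcomp c (-1) v.

(* [S [:: v_1; ...; v_k]] is the element of k^{k-2} identified with the
   symmetric product v_1 ... v_k; the clauses say that S induces isomorphisms
   S^k(c^{-1}) -> k^{k-2} under which the bracket is the displayed one. *)
Record symmetric_product (B : c -> c -> R) (S : seq c -> c) : Prop := {
  symp0 : S [::] = em2 c;
  symp1 : forall v, gcomp c (-1) v -> S [:: v] = v;
  symp_perm : forall vs ws, in_cm1 vs -> perm_eq vs ws -> S vs = S ws;
  symp_lin : forall (a : R) v w vs, in_cm1 (v :: w :: vs) ->
    S ((a *: v + w) :: vs) = a *: S (v :: vs) + S (w :: vs);
  symp_basis : forall k : nat,
    basis_of (fun j : 'I_k.+1 => S (nseq (k - j) (e1 c) ++ nseq j (e2 c)))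
             (kcomp (k%:Z - 2));
  symp_br : forall vs ws, in_cm1 vs -> in_cm1 ws ->
    (0 < size vs)%N -> (0 < size ws)%N ->
    lbr (S vs) (S ws) =
      \sum_(i < size vs) \sum_(j < size ws)
        B (nth 0 vs i) (nth 0 ws j) *: S (omit i vs ++ omit j ws)
}.

Definition is_mu1 (B : c -> c -> R) (S : seq c -> c) (E : c) (mu : c -> c) :
  Prop :=
  forall X, gcomp c (-1) X ->
    [/\ gcomp c 1 (mu X), lbr (mu X) (em2 c) = X &
        forall v, gcomp c (-1) v ->
          lbr (mu X) v = - (2^-1 * B X v) *: E + 2^-1 *: S [:: X; v]].

Definition is_complex_structure (J : c) : Prop :=
  [/\ kcomp 0 J, lbr J (e1 c) = - e2 c & lbr J (e2 c) = e1 c].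

Variable J : c.

Definition adeigen (p : int) (l : R[i]) : set ch :=
  hat (gcomp c p) `&` [set X | cbr (cincl J) X = l *: X].

(* Sum of the eigenspaces of ad J on c^p with eigenvalue different from l. *)
Definition adeigen_other (p : int) (l : R[i]) : set ch :=
  cspan (\bigcup_(m in [set m | m <> l]) adeigen p m).

Definition M10 (p : int) : set ch := adeigen p (ci * (p + 2)%:~R).

Definition up (p : int) : set ch := adeigen_other p (- (ci * (p + 2)%:~R)).

Definition utot : set ch := cspan (\bigcup_(p in [set p : int | -1 <= p]) up p).

(* Image of W under the projection of c^p onto M^{p(10)} along the other
   eigenspaces. *)
Definition projM10 (p : int) (W : set ch) : set ch :=
  [set Y | M10 p Y /\
     exists2 X, W X & adeigen_other p (ci * (p + 2)%:~R) (X - Y)].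

Definition gpart (g : set c) (p : int) : set c := g `&` gcomp c p.

Definition graded_subalgebra (g : set c) : Prop :=
  [/\ subspace g,
      (forall X Y, g X -> g Y -> g (lbr X Y)) &
      g = lspan (\bigcup_p gpart g p)].

(* [m p] is the component m^{p(10)} of the core, used for p >= 0 only; all the
   cores have m^{-2} = c^{-2} and m^{-1} = c^{-1}. *)
Record model (E : c) (m : int -> set ch) (g : set c) : Prop := {
  model_sub : graded_subalgebra g;
  model_neg : forall p : int, p < 0 -> gpart g p = gcomp c p;
  model_E : gpart g 0 E;
  model_sum : forall p : int, 0 <= p ->
    hat (gpart g p) = setsum (hat (gpart g p) `&` up p)
                             (hat (gpart g p) `&` (@cconj R c @` up p));
  model_proj : forall p : int, 0 <= p ->
    projM10 p (hat (gpart g p) `&` up p) = m p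
}.

(* Maximality is among the models of the same type: c itself satisfies (i)-(iii)
   and contains every model. *)
Definition maximal_model (E : c) (m : int -> set ch) (g : set c) : Prop :=
  model E m g /\ forall g', model E m g' -> g `<=` g' -> g' = g.

Definition AutcJ (f : {linear c -> c}) : Prop :=
  [/\ graded_hom f, bijective f & forall X, f (lbr J X) = lbr J (f X)].

Definition isomorphic_models (g g' : set c) : Prop :=
  exists f : {linear c -> c}, AutcJ f /\ g' = f @` g.

Definition core_m (p : int) : set ch :=
  if p <= 1 then M10 p else [set 0].

Definition qalg (g : set c) : set ch := hat g `&` utot.

Definition go_alg (g : set c) : set c := g `&` Repart (qalg g).

(* [freeman q n] is q_{n-1}. *)
Fixpoint freeman (q : set ch) (n : nat) : set ch :=
  if n is n'.+1 then
    [set Z | freeman q n' Z /\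
       forall W, q W -> setsum (freeman q n') (@cconj R c @` q) (cbr Z (cconj W))]
  else q.

Definition zel : ch := (2^-1 : R[i]) *: (cincl (e1 c) - ci *: cincl (lbr J (e1 c))).
Definition zbel : ch := cconj zel.

Definition Mel (S : seq c -> c) : ch :=
  cextseq S [:: zel; zel] + cextseq S [:: zel; zbel].

Definition Nel (S : seq c -> c) (mu : c -> c) : ch :=
  cextseq S [:: zel; zel; zel] + (2 : R[i]) *: cextseq S [:: zel; zel; zbel]
  + cextseq S [:: zel; zbel; zbel]
  - (3 * ci) *: cmap mu zel - (3 * ci) *: cmap mu zbel.

End ContactAlgebra.

Section Smooth.
Variable R : realType.

(* Iterated directional derivatives. *)
Definition iterD (V W : normedModType R) (vs : seq V) (f : V -> W) : V -> W :=
  foldr (fun v h => 'D_v h) f vs.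

(* f is C^oo on the open set U; its values outside U are irrelevant. *)
Definition smooth_on (V W : normedModType R) (U : set V) (f : V -> W) : Prop :=
  open U /\ forall (vs : seq V) x, U x -> differentiable (iterD vs f) x.

End Smooth.

(* [chart_at x] is a preferred chart around x; the coordinates in it identify
   the tangent space at x with 'rV_n. [crdV i] is the inverse of [crd i]. *)
Record manifold (R : realType) (n : nat) := Manifold {
  mf_pt :> topologicalType;
  mf_hausdorff : hausdorff_space mf_pt;
  mf_countable : @second_countable mf_pt;
  chart : Type;
  cdom : chart -> set mf_pt;
  crd : chart -> mf_pt -> 'rV[R]_n;
  crdV : chart -> 'rV[R]_n -> mf_pt;
  chart_at : mf_pt -> chart;
  cdom_open : forall i, open (cdom i);
  mem_chart_at : forall x, cdom (chart_at x) x;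
  crd_open : forall i, open (crd i @` cdom i);
  crdK : forall i x, cdom i x -> crdV i (crd i x) = x;
  crd_cont : forall i x, cdom i x -> {for x, continuous (crd i)};
  crdV_cont : forall i x, cdom i x -> {for crd i x, continuous (crdV i)};
  crd_compat : forall i j,
    smooth_on (crd i @` (cdom i `&` cdom j)) (crd j \o crdV i)
}.

Section Manifolds.
Variable R : realType.

Definition smooth_map (m n : nat) (X : manifold R m) (Y : manifold R n)
    (f : X -> Y) : Prop :=
  continuous f /\
  forall (i : chart X) (j : chart Y),
    smooth_on (crd i @` (cdom i `&` f @^-1` cdom j))
              (crd j \o f \o crdV i).

(* Smoothness of a map defined on a product manifold. *)
Definition smooth_map2 (l m n : nat) (X : manifold R l) (Y : manifold R m)
    (Z : manifold R n) (f : X -> Y -> Z) : Prop :=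
  continuous (fun p : X * Y => f p.1 p.2) /\
  forall (i : chart X) (j : chart Y) (k : chart Z),
    smooth_on
      [set v : 'rV[R]_l * 'rV[R]_m | exists x y,
         [/\ cdom i x, cdom j y, cdom k (f x y) & v = (crd i x, crd j y)]]
      (fun v => crd k (f (crdV i v.1) (crdV j v.2))).

(* Tangent map, in the preferred charts at x and at f x. *)
Definition tmap (m n : nat) (X : manifold R m) (Y : manifold R n)
    (f : X -> Y) (x : X) : 'rV[R]_m -> 'rV[R]_n :=
  'd (crd (chart_at (f x)) \o f \o crdV (chart_at x)) (crd (chart_at x) x).

Section VectorFields.
Variables (n : nat) (X : manifold R n).

(* A vector field V is given by its values in the preferred charts; [vf_in V i]
   is its expression in the chart i. *)
Definition vf_in (V : X -> 'rV[R]_n) (i : chart X) (v : 'rV[R]_n) : 'rV[R]_n :=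
  let x := crdV i v in
  'd (crd i \o crdV (chart_at x)) (crd (chart_at x) x) (V x).

Definition smooth_vf_on (U : set X) (V : X -> 'rV[R]_n) : Prop :=
  forall i, smooth_on (crd i @` (cdom i `&` U)) (vf_in V i).

Definition vf_br (V W : X -> 'rV[R]_n) (x : X) : 'rV[R]_n :=
  let i := chart_at x in
  let v := crd i x in
  'D_(vf_in V i v) (vf_in W i) v - 'D_(vf_in W i v) (vf_in V i) v.

Definition cvf : Type := X -> cplx 'rV[R]_n.

Definition smooth_cvf (Z : cvf) : Prop :=
  smooth_vf_on setT (fun x => (Z x).1) /\ smooth_vf_on setT (fun x => (Z x).2).

Definition cvf_br (Z W : cvf) : cvf := fun x =>
  (vf_br (fun y => (Z y).1) (fun y => (W y).1) x
     - vf_br (fun y => (Z y).2) (fun y => (W y).2) x,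
   vf_br (fun y => (Z y).1) (fun y => (W y).2) x
     + vf_br (fun y => (Z y).2) (fun y => (W y).1) x).

Definition sections (D : X -> set (cplx 'rV[R]_n)) : set cvf :=
  [set Z | smooth_cvf Z /\ forall x, D x (Z x)].

(* The +i-eigenbundle of the complex linear extension of JJ. *)
Definition D10 (D : X -> set 'rV[R]_n) (JJ : X -> 'rV[R]_n -> 'rV[R]_n)
    (x : X) : set (cplx 'rV[R]_n) :=
  hat (D x) `&` [set w | cmap (JJ x) w = ci *: w].

Definition D01 (D : X -> set 'rV[R]_n) (JJ : X -> 'rV[R]_n -> 'rV[R]_n)
    (x : X) : set (cplx 'rV[R]_n) :=
  @cconj R 'rV[R]_n @` D10 D JJ x.

(* [JJ x] is only relevant on [D x]. *)
Record CR_structure (D : X -> set 'rV[R]_n)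
    (JJ : X -> 'rV[R]_n -> 'rV[R]_n) : Prop := {
  CR_stable : forall x v, D x v -> D x (JJ x v);
  CR_lin : forall x (a : R) v w, D x v -> D x w ->
    JJ x (a *: v + w) = a *: JJ x v + JJ x w;
  CR_square : forall x v, D x v -> JJ x (JJ x v) = - v;
  CR_frame : exists r : nat, forall x0 : X,
    exists (U : set X) (V : 'I_r -> X -> 'rV[R]_n),
      [/\ open U, U x0,
          forall i, smooth_vf_on U (V i),
          forall i, smooth_vf_on U (fun x => JJ x (V i x)) &
          forall x, U x -> basis_of (fun i => V i x) (D x)];
  CR_involutive : forall Z W, sections (D10 D JJ) Z -> sections (D10 D JJ) W ->
    sections (D10 D JJ) (cvf_br Z W)
}.

(* [freemanCR D JJ p] is the set of sections of F^{10}_{p-1}. *)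
Fixpoint freemanCR (D : X -> set 'rV[R]_n) (JJ : X -> 'rV[R]_n -> 'rV[R]_n)
    (p : nat) : set cvf :=
  if p is p'.+1 then
    [set Z | freemanCR D JJ p' Z /\
       forall W, sections (D01 D JJ) W ->
         exists Z' W', [/\ freemanCR D JJ p' Z', sections (D01 D JJ) W' &
                           forall x, cvf_br Z W x = Z' x + W' x]]
  else sections (D10 D JJ).

Definition k_nondegenerate (D : X -> set 'rV[R]_n)
    (JJ : X -> 'rV[R]_n -> 'rV[R]_n) (k : nat) : Prop :=
  (forall p, (p < k)%N -> exists Z, freemanCR D JJ p Z /\ exists x, Z x <> 0) /\
  (forall Z, freemanCR D JJ k Z -> forall x, Z x = 0).

End VectorFields.

End Manifolds.

Record lieGroup (R : realType) (n : nat) := LieGroup {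
  lg_man :> manifold R n;
  lmul : lg_man -> lg_man -> lg_man;
  lone : lg_man;
  linv : lg_man -> lg_man;
  lmulA : forall x y z, lmul x (lmul y z) = lmul (lmul x y) z;
  lmul1g : forall x, lmul lone x = x;
  lmulVg : forall x, lmul (linv x) x = lone;
  lmul_smooth : smooth_map2 lmul;
  linv_smooth : smooth_map linv
}.

Section LieGroups.
Variables (R : realType) (n : nat) (G : lieGroup R n).

(* Left invariant vector field with value v at the identity. *)
Definition left_inv (v : 'rV[R]_n) : G -> 'rV[R]_n :=
  fun g => tmap (lmul g) (lone G) v.

(* The bracket of Lie(G) = T_e G. *)
Definition lie_br (v w : 'rV[R]_n) : 'rV[R]_n :=
  vf_br (left_inv v) (left_inv w) (lone G).

Definition closed_subgroup (H : set G) : Prop :=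
  [/\ closed H, H (lone G), forall x y, H x -> H y -> H (lmul x y) &
      forall x, H x -> H (linv x)].

Definition one_param (a : R -> G) : Prop :=
  [/\ forall s t, a (s + t) = lmul (a s) (a t), continuous a &
      forall i : chart G, smooth_on (a @^-1` cdom i) (crd i \o a)].

Definition velocity0 (a : R -> G) : 'rV[R]_n :=
  'D_(1 : R) (crd (chart_at (lone G)) \o a) (0 : R).

(* Lie(H) as a subspace of T_e G, for H a closed subgroup. *)
Definition Lie_of (H : set G) : set 'rV[R]_n :=
  [set v | exists a, [/\ one_param a, forall t, H (a t) & velocity0 a = v]].

Variables (d : nat) (X : manifold R d).

(* X is the homogeneous space G/H, with base point o = eH. *)
Definition homogeneous_space (H : set G) (act : G -> X -> X) (o : X) : Prop :=
  [/\ closed_subgroup H, smooth_map2 act,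
      (forall x, act (lone G) x = x) /\
      (forall g h x, act (lmul g h) x = act g (act h x)),
      forall x, exists g, act g o = x &
      H = [set g | act g o = o]].

Definition invariant_CR (act : G -> X -> X) (D : X -> set 'rV[R]_d)
    (JJ : X -> 'rV[R]_d -> 'rV[R]_d) : Prop :=
  forall g x,
    tmap (act g) x @` D x = D (act g x) /\
    forall v, D x v -> tmap (act g) x (JJ x v) = JJ (act g x) (tmap (act g) x v).

End LieGroups.

Section Realization.
Variables (R : realType) (c : contactAlgebra R) (J : c) (g : set c).

(* phi identifies g with Lie(G). *)
Definition Lie_identification (n : nat) (G : lieGroup R n)
    (phi : c -> 'rV[R]_n) : Prop :=
  [/\ forall (a : R) X Y, g X -> g Y -> phi (a *: X + Y) = a *: phi X + phi Y,
      forall X, g X -> phi X = 0 -> X = 0,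
      phi @` g = setT &
      forall X Y, g X -> g Y -> phi (lbr X Y) = lie_br G (phi X) (phi Y)].

(* The CR algebra of the homogeneous CR manifold (G/H, D, JJ) is (g, q) with
   q = qalg J g: under X |-> d(orbit map)_e (phi X) one has T_o(G/H) = g/g_o
   and D^{10}_o is the image of q, i.e. q/(q :&: conj q). *)
Definition CR_algebra_is (n d : nat) (G : lieGroup R n) (X : manifold R d)
    (act : G -> X -> X) (o : X) (D : X -> set 'rV[R]_d)
    (JJ : X -> 'rV[R]_d -> 'rV[R]_d) (phi : c -> 'rV[R]_n) : Prop :=
  let ev := fun Y : c => tmap (act^~ o) (lone G) (phi Y) in
  [/\ ev @` g = setT,
      forall Y, g Y -> (ev Y = 0 <-> go_alg J g Y) &
      D10 D JJ o = cmap ev @` qalg J g].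

(* There is a globally defined k-nondegenerate homogeneous CR manifold G/H of
   dimension d with dim G = n, Lie(G) = g, Lie(H) = ho and CR algebra (g, q). *)
Definition globally_defined_CR (n d k : nat) (ho : set c) : Prop :=
  exists (G : lieGroup R n) (H : set G) (X : manifold R d)
         (act : G -> X -> X) (o : X) (phi : c -> 'rV[R]_n)
         (D : X -> set 'rV[R]_d) (JJ : X -> 'rV[R]_d -> 'rV[R]_d),
    homogeneous_space H act o /\
    [/\ Lie_identification G phi,
        Lie_of H = phi @` ho,
        CR_structure D JJ /\ invariant_CR act D JJ,
        CR_algebra_is act o D JJ phi &
        k_nondegenerate D JJ k].

End Realization.

(* Main.v *)
Require Import Defs.
From HB Require Import structures.
From mathcomp Require Import ring lra.
From mathcomp.real_closed Require Import complex.
From mathcomp Require Import all_boot all_order all_algebra.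
From mathcomp Require Import all_classical all_reals all_analysis.

(** In degrees [<= 1] everything is a finite linear algebra problem in the basis [e^-2],
  [e_i], [E], [e_i e_j], [e_i e_j e_k], [mu e_i] of the contact algebra.

  Uniqueness. Since [J] kills [c^-2], iterating [ad zbar] (resp. [ad z]) [p + 2] times sends [c^p]
  to [c^-2] and vanishes on all the eigenspaces of [ad J] on [c^p] except that of eigenvalue
  [i(p + 2)] (resp. [- i(p + 2)]).  The conditions (iii)-(iv) on a model [g] become linear
  equations for the components of [g^0], [g^1], [g^2].  In degree 0 they give two elements [r1],
  [r2] of [g^0] depending on [(u, v)], and [[r1, r2]] shows that either [u^2 + v^2 = 1] or [J]
  lies in [g]; the latter would give [e_1^3] and [e_1^2 e_2] in [g], against the equation in
  degree 2.  A rotation of [(e_1, e_2)], which extends to an automorphism commuting with [J],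
  normalises [(u, v)] to [(1, 0)], that is, [e_1^2] and [e_1 e_2] lie in [g].  Then [g^1] is
  spanned by [e_1^3] and [n = e_1^2 e_2 - 6 mu e_1], the equation in degree 2 kills [g^2], and
  transitivity kills the rest.

  CR manifold. The algebra [g] is the semidirect product of [gl_2] and the cubic representation
  [S^3], so [G] is the open subset of [R^8] of the pairs [(A, v)] with [det A <> 0].  [G / G_o] is
  the product of [SL_2] and [R^4], covered by one chart; [g / g_o] gives a global frame on it, in
  which the invariant CR structure has constant coefficients, so that the Freeman sequence of
  sections is computed coordinate by coordinate. *)

Set Implicit Arguments.
Unset Strict Implicit.
Unset Printing Implicit Defensive.

Import Order.TTheory GRing.Theory Num.Theory numFieldNormedType.Exports.

Local Open Scope classical_set_scope.
Local Open Scope ring_scope.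

(** * Smooth maps *)

Section SmoothClosure.
Variables (R : realType) (V : normedModType R).
Implicit Types (W : normedModType R) (U : set V).

(** In degrees at least 2 the data describe only the subspaces k^p of the contact algebra, so no
    basis is used there: an element is determined by its brackets with two vectors of degree -1, and
    the condition in degree 2 is read in degree 1 after one bracket. The rotations come from the
    universal property, applied to the algebra itself with a rotated negative part. Every model is
    rotated to one and the same algebra, which gives maximality and uniqueness together. The abelian
    ideal S^3 of g is spanned by e^-2, e_1, e_1^2, e_1^3, and gl_2 by e_2, e_1 e_2, E, n. The
    isotropy E has nonzero trace, so sl_2 and S^3 span a complement of it: the group of pairs (A, v)
    with det A = 1 acts simply transitively, and its left-invariant fields are the global frame. The
    other elements of G only rescale the frame by powers of the determinant. The frame is graded
    like g, and the Freeman sequence of sections is a filtration by degree. *)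

Lemma near_eq_differentiable W (f g : V -> W) x :
  (\near x, f x = g x) -> differentiable f x -> differentiable g x.
Proof.
move=> fg /diff_locallyP [cdf /eqaddoP df].
have dg : g \o shift x = cst (g x) + 'd f x +o_ 0 id.
  apply/eqaddoP => e e0; have := df e e0.
  have fg0 : \forall h \near (0 : V), f (h + x) = g (h + x).
    by move: fg; rewrite (near_shift 0) subr0.
  apply: filterS2 fg0 => h fgh.
  by rewrite !fctE /= fgh (nbhs_singleton fg).
apply/diff_locallyP; have -> // : 'd g x = 'd f x :> (V -> W).
exact: diff_unique.
Qed.

(* Unlike [smooth_on], this notion is stable under the operations below by a plain induction
  on the order [k]. *)
Fixpoint Ck W U (k : nat) (f : V -> W) : Prop :=
  (forall x, U x -> differentiable f x) /\
  (if k is k'.+1 then forall v, Ck U k' ('D_v f) else True).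

Lemma CkS W U k (f : V -> W) : Ck U k.+1 f -> Ck U k f.
Proof.
elim: k f => [|k IH] f [df Df]; split => // v.
by apply: IH; exact: Df.
Qed.

Lemma Ck_differentiable W U k (f : V -> W) x :
  Ck U k f -> U x -> differentiable f x.
Proof. by case: k => [|k] [df _]; exact: df. Qed.

Lemma Ck_derive W U k (f : V -> W) v : Ck U k.+1 f -> Ck U k ('D_v f).
Proof. by move=> [_ /(_ v)]. Qed.

(** In [iterD] the last vector of the list is the first direction of differentiation, hence the
    induction on the list from its end. *)
Lemma smooth_onP W U (f : V -> W) :
  smooth_on U f <-> open U /\ forall k, Ck U k f.
Proof.
split=> [[oU sf]|[oU Cf]].
  split=> // k; elim: k f sf => [|k IH] f sf; (split; first by move=> x Ux; exact: (sf [::])) => //.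
  move=> v; apply: IH => vs x Ux; have := sf (rcons vs v) x Ux.
  by rewrite /Defs.iterD -cats1 foldr_cat.
split=> // vs; elim/last_ind: vs f Cf => [|vs v IH] f Cf x Ux.
  exact: (Ck_differentiable (Cf 0%N)).
rewrite /Defs.iterD -cats1 foldr_cat; apply: IH => // k.
exact: Ck_derive (Cf k.+1).
Qed.

Lemma Ck_eq W U k (f g : V -> W) : open U -> (forall x, U x -> f x = g x) ->
  Ck U k f -> Ck U k g.
Proof.
move=> oU; elim: k f g => [|k IH] f g fg [df Df]; split => //.
- move=> x Ux; apply: near_eq_differentiable (df x Ux).
  by move: (open_nbhs_nbhs (conj oU Ux)); apply: filterS.
- move=> x Ux; apply: near_eq_differentiable (df x Ux).
  by move: (open_nbhs_nbhs (conj oU Ux)); apply: filterS.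
- move=> v; apply: IH (Df v) => x Ux; apply: near_eq_derive.
  by move: (open_nbhs_nbhs (conj oU Ux)); apply: filterS.
Qed.

Lemma Ck_cst W U k (a : W) : open U -> Ck U k (fun=> a).
Proof.
move=> oU; elim: k a => [|k IH] a; split=> // v.
by apply: (Ck_eq oU _ (IH 0)) => x Ux; rewrite derive_cst.
Qed.

Lemma Ck_linear W U k (f : {linear V -> W}) : open U -> continuous f ->
  Ck U k f.
Proof.
move=> oU cf; case: k => [|k]; split=> //;
  try by move=> x _; exact: linear_differentiable.
move=> v; apply: (Ck_eq oU _ (Ck_cst k (f v) oU)) => x Ux.
by rewrite deriveE ?diff_lin //; exact: linear_differentiable.
Qed.

Lemma CkD W U k (f g : V -> W) : open U -> Ck U k f -> Ck U k g ->
  Ck U k (fun x => f x + g x).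
Proof.
move=> oU; elim: k f g => [|k IH] f g [df Df] [dg Dg]; split=> //;
  try by move=> x Ux; apply: differentiableD; auto.
move=> v; apply: (Ck_eq oU _ (IH _ _ (Df v) (Dg v))) => x Ux.
by rewrite deriveD //; apply: diff_derivable; auto.
Qed.

Lemma CkN W U k (f : V -> W) : open U -> Ck U k f -> Ck U k (fun x => - f x).
Proof.
move=> oU; elim: k f => [|k IH] f [df Df]; split=> //;
  try by move=> x Ux; apply: differentiableN; auto.
move=> v; apply: (Ck_eq oU _ (IH _ (Df v))) => x Ux.
by rewrite deriveN //; apply: diff_derivable; auto.
Qed.

Lemma CkM U k (f g : V -> R) : open U -> Ck U k f -> Ck U k g ->
  Ck U k (fun x => f x * g x).
Proof.
move=> oU; elim: k f g => [|k IH] f g Cf Cg; split=> //;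
  try by move=> x Ux; apply: differentiableM; apply: Ck_differentiable Ux; eauto.
move=> v; apply: (Ck_eq oU (f := fun x => f x * 'D_v g x + g x * 'D_v f x)).
  by move=> x Ux; rewrite deriveM //; apply: diff_derivable;
    apply: Ck_differentiable Ux; eauto.
by apply: CkD => //; apply: IH => //; first [exact: CkS | exact: Ck_derive].
Qed.

Lemma CkV U k (f : V -> R) : open U -> (forall x, U x -> f x != 0) ->
  Ck U k f -> Ck U k (fun x => (f x)^-1).
Proof.
move=> oU f0; elim: k => [|k IH] Cf; split=> //;
  try by move=> x Ux; apply: differentiableV; [apply: Ck_differentiable Cf Ux|auto].
move=> v; apply: (Ck_eq oU (f := fun x => - ((f x)^-1 * (f x)^-1 * 'D_v f x))).
  move=> x Ux; have df : derivable f x v.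
    by apply: diff_derivable; apply: Ck_differentiable Cf Ux.
  rewrite [RHS](deriveV (f0 x Ux) df) scaleNr.
  by rewrite /GRing.scale /= expr2 invfM.
apply: CkN => //; apply: CkM => //; last exact: Ck_derive.
by apply: CkM => //; apply: IH; exact: CkS.
Qed.

(** The chain rule for the exponential serves the one-parameter subgroups of the stabiliser. *)
Lemma derive_expR_comp (f : V -> R) x v : differentiable f x ->
  differentiable (fun y => expR (f y)) x /\
  'D_v (fun y => expR (f y)) x = expR (f x) * 'D_v f x.
Proof.
move=> df; have de : differentiable (expR : R -> R) (f x).
  by apply/derivable1_diffP; exact: derivable_expR.
have dc : differentiable (expR \o f) x by exact: differentiable_comp.
split=> //; rewrite deriveE //.
rewrite (_ : (fun y => expR (f y)) = expR \o f) // diff_comp //=.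
have -> : 'd (expR : R -> R) (f x) = ( *:%R^~ (expR (f x))) :> (R -> R).
  rewrite deriv1E; last exact: derivable_expR.
  by rewrite derive1E (congr1 (fun g => g _) (exp.derive_expR _)).
by rewrite deriveE // /GRing.scale /= mulrC.
Qed.

Lemma Ck_expR U k (f : V -> R) : open U -> Ck U k f ->
  Ck U k (fun x => expR (f x)).
Proof.
move=> oU; elim: k => [|k IH] Cf; split=> //.
- by move=> x Ux; have [] := derive_expR_comp 0 (Ck_differentiable Cf Ux).
- by move=> x Ux; have [] := derive_expR_comp 0 (Ck_differentiable Cf Ux).
move=> v; apply: (Ck_eq oU (f := fun x => expR (f x) * 'D_v f x)).
  by move=> x Ux; have [_ ->] := derive_expR_comp v (Ck_differentiable Cf Ux).
by apply: CkM => //; [apply: IH; exact: CkS|exact: Ck_derive].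
Qed.

Section Rows.
Variable n : nat.

Lemma differentiable_row (f : V -> 'rV[R]_n) x :
  (forall i, differentiable (fun y => f y 0 i) x) -> differentiable f x.
Proof.
move=> df; have -> : f = \sum_(i < n) (fun y => f y 0 i *: delta_mx 0 i).
  apply/funext => y; rewrite fct_sumE; apply/rowP => j.
  rewrite summxE (bigD1 j) //= !mxE !eqxx mulr1 big1 ?addr0 // => i ij.
  by rewrite !mxE eqxx eq_sym (negPf ij) mulr0.
by apply: differentiable_sum => i; exact: differentiableZl.
Qed.

Lemma derive_row (f : V -> 'rV[R]_n) x v i :
  differentiable f x -> ('D_v f x) 0 i = 'D_v (fun y => f y 0 i) x.
Proof.
by move=> df; rewrite derive_mx ?mxE //; exact: diff_derivable.
Qed.

Lemma differentiable_row_coord (f : V -> 'rV[R]_n) x i :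
  differentiable f x -> differentiable (fun y => f y 0 i) x.
Proof.
move=> df; rewrite (_ : (fun y => _) = (fun N : 'rV[R]_n => N 0 i) \o f) //.
by apply: differentiable_comp => //; exact: differentiable_coord.
Qed.

Lemma Ck_row U k (f : V -> 'rV[R]_n) : open U ->
  (forall i, Ck U k (fun y => f y 0 i)) <-> Ck U k f.
Proof.
move=> oU; elim: k f => [|k IH] f; split.
- by move=> Cf; split=> // x Ux; apply: differentiable_row => i; case: (Cf i); auto.
- by move=> [df _] i; split=> // x Ux; apply: differentiable_row_coord; auto.
- move=> Cf.
  have df x : U x -> differentiable f x.
    by move=> Ux; apply: differentiable_row => i; case: (Cf i); auto.
  split=> // v; apply/IH => i.
  by apply: (Ck_eq oU _ (Ck_derive v (Cf i))) => x Ux; rewrite derive_row; auto.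
- move=> [df Df] i; split=> [x Ux|v].
    by apply: differentiable_row_coord; auto.
  have /IH /(_ i) := Df v; apply: Ck_eq => // x Ux.
  by rewrite derive_row; auto.
Qed.

End Rows.

End SmoothClosure.

(** * Open subsets of a Euclidean space as manifolds *)

Section SecondCountable.
Variables (R : realType) (n : nat).

(** The open cubes with a rational centre and a radius [1/(k+1)] form a countable base. *)
Lemma second_countable_row : @second_countable 'rV[R]_n.
Proof.
pose bl (p : 'rV[rat]_n * nat) : set 'rV[R]_n :=
  [set x | forall i, `|ratr (p.1 0 i) - x 0 i| < p.2.+1%:R^-1].
have obl p : open (bl p).
  rewrite openE => x bx; rewrite /interior.
  have bx' : forall i j, nbhs (x i j) [set y : R | `|ratr (p.1 0 j) - y| < p.2.+1%:R^-1].
    move=> i j; rewrite (ord1 i).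
    have : open [set y : R | `|ratr (p.1 0 j) - y| < p.2.+1%:R^-1].
      rewrite (_ : [set _ | _] = ball (ratr (p.1 0 j) : R) p.2.+1%:R^-1) //.
      exact: ball_open.
    by move=> oB; apply: open_nbhs_nbhs; split => //; exact: bx.
  exists (fun i j => [set y : R | `|ratr (p.1 0 j) - y| < p.2.+1%:R^-1]) => //.
  by move=> y /= yP i; exact: yP.
exists (range bl); first exact: card_le_trans (card_image_le _ _) (countableP _).
split=> [_ [p _ <-]|x A] //.
move=> [P Px sPA].
have [e e0 he] : exists2 e : R, 0 < e & forall i j, ball (x i j) e `<=` P i j.
  have /nbhs_ballP [e /= e0 he] : nbhs x [set y : 'rV[R]_n | forall i j, P i j (y i j)].
    by exists P.
  exists e => // i j y xy.
  (* A test matrix that differs from [x] in one entry: it lies in the ball of radius [e], hence in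
     the box. *)
  have := he (\matrix_(k, l) if (k == i) && (l == j) then y else x k l).
  rewrite /ball /= /mx_ball => /(_ _ i j); rewrite !mxE !eqxx; apply.
  split => // k l; rewrite mxE; case: ifP => [/andP[/eqP -> /eqP ->] //|_].
  exact: ballxx.
have [k ke] : exists k : nat, k.+1%:R^-1 < e / 2 :> R.
  have e20 : 0 < e / 2 by rewrite divr_gt0.
  exists (Num.bound (e / 2)^-1); rewrite invf_plt ?posrE ?ltr0n //.
  apply: lt_trans (archi_boundP _) _; first by rewrite invr_ge0 ltW.
  by rewrite ltr_nat.
(* Each coordinate is approximated within [1/(k+1) < e/2], so that the cube of radius [1/(k+1)]
   around the approximation stays within [e] of [x]. *)
have /choice [q qP] : forall i : 'I_n, exists q : rat, `|x 0 i - ratr q| < k.+1%:R^-1 :> R.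
  move=> i.
  have kk : 0 < k.+1%:R^-1 :> R by rewrite invr_gt0 ltr0n.
  have [q] := rat_in_itvoo (ltr_pwDr kk (lexx (x 0 i))).
  rewrite in_itv /= => /andP [q1 q2]; exists q.
  by rewrite ltr_distlC (lt_trans _ q1) ?gtrBl ?q2 // addrC.
exists (bl (\row_i q i, k)).
  split; first by exists (\row_i q i, k).
  by move=> i; rewrite /= mxE distrC.
- move=> y yb; apply: sPA => i j; apply: he; rewrite (ord1 i) /ball /=.
  apply: le_lt_trans (ler_distD (ratr (q j)) _ _) _.
  rewrite (splitr e) ltrD // (lt_trans _ ke) //.
  by have := yb j; rewrite /= mxE.
Qed.

End SecondCountable.

Section OpenManifold.
Variables (R : realType) (n : nat) (Om : set 'rV[R]_n) (o : 'rV[R]_n).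
Hypotheses (oOm : open Om) (Omo : Om o).

(** An inverse chart is a total function; outside [Om] its value is the base point. *)
Definition om_crdV (v : 'rV[R]_n) : Om :=
  if pselect (Om v) is left p then exist _ v (mem_set p)
  else exist _ o (mem_set Omo).

Lemma om_valP (x : Om) : Om (val x).
Proof. by case: x => x /= /set_mem. Qed.

Lemma om_valK (x : Om) : om_crdV (val x) = x.
Proof.
rewrite /om_crdV; case: pselect => [p|/(_ (om_valP x)) //].
exact: val_inj.
Qed.

Lemma om_crdVK v : Om v -> val (om_crdV v) = v.
Proof. by move=> Ov; rewrite /om_crdV; case: pselect. Qed.

Let om_hausdorff : hausdorff_space Om.
Proof.
move=> p q cpq; apply: val_inj; apply: (@norm_hausdorff _ 'rV[R]_n) => A B nA nB.
have cv : continuous (val : Om -> 'rV[R]_n) by exact: initial_continuous.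
have [x [Ax Bx]] := cpq _ _ (cv p _ nA) (cv q _ nB).
by exists (val x).
Qed.

Let om_countable : @second_countable Om.
Proof.
have [B cB [oB bB]] := @second_countable_row R n.
exists [set (val : Om -> 'rV[R]_n) @^-1` b | b in B].
  exact: card_le_trans (card_image_le _ _) cB.
split=> [_ [b Bb <-]|x A [_ [[U oU <-] Ux UA]]].
  by exists b => //; exact: oB.
have [b [Bb bx] bU] := bB (val x) U (open_nbhs_nbhs (conj oU Ux)).
exists (val @^-1` b); first by split => //; exists b.
by move=> y by_; apply: UA; exact: bU.
Qed.

Let om_image : (val : Om -> 'rV[R]_n) @` setT = Om.
Proof.
apply/seteqP; split=> [_ [x _ <-]|v Ov]; first exact: om_valP.
by exists (om_crdV v) => //; exact: om_crdVK.
Qed.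

Lemma om_crdV_continuous v : Om v -> {for v, continuous om_crdV}.
Proof.
move=> Ov A [_ [[U oU <-] Ux UA]]; have Uv : U v by rewrite -(om_crdVK Ov).
rewrite nbhs_simpl /=; near=> w; apply: UA.
have Ow : Om w by near: w; exact: open_nbhs_nbhs.
change (U (val (om_crdV w))); rewrite om_crdVK //.
by near: w; exact: open_nbhs_nbhs.
Unshelve. all: by end_near. Qed.

Let om_compat (i j : unit) :
  smooth_on ((val : Om -> 'rV[R]_n) @` (setT `&` setT)) (val \o om_crdV).
Proof.
rewrite setTI om_image; apply/smooth_onP; split => // k.
apply: (Ck_eq oOm (f := idfun)) => [x Ox|]; first by rewrite /= om_crdVK.
by apply: Ck_linear => // x.
Qed.

(* A single chart, the inclusion; points are elements of the subtype [Om]. *)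
Definition open_manifold : manifold R n :=
  @Manifold R n Om om_hausdorff om_countable unit (fun=> setT) (fun=> val)
    (fun=> om_crdV) (fun=> tt) (fun=> openT) (fun=> I)
    (fun=> (eq_ind_r open oOm om_image)) (fun _ x _ => om_valK x)
    (fun _ x _ => @initial_continuous _ _ _ x)
    (fun _ x _ => om_crdV_continuous (om_valP x)) om_compat.

End OpenManifold.

Section OpenManifoldCalculus.
Variables (R : realType) (n : nat) (Om : set 'rV[R]_n) (o : 'rV[R]_n).
Hypotheses (oOm : open Om) (Omo : Om o).
Let M := open_manifold oOm Omo.

Lemma om_range : (crd (m:=M) tt) @` setT = Om.
Proof.
apply/seteqP; split=> [_ [x _ <-]|v Ov]; first exact: om_valP.
by exists (om_crdV Omo v) => //; exact: om_crdVK.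
Qed.

Lemma om_near (P : 'rV[R]_n -> Prop) (x : M) :
  (forall y : M, P (val y)) -> \forall v \near val x, P v.
Proof.
move=> HP; move: (open_nbhs_nbhs (conj oOm (om_valP x))); apply: filterS => v Ov.
by rewrite -(om_crdVK Omo Ov); exact: HP.
Qed.

Section Maps.
Variables (m : nat) (Om' : set 'rV[R]_m) (o' : 'rV[R]_m).
Hypotheses (oOm' : open Om') (Omo' : Om' o').
Let N := open_manifold oOm' Omo'.

(** The expression of [f] in the charts agrees with [phi] only on [Om]; as [Om] is open, the
    derivative at a point of [Om] does not see the difference. *)
Lemma om_tmap (f : M -> N) (phi : 'rV[R]_n -> 'rV[R]_m) x v :
  (forall y, val (f y) = phi (val y)) -> differentiable phi (val x) ->
  tmap f x v = 'D_v phi (val x).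
Proof.
move=> fphi dphi; rewrite /tmap /=.
have e : \forall w \near val x, phi w = (val \o f \o om_crdV Omo) w.
  by apply: om_near => y /=; rewrite om_valK fphi.
rewrite -deriveE; last exact: near_eq_differentiable e _.
by rewrite (near_eq_derive _ e).
Qed.

Lemma om_continuous (f : M -> N) (phi : 'rV[R]_n -> 'rV[R]_m) :
  (forall y, val (f y) = phi (val y)) ->
  (forall x : M, {for val x, continuous phi}) -> continuous f.
Proof.
move=> fphi cphi x A [_ [[U oU <-] Ux UA]].
have cv : continuous (val : M -> 'rV[R]_n) by exact: initial_continuous.
have nU : nbhs (phi (val x)) U by rewrite -fphi; exact: open_nbhs_nbhs.
have H : nbhs x [set y : M | U (phi (val y))] := cv x _ (cphi x _ nU).
change (nbhs x (f @^-1` A)); apply: filterS H => y Uy.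
by apply: UA; change (U (val (f y))); rewrite fphi.
Qed.

Lemma om_smooth_map (f : M -> N) (phi : 'rV[R]_n -> 'rV[R]_m) :
  (forall y, val (f y) = phi (val y)) -> (forall k, Ck Om k phi) ->
  smooth_map f.
Proof.
move=> fphi Cphi; split.
  apply: (om_continuous fphi) => x.
  exact: (differentiable_continuous (Ck_differentiable (Cphi 0%N) (om_valP x))).
move=> i j; case: i; rewrite /= setTI preimage_setT om_range.
apply/smooth_onP; split => // k; apply: (Ck_eq oOm _ (Cphi k)) => v Ov /=.
by rewrite fphi om_crdVK.
Qed.

Variables (l : nat) (Om'' : set 'rV[R]_l) (o'' : 'rV[R]_l).
Hypotheses (oOm'' : open Om'') (Omo'' : Om'' o'').
Let L := open_manifold oOm'' Omo''.

Lemma om_smooth_map2 (f : M -> N -> L)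
    (phi : 'rV[R]_n * 'rV[R]_m -> 'rV[R]_l) :
  (forall y z, val (f y z) = phi (val y, val z)) ->
  (forall k, Ck (Om `*` Om') k phi) -> smooth_map2 f.
Proof.
move=> fphi Cphi; have oX : open (Om `*` Om').
  rewrite (_ : Om `*` Om' = fst @^-1` Om `&` snd @^-1` Om') //.
  by apply: openI; apply: open_comp => // p _; [exact: cvg_fst | exact: cvg_snd].
split.
  move=> [x y] A [_ [[U oU <-] Ux UA]].
  have cM : continuous (val : M -> 'rV[R]_n) by exact: initial_continuous.
  have cN : continuous (val : N -> 'rV[R]_m) by exact: initial_continuous.
  have cphi : {for (val x, val y), continuous phi}.
    apply: differentiable_continuous; apply: (Ck_differentiable (Cphi 0%N)).
    by split; exact: om_valP.
  have nU : nbhs (phi (val x, val y)) U by rewrite -fphi; exact: open_nbhs_nbhs.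
  have [[P Q] /= [nP nQ] sPQ] := cphi _ nU.
  exists ((val : M -> 'rV[R]_n) @^-1` P, (val : N -> 'rV[R]_m) @^-1` Q).
    by split; [exact: cM nP | exact: cN nQ].
  move=> [x' y'] [/= Px' Qy']; apply: UA; change (U (val (f x' y'))); rewrite fphi.
  exact: (sPQ (_, _)).
move=> i j k; case: i; case: j; case: k => /=.
have -> : [set v | exists (x : M) (y : N),
    [/\ setT x, setT y, setT (f x y) & v = (val x, val y)]] = Om `*` Om'.
  apply/seteqP; split=> [v [x [y [_ _ _ ->]]]|[v w] [/= Ov Ow]].
    by split; exact: om_valP.
  exists (om_crdV Omo v), (om_crdV Omo' w); split => //.
  by rewrite !om_crdVK.
apply/smooth_onP; split => // k; apply: (Ck_eq oX _ (Cphi k)) => -[v w] [Ov Ow] /=.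
by rewrite fphi !om_crdVK.
Qed.

End Maps.

(** With a single chart, the change of charts in [vf_in] is the identity near every point of
    [Om]. *)
Lemma om_vf_in (V : M -> 'rV[R]_n) : vf_in V tt = V \o om_crdV Omo.
Proof.
apply/funext => v; rewrite /vf_in /=; set x := om_crdV Omo v.
have e : \forall w \near val x, idfun w = (val \o om_crdV Omo) w.
  by apply: om_near => y /=; rewrite om_valK.
have di : differentiable (idfun : 'rV[R]_n -> 'rV[R]_n) (val x).
  exact: (@linear_differentiable _ _ _ idfun (val x) (fun y => @cvg_id _ _)).
rewrite -deriveE; last exact: near_eq_differentiable e di.
by rewrite -(near_eq_derive _ e) derive_id.
Qed.

Lemma om_smooth_vf (V : M -> 'rV[R]_n) :
  smooth_vf_on setT V <-> forall k, Ck Om k (V \o om_crdV Omo).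
Proof.
split=> [/(_ tt)|CV [] /=]; rewrite /= setTI om_range om_vf_in.
  by move/smooth_onP => [].
by apply/smooth_onP; split.
Qed.

Lemma om_vf_br (V W : M -> 'rV[R]_n) x :
  vf_br V W x = 'D_(V x) (W \o om_crdV Omo) (val x)
              - 'D_(W x) (V \o om_crdV Omo) (val x).
Proof. by rewrite /vf_br !om_vf_in /= !om_valK. Qed.

End OpenManifoldCalculus.

(** * Coordinates of row vectors and directional derivatives *)

Section Coordinates.
Variables (R : realType) (n : nat).

Definition co (k : nat) (x : 'rV[R]_n.+1) : R := x 0 (inord k).
(** A list shorter than the row is completed by zeros, the default of list access; [gone] and [xo]
    rely on it. *)
Definition mk (s : seq R) : 'rV[R]_n.+1 := \row_i s`_i.

Lemma co_mk s k : (k <= n)%N -> co k (mk s) = s`_k.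
Proof. by move=> kn; rewrite /co mxE inordK. Qed.

Lemma co_eq (x y : 'rV[R]_n.+1) :
  (forall k, (k <= n)%N -> co k x = co k y) -> x = y.
Proof.
by move=> xy; apply/rowP => i; have := xy i (ltn_ord i); rewrite /co inord_val.
Qed.

Lemma coZD (a : R) k x y : co k (a *: x + y) = a * co k x + co k y.
Proof. by rewrite /co !mxE. Qed.
Lemma coD k x y : co k (x + y) = co k x + co k y.
Proof. by rewrite /co !mxE. Qed.
Lemma coB k x y : co k (x - y) = co k x - co k y.
Proof. by rewrite /co !mxE. Qed.
Lemma coN k x : co k (- x) = - co k x.
Proof. by rewrite /co !mxE. Qed.
Lemma coZ (a : R) k x : co k (a *: x) = a * co k x.
Proof. by rewrite /co !mxE. Qed.
Lemma co0 k : co k 0 = 0.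
Proof. by rewrite /co !mxE. Qed.

Lemma co_is_linear k : linear (co k).
Proof. by move=> a x y; rewrite coZD. Qed.
HB.instance Definition _ k :=
  GRing.isLinear.Build R 'rV[R]_n.+1 R _ (co k) (co_is_linear k).

Lemma co_continuous k : continuous (co k).
Proof. exact: coord_continuous. Qed.

End Coordinates.

Arguments co {R n} k x.
Arguments mk {R} n s.

Section DirectionalDerivative.
Variables (R : realType) (V : normedModType R).
Implicit Types f g : V -> R.

(** Differentiability and value travel together, so that the derivative of a formula is found by
    backward chaining, with its value left open until [dv_eq]. *)
Definition dv f (x v : V) (d : R) := differentiable f x /\ 'D_v f x = d.

Lemma dv_eq f x v d d' : dv f x v d -> d = d' -> dv f x v d'.
Proof. by move=> h <-. Qed.

Lemma dvC (a : R) x v : dv (fun=> a) x v 0.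
Proof. by split; [exact: differentiable_cst | exact: derive_cst]. Qed.

Lemma dvL (f : {linear V -> R}) x v : continuous f -> dv f x v (f v).
Proof.
move=> cf; have df : differentiable f x by exact: linear_differentiable.
by split=> //; rewrite deriveE // diff_lin.
Qed.

Lemma dvD f g x v a b : dv f x v a -> dv g x v b ->
  dv (fun y => f y + g y) x v (a + b).
Proof.
move=> [df <-] [dg <-]; split; first exact: differentiableD.
by rewrite [LHS]deriveD //; exact: diff_derivable.
Qed.

Lemma dvN f x v a : dv f x v a -> dv (fun y => - f y) x v (- a).
Proof.
move=> [df <-]; split; first exact: differentiableN.
by rewrite [LHS]deriveN //; exact: diff_derivable.
Qed.

Lemma dvM f g x v a b : dv f x v a -> dv g x v b ->
  dv (fun y => f y * g y) x v (f x * b + g x * a).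
Proof.
move=> [df <-] [dg <-]; split; first exact: differentiableM.
by rewrite [LHS]deriveM //; exact: diff_derivable.
Qed.

Lemma dvV f x v a : f x != 0 -> dv f x v a ->
  dv (fun y => (f y)^-1) x v (- ((f x)^-1 * (f x)^-1 * a)).
Proof.
move=> f0 [df <-]; split; first exact: differentiableV.
rewrite [LHS]deriveV //; last exact: diff_derivable.
by rewrite scaleNr /GRing.scale /= expr2 invfM.
Qed.

Lemma dvE f x v a : dv f x v a ->
  dv (fun y => expR (f y)) x v (expR (f x) * a).
Proof. by move=> [df <-]; have [] := derive_expR_comp v df. Qed.

Lemma dv_row n (f : V -> 'rV[R]_n.+1) x v (d : 'rV[R]_n.+1) :
  (forall k, (k <= n)%N -> dv (fun y => co k (f y)) x v (co k d)) ->
  differentiable f x /\ 'D_v f x = d.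
Proof.
move=> H; have df : differentiable f x.
  apply: differentiable_row => i; have [+ _] := H i (ltn_ord i).
  by rewrite /co inord_val.
split=> //; apply/rowP => i; rewrite derive_row //.
by have [_] := H i (ltn_ord i); rewrite /co inord_val.
Qed.

Lemma Ck_rowco n U k (f : V -> 'rV[R]_n.+1) : open U ->
  (forall j, (j <= n)%N -> Ck U k (fun y => co j (f y))) -> Ck U k f.
Proof.
move=> oU H; apply/Ck_row => // i; have := H i (ltn_ord i).
by rewrite /co inord_val.
Qed.

Lemma Ck_co n U k (f : V -> 'rV[R]_n.+1) j : open U ->
  Ck U k f -> Ck U k (fun y => co j (f y)).
Proof. by move=> oU /Ck_row; apply. Qed.

End DirectionalDerivative.

Section CoordinateDerivatives.
Variables (R : realType).

Lemma dv_co n k (x v : 'rV[R]_n.+1) : dv (fun y => co k y) x v (co k v).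
Proof. exact: (@dvL R _ (co k) x v (@co_continuous R n k)). Qed.

Lemma Ck_coord n k (U : set 'rV[R]_n.+1) j : open U -> Ck U j (fun y => co k y).
Proof. by move=> oU; exact: (@Ck_linear R _ _ U j (co k) oU (@co_continuous R n k)). Qed.

Lemma Ck_coord1 n m k (U : set ('rV[R]_n.+1 * 'rV[R]_m)) j : open U ->
  Ck U j (fun y => co k y.1).
Proof.
move=> oU; apply: (@Ck_linear R _ _ U j (co k \o fst)) => // x.
by apply: continuous_comp; [exact: cvg_fst | exact: co_continuous].
Qed.

Lemma Ck_coord2 n m k (U : set ('rV[R]_m * 'rV[R]_n.+1)) j : open U ->
  Ck U j (fun y => co k y.2).
Proof.
move=> oU; apply: (@Ck_linear R _ _ U j (co k \o snd)) => // x.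
by apply: continuous_comp; [exact: cvg_snd | exact: co_continuous].
Qed.

End CoordinateDerivatives.

Ltac nat_cases k := do 8?[case: k => [|k]] => //.

(* Same as [nat_cases], without trying [done] on the goals that remain. *)
Ltac ord_cases k := do 8?[case: k => [|k]]; try (let H := fresh in intro H; discriminate H).

Ltac ck_tac := repeat first
  [ assumption
  | apply: Ck_coord | apply: Ck_coord1 | apply: Ck_coord2
  | apply: Ck_cst
  | apply: CkD | apply: CkN | apply: CkM | apply: CkV ].

(** * The semidirect product of [GL_2] and the cubics *)

Section Group.
Variable R : realType.

(* Coordinates of the cubic with coefficients [y_j] after the linear substitution of matrix
  [[a, b], [c, d]]; the action of [GL_2] on [S^3(R^2)]. *)
Definition cubic_subst (a b c d y0 y1 y2 y3 : R) : seq R :=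
  [:: d * d * d * y0 + c * d * d * y1 + c * c * d * y2 + c * c * c * y3;
   3 * b * d * d * y0 + (a * d * d + 2 * b * c * d) * y1
     + (2 * a * c * d + b * c * c) * y2 + 3 * a * c * c * y3;
   3 * b * b * d * y0 + (2 * a * b * d + b * b * c) * y1
     + (a * a * d + 2 * a * b * c) * y2 + 3 * a * a * c * y3;
   b * b * b * y0 + a * b * b * y1 + a * a * b * y2 + a * a * a * y3].

Notation row := 'rV[R]_8.

Definition gdet (x : row) : R := co 0 x * co 3 x - co 1 x * co 2 x.

Definition gcubic (x y : row) : seq R :=
  cubic_subst (co 0 x) (co 1 x) (co 2 x) (co 3 x) (co 4 y) (co 5 y) (co 6 y) (co 7 y).

(* [(a, b, c, d, y_0, .., y_3)] stands for the pair of the matrix [[a, b], [c, d]] and the cubic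
  [y]. *)
Definition gmul (x y : row) : row := mk 7
  [:: co 0 x * co 0 y + co 1 x * co 2 y; co 0 x * co 1 y + co 1 x * co 3 y;
      co 2 x * co 0 y + co 3 x * co 2 y; co 2 x * co 1 y + co 3 x * co 3 y;
      co 4 x + (gcubic x y)`_0; co 5 x + (gcubic x y)`_1;
      co 6 x + (gcubic x y)`_2; co 7 x + (gcubic x y)`_3].

Definition gone : row := mk 7 [:: 1; 0; 0; 1].

Definition ginv (x : row) : row :=
  let e := (gdet x)^-1 in
  let u := cubic_subst (e * co 3 x) (- e * co 1 x) (- e * co 2 x) (e * co 0 x)
             (co 4 x) (co 5 x) (co 6 x) (co 7 x) in
  mk 7 [:: e * co 3 x; - e * co 1 x; - e * co 2 x; e * co 0 x;
           - u`_0; - u`_1; - u`_2; - u`_3].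

Definition OmG : set row := [set x | gdet x != 0].

Lemma gdet_continuous : continuous gdet.
Proof.
move=> x; apply: differentiable_continuous.
by apply: (@Ck_differentiable _ _ _ setT 0%N) => //; rewrite /gdet; ck_tac; exact: openT.
Qed.

Lemma oOmG : open OmG.
Proof.
rewrite (_ : OmG = gdet @^-1` [set y | y != 0]) //.
by apply: open_comp => [x _|]; [exact: gdet_continuous | exact: open_neq].
Qed.

Lemma gdet_mul x y : gdet (gmul x y) = gdet x * gdet y.
Proof. by rewrite /gdet /gmul !co_mk //=; ring. Qed.

Lemma gdet_one : gdet gone = 1.
Proof. by rewrite /gdet !co_mk //=; ring. Qed.

Lemma gmulA x y z : gmul x (gmul y z) = gmul (gmul x y) z.
Proof.
apply: co_eq => k kn; rewrite {1 3}/gmul !co_mk //; move: kn.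
by nat_cases k => _ /=; rewrite /gmul ?co_mk //= /gcubic /cubic_subst /=; ring.
Qed.

Lemma gmul1 x : gmul gone x = x.
Proof.
apply: co_eq => k kn; rewrite /gmul !co_mk //; move: kn.
by nat_cases k => _ /=; rewrite /gone ?co_mk //=; ring.
Qed.

Lemma gmulV x : OmG x -> gmul (ginv x) x = gone.
Proof.
move=> x0; apply: co_eq => k kn; rewrite /gmul /gone !co_mk //; move: kn.
(* This product replaces the entries 1 of the identity; the equations become polynomial in the
   entries of [x] and in the inverse determinant. *)
have e1 : (gdet x)^-1 * (co 0 x * co 3 x - co 1 x * co 2 x) = 1.
  by rewrite mulVf.
nat_cases k => _ /=; rewrite /ginv ?co_mk //=; set e := (gdet x)^-1 in e1 *.
all: by rewrite -?e1; ring.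
Qed.

Lemma Ck_gmul k : Ck (@OmG `*` @OmG) k (fun p => gmul p.1 p.2).
Proof.
have oX : open (OmG `*` OmG).
  rewrite (_ : OmG `*` OmG = fst @^-1` OmG `&` snd @^-1` OmG) //.
  by apply: openI; apply: open_comp (oOmG) => p _; [exact: cvg_fst | exact: cvg_snd].
apply: Ck_rowco => // j jn; apply: (Ck_eq oX (f := fun p => co j (gmul p.1 p.2))) => //.
rewrite /gmul; move: jn; nat_cases j => _.
all: apply: (Ck_eq oX); [by move=> p _; rewrite co_mk //= /gcubic /cubic_subst /=|].
all: ck_tac.
Qed.

Lemma Ck_ginv k : Ck OmG k ginv.
Proof.
have oX := oOmG.
apply: Ck_rowco => // j jn; move: jn; nat_cases j => _.
all: apply: (Ck_eq oX); [by move=> p _; rewrite /ginv co_mk //= /gdet|].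
all: ck_tac.
all: by [].
Qed.

Lemma gmulS_subproof (x y : OmG) : OmG (gmul (val x) (val y)).
Proof.
by rewrite /OmG /= gdet_mul mulf_neq0 //; exact: (@om_valP _ _ OmG).
Qed.

Definition gmulS (x y : OmG) : OmG := exist (fun z => z \in OmG) _ (mem_set (gmulS_subproof x y)).

Lemma gone_subproof : OmG gone.
Proof. by rewrite /OmG /= gdet_one oner_neq0. Qed.

Definition goneS : OmG := exist (fun z => z \in OmG) _ (mem_set gone_subproof).

Lemma ginv_subproof (x : OmG) : OmG (ginv (val x)).
Proof.
have x0 : gdet (val x) != 0 by exact: (@om_valP _ _ OmG).
have := gmulV x0 => /(congr1 gdet); rewrite gdet_mul gdet_one /OmG /= => e1.
by apply/eqP => e0; move: e1; rewrite e0 mul0r => /esym/eqP; rewrite oner_eq0.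
Qed.

Definition ginvS (x : OmG) : OmG := exist (fun z => z \in OmG) _ (mem_set (ginv_subproof x)).

Let G := open_manifold oOmG gone_subproof.

Lemma gmulS_smooth : @smooth_map2 _ _ _ _ G G G gmulS.
Proof. by apply: (om_smooth_map2 _ Ck_gmul). Qed.

Lemma ginvS_smooth : @smooth_map _ _ _ G G ginvS.
Proof. by apply: (om_smooth_map _ Ck_ginv). Qed.

Definition GLR4 : lieGroup R 8.
Proof.
refine (@LieGroup R 8 G gmulS goneS ginvS _ _ _ gmulS_smooth ginvS_smooth).
- by move=> x y z; apply: val_inj; exact: gmulA.
- by move=> x; apply: val_inj; exact: gmul1.
- by move=> x; apply: val_inj; apply: gmulV; exact: (@om_valP _ _ OmG).
Defined.

End Group.

(** * The homogeneous space *)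

Section Space.
Variable R : realType.

Notation rowG := 'rV[R]_8.
Notation row := 'rV[R]_7.

(* A point of [SL_2 x R^4] is given by the first column [u = (x_0, x_1)] of the matrix, by [x_2]
  and by the cubic; the second column is [w = x_2 u + Ju / |u|^2]. *)
Definition xq (x : row) : R := co 0 x * co 0 x + co 1 x * co 1 x.
Definition xw1 (x : row) : R := co 2 x * co 0 x - (xq x)^-1 * co 1 x.
Definition xw2 (x : row) : R := co 2 x * co 1 x + (xq x)^-1 * co 0 x.

Definition OmX : set row := [set x | xq x != 0].

Lemma oOmX : open OmX.
Proof.
rewrite (_ : OmX = xq @^-1` [set y | y != 0]) //.
apply: open_comp => [x _|]; last exact: open_neq.
apply: differentiable_continuous.
by apply: (@Ck_differentiable _ _ _ setT 0%N) => //; rewrite /xq; ck_tac; exact: openT.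
Qed.

Lemma xw_det x : OmX x -> co 0 x * xw2 x - co 1 x * xw1 x = 1.
Proof. by rewrite /OmX /= /xw1 /xw2 /xq => x0; field. Qed.

Lemma xw_dot x : OmX x -> xw1 x * co 0 x + xw2 x * co 1 x = co 2 x * xq x.
Proof. by rewrite /OmX /= /xw1 /xw2 /xq => x0; field. Qed.

(** Coordinates of the point with columns u and w. When the determinant is 1, w is recovered from u
    and from its component along u, [<w, u>/|u|^2], which is the third coordinate. *)
Definition xmk (u1 u2 w1 w2 v0 v1 v2 v3 : R) : row :=
  mk 6 [:: u1; u2; (w1 * u1 + w2 * u2) * (u1 * u1 + u2 * u2)^-1; v0; v1; v2; v3].

Lemma sum_sq_neq0 (a b : R) : (a * a + b * b != 0) = (a != 0) || (b != 0).
Proof. by rewrite -!expr2 paddr_eq0 ?sqr_ge0 // !sqrf_eq0 negb_and. Qed.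

Lemma det1_OmX (u1 u2 w1 w2 : R) : u1 * w2 - u2 * w1 = 1 ->
  u1 * u1 + u2 * u2 != 0.
Proof.
rewrite sum_sq_neq0 -negb_and; apply: contra_eqN => /andP [/eqP -> /eqP ->].
by rewrite !mul0r subrr eq_sym oner_eq0.
Qed.

Lemma xmk_w1 (u1 u2 w1 w2 v0 v1 v2 v3 : R) : u1 * w2 - u2 * w1 = 1 ->
  xw1 (xmk u1 u2 w1 w2 v0 v1 v2 v3) = w1.
Proof.
move=> d1; have q0 := det1_OmX d1.
rewrite /xw1 /xq /xmk !co_mk //=.
(* The added term vanishes because the determinant is 1; with it the equality is an identity of
   rational functions. *)
transitivity ((w1 * (u1 * u1 + u2 * u2) + (u1 * w2 - u2 * w1 - 1) * u2) *
  (u1 * u1 + u2 * u2)^-1); first by field.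
by rewrite d1 subrr mul0r addr0 mulfK.
Qed.

Lemma xmk_w2 (u1 u2 w1 w2 v0 v1 v2 v3 : R) : u1 * w2 - u2 * w1 = 1 ->
  xw2 (xmk u1 u2 w1 w2 v0 v1 v2 v3) = w2.
Proof.
move=> d1; have q0 := det1_OmX d1.
rewrite /xw2 /xq /xmk !co_mk //=.
transitivity ((w2 * (u1 * u1 + u2 * u2) - (u1 * w2 - u2 * w1 - 1) * u1) *
  (u1 * u1 + u2 * u2)^-1); first by field.
by rewrite d1 subrr mul0r subr0 mulfK.
Qed.

Lemma xmkK x : OmX x ->
  xmk (co 0 x) (co 1 x) (xw1 x) (xw2 x) (co 3 x) (co 4 x) (co 5 x) (co 6 x) = x.
Proof.
move=> x0; apply: co_eq => k kn; rewrite /xmk co_mk //; move: kn.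
by nat_cases k => _ /=; rewrite xw_dot // mulfK.
Qed.

Definition gcubicx (g : rowG) (x : row) : seq R :=
  cubic_subst (co 0 g) (co 1 g) (co 2 g) (co 3 g) (co 3 x) (co 4 x) (co 5 x) (co 6 x).

(** Right multiplication of a matrix A with columns u, w by [diag(s, s^-2)] divides det A by s, so
    [(det A) u] and [(det A)^-2 w] are invariant; they are the columns of a matrix of determinant 1.
    This identifies the quotient of GL_2 with SL_2, and the left action becomes [u -> (det g) g u],
    [w -> (det g)^-2 g w]. The cubic part is not twisted. *)
Definition gact (g : rowG) (x : row) : row :=
  let d := gdet g in
  let e := d^-1 * d^-1 in
  xmk (d * (co 0 g * co 0 x + co 1 g * co 1 x))
      (d * (co 2 g * co 0 x + co 3 g * co 1 x))
      (e * (co 0 g * xw1 x + co 1 g * xw2 x))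
      (e * (co 2 g * xw1 x + co 3 g * xw2 x))
      (co 4 g + (gcubicx g x)`_0) (co 5 g + (gcubicx g x)`_1)
      (co 6 g + (gcubicx g x)`_2) (co 7 g + (gcubicx g x)`_3).

Lemma gact_det g x : OmG g -> OmX x -> let d := gdet g in
  let e := d^-1 * d^-1 in
  (d * (co 0 g * co 0 x + co 1 g * co 1 x)) *
  (e * (co 2 g * xw1 x + co 3 g * xw2 x)) -
  (d * (co 2 g * co 0 x + co 3 g * co 1 x)) *
  (e * (co 0 g * xw1 x + co 1 g * xw2 x)) = 1.
Proof.
move=> g0 x0 d e; have d1 := xw_det x0.
have de : d * e * d = 1 by rewrite /e mulrA mulfV // mul1r mulVf.
transitivity (d * e * gdet g * (co 0 x * xw2 x - co 1 x * xw1 x)).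
  by rewrite /gdet; ring.
by rewrite d1 mulr1.
Qed.

Lemma gact_u1 g x : co 0 (gact g x) = gdet g * (co 0 g * co 0 x + co 1 g * co 1 x).
Proof. by rewrite co_mk. Qed.
Lemma gact_u2 g x : co 1 (gact g x) = gdet g * (co 2 g * co 0 x + co 3 g * co 1 x).
Proof. by rewrite co_mk. Qed.
Lemma gact_w1 g x : OmG g -> OmX x ->
  xw1 (gact g x) = (gdet g)^-1 * (gdet g)^-1 * (co 0 g * xw1 x + co 1 g * xw2 x).
Proof. by move=> g0 x0; rewrite xmk_w1 //; exact: gact_det. Qed.
Lemma gact_w2 g x : OmG g -> OmX x ->
  xw2 (gact g x) = (gdet g)^-1 * (gdet g)^-1 * (co 2 g * xw1 x + co 3 g * xw2 x).
Proof. by move=> g0 x0; rewrite xmk_w2 //; exact: gact_det. Qed.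

Lemma gact_OmX g x : OmG g -> OmX x -> OmX (gact g x).
Proof.
move=> g0 x0; rewrite /OmX /= /xq gact_u1 gact_u2.
exact: det1_OmX (gact_det g0 x0).
Qed.

Lemma gact_v g x k : (k < 4)%N -> co (3 + k) (gact g x) = co (4 + k) g + (gcubicx g x)`_k.
Proof. by nat_cases k => _; rewrite co_mk. Qed.

Lemma gact1 x : OmX x -> gact (gone R) x = x.
Proof.
move=> x0; rewrite -[RHS]xmkK // /gact gdet_one invr1.
rewrite /gcubicx /cubic_subst /gone !co_mk //=.
by congr xmk; ring.
Qed.

Lemma gact_mul g h x : OmG g -> OmG h -> OmX x ->
  gact (gmul g h) x = gact g (gact h x).
Proof.
move=> g0 h0 x0; have gh0 := gdet_mul g h.
rewrite /gact -/(gact h x) gact_w1 // gact_w2 // gact_u1 gact_u2 gh0 invfM.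
have e k : (k <= 7)%N -> co k (gmul g h) = (nth 0
  [:: co 0 g * co 0 h + co 1 g * co 2 h; co 0 g * co 1 h + co 1 g * co 3 h;
      co 2 g * co 0 h + co 3 g * co 2 h; co 2 g * co 1 h + co 3 g * co 3 h;
      co 4 g + (gcubic g h)`_0; co 5 g + (gcubic g h)`_1;
      co 6 g + (gcubic g h)`_2; co 7 g + (gcubic g h)`_3] k) by move=> kn; rewrite co_mk.
rewrite /gcubicx !e //=.
rewrite (@gact_v h x 0) // (@gact_v h x 1) // (@gact_v h x 2) // (@gact_v h x 3) //.
congr xmk; rewrite /gcubic /gcubicx /cubic_subst /=; ring.
Qed.

End Space.

Section Homogeneous.
Variable R : realType.

Notation rowG := 'rV[R]_8.
Notation row := 'rV[R]_7.

Lemma Ck_gact k : Ck (@OmG R `*` @OmX R) k (fun p => gact p.1 p.2).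
Proof.
have oX : open (@OmG R `*` @OmX R).
  rewrite (_ : _ `*` _ = fst @^-1` (@OmG R) `&` snd @^-1` (@OmX R)) //.
  apply: openI; apply: open_comp; try exact: oOmG; try exact: oOmX.
    by move=> p _; exact: cvg_fst.
  by move=> p _; exact: cvg_snd.
have Cw1 : Ck (@OmG R `*` @OmX R) k (fun p => xw1 p.2).
  by rewrite /xw1 /xq; ck_tac => -[? ?] [].
have Cw2 : Ck (@OmG R `*` @OmX R) k (fun p => xw2 p.2).
  by rewrite /xw2 /xq; ck_tac => -[? ?] [].
have Cdi : Ck (@OmG R `*` @OmX R) k (fun p => (gdet p.1)^-1).
  by rewrite /gdet; ck_tac => -[? ?] [].
have Cd : Ck (@OmG R `*` @OmX R) k (fun p => gdet p.1).
  by rewrite /gdet; ck_tac.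
apply: Ck_rowco => // j jn; move: jn; nat_cases j => _.
all: apply: (Ck_eq oX); [by move=> p _; rewrite /gact /xmk co_mk //= /gcubicx /cubic_subst /=|].
all: ck_tac.
move=> [g x] [g0 x0] /=; exact: det1_OmX (gact_det g0 x0).
Qed.

Definition xo : row := mk 6 [:: 1].

Lemma xo_subproof : OmX xo.
Proof. by rewrite /OmX /= /xq !co_mk //= mulr0 addr0 mulr1 oner_neq0. Qed.

Definition GLG : lieGroup R 8 := GLR4 R.
Definition Xm : manifold R 7 := open_manifold (@oOmX R) xo_subproof.

Lemma gP (g : GLG) : OmG (val g).
Proof. exact: (@om_valP _ _ (@OmG R)). Qed.
Lemma xP (x : Xm) : OmX (val x).
Proof. exact: (@om_valP _ _ (@OmX R)). Qed.

Definition actS (g : GLG) (x : Xm) : Xm :=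
  exist (fun z => z \in @OmX R) _ (mem_set (gact_OmX (gP g) (xP x))).

Lemma val_actS g x : val (actS g x) = gact (val g) (val x).
Proof. by []. Qed.

Definition xoS : Xm := exist (fun z => z \in @OmX R) _ (mem_set xo_subproof).

Definition Hs : set GLG := [set g | actS g xoS = xoS].

(** The base point is the identity matrix with the zero cubic. Fixing it forces b = c = 0 and
    [(det g) a = 1], that is [a^2 d = 1], and leaves no translation. *)
Lemma HsP (g : GLG) : Hs g <->
  [/\ co 1 (val g) = 0, co 2 (val g) = 0,
      co 0 (val g) * co 0 (val g) * co 3 (val g) = 1 &
      forall k, (k < 4)%N -> co (4 + k) (val g) = 0].
Proof.
have w1o : xw1 xo = 0 by rewrite /xw1 /xq !co_mk //=; field.
have w2o : xw2 xo = 1 by rewrite /xw2 /xq !co_mk //=; field.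
have g0 : gdet (val g) != 0 := gP g.
have o0 : co 0 xo = 1 by rewrite co_mk.
have ok k : (k < 6)%N -> co k.+1 xo = 0 by move=> kn; rewrite co_mk //; case: k kn => [|k] //=;
  rewrite nth_nil.
split=> [/(congr1 val)|[e1 e2 e3 e4]].
  rewrite val_actS /= => e.
  have := congr1 (co 0) e; rewrite gact_u1 o0 (ok 0%N) // mulr0 addr0 mulr1 => da.
  have := congr1 (co 1) e; rewrite gact_u2 o0 (ok 0%N) // mulr0 addr0 mulr1 => /eqP.
  rewrite mulf_eq0 (negPf g0) /= => /eqP c0.
  have := congr1 (@xw1 R) e; rewrite gact_w1 // ?w1o ?w2o; last exact: xo_subproof.
  rewrite mulr0 add0r mulr1 => /eqP; rewrite !mulf_eq0 invr_eq0 (negPf g0) /= => /eqP b0.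
  have := congr1 (@xw2 R) e; rewrite gact_w2 // ?w1o ?w2o; last exact: xo_subproof.
  rewrite mulr0 add0r mulr1 => dd.
  split => //.
    by move: da dd; rewrite /gdet b0 mul0r subr0 => da _; rewrite -[RHS]da; ring.
  move=> k k4; have := congr1 (co (3 + k)) e.
  rewrite gact_v // ok; last by rewrite -(ltn_add2l 2) in k4.
  have -> : (gcubicx (val g) xo)`_k = 0.
    rewrite /gcubicx /cubic_subst !ok //.
    by move: k4; nat_cases k => _ /=; rewrite ?mulr0 ?addr0.
  by rewrite addr0.
apply: val_inj; rewrite val_actS /=.
have da : gdet (val g) * co 0 (val g) = 1.
  by rewrite -[RHS]e3 /gdet e1 mul0r subr0; ring.
have di : (gdet (val g))^-1 = co 0 (val g) by apply: (mulfI g0); rewrite mulfV.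
have o0' := xo_subproof.
rewrite -[RHS](xmkK o0') /gact w1o w2o o0 (ok 0%N) // di e1 e2.
rewrite /gcubicx /cubic_subst !ok // (e4 0%N) // (e4 1%N) // (e4 2%N) // (e4 3%N) //=.
by congr xmk; rewrite ?(mulr1, mulr0, mul0r, addr0, add0r, da, e3).
Qed.

Lemma gact_transitive (y : row) : OmX y ->
  exists g : rowG, OmG g /\ gact g xo = y.
Proof.
move=> y0; have d1 := xw_det y0.
(* The witness has the matrix and the cubic of [y] itself; its determinant is 1, so the twist
   disappears. *)
have [g gk] : exists g : rowG, forall k, (k <= 7)%N ->
    co k g = [:: co 0 y; xw1 y; co 1 y; xw2 y; co 3 y; co 4 y; co 5 y; co 6 y]`_k.
  by eexists (mk 7 [:: _; _; _; _; _; _; _; _]) => k kn; rewrite co_mk.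
have gd : gdet g = 1 by rewrite /gdet !gk //= -d1; ring.
exists g; split; first by rewrite /OmG /= gd oner_neq0.
have w1o : xw1 xo = 0 by rewrite /xw1 /xq !co_mk //=; field.
have w2o : xw2 xo = 1 by rewrite /xw2 /xq !co_mk //=; field.
have ok k : (k <= 6)%N -> co k xo = (k == 0%N)%:R.
  by move=> kn; rewrite co_mk //; case: k kn => [|k] //=; rewrite nth_nil.
rewrite -[RHS](xmkK y0) /gact gd w1o w2o /gcubicx /cubic_subst !gk // !ok // invr1 /=.
by congr xmk; ring.
Qed.

Lemma xo_transitive x : exists g : GLG, actS g xoS = x.
Proof.
have [g [Og e]] := gact_transitive (xP x).
exists (exist (fun z => z \in @OmG R) g (mem_set Og)); apply: val_inj.
exact: e.
Qed.

Lemma actS1 x : actS (lone GLG) x = x.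
Proof. by apply: val_inj; exact: gact1 (xP x). Qed.

Lemma actSM g h x : actS (lmul g h) x = actS g (actS h x).
Proof. by apply: val_inj; apply: gact_mul; [exact: gP|exact: gP|exact: xP]. Qed.

Lemma actS_smooth : smooth_map2 actS.
Proof.
exact: (@om_smooth_map2 _ _ _ _ (@oOmG R) (@gone_subproof R) _ _ _ (@oOmX R)
  xo_subproof _ _ _ (@oOmX R) xo_subproof actS _ (fun=> fun=> erefl) Ck_gact).
Qed.

Lemma Hs_closed : closed Hs.
Proof.
have cact : continuous (fun g : GLG => actS g xoS).
  move=> g A nA; have [cA _] := actS_smooth.
  have [[P Q] /= [nP nQ] sPQ] := cA (g, xoS) A nA.
  change (nbhs g [set g' | A (actS g' xoS)]); apply: filterS nP => g' Pg'.
  apply: (sPQ (g', xoS)); split => //=; exact: nbhs_singleton.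
rewrite (_ : Hs = (fun g : GLG => actS g xoS) @^-1` [set xoS]) //.
apply: closed_comp => [g _|]; first exact: cact.
apply: accessible_closed_set1; apply: hausdorff_accessible.
exact: mf_hausdorff.
Qed.

Lemma GLG_homogeneous : homogeneous_space Hs actS xoS.
Proof.
split.
- split; first exact: Hs_closed.
  + exact: actS1.
  + by move=> g h Hg Hh; rewrite /Hs /= actSM Hh.
  + move=> g Hg; rewrite /Hs /= -{1}Hg -actSM lmulVg; exact: actS1.
- exact: actS_smooth.
- by split; [exact: actS1 | exact: actSM].
- exact: xo_transitive.
- by [].
Qed.

(* The stabiliser of the base point is [diag(s, s^-2)]. *)
Definition hvec : rowG := mk 7 [:: 1; 0; 0; - 2].

(** Differentiating [a^2 d = 1] at the identity gives [d' = - 2 a']; conversely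
    [diag(e^(st), e^(-2st))] is a one-parameter subgroup with velocity [s *: hvec]. *)
Lemma lie_Hs : Lie_of Hs = [set s *: hvec | s in setT].
Proof.
apply/seteqP; split=> [v [a [[aD ca sa] aH av]]|_ [s _ <-]].
  have da : differentiable (val \o a : R -> rowG) 0.
    by have /smooth_onP [_ /(_ 0%N) C0] := sa tt; exact: (Ck_differentiable C0).
  (* [a 0] is idempotent, hence the identity. *)
  have a0 : a 0 = lone GLG.
    have := aD 0 0; rewrite addr0 => e.
    by rewrite -[LHS]lmul1g -(lmulVg (a 0)) -lmulA -e lmulVg.
  have vE k : co k v = 'D_1 (fun t => co k (val (a t))) 0.
    rewrite -av /velocity0 /= {1}/co derive_row //.
  have cst0 k : (forall t, co k (val (a t)) = 0) -> co k v = 0.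
    move=> ak; rewrite vE (_ : (fun t => _) = cst 0) ?derive_cst //.
    by apply/funext => t; exact: ak.
  have H t := (HsP (a t)).1 (aH t).
  have dc k : dv (fun t => co k (val (a t))) 0 1 (co k v).
    rewrite vE; split=> //.
    by have := differentiable_row_coord (inord k) da.
  have e03 : co 3 v = - 2 * co 0 v.
    have := dvM (dvM (dc 0%N) (dc 0%N)) (dc 3%N).
    rewrite (_ : (fun t => _) = cst 1); last by apply/funext => t; case: (H t).
    move=> [_]; rewrite derive_cst a0 /= !co_mk //= => e.
    by apply/eqP; rewrite -subr_eq0; apply/eqP; rewrite [RHS]e; ring.
  exists (co 0 v) => //; apply: co_eq => k kn; rewrite coZ /hvec co_mk //.
  move: kn; nat_cases k => _ /=; rewrite ?mulr0 ?mulr1 //.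
  - by rewrite cst0 // => t; case: (H t).
  - by rewrite cst0 // => t; case: (H t).
  - by rewrite e03 mulrC.
  - by rewrite cst0 // => t; case: (H t) => _ _ _ /(_ 0%N); apply.
  - by rewrite cst0 // => t; case: (H t) => _ _ _ /(_ 1%N); apply.
  - by rewrite cst0 // => t; case: (H t) => _ _ _ /(_ 2%N); apply.
  - by rewrite cst0 // => t; case: (H t) => _ _ _ /(_ 3%N); apply.
pose r t : rowG := mk 7 [:: expR (s * t); 0; 0; expR (- 2 * (s * t))].
have rd t : gdet (r t) = expR (- (s * t)).
  by rewrite /gdet !co_mk //= mul0r subr0 -expRD; congr expR; ring.
have Or t : OmG (r t) by rewrite /OmG /= rd gt_eqF ?expR_gt0.
pose a t : GLG := exist (fun z => z \in @OmG R) (r t) (mem_set (Or t)).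
have Cr k : Ck setT k r.
  apply: Ck_rowco => [|j jn]; first exact: openT.
  apply: (Ck_eq openT (f := fun t => [:: expR (s * t); 0; 0; expR (- 2 * (s * t))]`_j)).
    by move=> t _; rewrite co_mk.
  have Cs : Ck setT k (fun t : R => s * t).
    apply: CkM; [exact: openT| exact: Ck_cst openT |].
    by apply: (@Ck_linear R _ _ _ _ idfun) => //; [exact: openT | move=> x].
  move: jn; nat_cases j => _ /=; try exact: Ck_cst openT.
    by apply: Ck_expR => //; exact: openT.
  apply: Ck_expR => //; first exact: openT.
  by apply: CkM => //; [exact: openT | exact: Ck_cst openT].
have cr : continuous r.
  by move=> t; apply: differentiable_continuous; apply: (Ck_differentiable (Cr 0%N)).
exists a; split.
- split.
  + move=> t t'; apply: val_inj; apply: co_eq => k kn.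
    change (co k (r (t + t')) = co k (gmul (r t) (r t'))).
    rewrite /gmul !co_mk //; move: kn.
    nat_cases k => _ /=; rewrite /gcubic /cubic_subst /r ?co_mk //=;
      rewrite ?(mulr0, mul0r, addr0, add0r) // -expRD; congr expR; ring.
  + move=> t A [_ [[U oU <-] Ux UA]].
    change (nbhs t (a @^-1` A)).
    have rU : nbhs t (r @^-1` U) := cr t U (open_nbhs_nbhs (conj oU Ux)).
    by apply: filterS rU => t' Ut'; exact: UA.
  + by move=> [] /=; rewrite preimage_setT; apply/smooth_onP; split; [exact: openT | exact: Cr].
- move=> t; apply/HsP; split; rewrite ?/a /= ?co_mk //=.
  + by rewrite -!expRD -[RHS](expR0 R); congr expR; ring.
  + by move=> k; nat_cases k => _; rewrite co_mk.
- have dr : differentiable r 0 by exact: (Ck_differentiable (Cr 0%N)).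
  rewrite /velocity0 /=; change ('D_1 r 0 = s *: hvec).
  have ds : dv (fun t : R => s * t) 0 1 s.
    apply: dv_eq; first exact: (dvM (dvC s _ _) (@dvL R _ idfun 0 1 (fun y => @cvg_id _ _))).
    by rewrite /= mulr0 addr0 mulr1.
  apply: (proj2 (dv_row _)) => k kn.
  rewrite (_ : (fun t => _) =
      (fun t => [:: expR (s * t); 0; 0; expR (- 2 * (s * t))]`_k)); last first.
    by apply/funext => t; rewrite co_mk.
  rewrite coZ /hvec co_mk //.
  move: kn; nat_cases k => _ /=; rewrite ?mulr0; try exact: dvC.
    apply: dv_eq; first exact: dvE ds.
    by rewrite /= mulr0 expR0 mul1r mulr1.
  apply: dv_eq; first exact: dvE (dvM (dvC (- 2) _ _) ds).
  by rewrite /= !mulr0 expR0 mul1r addr0 mulrC.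
Qed.

End Homogeneous.

Ltac dv_tac := repeat first
  [ eassumption | eapply dvC | eapply dv_co | eapply dvD | eapply dvN
  | eapply dvM | eapply dvV ].

(** * The invariant frame and the CR structure *)

Section Frame.
Variable R : realType.

Notation row := 'rV[R]_7.

(** Substitution is an action of matrices; through this the inverse frame [Th] uses the substitution
    by the inverse matrix. *)
Lemma cubic_subst_comp (a b c d a' b' c' d' y0 y1 y2 y3 : R) (j : nat) :
  let z := cubic_subst a' b' c' d' y0 y1 y2 y3 in
  (cubic_subst a b c d z`_0 z`_1 z`_2 z`_3)`_j =
  (cubic_subst (a * a' + b * c') (a * b' + b * d') (c * a' + d * c') (c * b' + d * d')
     y0 y1 y2 y3)`_j.
Proof. by move: j => [|[|[|[|j]]]] /=; rewrite ?nth_nil //; ring. Qed.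

Lemma cubic_subst_one (y0 y1 y2 y3 : R) j :
  (cubic_subst 1 0 0 1 y0 y1 y2 y3)`_j = [:: y0; y1; y2; y3]`_j.
Proof. by move: j => [|[|[|[|j]]]] /=; rewrite ?nth_nil //; ring. Qed.

(* [Y] lists the coordinates of a vector of [g / g_o] in the basis [e^-2], [e_1], [e_2], [e_1^2],
  [e_1 e_2], [e_1^3], [n]; [Fr x Y] is the tangent vector at [x] that it defines in the invariant
  frame, and [Th x] is the inverse of [Fr x]. *)
Definition fr_al (Y : row) : R := - 2 * co 4 Y.
Definition fr_be (Y : row) : R := - 2 * co 6 Y.
Definition fr_ga (Y : row) : R := - co 2 Y.

Definition Fr (x Y : row) : row :=
  let y := cubic_subst (co 0 x) (xw1 x) (co 1 x) (xw2 x)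
             (co 0 Y) (co 1 Y) (co 3 Y) (co 5 Y) in
  mk 6 [:: fr_al Y * co 0 x + fr_ga Y * xw1 x;
           fr_al Y * co 1 x + fr_ga Y * xw2 x;
           fr_be Y - 2 * fr_al Y * co 2 x
             + fr_ga Y * ((xq x)^-1 * (xq x)^-1 - co 2 x * co 2 x);
           y`_0; y`_1; y`_2; y`_3].

Definition Th (x V : row) : row :=
  let al := co 0 V * xw2 x - co 1 V * xw1 x in
  let ga := co 0 x * co 1 V - co 1 x * co 0 V in
  let be := co 2 V + 2 * al * co 2 x
            - ga * ((xq x)^-1 * (xq x)^-1 - co 2 x * co 2 x) in
  let y := cubic_subst (xw2 x) (- xw1 x) (- co 1 x) (co 0 x)
             (co 3 V) (co 4 V) (co 5 V) (co 6 V) in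
  mk 6 [:: y`_0; y`_1; - ga; y`_2; - 2^-1 * al; y`_3; - 2^-1 * be].

Lemma FrK x Y : OmX x -> Th x (Fr x Y) = Y.
Proof.
move=> x0; have d1 := xw_det x0.
have e k : (k < 4)%N -> (cubic_subst (xw2 x) (- xw1 x) (- co 1 x) (co 0 x)
   (co 3 (Fr x Y)) (co 4 (Fr x Y)) (co 5 (Fr x Y)) (co 6 (Fr x Y)))`_k =
   [:: co 0 Y; co 1 Y; co 3 Y; co 5 Y]`_k.
  move=> k4; rewrite /Fr !(co_mk _ (n := 6)) // cubic_subst_comp -cubic_subst_one.
  by congr ((cubic_subst _ _ _ _ _ _ _ _)`_ _); rewrite -?d1; ring.
have eal : co 0 (Fr x Y) * xw2 x - co 1 (Fr x Y) * xw1 x = fr_al Y.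
  by rewrite !(co_mk _ (n := 6)) //= -[RHS]mulr1 -d1; ring.
have ega : co 0 x * co 1 (Fr x Y) - co 1 x * co 0 (Fr x Y) = fr_ga Y.
  by rewrite !(co_mk _ (n := 6)) //= -[RHS]mulr1 -d1; ring.
apply: co_eq => k kn; rewrite /Th eal ega !e // co_mk //.
have -> : co 2 (Fr x Y) = fr_be Y - 2 * fr_al Y * co 2 x
             + fr_ga Y * ((xq x)^-1 * (xq x)^-1 - co 2 x * co 2 x) by rewrite co_mk.
by move: kn; rewrite /fr_al /fr_ga /fr_be; ord_cases k => _ /=; field.
Qed.

Lemma ThK x V : OmX x -> Fr x (Th x V) = V.
Proof.
move=> x0; have d1 := xw_det x0.
have e k : (k < 4)%N -> (cubic_subst (co 0 x) (xw1 x) (co 1 x) (xw2 x)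
   (co 0 (Th x V)) (co 1 (Th x V)) (co 3 (Th x V)) (co 5 (Th x V)))`_k =
   [:: co 3 V; co 4 V; co 5 V; co 6 V]`_k.
  move=> k4; rewrite /Th !(co_mk _ (n := 6)) // cubic_subst_comp -cubic_subst_one.
  by congr ((cubic_subst _ _ _ _ _ _ _ _)`_ _); rewrite -?d1; ring.
have eal : fr_al (Th x V) = co 0 V * xw2 x - co 1 V * xw1 x.
  by rewrite /fr_al co_mk //=; field.
have ega : fr_ga (Th x V) = co 0 x * co 1 V - co 1 x * co 0 V.
  by rewrite /fr_ga co_mk //=; field.
have ebe : fr_be (Th x V) = co 2 V + 2 * fr_al (Th x V) * co 2 x
            - fr_ga (Th x V) * ((xq x)^-1 * (xq x)^-1 - co 2 x * co 2 x).
  by rewrite eal ega /fr_be co_mk //=; field.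
apply: co_eq => k kn; rewrite /Fr co_mk // !e // ebe eal ega.
move: kn; ord_cases k => _ /=; try ring.
  by rewrite -[RHS]mulr1 -d1; ring.
by rewrite -[RHS]mulr1 -d1; ring.
Qed.

(** The infinitesimal action on cubics of the matrix [[[al, be], [ga, -al]]] attached to [Y]: the
    derivative of [cubic_subst] at the identity. *)
Definition rho (Y Z : row) : seq R :=
  let a := fr_al Y in let b := fr_be Y in let g := fr_ga Y in
  [:: - 3 * a * co 0 Z + g * co 1 Z;
      - a * co 1 Z + 2 * g * co 3 Z + 3 * b * co 0 Z;
      a * co 3 Z + 3 * g * co 5 Z + 2 * b * co 1 Z;
      3 * a * co 5 Z + b * co 3 Z].

(** The Lie bracket of the semidirect product of sl_2 and S^3, transported to g / g_o; [Y] stands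
    for the matrix [[[al, be], [ga, -al]]] and the cubic of coefficients of e^-2, e_1, e_1^2,
    e_1^3. *)
Definition br (Y Z : row) : row :=
  let a := fr_al Y in let b := fr_be Y in let g := fr_ga Y in
  let a' := fr_al Z in let b' := fr_be Z in let g' := fr_ga Z in
  mk 6 [:: (rho Y Z)`_0 - (rho Z Y)`_0; (rho Y Z)`_1 - (rho Z Y)`_1;
    - (2 * (g * a' - g' * a)); (rho Y Z)`_2 - (rho Z Y)`_2;
    - 2^-1 * (b * g' - b' * g); (rho Y Z)`_3 - (rho Z Y)`_3;
    - 2^-1 * (2 * (a * b' - a' * b))].

Section Derivatives.
Variables (x Y : row).
Hypothesis x0 : OmX x.

Lemma dv_Fr k : (k <= 6)%N -> forall z d, d = co k (Fr x Y) ->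
  dv (fun y : row => co k y) z (Fr x Y) d.
Proof. by move=> _ z d ->; exact: dv_co. Qed.

(** [Fr x Y] is the velocity of the right multiplication of the matrix of columns u, w by
    [[[al, be], [ga, -al]]]: the derivative of u is [al u + ga w], that of w is [be u - al w]. The
    third entry of [Fr] is chosen to this effect. *)
Lemma dv_xw1 :
  dv (@xw1 R) x (Fr x Y) (fr_be Y * co 0 x - fr_al Y * xw1 x).
Proof.
rewrite /xw1 /xq; eapply dv_eq; first by dv_tac; exact: x0.
rewrite /Fr !(co_mk _ (n := 6)) //= /xw1 /xw2 /xq.
by move: x0; rewrite /OmX /= /xq => x0'; field.
Qed.

Lemma dv_xw2 :
  dv (@xw2 R) x (Fr x Y) (fr_be Y * co 1 x - fr_al Y * xw2 x).
Proof.
rewrite /xw2 /xq; eapply dv_eq; first by dv_tac; exact: x0.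
rewrite /Fr !(co_mk _ (n := 6)) //= /xw1 /xw2 /xq.
by move: x0; rewrite /OmX /= /xq => x0'; field.
Qed.

Lemma dv_xqV : dv (fun y => (@xq R y)^-1) x (Fr x Y)
  (- 2 * (xq x)^-1 * (fr_al Y + fr_ga Y * co 2 x)).
Proof.
rewrite /xq; eapply dv_eq; first by dv_tac; exact: x0.
rewrite /Fr !(co_mk _ (n := 6)) //= /xw1 /xw2 /xq.
by move: x0; rewrite /OmX /= /xq => x0'; field.
Qed.

Lemma dv_u1 : dv (fun y : row => co 0 y) x (Fr x Y)
  (fr_al Y * co 0 x + fr_ga Y * xw1 x).
Proof. by apply: dv_Fr => //; rewrite co_mk. Qed.

Lemma dv_u2 : dv (fun y : row => co 1 y) x (Fr x Y)
  (fr_al Y * co 1 x + fr_ga Y * xw2 x).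
Proof. by apply: dv_Fr => //; rewrite co_mk. Qed.

Lemma dv_t : dv (fun y : row => co 2 y) x (Fr x Y)
  (fr_be Y - 2 * fr_al Y * co 2 x
             + fr_ga Y * ((xq x)^-1 * (xq x)^-1 - co 2 x * co 2 x)).
Proof. by apply: dv_Fr => //; rewrite co_mk. Qed.

End Derivatives.

(** Leibniz rule: [Fr x q] comes from the derivative [q] of the coefficients, the other term from
    the derivative of the frame. *)
Definition dFr (x Y Z q : row) : row :=
  let du1 := fr_al Y * co 0 x + fr_ga Y * xw1 x in
  let du2 := fr_al Y * co 1 x + fr_ga Y * xw2 x in
  let dw1 := fr_be Y * co 0 x - fr_al Y * xw1 x in
  let dw2 := fr_be Y * co 1 x - fr_al Y * xw2 x in
  let r := (xq x)^-1 in
  let t := co 2 x in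
  let dt := fr_be Y - 2 * fr_al Y * t + fr_ga Y * (r * r - t * t) in
  let dr := - 2 * r * (fr_al Y + fr_ga Y * t) in
  let y := cubic_subst (co 0 x) (xw1 x) (co 1 x) (xw2 x)
    (rho Y Z)`_0 (rho Y Z)`_1 (rho Y Z)`_2 (rho Y Z)`_3 in
  Fr x q + mk 6 [:: fr_al Z * du1 + fr_ga Z * dw1; fr_al Z * du2 + fr_ga Z * dw2;
    - 2 * fr_al Z * dt + fr_ga Z * (2 * r * dr - 2 * t * dt);
    y`_0; y`_1; y`_2; y`_3].

Lemma derive_Fr (Y : row) (Z : row -> row) x : OmX x -> differentiable Z x ->
  differentiable (fun y => Fr y (Z y)) x /\
  'D_(Fr x Y) (fun y => Fr y (Z y)) x = dFr x Y (Z x) ('D_(Fr x Y) Z x).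
Proof.
move=> x0 dZ; set v := Fr x Y; set q := 'D_v Z x.
have hZ j : dv (fun y => co j (Z y)) x v (co j q).
  split; last by rewrite /q /co derive_row.
  by have := differentiable_row_coord (inord j) dZ.
have h1 := dv_u1 x Y; have h2 := dv_u2 x Y; have h3 := dv_t x Y.
have h4 := dv_xw1 Y x0; have h5 := dv_xw2 Y x0; have h6 := dv_xqV Y x0.
rewrite -/v in h1 h2 h3 h4 h5 h6.
have H k : (k <= 6)%N ->
  dv (fun y => co k (Fr y (Z y))) x v (co k (dFr x Y (Z x) q)).
  move=> kn; rewrite (_ : (fun y => co k (Fr y (Z y))) = fun y =>
    (let y' := cubic_subst (co 0 y) (xw1 y) (co 1 y) (xw2 y)
             (co 0 (Z y)) (co 1 (Z y)) (co 3 (Z y)) (co 5 (Z y)) in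
     [:: fr_al (Z y) * co 0 y + fr_ga (Z y) * xw1 y;
           fr_al (Z y) * co 1 y + fr_ga (Z y) * xw2 y;
           fr_be (Z y) - 2 * fr_al (Z y) * co 2 y
             + fr_ga (Z y) * ((xq y)^-1 * (xq y)^-1 - co 2 y * co 2 y);
           y'`_0; y'`_1; y'`_2; y'`_3])`_k); last first.
    by apply/funext => y; rewrite co_mk.
  rewrite /dFr coD /Fr !(co_mk _ (n := 6)) //.
  move: h1 h2 h3 h4 h5 h6 kn; rewrite /fr_al /fr_be /fr_ga => h1 h2 h3 h4 h5 h6.
  ord_cases k => _ /=;
    (eapply dv_eq; [by repeat first [eapply hZ | dv_tac]|]);
    rewrite /= /rho /fr_al /fr_be /fr_ga /=; ring.
exact: dv_row H.
Qed.

(** The frame has the constant structure [br], because it consists of left-invariant fields; only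
    the coefficients contribute derivatives. *)
Lemma Fr_bracket (Y Z : row -> row) x : OmX x ->
  differentiable Y x -> differentiable Z x ->
  let V := fun y => Fr y (Y y) in let W := fun y => Fr y (Z y) in
  'D_(V x) W x - 'D_(W x) V x =
  Fr x ('D_(V x) Z x - 'D_(W x) Y x + br (Y x) (Z x)).
Proof.
move=> x0 dY dZ V W.
rewrite /V /W (derive_Fr (Y x) x0 dZ).2 (derive_Fr (Z x) x0 dY).2.
set p := 'D__ Z x; set q := 'D__ Y x.
move: (Y x) (Z x) p q => y z p q.
have ea : fr_al (p - q + br y z) =
    fr_al p - fr_al q + (fr_be y * fr_ga z - fr_be z * fr_ga y).
  by rewrite {1 2 3}/fr_al coD coB /br (co_mk _ (n := 6)) //=; field.
have eb : fr_be (p - q + br y z) =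
    fr_be p - fr_be q + 2 * (fr_al y * fr_be z - fr_al z * fr_be y).
  by rewrite {1 2 3}/fr_be coD coB /br (co_mk _ (n := 6)) //=; field.
have eg : fr_ga (p - q + br y z) =
    fr_ga p - fr_ga q + 2 * (fr_ga y * fr_al z - fr_ga z * fr_al y).
  by rewrite {1 2 3}/fr_ga coD coB /br (co_mk _ (n := 6)) //=; ring.
have ey k : (k < 4)%N -> let j := [:: 0; 1; 3; 5]%N`_k in
    co j (p - q + br y z) = co j p - co j q + ((rho y z)`_k - (rho z y)`_k).
  by move=> k4 j; rewrite {}/j coD coB /br; move: k4; nat_cases k => _; rewrite co_mk.
have e0 := ey 0%N isT; have e1 := ey 1%N isT; have e2 := ey 2%N isT; have e3 := ey 3%N isT.
rewrite /= in e0 e1 e2 e3.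
move: (rho y z) (rho z y) e0 e1 e2 e3 {ey} => s s' e0 e1 e2 e3.
apply: co_eq => k kn; rewrite coB /dFr !coD /Fr ea eb eg e0 e1 e2 e3.
rewrite !(co_mk _ (n := 6)) //.
move: s`_0 s`_1 s`_2 s`_3 s'`_0 s'`_1 s'`_2 s'`_3 => *.
by move: kn; ord_cases k => _ /=; ring.
Qed.

End Frame.

Lemma ci_scale (R : realType) (V : lmodType R) (u : cplx V) :
  (@ci R) *: u = (- u.2, u.1).
Proof.
rewrite [LHS]/(@Defs.cscale R V (@ci R) u) /Defs.cscale /=.
by rewrite !scale0r !scale1r sub0r add0r.
Qed.

Section CRStructure.
Variable R : realType.

Notation row := 'rV[R]_7.
Local Notation Xm := (Xm R).
Local Notation OmX := (@OmX R).

Lemma Fr_lin (x Y Z : row) (a : R) : Fr x (a *: Y + Z) = a *: Fr x Y + Fr x Z.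
Proof.
apply: co_eq => k kn; rewrite coZD /Fr !co_mk // /fr_al /fr_be /fr_ga /cubic_subst !coZD.
by move: kn; ord_cases k => _ /=; ring.
Qed.

Lemma FrD (x Y Z : row) : Fr x (Y + Z) = Fr x Y + Fr x Z.
Proof. by rewrite -{1}[Y]scale1r Fr_lin scale1r. Qed.

Lemma Fr0 (x : row) : Fr x 0 = 0.
Proof. by apply: (@addrI _ (Fr x 0)); rewrite -FrD !addr0. Qed.

Lemma FrZ (x Y : row) (a : R) : Fr x (a *: Y) = a *: Fr x Y.
Proof. by rewrite -[a *: Y]addr0 Fr_lin Fr0 addr0. Qed.

Lemma FrN (x Y : row) : Fr x (- Y) = - Fr x Y.
Proof. by rewrite -scaleN1r FrZ scaleN1r. Qed.

Lemma FrB (x Y Z : row) : Fr x (Y - Z) = Fr x Y - Fr x Z.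
Proof. by rewrite FrD FrN. Qed.

Lemma Fr_inj (x Y Z : row) : OmX x -> Fr x Y = Fr x Z -> Y = Z.
Proof. by move=> x0 /(congr1 (Th x)); rewrite !FrK. Qed.

Lemma Th_lin (x V W : row) (a : R) : OmX x ->
  Th x (a *: V + W) = a *: Th x V + Th x W.
Proof. by move=> x0; apply: (Fr_inj x0); rewrite Fr_lin !ThK. Qed.

(** Read off from q, whose elements have coordinates of the form [(p, ip)] along each of the pairs
    (1,2), (3,4), (5,6). Coordinate 0, that of e^-2, is transverse to the distribution and is sent
    to 0. *)
Definition J0 (Y : row) : row :=
  mk 6 [:: 0; co 2 Y; - co 1 Y; co 4 Y; - co 3 Y; co 6 Y; - co 5 Y].

Lemma J0_lin (a : R) (Y Z : row) : J0 (a *: Y + Z) = a *: J0 Y + J0 Z.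
Proof.
apply: co_eq => k kn; rewrite coZD /J0 !co_mk // !coZD.
by move: kn; ord_cases k => _ /=; ring.
Qed.

Lemma J0D (Y Z : row) : J0 (Y + Z) = J0 Y + J0 Z.
Proof. by rewrite -{1}[Y]scale1r J0_lin scale1r. Qed.

Lemma J0_0 : J0 0 = 0.
Proof. by apply: (@addrI _ (J0 0)); rewrite -J0D !addr0. Qed.

Lemma J0Z (a : R) (Y : row) : J0 (a *: Y) = a *: J0 Y.
Proof. by rewrite -[a *: Y]addr0 J0_lin J0_0 addr0. Qed.

Lemma J0N (Y : row) : J0 (- Y) = - J0 Y.
Proof. by rewrite -scaleN1r J0Z scaleN1r. Qed.

Lemma J0_co0 Y : co 0 (J0 Y) = 0.
Proof. by rewrite co_mk. Qed.

Lemma J0K Y : co 0 Y = 0 -> J0 (J0 Y) = - Y.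
Proof.
move=> Y0; apply: co_eq => k kn; rewrite coN /J0 !(co_mk _ (n := 6)) //.
by move: kn; nat_cases k => _ /=; rewrite ?Y0 ?oppr0.
Qed.

Definition XD (x : Xm) : set row := [set V | co 0 (Th (val x) V) = 0].
Definition XJ (x : Xm) (V : row) : row := Fr (val x) (J0 (Th (val x) V)).

Lemma XDFr (x : Xm) Y : XD x (Fr (val x) Y) <-> co 0 Y = 0.
Proof. by rewrite /XD /= FrK //; exact: xP. Qed.

Lemma XJFr (x : Xm) Y : XJ x (Fr (val x) Y) = Fr (val x) (J0 Y).
Proof. by rewrite /XJ FrK //; exact: xP. Qed.

Lemma D10P (x : Xm) Y Z : D10 XD XJ x (Fr (val x) Y, Fr (val x) Z) <->
  co 0 Y = 0 /\ Z = - J0 Y.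
Proof.
split=> [[[/= /XDFr Y0 /XDFr Z0]]|[Y0 ->]].
  rewrite /cmap ci_scale /= !XJFr.
  move=> [/eqP + _]; rewrite -FrN => /eqP /(Fr_inj (xP x)) ->.
  by rewrite opprK.
split; first by split; apply/XDFr => //=; rewrite coN J0_co0 oppr0.
rewrite /= /cmap ci_scale /= !XJFr.
by rewrite -FrN opprK J0N J0K // opprK.
Qed.

Lemma D01P (x : Xm) Y Z : D01 XD XJ x (Fr (val x) Y, Fr (val x) Z) <->
  co 0 Y = 0 /\ Z = J0 Y.
Proof.
split=> [[[V W] h [e1 e2]]|[Y0 ->]].
  have eW : W = Fr (val x) (- Z) by rewrite FrN -e2 opprK.
  by move: h; rewrite e1 eW => /D10P [-> /oppr_inj].
exists (Fr (val x) Y, Fr (val x) (- J0 Y)); first exact/D10P.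
by rewrite /cconj /= FrN opprK.
Qed.

Lemma Ck_Fr k (Z : row -> row) : Ck OmX k Z -> Ck OmX k (fun y => Fr y (Z y)).
Proof.
have oX := @oOmX R => CZ.
have hZ j : Ck OmX k (fun y => co j (Z y)) by exact: Ck_co.
have h1 : Ck OmX k (@xw1 R) by rewrite /xw1 /xq; ck_tac => ?.
have h2 : Ck OmX k (@xw2 R) by rewrite /xw2 /xq; ck_tac => ?.
have h3 : Ck OmX k (fun y => (@xq R y)^-1) by rewrite /xq; ck_tac => ?.
apply: Ck_rowco => // j jn; move: jn; nat_cases j => _.
all: apply: (Ck_eq oX); [by move=> p _; rewrite /Fr co_mk //= /fr_al /fr_be /fr_ga|].
all: repeat first [apply: hZ | ck_tac].
Qed.

Lemma Ck_Th k (V : row -> row) : Ck OmX k V -> Ck OmX k (fun y => Th y (V y)).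
Proof.
have oX := @oOmX R => CZ.
have hZ j : Ck OmX k (fun y => co j (V y)) by exact: Ck_co.
have h1 : Ck OmX k (@xw1 R) by rewrite /xw1 /xq; ck_tac => ?.
have h2 : Ck OmX k (@xw2 R) by rewrite /xw2 /xq; ck_tac => ?.
have h3 : Ck OmX k (fun y => (@xq R y)^-1) by rewrite /xq; ck_tac => ?.
apply: Ck_rowco => // j jn; move: jn; nat_cases j => _.
all: apply: (Ck_eq oX); [by move=> p _; rewrite /Th co_mk //=|].
all: repeat first [apply: hZ | ck_tac].
Qed.

Lemma Ck_J0 k (Z : row -> row) : Ck OmX k Z -> Ck OmX k (fun y => J0 (Z y)).
Proof.
have oX := @oOmX R => CZ.
have hZ j : Ck OmX k (fun y => co j (Z y)) by exact: Ck_co.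
apply: Ck_rowco => // j jn; move: jn; nat_cases j => _.
all: apply: (Ck_eq oX); [by move=> p _; rewrite /J0 co_mk //=|].
all: repeat first [apply: hZ | ck_tac].
Qed.

Lemma Ck_br k (Y Z : row -> row) : Ck OmX k Y -> Ck OmX k Z ->
  Ck OmX k (fun y => br (Y y) (Z y)).
Proof.
have oX := @oOmX R => CY CZ.
have hY j : Ck OmX k (fun y => co j (Y y)) by exact: Ck_co.
have hZ j : Ck OmX k (fun y => co j (Z y)) by exact: Ck_co.
apply: Ck_rowco => // j jn; move: jn; nat_cases j => _.
all: apply: (Ck_eq oX); [by move=> p _; rewrite /br co_mk //= /rho /fr_al /fr_be /fr_ga /=|].
all: repeat first [apply: hY | apply: hZ | ck_tac].
Qed.

(** The derivative is linear in the direction, hence a combination of the partial derivatives of [Z]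
    with the entries of [V] as coefficients. *)
Lemma Ck_derive_along k (V Z : row -> row) : Ck OmX k V -> Ck OmX k.+1 Z ->
  Ck OmX k (fun y => 'D_(V y) Z y).
Proof.
have oX := @oOmX R => CV CZ.
apply: (Ck_eq oX (f := fun y => \sum_(i < 7) V y 0 i *: 'D_(delta_mx 0 i) Z y)).
  move=> y y0; have dZ := Ck_differentiable CZ y0.
  rewrite deriveE // [in RHS](row_sum_delta (V y)) linear_sum.
  by apply: eq_bigr => i _; rewrite linearZ deriveE.
apply/Ck_row => // j.
apply: (Ck_eq oX (f := fun y => \sum_(i < 7) V y 0 i * ('D_(delta_mx 0 i) Z y) 0 j)).
  by move=> y _; rewrite summxE; apply: eq_bigr => i _; rewrite mxE.
rewrite (_ : (fun y => _) = fun y => \sum_(i <- enum 'I_7) V y 0 i * ('D_(delta_mx 0 i) Z y) 0 j);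
  last first.
  by apply/funext => y; rewrite big_enum.
elim: (enum _) => [|i s IH].
  by apply: (Ck_eq oX _ (Ck_cst k (0 : R) oX)) => y _; rewrite big_nil.
apply: (Ck_eq oX (f := fun y => V y 0 i * ('D_(delta_mx 0 i) Z y) 0 j +
   \sum_(i <- s) V y 0 i * ('D_(delta_mx 0 i) Z y) 0 j)).
  by move=> y _; rewrite big_cons.
apply: CkD => //; apply: CkM => //; first exact: ((Ck_row k V oX).2 CV i).
exact: ((Ck_row k _ oX).2 (Ck_derive _ CZ) j).
Qed.

(** The coefficients are obtained by [Th]; smoothness passes both ways because the frame and its
    inverse are smooth. *)
Lemma vf_rep (V : Xm -> row) : smooth_vf_on setT V <->
  exists Y : row -> row, (forall k, Ck OmX k Y) /\
    forall x, V x = Fr (val x) (Y (val x)).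
Proof.
split=> [/om_smooth_vf CV|[Y [CY VY]]].
  exists (fun v => Th v (V (om_crdV (@xo_subproof R) v))); split.
    by move=> k; apply: Ck_Th; exact: CV.
  by move=> x; rewrite om_valK ThK //; exact: xP.
apply/om_smooth_vf => k; apply: (Ck_eq (@oOmX R) _ (Ck_Fr (CY k))) => v v0 /=.
by rewrite VY om_crdVK.
Qed.

Definition Bop (Y Z : row -> row) (y : row) : row :=
  'D_(Fr y (Y y)) Z y - 'D_(Fr y (Z y)) Y y + br (Y y) (Z y).

Lemma vf_br_rep (V W : Xm -> row) (Y Z : row -> row) x :
  Ck OmX 0 Y -> Ck OmX 0 Z ->
  (forall x, V x = Fr (val x) (Y (val x))) ->
  (forall x, W x = Fr (val x) (Z (val x))) ->
  vf_br V W x = Fr (val x) (Bop Y Z (val x)).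
Proof.
move=> CY CZ VY WZ; rewrite om_vf_br.
have eV : \forall v \near val x, (V \o om_crdV (@xo_subproof R)) v = Fr v (Y v).
  apply: (@om_near _ _ _ _ (@oOmX R) (@xo_subproof R)) => y /=.
  by rewrite om_valK VY.
have eW : \forall v \near val x, (W \o om_crdV (@xo_subproof R)) v = Fr v (Z v).
  apply: (@om_near _ _ _ _ (@oOmX R) (@xo_subproof R)) => y /=.
  by rewrite om_valK WZ.
rewrite (near_eq_derive _ eV) (near_eq_derive _ eW) VY WZ.
apply: Fr_bracket; first exact: xP.
  exact: Ck_differentiable CY (xP x).
exact: Ck_differentiable CZ (xP x).
Qed.

End CRStructure.

(** * The Freeman sequence of sections *)

Section Freeman.
Variable R : realType.

Notation row := 'rV[R]_7.
Local Notation Xm := (Xm R).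
Local Notation OmX := (@OmX R).
Implicit Types a b : row -> row.

Lemma derive_J0 a (y v : row) : differentiable a y ->
  differentiable (fun z => J0 (a z)) y /\
  'D_v (fun z => J0 (a z)) y = J0 ('D_v a y).
Proof.
move=> da; apply: dv_row => k kn.
have ha j : dv (fun z => co j (a z)) y v (co j ('D_v a y)).
  split; last by rewrite /co derive_row.
  by have := differentiable_row_coord (inord j) da.
rewrite /J0 co_mk // (_ : (fun z => _) = fun z => [:: 0; co 2 (a z);
  - co 1 (a z); co 4 (a z); - co 3 (a z); co 6 (a z); - co 5 (a z)]`_k); last first.
  by apply/funext => z; rewrite co_mk.
by move: kn; ord_cases k => _ /=; first [exact: dvC | exact: ha | apply: dvN; exact: ha].
Qed.

Lemma derive_scale (e : R) a (y v : row) : differentiable a y ->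
  differentiable (fun z => e *: a z) y /\
  'D_v (fun z => e *: a z) y = e *: 'D_v a y.
Proof.
move=> da; split; first exact: differentiableZ.
by rewrite [LHS]deriveZ //; exact: diff_derivable.
Qed.

Lemma CkZ k (e : R) a : Ck OmX k a -> Ck OmX k (fun y => e *: a y).
Proof.
have oX := @oOmX R => Ca; apply: Ck_rowco => // j jn.
apply: (Ck_eq oX (f := fun y => e * co j (a y))); first by move=> y _; rewrite coZ.
by apply: CkM => //; [exact: Ck_cst | exact: Ck_co].
Qed.

Lemma derive_dirZ (e : R) a (y v : row) : differentiable a y ->
  'D_(e *: v) a y = e *: 'D_v a y.
Proof. by move=> da; rewrite !deriveE // linearZ. Qed.

Lemma derive_co0 a k (y v : row) : OmX y -> differentiable a y ->
  (forall z, OmX z -> co k (a z) = 0) -> co k ('D_v a y) = 0.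
Proof.
move=> y0 da a0; rewrite /co derive_row //.
rewrite -[RHS](derive_cst (0 : R) y v); apply: near_eq_derive.
by move: (open_nbhs_nbhs (conj (@oOmX R) y0)); apply: filterS => z /a0.
Qed.

(* For [e = -1] (resp. [e = 1]) a section of [D^10] (resp. [D^01]) with real part [a]. *)
Definition zf (e : R) a : cvf Xm := fun x =>
  (Fr (val x) (a (val x)), Fr (val x) (e *: J0 (a (val x)))).

Definition cvf_rep (Z : cvf Xm) (e : R) a :=
  [/\ forall k, Ck OmX k a, forall y, OmX y -> co 0 (a y) = 0 & Z = zf e a].

Lemma smooth_zf e a : (forall k, Ck OmX k a) -> smooth_cvf (zf e a).
Proof.
move=> Ca; split; apply/vf_rep; first by exists a.
exists (fun y => e *: J0 (a y)); split=> // k.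
by apply: CkZ; exact: Ck_J0.
Qed.

Lemma sections10 Z : sections (D10 (@XD R) (@XJ R)) Z <->
  exists a, cvf_rep Z (-1) a.
Proof.
split=> [[[/vf_rep [a [Ca aE]] /vf_rep [b [Cb bE]]] ZD]|[a [Ca a0 ->]]].
  have h (x : Xm) : co 0 (a (val x)) = 0 /\ b (val x) = - J0 (a (val x)).
    by apply/(@D10P R x); rewrite -aE -bE; have := ZD x; case: (Z x).
  exists a; split => //.
    by move=> y y0; have [+ _] := h (om_crdV (@xo_subproof R) y); rewrite om_crdVK.
  apply/funext => x; rewrite /zf scaleN1r -(h x).2 -aE -bE; by case: (Z x).
split; first exact: smooth_zf.
by move=> x; rewrite /zf scaleN1r; apply/D10P; split => //; apply: a0; exact: xP.
Qed.

Lemma sections01 Z : sections (D01 (@XD R) (@XJ R)) Z <->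
  exists a, cvf_rep Z 1 a.
Proof.
split=> [[[/vf_rep [a [Ca aE]] /vf_rep [b [Cb bE]]] ZD]|[a [Ca a0 ->]]].
  have h (x : Xm) : co 0 (a (val x)) = 0 /\ b (val x) = J0 (a (val x)).
    by apply/(@D01P R x); rewrite -aE -bE; have := ZD x; case: (Z x).
  exists a; split => //.
    by move=> y y0; have [+ _] := h (om_crdV (@xo_subproof R) y); rewrite om_crdVK.
  apply/funext => x; rewrite /zf scale1r -(h x).2 -aE -bE; by case: (Z x).
split; first exact: smooth_zf.
by move=> x; rewrite /zf scale1r; apply/D01P; split => //; apply: a0; exact: xP.
Qed.

(* [daB = 'D_a b], [djaB = 'D_(J0 a) b], [dbA = 'D_b a], [djbA = 'D_(J0 b) a]. *)
Definition brP (e : R) (a b daB djaB dbA djbA : row) : row :=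
  daB - dbA + br a b + e *: (J0 djaB - J0 djbA + br (J0 a) (J0 b)).
Definition brQ (e : R) (a b daB djaB dbA djbA : row) : row :=
  e *: (J0 daB - djbA + br a (J0 b)) - (djaB - J0 dbA + br (J0 a) b).

(** [fP] and [fQ] are the frame coordinates of the real and imaginary parts of the bracket of
    [zf (-1) a] with [zf e b]; [e = 1] is a bracket with D^01, [e = -1] a bracket inside D^10. *)
Definition fP e a b (y : row) : row :=
  brP e (a y) (b y) ('D_(Fr y (a y)) b y) ('D_(Fr y (J0 (a y))) b y)
    ('D_(Fr y (b y)) a y) ('D_(Fr y (J0 (b y))) a y).
Definition fQ e a b (y : row) : row :=
  brQ e (a y) (b y) ('D_(Fr y (a y)) b y) ('D_(Fr y (J0 (a y))) b y)
    ('D_(Fr y (b y)) a y) ('D_(Fr y (J0 (b y))) a y).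

Lemma br_scale (e e' : R) (Y Z : row) : br (e *: Y) (e' *: Z) = (e * e') *: br Y Z.
Proof.
apply: co_eq => k kn; rewrite coZ /br !(co_mk _ (n := 6)) // /rho /fr_al /fr_be /fr_ga !coZ.
by move: kn; ord_cases k => _ /=; field.
Qed.

Lemma br_scalel (e : R) (Y Z : row) : br (e *: Y) Z = e *: br Y Z.
Proof. by rewrite -{1}[Z]scale1r br_scale mulr1. Qed.

Lemma br_scaler (e : R) (Y Z : row) : br Y (e *: Z) = e *: br Y Z.
Proof. by rewrite -{1}[Y]scale1r br_scale mul1r. Qed.

Lemma cvf_br_zf e a b x : (forall k, Ck OmX k a) -> (forall k, Ck OmX k b) ->
  cvf_br (zf (-1) a) (zf e b) x =
  (Fr (val x) (fP e a b (val x)), Fr (val x) (fQ e a b (val x))).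
Proof.
move=> Ca Cb; have x0 := xP x.
have CJ (f : R) c : (forall k, Ck OmX k c) -> Ck OmX 0 (fun y => f *: J0 (c y)).
  by move=> Cc; apply: CkZ; exact: Ck_J0.
have br_ (c d : row -> row) Cc Cd :=
  @vf_br_rep R (fun x => Fr (val x) (c (val x))) (fun x => Fr (val x) (d (val x))) c d x
   Cc Cd (fun=> erefl) (fun=> erefl).
rewrite /cvf_br /zf; cbn [fst snd].
rewrite (br_ a b (Ca 0%N) (Cb 0%N)).
rewrite (br_ _ _ (CJ (-1) a Ca) (CJ e b Cb)).
rewrite (br_ _ _ (Ca 0%N) (CJ e b Cb)).
rewrite (br_ _ _ (CJ (-1) a Ca) (Cb 0%N)).
rewrite -FrB -FrD /Bop /fP /fQ /brP /brQ.
move: (val x) x0 => y y0.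
have da := Ck_differentiable (Ca 0%N) y0; have db := Ck_differentiable (Cb 0%N) y0.
have DJa v := (derive_J0 v da).2; have DJb v := (derive_J0 v db).2.
have dJa := (derive_J0 0 da).1; have dJb := (derive_J0 0 db).1.
rewrite !(derive_scale _ _ dJa).2 !(derive_scale _ _ dJb).2 !FrZ.
rewrite !(derive_dirZ _ _ da) !(derive_dirZ _ _ db) !(derive_dirZ _ _ dJa) !(derive_dirZ _ _ dJb)
  !DJa !DJb.
rewrite br_scale br_scaler br_scalel.
move: ('D_(Fr y (a y)) b y) ('D_(Fr y (J0 (a y))) b y)
  ('D_(Fr y (b y)) a y) ('D_(Fr y (J0 (b y))) a y) (br _ _) (br _ _) (br _ _) (br _ _).
move=> D1 D2 D3 D4 b1 b2 b3 b4.
by congr (Fr _ _, Fr _ _); apply: co_eq => k kn; rewrite !(coD, coB, coZ, coN); ring.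
Qed.

Lemma Ck_fPQ e a b : (forall k, Ck OmX k a) -> (forall k, Ck OmX k b) ->
  forall k, Ck OmX k (fP e a b) /\ Ck OmX k (fQ e a b).
Proof.
have oX := @oOmX R => Ca Cb k.
have CJa := fun k => Ck_J0 (Ca k); have CJb := fun k => Ck_J0 (Cb k).
have D1 := Ck_derive_along (Ck_Fr (Ca k)) (Cb k.+1).
have D2 := Ck_derive_along (Ck_Fr (CJa k)) (Cb k.+1).
have D3 := Ck_derive_along (Ck_Fr (Cb k)) (Ca k.+1).
have D4 := Ck_derive_along (Ck_Fr (CJb k)) (Ca k.+1).
have B1 := Ck_br (Ca k) (Cb k); have B2 := Ck_br (CJa k) (CJb k).
have B3 := Ck_br (Ca k) (CJb k); have B4 := Ck_br (CJa k) (Cb k).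
rewrite /fP /fQ /brP /brQ.
by split; repeat first [assumption | apply: Ck_J0 | apply: CkZ | apply: CkN | apply: CkD].
Qed.

(* The sections of [F_{p-1}^10] are those with [vanish p]: each step kills two more coordinates. *)
Definition vanish (p : nat) a := forall j, (j < p.*2.+1)%N ->
  forall y, OmX y -> co j (a y) = 0.

Lemma vanish_derive p a j (y v : row) : OmX y -> (forall k, Ck OmX k a) ->
  vanish p a -> (j < p.*2.+1)%N -> co j ('D_v a y) = 0.
Proof.
move=> y0 Ca va jp; apply: derive_co0 => //; last exact: va.
exact: Ck_differentiable (Ca 0%N) y0.
Qed.

Lemma co_J0 (Y : row) :
  (co 0 (J0 Y) = 0) * (co 1 (J0 Y) = co 2 Y) * (co 2 (J0 Y) = - co 1 Y) *
  (co 3 (J0 Y) = co 4 Y) * (co 4 (J0 Y) = - co 3 Y) *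
  (co 5 (J0 Y) = co 6 Y) * (co 6 (J0 Y) = - co 5 Y).
Proof. by do !split; rewrite co_mk. Qed.

Lemma co_br (Y Z : row) :
  (co 0 (br Y Z) = 6 * (co 4 Y * co 0 Z - co 4 Z * co 0 Y)
     - (co 2 Y * co 1 Z - co 2 Z * co 1 Y)) *
  (co 1 (br Y Z) = 2 * (co 4 Y * co 1 Z - co 4 Z * co 1 Y)
     - 2 * (co 2 Y * co 3 Z - co 2 Z * co 3 Y)
     - 6 * (co 6 Y * co 0 Z - co 6 Z * co 0 Y)) *
  (co 2 (br Y Z) = - 4 * (co 2 Y * co 4 Z - co 2 Z * co 4 Y)) *
  (co 3 (br Y Z) = - 2 * (co 4 Y * co 3 Z - co 4 Z * co 3 Y)
     - 3 * (co 2 Y * co 5 Z - co 2 Z * co 5 Y)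
     - 4 * (co 6 Y * co 1 Z - co 6 Z * co 1 Y)) *
  (co 4 (br Y Z) = - (co 6 Y * co 2 Z - co 6 Z * co 2 Y)) *
  (co 5 (br Y Z) = - 6 * (co 4 Y * co 5 Z - co 4 Z * co 5 Y)
     - 2 * (co 6 Y * co 3 Z - co 6 Z * co 3 Y)) *
  (co 6 (br Y Z) = - 4 * (co 4 Y * co 6 Z - co 4 Z * co 6 Y)).
Proof.
by do !split; rewrite co_mk //= /rho /fr_al /fr_be /fr_ga /=; field.
Qed.

End Freeman.

Ltac co_expand := rewrite ?(coD, coB, coN, coZ, co_J0, co_br).

Section Involutive.
Variable R : realType.

Notation row := 'rV[R]_7.
Local Notation Xm := (Xm R).
Local Notation OmX := (@OmX R).

(** In the frame, involutivity is an identity between the coordinates of [br] and [J0], once the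
    derivatives of coordinate 0, which vanishes on [OmX], are dropped. *)
Lemma XD_involutive Z W : sections (D10 (@XD R) (@XJ R)) Z ->
  sections (D10 (@XD R) (@XJ R)) W ->
  sections (D10 (@XD R) (@XJ R)) (cvf_br Z W).
Proof.
move=> /sections10 [a [Ca a0 ->]] /sections10 [b [Cb b0 ->]].
apply/sections10; exists (fP (-1) a b).
have va : vanish 0 a by move=> [|j] // _.
have vb : vanish 0 b by move=> [|j] // _.
have key y : OmX y -> co 0 (fP (-1) a b y) = 0 /\
    fQ (-1) a b y = -1 *: J0 (fP (-1) a b y).
  move=> y0; rewrite /fP /fQ.
  have := @vanish_derive R 0 b 0%N y (Fr y (a y)) y0 Cb vb isT.
  have := @vanish_derive R 0 b 0%N y (Fr y (J0 (a y))) y0 Cb vb isT.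
  have := @vanish_derive R 0 a 0%N y (Fr y (b y)) y0 Ca va isT.
  have := @vanish_derive R 0 a 0%N y (Fr y (J0 (b y))) y0 Ca va isT.
  move: ('D_(Fr y (a y)) b y) ('D_(Fr y (J0 (a y))) b y)
    ('D_(Fr y (b y)) a y) ('D_(Fr y (J0 (b y))) a y) (a0 y y0) (b0 y y0).
  move: (a y) (b y) => A B D1 D2 D3 D4 A0 B0 d4 d3 d2 d1.
  rewrite /brP /brQ; split.
    by co_expand; rewrite A0 B0 d1 d3; ring.
  apply: co_eq => k kn; move: kn; ord_cases k => _; co_expand;
    rewrite ?A0 ?B0 ?d1 ?d2 ?d3 ?d4; by ring.
split.
- by move=> k; have [] := Ck_fPQ (-1) Ca Cb k.
- by move=> y /key [].
- by apply/funext => x; rewrite cvf_br_zf // /zf; have [_ ->] := key _ (xP x).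
Qed.

End Involutive.

Section Nondegenerate.
Variable R : realType.

Notation row := 'rV[R]_7.
Local Notation Xm := (Xm R).
Local Notation OmX := (@OmX R).
Implicit Types a b : row -> row.

Definition free_rep (p : nat) (Z : cvf Xm) := exists a,
  [/\ forall k, Ck OmX k a, vanish p a & Z = zf (-1) a].

Lemma vanish0P a : vanish 0 a <-> forall y, OmX y -> co 0 (a y) = 0.
Proof. by split=> [va|a0 [|j] //]; exact: (va 0%N). Qed.

Lemma vanish_le p q a : (q <= p)%N -> vanish p a -> vanish q a.
Proof.
move=> qp va j jq; apply: va; apply: leq_trans jq _.
by rewrite ltnS leq_double.
Qed.

(** Where coordinate 0 vanishes, [(P, Q) = (c, - J0 c) + (d, J0 d)] has the unique solution
    [c = (P + J0 Q)/2], [d = (P - J0 Q)/2]: the components in D^10 and D^01. *)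
Definition fc a b (y : row) : row := 2^-1 *: (fP 1 a b y + J0 (fQ 1 a b y)).
Definition fd a b (y : row) : row := 2^-1 *: (fP 1 a b y - J0 (fQ 1 a b y)).

(** Coordinates 0; 1, 2; 3, 4; 5, 6 have degrees -2, -1, 0, 1, for which [br] is graded and which
    [J0] preserves. Here [a] has degrees at least [p] and [b] at least -1, so the bracket has
    degrees at least [p - 1], which is [vanish p]. The derivatives of [b] cancel in [fc]: they only
    enter the component in D^01. *)
Lemma free_step p a : (p < 3)%N -> (forall k, Ck OmX k a) -> vanish p.+1 a ->
  forall b, (forall k, Ck OmX k b) -> vanish 0 b ->
  (forall y, OmX y -> co 0 (fP 1 a b y) = 0 /\ co 0 (fQ 1 a b y) = 0) /\
  vanish p (fc a b).
Proof.
move=> p3 Ca va b Cb vb.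
have key y : OmX y -> (co 0 (fP 1 a b y) = 0 /\ co 0 (fQ 1 a b y) = 0) /\
   forall j, (j < p.*2.+1)%N -> co j (fc a b y) = 0.
  move=> y0; rewrite /fc /fP /fQ.
  have d1 := @vanish_derive R 0 b 0%N y (Fr y (a y)) y0 Cb vb isT.
  have d2 := @vanish_derive R 0 b 0%N y (Fr y (J0 (a y))) y0 Cb vb isT.
  have d3 j jp := @vanish_derive R p.+1 a j y (Fr y (b y)) y0 Ca va jp.
  have d4 j jp := @vanish_derive R p.+1 a j y (Fr y (J0 (b y))) y0 Ca va jp.
  have A0 j jp := va j jp y y0; have B0 := vb 0%N isT y y0.
  move: ('D_(Fr y (a y)) b y) ('D_(Fr y (J0 (a y))) b y)
    ('D_(Fr y (b y)) a y) ('D_(Fr y (J0 (b y))) a y) d1 d2 d3 d4.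
  move: (a y) (b y) A0 B0 => A B A0 B0 D1 D2 D3 D4 d1 d2 d3 d4 {va Ca}.
  have [[a0 a1 a2] [e0 e1 e2] [f0 f1 f2]] : [/\ [/\ co 0 A = 0, co 1 A = 0 & co 2 A = 0],
     [/\ co 0 D3 = 0, co 1 D3 = 0 & co 2 D3 = 0] &
     [/\ co 0 D4 = 0, co 1 D4 = 0 & co 2 D4 = 0]].
    have h0 : (0 < p.+1.*2.+1)%N by [].
    have h1 : (1 < p.+1.*2.+1)%N by [].
    have h2 : (2 < p.+1.*2.+1)%N by [].
    by rewrite !(A0 _ h0, A0 _ h1, A0 _ h2, d3 _ h0, d3 _ h1, d3 _ h2, d4 _ h0, d4 _ h1, d4 _ h2).
  rewrite /brP /brQ; split.
    by split; co_expand; rewrite ?(a0, a1, a2, e0, e1, e2, f0, f1, f2, B0, d1, d2); ring.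
  move=> j; move: A0 d3 d4; move: p p3 => [|[|[|//]]] _ A0 d3 d4.
  - by ord_cases j => _; co_expand;
      rewrite ?(a0, a1, a2, e0, e1, e2, f0, f1, f2, B0, d1, d2); ring.
  - have a3 := A0 3%N isT; have a4 := A0 4%N isT.
    have e3 := d3 3%N isT; have e4 := d3 4%N isT.
    have f3 := d4 3%N isT; have f4 := d4 4%N isT.
    ord_cases j => _; co_expand; rewrite ?(a0, a1, a2, e0, e1, e2, f0, f1, f2,
      B0, d1, d2, a3, a4, e3, e4, f3, f4); ring.
  - have a3 := A0 3%N isT; have a4 := A0 4%N isT; have a5 := A0 5%N isT; have a6 := A0 6%N isT.
    have e3 := d3 3%N isT; have e4 := d3 4%N isT.
    have f3 := d4 3%N isT; have f4 := d4 4%N isT.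
    ord_cases j => _; co_expand; rewrite ?(a0, a1, a2, e0, e1, e2, f0, f1, f2,
      B0, d1, d2, a3, a4, e3, e4, f3, f4, a5, a6); ring.
split=> [y /key [] //|j jp y /key [_]]; exact.
Qed.

(* The bracket with the constant section of coordinates [e_1] detects the next two coordinates. *)
Lemma free_back p a : (p < 3)%N -> (forall k, Ck OmX k a) -> vanish p a ->
  (forall b, (forall k, Ck OmX k b) -> vanish 0 b ->
    (forall y, OmX y -> co 0 (fP 1 a b y) = 0 /\ co 0 (fQ 1 a b y) = 0) /\
    vanish p (fc a b)) -> vanish p.+1 a.
Proof.
move=> p3 Ca va H.
pose b (_ : row) : row := mk 6 [:: 0; 1].
have Cb k : Ck OmX k b by apply: Ck_cst; exact: oOmX.
have vb : vanish 0 b by apply/vanish0P => y _; rewrite co_mk.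
have [h0 hc] := H b Cb vb.
move=> j jp y y0; have [hP hQ] := h0 y y0.
have {}hc i ip := hc i ip y y0.
have d1 v : 'D_v b y = 0 by exact: derive_cst.
have d3 i ip := @vanish_derive R p a i y (Fr y (b y)) y0 Ca va ip.
have d4 i ip := @vanish_derive R p a i y (Fr y (J0 (b y))) y0 Ca va ip.
have A0 i ip := va i ip y y0.
move: hP hQ hc; rewrite /fc /fP /fQ !d1.
move: ('D_(Fr y (b y)) a y) ('D_(Fr y (J0 (b y))) a y) d3 d4.
move: (a y) A0.
have Bk k : (k <= 6)%N -> co k (b y) = (k == 1%N)%:R.
  by move=> kn; rewrite co_mk //; case: k kn => [|[|k]] //=; rewrite nth_nil.
move: (b y) Bk => B Bk.
move=> A A0 D3 D4 d3 d4 hP hQ hc {va Ca H h0 d1}.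
move: p3 jp d3 d4 A0 hP hQ hc; rewrite /brP /brQ; move: p => [|[|[|//]]] _ jp d3 d4 A0 hP hQ hc.
- have a0 := A0 0%N isT; have e0 := d3 0%N isT; have f0 := d4 0%N isT.
  move: hP hQ jp; co_expand; rewrite ?(a0, e0, f0) !Bk //= !co0 => hP hQ.
  nat_cases j => _ //; lra.
- have a0 := A0 0%N isT; have a1 := A0 1%N isT; have a2 := A0 2%N isT.
  have e0 := d3 0%N isT; have e1 := d3 1%N isT; have e2 := d3 2%N isT.
  have f0 := d4 0%N isT; have f1 := d4 1%N isT; have f2 := d4 2%N isT.
  have := hc 1%N isT; have := hc 2%N isT; move: jp.
  co_expand; rewrite ?(a0, a1, a2, e0, e1, e2, f0, f1, f2) !Bk //= !co0.
  nat_cases j => _ h1 h2 //; lra.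
- have a0 := A0 0%N isT; have a1 := A0 1%N isT; have a2 := A0 2%N isT.
  have a3 := A0 3%N isT; have a4 := A0 4%N isT.
  have e0 := d3 0%N isT; have e1 := d3 1%N isT; have e2 := d3 2%N isT.
  have e3 := d3 3%N isT; have e4 := d3 4%N isT.
  have f0 := d4 0%N isT; have f1 := d4 1%N isT; have f2 := d4 2%N isT.
  have f3 := d4 3%N isT; have f4 := d4 4%N isT.
  have := hc 3%N isT; have := hc 4%N isT; move: jp.
  co_expand; rewrite ?(a0, a1, a2, e0, e1, e2, f0, f1, f2, a3, a4, e3, e4, f3, f4) !Bk //= !co0.
  nat_cases j => _ h1 h2 //; lra.
Qed.

Lemma zf_split a b (x : Xm) : (forall k, Ck OmX k a) -> (forall k, Ck OmX k b) ->
  co 0 (fP 1 a b (val x)) = 0 -> co 0 (fQ 1 a b (val x)) = 0 ->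
  cvf_br (zf (-1) a) (zf 1 b) x = zf (-1) (fc a b) x + zf 1 (fd a b) x.
Proof.
move=> Ca Cb; rewrite cvf_br_zf // /zf /fc /fd.
move: (val x) => y; move: (fP 1 a b y) (fQ 1 a b y) => P Q P0 Q0.
congr pair; rewrite /= -FrD; congr Fr.
  by apply: co_eq => k kn; rewrite coD !coZ coB coD; field.
by apply: co_eq => k kn; move: kn; ord_cases k => _; co_expand; rewrite ?P0 ?Q0; field.
Qed.

Lemma zf_unique (x : Xm) (P Q c d : row) : co 0 c = 0 -> co 0 d = 0 ->
  (Fr (val x) P, Fr (val x) Q) =
    (Fr (val x) c, Fr (val x) (-1 *: J0 c)) + (Fr (val x) d, Fr (val x) (1 *: J0 d))
    :> cplx row ->
  (co 0 P = 0 /\ co 0 Q = 0) /\ c = 2^-1 *: (P + J0 Q).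
Proof.
move=> c0 d0 [/esym + /esym]; rewrite /= -!FrD => /(Fr_inj (xP x)) <- /(Fr_inj (xP x)) <-.
split; first by co_expand; rewrite c0 d0; split; ring.
by apply: co_eq => k kn; move: kn; ord_cases k => _; co_expand; rewrite ?c0 ?d0; field.
Qed.

Lemma Ck_fcd a b : (forall k, Ck OmX k a) -> (forall k, Ck OmX k b) ->
  forall k, Ck OmX k (fc a b) /\ Ck OmX k (fd a b).
Proof.
have oX := @oOmX R.
move=> Ca Cb k; have [CP CQ] := Ck_fPQ 1 Ca Cb k; rewrite /fc /fd.
by split; apply: CkZ; apply: CkD => //; [exact: Ck_J0 | apply: CkN => //; exact: Ck_J0].
Qed.

(** One inclusion uses the explicit smooth components [fc], [fd]; the other compares them with
    arbitrary ones by [zf_unique]. For [p = 3] all seven coordinates vanish. *)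
Lemma freemanP p Z : (p <= 3)%N ->
  freemanCR (@XD R) (@XJ R) p Z <-> free_rep p Z.
Proof.
elim: p Z => [|p IH] Z p3.
  split=> [/sections10 [a [Ca a0 ->]]|[a [Ca va ->]]].
    by exists a; split => //; apply/vanish0P.
  by apply/sections10; exists a; split => //; apply/vanish0P.
have p3' := ltnW p3; split=> [[/(IH _ p3') [a [Ca va ->]] H]|[a [Ca va ->]]].
  exists a; split => //; apply: free_back => // b Cb vb.
  have [] := H (zf 1 b).
    by apply/sections01; exists b; split => //; apply/vanish0P.
  move=> Z' [W' [/(IH _ p3') [c [Cc vc ->]] /sections01 [d [Cd d0 ->]] e]].
  have key y : OmX y -> (co 0 (fP 1 a b y) = 0 /\ co 0 (fQ 1 a b y) = 0) /\
      fc a b y = c y.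
    move=> y0; have := e (om_crdV (@xo_subproof R) y).
    rewrite cvf_br_zf // /zf om_crdVK // => e'.
    have c0 : co 0 (c y) = 0 by exact: vc.
    have d0' := d0 y y0.
    move: e'; rewrite -(om_crdVK (@xo_subproof R) y0) => /zf_unique.
    rewrite om_crdVK // => /(_ c0 d0') [h0 ->].
    by split.
  split=> [y /key [] //|j jp y y0].
  by have [_ ->] := key y y0; exact: vc.
split; first by apply/(IH _ p3'); exists a; split => //; exact: vanish_le va.
move=> W /sections01 [b [Cb b0 ->]].
have vb : vanish 0 b by apply/vanish0P.
have [h0 hc] := free_step p3 Ca va Cb vb.
exists (zf (-1) (fc a b)), (zf 1 (fd a b)); split.
- apply/(IH _ p3'); exists (fc a b); split => // k.
  by have [] := Ck_fcd Ca Cb k.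
- apply/sections01; exists (fd a b); split => //.
    by move=> k; have [] := Ck_fcd Ca Cb k.
  move=> y /h0 [P0 Q0]; rewrite /fd; move: (fP 1 a b y) (fQ 1 a b y) P0 Q0.
  by move=> P Q P0 Q0; co_expand; rewrite P0; ring.
- move=> x; have [P0 Q0] := h0 _ (xP x); exact: zf_split.
Qed.

Lemma Xm_nondegenerate : k_nondegenerate (@XD R) (@XJ R) 3.
Proof.
split=> [p p3|Z /freemanP -/(_ isT) [a [Ca va ->]] x].
  (* The constant section along e_1^3, of the highest degree, belongs to the first three terms of
     the sequence. *)
  pose b (_ : row) : row := mk 6 [:: 0; 0; 0; 0; 0; 1].
  exists (zf (-1) b); split.
    apply/freemanP; first exact: ltnW.
    exists b; split => //.
      by move=> k; apply: Ck_cst; exact: oOmX.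
    move=> j jp y _; rewrite /b.
    have j5 : (j < 5)%N by move: p p3 jp => [|[|[|//]]] _ /leq_trans; exact.
    rewrite co_mk; last by rewrite -ltnS ltnW // ltnW.
    by move: j5 {jp}; nat_cases j.
  exists (xoS R) => /(congr1 fst) /= e0.
  have e1 : Fr (xo R) (b (xo R)) = Fr (xo R) 0 by rewrite Fr0.
  have /(congr1 (co 5)) := Fr_inj (@xo_subproof R) e1.
  by rewrite co_mk // co0 => /eqP; rewrite oner_eq0.
have a0 : a (val x) = 0.
  by apply: co_eq => k kn; rewrite co0; apply: va => //; exact: xP.
by rewrite /zf a0 J0_0 scaler0 Fr0.
Qed.

Lemma Xm_CR_structure : CR_structure (@XD R) (@XJ R).
Proof.
split.
- by move=> x V _; rewrite /XJ; apply/XDFr; exact: J0_co0.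
- move=> x r V W _ _; rewrite /XJ Th_lin; last exact: xP.
  by rewrite J0_lin Fr_lin.
- move=> x V VD; rewrite /XJ FrK; last exact: xP.
  by rewrite J0K // FrN ThK //; exact: xP.
(* The frame fields other than that of e^-2 span the distribution over the whole manifold. *)
- exists 6%N => x0; exists setT, (fun i x => Fr (val x) (delta_mx 0 (lift ord0 i))).
  split => //; first exact: openT.
  + move=> i; apply/vf_rep; exists (fun=> delta_mx 0 (lift ord0 i)); split => // k.
    by apply: Ck_cst; exact: oOmX.
  + move=> i; apply/vf_rep; exists (fun=> J0 (delta_mx 0 (lift ord0 i))); split.
      by move=> k; apply: Ck_cst; exact: oOmX.
    by move=> x; rewrite XJFr.
  move=> x _.
  have sumFr (a : 'I_6 -> R) : \sum_i a i *: Fr (val x) (delta_mx 0 (lift ord0 i)) =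
      Fr (val x) (\sum_i a i *: delta_mx 0 (lift ord0 i)).
    move: (val x) => y.
    elim/big_ind2: _ => [|V1 Y1 V2 Y2 -> ->|i _]; first by rewrite Fr0.
      by rewrite FrD.
    by rewrite FrZ.
  have cosum (a : 'I_6 -> R) (j : 'I_7) :
      (\sum_i a i *: (delta_mx 0 (lift ord0 i) : row)) 0 j =
      if unlift ord0 j is Some i then a i else 0.
    rewrite summxE; case: unliftP => [i ->|->].
      rewrite (bigD1 i) //= !mxE !eqxx mulr1 big1 ?addr0 // => k ki.
      by rewrite !mxE (inj_eq lift_inj) eq_sym (negPf ki) mulr0.
    by apply: big1 => k _; rewrite !mxE (negPf (neq_lift _ _)) mulr0.
  split.
    apply/seteqP; split=> [V [n [a [v [vP ->]]]]|V VD].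
      have xx := xP x; rewrite /XD /=.
      elim/big_ind: _ => [||i _].
      - by rewrite -(Fr0 (val x)) FrK // co0.
      - by move=> V1 V2 h1 h2; rewrite -[V1]scale1r Th_lin // coD coZ h1 h2 mulr0 addr0.
      have [j _ <-] := vP i.
      rewrite -FrZ FrK // coZ /co mxE -[inord 0]/(inord (ord0 : 'I_7)) inord_val.
      by rewrite (negPf (neq_lift _ _)) andbF mulr0.
    exists 6%N, (fun i => Th (val x) V 0 (lift ord0 i)),
      (fun i => Fr (val x) (delta_mx 0 (lift ord0 i))).
    split; first by move=> i; exists i.
    rewrite sumFr -[LHS](ThK V (xP x)); congr Fr; apply/rowP => j.
    rewrite cosum; case: unliftP => [i -> //|->].
    by move: VD; rewrite /XD /= /co -[inord 0]/(inord (ord0 : 'I_7)) inord_val.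
  move=> a; rewrite sumFr => e0 i.
  have /(Fr_inj (xP x)) e := etrans e0 (esym (Fr0 (val x))).
  by have := cosum a (lift ord0 i); rewrite e mxE liftK.
- exact: XD_involutive.
Qed.

End Nondegenerate.

(** * Invariance and the Lie algebra of the group *)

Section Invariance.
Variable R : realType.

Notation rowG := 'rV[R]_8.
Notation row := 'rV[R]_7.
Local Notation Xm := (Xm R).
Local Notation GLG := (GLG R).
Local Notation OmX := (@OmX R).
Local Notation OmG := (@OmG R).

(** The dilation by [s^(-p)] in degree p. With [s = (det g)^3] it expresses the action of [g] in the
    frame; being graded, it preserves the distribution and commutes with [J0], hence the invariance
    of the CR structure. *)
Definition Adr (s : R) (Y : row) : row :=
  mk 6 [:: s * s * co 0 Y; s * co 1 Y; s * co 2 Y; co 3 Y; co 4 Y;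
           s^-1 * co 5 Y; s^-1 * co 6 Y].

(** Derivative of the third coordinate [<w, u>/|u|^2], for columns u, w that move by an sl_2 matrix;
    it is applied to the columns of the image point under [gact g]. *)
Lemma dv_ratio (f1 f2 g1 g2 : row -> R) x v (al be ga : R) :
  f1 x * g2 x - f2 x * g1 x = 1 ->
  dv f1 x v (al * f1 x + ga * g1 x) -> dv f2 x v (al * f2 x + ga * g2 x) ->
  dv g1 x v (be * f1 x - al * g1 x) -> dv g2 x v (be * f2 x - al * g2 x) ->
  let q := fun y => (f1 y * f1 y + f2 y * f2 y)^-1 in
  let t := fun y => (g1 y * f1 y + g2 y * f2 y) * q y in
  dv t x v (be - 2 * al * t x + ga * (q x * q x - t x * t x)).
Proof.
move=> d1 h1 h2 h3 h4 q t; have q0 := det1_OmX d1.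
rewrite /t /q; eapply dv_eq; first by dv_tac.
rewrite /=; move: (f1 x) (f2 x) (g1 x) (g2 x) d1 q0 => u1 u2 w1 w2 d1 q0.
set r := (u1 * u1 + u2 * u2)^-1.
have r1 : r * (u1 * u1 + u2 * u2) = 1 by rewrite mulVf.
(* Lagrange's identity [|u|^2 |w|^2 - <u, w>^2 = 1], the square of the determinant, multiplied by
   [r^2]. *)
have rr : r * r = r * (w1 * w1 + w2 * w2) - (w1 * u1 + w2 * u2) * (w1 * u1 + w2 * u2) * r * r.
  transitivity (r * r * (u1 * w2 - u2 * w1) * (u1 * w2 - u2 * w1)); first by rewrite d1 !mulr1.
  transitivity (r * (r * (u1 * u1 + u2 * u2)) * (w1 * w1 + w2 * w2) -
    (w1 * u1 + w2 * u2) * (w1 * u1 + w2 * u2) * r * r); first by ring.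
  by rewrite r1 mulr1.
rewrite [in RHS]rr; transitivity (be * (r * (u1 * u1 + u2 * u2)) + ga * r * (w1 * w1 + w2 * w2)
  - 2 * (w1 * u1 + w2 * u2) * r * (al * (r * (u1 * u1 + u2 * u2)) + ga * (w1 * u1 + w2 * u2) * r)).
  by ring.
by rewrite r1; ring.
Qed.

(** The twist multiplies the first column by [d] and the second by [d^-2]; hence [al] is unchanged,
    [ga] is multiplied by [d^3] and [be] by [d^-3]. *)
Lemma derive_gact (g : rowG) (x Y : row) : OmG g -> OmX x ->
  differentiable (gact g) x /\
  'D_(Fr x Y) (gact g) x =
    Fr (gact g x) (Adr (gdet g * gdet g * gdet g) Y).
Proof.
move=> g0 x0; apply: dv_row => k kn.
have h1 := dv_u1 x Y; have h2 := dv_u2 x Y.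
have h4 := dv_xw1 Y x0; have h5 := dv_xw2 Y x0.
have hv j : (j < 4)%N -> dv (fun y : row => co (3 + j) y) x (Fr x Y)
    (cubic_subst (co 0 x) (xw1 x) (co 1 x) (xw2 x) (co 0 Y) (co 1 Y) (co 3 Y) (co 5 Y))`_j.
  by move=> j4; apply: dv_Fr; [by move: j4; nat_cases j|]; move: j4; nat_cases j => _; rewrite
    co_mk.
have d0 : gdet g != 0 := g0.
set d := gdet g in d0 *; set s := d * d * d.
have s0 : s != 0 by rewrite !mulf_neq0.
have ed : d^-1 * d^-1 * d * s = d * d by rewrite /s; field.
pose al := fr_al Y; pose ga := s * fr_ga Y; pose be := s^-1 * fr_be Y.
have eal : fr_al (Adr s Y) = al by rewrite /fr_al co_mk.
have ega : fr_ga (Adr s Y) = ga by rewrite /fr_ga co_mk //= /ga /fr_ga; ring.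
have ebe : fr_be (Adr s Y) = be by rewrite /fr_be co_mk //= /be /fr_be; ring.
pose f1 (y : row) := d * (co 0 g * co 0 y + co 1 g * co 1 y).
pose f2 (y : row) := d * (co 2 g * co 0 y + co 3 g * co 1 y).
pose g1 (y : row) := d^-1 * d^-1 * (co 0 g * xw1 y + co 1 g * xw2 y).
pose g2 (y : row) := d^-1 * d^-1 * (co 2 g * xw1 y + co 3 g * xw2 y).
have D1 : dv f1 x (Fr x Y) (al * f1 x + ga * g1 x).
  rewrite /f1; eapply dv_eq; first by dv_tac.
  by rewrite /f1 /g1 /al /ga /s /=; field.
have D2 : dv f2 x (Fr x Y) (al * f2 x + ga * g2 x).
  rewrite /f2; eapply dv_eq; first by dv_tac.
  by rewrite /f2 /g2 /al /ga /s /=; field.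
have D3 : dv g1 x (Fr x Y) (be * f1 x - al * g1 x).
  rewrite /g1; eapply dv_eq; first by dv_tac.
  by rewrite /f1 /g1 /al /be /s /=; field.
have D4 : dv g2 x (Fr x Y) (be * f2 x - al * g2 x).
  rewrite /g2; eapply dv_eq; first by dv_tac.
  by rewrite /f2 /g2 /al /be /s /=; field.
have W1 : xw1 (gact g x) = g1 x by exact: gact_w1.
have W2 : xw2 (gact g x) = g2 x by exact: gact_w2.
have U1 : co 0 (gact g x) = f1 x by exact: gact_u1.
have U2 : co 1 (gact g x) = f2 x by exact: gact_u2.
have Q : xq (gact g x) = f1 x * f1 x + f2 x * f2 x by rewrite /xq U1 U2.
have T : co 2 (gact g x) = (g1 x * f1 x + g2 x * f2 x) * (f1 x * f1 x + f2 x * f2 x)^-1.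
  by rewrite co_mk.
rewrite {2}/Fr co_mk // W1 W2 U1 U2 Q T eal ega ebe.
have vcase j : (j < 4)%N -> dv (fun y => co (3 + j) (gact g y)) x (Fr x Y)
   (cubic_subst (f1 x) (g1 x) (f2 x) (g2 x) (co 0 (Adr s Y)) (co 1 (Adr s Y))
       (co 3 (Adr s Y)) (co 5 (Adr s Y)))`_j.
  move=> j4; rewrite (_ : (fun y => _) = fun y => co (4 + j) g + (gcubicx g y)`_j); last first.
    by apply/funext => y; rewrite gact_v.
  have H0 := hv 0%N isT; have H1 := hv 1%N isT; have H2 := hv 2%N isT; have H3 := hv 3%N isT.
  rewrite /gcubicx /Adr !(co_mk _ (n := 6)) //.
  have e : (cubic_subst (co 0 g) (co 1 g) (co 2 g) (co 3 g)
     (cubic_subst (co 0 x) (xw1 x) (co 1 x) (xw2 x) (co 0 Y) (co 1 Y) (co 3 Y) (co 5 Y))`_0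
     (cubic_subst (co 0 x) (xw1 x) (co 1 x) (xw2 x) (co 0 Y) (co 1 Y) (co 3 Y) (co 5 Y))`_1
     (cubic_subst (co 0 x) (xw1 x) (co 1 x) (xw2 x) (co 0 Y) (co 1 Y) (co 3 Y) (co 5 Y))`_2
     (cubic_subst (co 0 x) (xw1 x) (co 1 x) (xw2 x) (co 0 Y) (co 1 Y) (co 3 Y) (co 5 Y))`_3)`_j =
     (cubic_subst (f1 x) (g1 x) (f2 x) (g2 x) (s * s * co 0 Y) (s * co 1 Y) (co 3 Y)
         (s^-1 * co 5 Y))`_j.
    rewrite cubic_subst_comp /f1 /f2 /g1 /g2 /s.
    by move: j4; ord_cases j => _ /=; field.
  move: e H0 H1 H2 H3.
  move: (_`_0) (_`_1) (_`_2) (_`_3) => c0 c1 c2 c3 e H0 H1 H2 H3.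
  apply: dv_eq; last exact: e.
  by move: j4 {e}; ord_cases j => _ /=; (eapply dv_eq; [by dv_tac | by rewrite /=; ring]).
move: kn; case: k => [|[|[|k]]] kn.
- rewrite (_ : (fun y => _) = f1); first exact: D1.
  by apply/funext => y; exact: gact_u1.
- rewrite (_ : (fun y => _) = f2); first exact: D2.
  by apply/funext => y; exact: gact_u2.
- rewrite (_ : (fun y => _) = fun y => (g1 y * f1 y + g2 y * f2 y) * (f1 y * f1 y + f2 y * f2
  y)^-1).
    apply: dv_ratio => //; exact: gact_det.
  by apply/funext => y; rewrite co_mk.
- by have := vcase k kn; rewrite (_ : [:: _, _, _ & _]`_ _ = (cubic_subst (f1 x) (g1 x) (f2 x) (g2
  x) (co 0 (Adr s Y)) (co 1 (Adr s Y))
       (co 3 (Adr s Y)) (co 5 (Adr s Y)))`_k) //; move: kn {D1 D2 D3 D4}; nat_cases k.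
Qed.

End Invariance.

Section Homogeneity.
Variable R : realType.

Notation rowG := 'rV[R]_8.
Notation row := 'rV[R]_7.
Local Notation Xm := (Xm R).
Local Notation GLG := (GLG R).
Local Notation OmX := (@OmX R).
Local Notation OmG := (@OmG R).

Lemma tmap_act (g : GLG) (x : Xm) (Y : row) :
  let d := gdet (val g) in
  tmap (actS g) x (Fr (val x) Y) = Fr (val (actS g x)) (Adr (d * d * d) Y).
Proof.
move=> d; have [df Df] := derive_gact Y (gP g) (xP x).
by rewrite (om_tmap (oOm := @oOmX R) (Omo := @xo_subproof R) _ _ df) ?Df.
Qed.

Lemma Adr_J0 (s : R) Y : Adr s (J0 Y) = J0 (Adr s Y).
Proof.
apply: co_eq => k kn; rewrite /Adr /J0 !(co_mk _ (n := 6)) //.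
by move: kn; ord_cases k => _ /=; ring.
Qed.

Lemma AdrK (s : R) Y : s != 0 -> Adr s (Adr s^-1 Y) = Y.
Proof.
move=> s0; apply: co_eq => k kn; rewrite /Adr !(co_mk _ (n := 6)) //.
by move: kn; ord_cases k => _ /=; field.
Qed.

Lemma Xm_invariant : invariant_CR (@actS R) (@XD R) (@XJ R).
Proof.
move=> g x; set s := gdet (val g) * gdet (val g) * gdet (val g).
have s0 : s != 0 by rewrite !mulf_neq0 //; exact: gP.
have tE Y : tmap (actS g) x (Fr (val x) Y) = Fr (val (actS g x)) (Adr s Y).
  exact: tmap_act.
split.
  apply/seteqP; split=> [_ [V VD <-]|V VD].
    rewrite -[V](ThK _ (xP x)) tE; apply/XDFr.
    by rewrite co_mk //= VD mulr0.
  exists (Fr (val x) (Adr s^-1 (Th (val (actS g x)) V))).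
    by apply/XDFr; rewrite co_mk //= VD mulr0.
  by rewrite tE AdrK // ThK //; exact: xP.
move=> V VD; rewrite -[V](ThK _ (xP x)) XJFr !tE XJFr.
by rewrite Adr_J0.
Qed.

Definition gdr (g v : rowG) : rowG := mk 7
  [:: co 0 g * co 0 v + co 1 g * co 2 v; co 0 g * co 1 v + co 1 g * co 3 v;
      co 2 g * co 0 v + co 3 g * co 2 v; co 2 g * co 1 v + co 3 g * co 3 v;
      (gcubic g v)`_0; (gcubic g v)`_1; (gcubic g v)`_2; (gcubic g v)`_3].

Lemma dv_lin2 (p q : R) i j (y v : rowG) :
  dv (fun z : rowG => p * co i z + q * co j z) y v (p * co i v + q * co j v).
Proof. by eapply dv_eq; [dv_tac | rewrite /=; ring]. Qed.

Lemma dv_lin4 (k p q r s : R) i j l m (y v : rowG) :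
  dv (fun z : rowG => k + (p * co i z + q * co j z + r * co l z + s * co m z)) y v
    (p * co i v + q * co j v + r * co l v + s * co m v).
Proof. by eapply dv_eq; [dv_tac | rewrite /=; ring]. Qed.

Lemma derive_gmul (g y v : rowG) :
  differentiable (gmul g) y /\ 'D_v (gmul g) y = gdr g v.
Proof.
apply: dv_row => k kn; rewrite (_ : (fun z => _) = fun z =>
  [:: co 0 g * co 0 z + co 1 g * co 2 z; co 0 g * co 1 z + co 1 g * co 3 z;
      co 2 g * co 0 z + co 3 g * co 2 z; co 2 g * co 1 z + co 3 g * co 3 z;
      co 4 g + (gcubic g z)`_0; co 5 g + (gcubic g z)`_1;
      co 6 g + (gcubic g z)`_2; co 7 g + (gcubic g z)`_3]`_k); last first.
  by apply/funext => z; rewrite co_mk.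
by rewrite /gdr co_mk //; move: kn; ord_cases k => _ /=; first [exact: dv_lin2 | exact: dv_lin4].
Qed.

Lemma left_invE (v : rowG) (g : GLG) : left_inv v g = gdr (val g) v.
Proof.
have [df Df] := derive_gmul (val g) (gone R) v.
rewrite /left_inv.
have e := @om_tmap _ _ _ _ (@oOmG R) (@gone_subproof R) _ _ _ (@oOmG R)
  (@gone_subproof R) (lmul g) (gmul (val g)) (lone GLG) v (fun=> erefl) df.
by rewrite [LHS]e.
Qed.

Definition glb (v w : rowG) : rowG := mk 7
  [:: co 1 v * co 2 w - co 1 w * co 2 v;
      co 0 v * co 1 w + co 1 v * co 3 w - (co 0 w * co 1 v + co 1 w * co 3 v);
      co 2 v * co 0 w + co 3 v * co 2 w - (co 2 w * co 0 v + co 3 w * co 2 v);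
      co 2 v * co 1 w - co 2 w * co 1 v;
      3 * co 3 v * co 4 w + co 2 v * co 5 w
        - (3 * co 3 w * co 4 v + co 2 w * co 5 v);
      3 * co 1 v * co 4 w + (co 0 v + 2 * co 3 v) * co 5 w + 2 * co 2 v * co 6 w
        - (3 * co 1 w * co 4 v + (co 0 w + 2 * co 3 w) * co 5 v + 2 * co 2 w * co 6 v);
      2 * co 1 v * co 5 w + (2 * co 0 v + co 3 v) * co 6 w + 3 * co 2 v * co 7 w
        - (2 * co 1 w * co 5 v + (2 * co 0 w + co 3 w) * co 6 v + 3 * co 2 w * co 7 v);
      co 1 v * co 6 w + 3 * co 0 v * co 7 w
        - (co 1 w * co 6 v + 3 * co 0 w * co 7 v)].

Lemma gdr_one v : gdr (gone R) v = v.
Proof.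
apply: co_eq => k kn; rewrite /gdr /gcubic /gone !(co_mk _ (n := 7)) //.
by move: kn; ord_cases k => _ /=; ring.
Qed.

Definition dgdr (v w : rowG) : rowG := mk 7
  [:: co 0 v * co 0 w + co 1 v * co 2 w; co 0 v * co 1 w + co 1 v * co 3 w;
      co 2 v * co 0 w + co 3 v * co 2 w; co 2 v * co 1 w + co 3 v * co 3 w;
      3 * co 3 v * co 4 w + co 2 v * co 5 w;
      3 * co 1 v * co 4 w + (co 0 v + 2 * co 3 v) * co 5 w + 2 * co 2 v * co 6 w;
      2 * co 1 v * co 5 w + (2 * co 0 v + co 3 v) * co 6 w + 3 * co 2 v * co 7 w;
      co 1 v * co 6 w + 3 * co 0 v * co 7 w].

Lemma derive_gdr (v w : rowG) :
  'D_v (fun g => gdr g w) (gone R) = dgdr v w.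
Proof.
apply: (proj2 (dv_row _)) => k kn; rewrite (_ : (fun g => _) = fun g =>
  [:: co 0 g * co 0 w + co 1 g * co 2 w; co 0 g * co 1 w + co 1 g * co 3 w;
      co 2 g * co 0 w + co 3 g * co 2 w; co 2 g * co 1 w + co 3 g * co 3 w;
      (gcubic g w)`_0; (gcubic g w)`_1; (gcubic g w)`_2; (gcubic g w)`_3]`_k); last first.
  by apply/funext => z; rewrite co_mk.
have g0 : co 0 (gone R) = 1 by rewrite co_mk.
have g1 : co 1 (gone R) = 0 by rewrite co_mk.
have g2 : co 2 (gone R) = 0 by rewrite co_mk.
have g3 : co 3 (gone R) = 1 by rewrite co_mk.
rewrite /dgdr co_mk //; move: kn; ord_cases k => _ /=;
  (eapply dv_eq; [by dv_tac | by rewrite /= ?g0 ?g1 ?g2 ?g3; ring]).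
Qed.

Lemma lie_brE (v w : rowG) : lie_br GLG v w = glb v w.
Proof.
rewrite /lie_br (om_vf_br (oOm := @oOmG R) (Omo := @gone_subproof R)).
have e (u : rowG) : \forall y \near val (lone GLG),
    ((left_inv u : GLG -> rowG) \o (om_crdV (@gone_subproof R) : rowG -> GLG)) y = gdr y u.
  apply: (@om_near _ _ _ _ (@oOmG R) (@gone_subproof R)) => y /=.
  by rewrite om_valK left_invE.
rewrite (near_eq_derive _ (e w)) (near_eq_derive _ (e v)) !left_invE.
change (val (lone GLG)) with (gone R).
rewrite !gdr_one !derive_gdr; apply: co_eq => k kn.
rewrite coB /dgdr /glb !(co_mk _ (n := 7)) //.
by move: kn; ord_cases k => _ /=; ring.
Qed.

(** Differentiating [(det g) (a, c)] and [(det g)^-2 (b, d)] at the identity gives [al = 2a + d],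
    [ga = c], [be = b]; the constants come from solving for the coordinates of g / g_o. *)
Definition evY (v : rowG) : row := mk 6
  [:: co 4 v; co 5 v; - co 2 v; co 6 v; - 2^-1 * (2 * co 0 v + co 3 v); co 7 v;
      - 2^-1 * co 1 v].

Lemma tmap_orbit (v : rowG) :
  tmap ((@actS R)^~ (xoS R)) (lone GLG) v = Fr (xo R) (evY v).
Proof.
have g0 : co 0 (gone R) = 1 by rewrite co_mk.
have g1 : co 1 (gone R) = 0 by rewrite co_mk.
have g2 : co 2 (gone R) = 0 by rewrite co_mk.
have g3 : co 3 (gone R) = 1 by rewrite co_mk.
have o0 : co 0 (xo R) = 1 by rewrite co_mk.
have ok k : (k < 6)%N -> co k.+1 (xo R) = 0.
  by move=> kn; rewrite co_mk //; case: k kn => [|k] //=; rewrite nth_nil.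
have w1 : xw1 (xo R) = 0 by rewrite /xw1 /xq o0 !ok //; field.
have w2 : xw2 (xo R) = 1 by rewrite /xw2 /xq o0 !ok //; field.
have q1 : xq (xo R) = 1 by rewrite /xq o0 !ok //; ring.
have [df Df] : differentiable (fun g => gact g (xo R)) (gone R) /\
   'D_v (fun g => gact g (xo R)) (gone R) = Fr (xo R) (evY v).
  apply: dv_row => k kn.
  rewrite (_ : (fun g => _) = fun g => (let d := gdet g in
  let e := d^-1 * d^-1 in
  let u1 := d * co 0 g in let u2 := d * co 2 g in
  let w1 := e * co 1 g in let w2 := e * co 3 g in
  [:: u1; u2; (w1 * u1 + w2 * u2) * (u1 * u1 + u2 * u2)^-1;
      co 4 g; co 5 g; co 6 g; co 7 g])`_k); last first.
    apply/funext => g; rewrite co_mk // w1 w2 o0 ok // !(mulr0, mulr1, addr0, add0r).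
    congr nth; congr [:: _; _; _; _; _; _; _]; rewrite /gcubicx /cubic_subst !ok //=; ring.
  rewrite /Fr co_mk // o0 w1 w2 q1 !ok //.
  rewrite /fr_al /fr_be /fr_ga /evY !(co_mk _ (n := 6)) // /gdet.
  have n0 : (1 : R) * 1 - 0 * 0 != 0 by rewrite mulr1 mulr0 subr0 oner_neq0.
  move: kn; ord_cases k => _ /=; (eapply dv_eq; [by dv_tac;
    rewrite /= ?g0 ?g1 ?g2 ?g3 ?(mulr0, mulr1, mul1r, addr0, subr0, invr1) ?oner_neq0
    | rewrite /= ?g0 ?g1 ?g2 ?g3; by field]).
have e := @om_tmap _ _ _ _ (@oOmG R) (@gone_subproof R) _ _ _ (@oOmX R)
  (@xo_subproof R) (@actS R ^~ (xoS R)) (fun g => gact g (xo R)) (lone GLG) v (fun=> erefl) df.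
by rewrite [LHS]e.
Qed.

End Homogeneity.

(** * Brackets in coordinates *)

Section LinearCombinations.
Variables (K : numFieldType) (V : lmodType K).
Implicit Types (vs : seq V) (ks ls : seq K).

(** Vectors are kept as coefficient lists over a fixed family, so that brackets reduce to scalar
    identities, left to [ring] or [field]. *)
Fixpoint lc vs ks : V :=
  match vs, ks with
  | v :: vs', k :: ks' => k *: v + lc vs' ks'
  | _, _ => 0
  end.

Fixpoint ladd ks ls : seq K :=
  match ks, ls with
  | k :: ks', l :: ls' => (k + l) :: ladd ks' ls'
  | [::], _ => ls
  | _, [::] => ks
  end.

Lemma lcD vs ks ls : lc vs ks + lc vs ls = lc vs (ladd ks ls).
Proof.
elim: vs ks ls => [|v vs IH] [|k ks] [|l ls] //=; rewrite ?addr0 ?add0r //.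
by rewrite scalerDl addrACA IH.
Qed.

Lemma lcZ vs ks (a : K) : a *: lc vs ks = lc vs [seq a * k | k <- ks].
Proof.
elim: vs ks => [|v vs IH] [|k ks] //=; rewrite ?scaler0 //.
by rewrite scalerDr scalerA IH.
Qed.

Lemma lcN vs ks : - lc vs ks = lc vs [seq - k | k <- ks].
Proof. by rewrite -scaleN1r lcZ; congr lc; apply: eq_map => k; rewrite mulN1r. Qed.

Lemma lc_nseq0 vs n : lc vs (nseq n 0) = 0.
Proof. by elim: vs n => [|v vs IH] [|n] //=; rewrite scale0r IH addr0. Qed.

Lemma lc_sum vs ks : size ks = size vs -> lc vs ks = \sum_(i < size vs) ks`_i *: vs`_i.
Proof.
elim: vs ks => [|v vs IH] [|k ks] //=; first by rewrite big_ord0.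
by move=> [/IH ->]; rewrite big_ord_recl.
Qed.

End LinearCombinations.

Section Blocks.
Variables (K : numFieldType) (V : lmodType K) (br : V -> V -> V).
Hypothesis brPl : forall k x y w, br (k *: x + y) w = k *: br x w + br y w.
Hypothesis brPr : forall k x y w, br w (k *: x + y) = k *: br w x + br w y.

Lemma br0l w : br 0 w = 0.
Proof. by have := brPl 1 0 0 w; rewrite !scale1r addr0 -[X in X = _]addr0 => /addrI. Qed.

Lemma br0r w : br w 0 = 0.
Proof. by have := brPr 1 0 0 w; rewrite !scale1r addr0 -[X in X = _]addr0 => /addrI. Qed.

Lemma brZl k x w : br (k *: x) w = k *: br x w.
Proof. by rewrite -[k *: x]addr0 brPl br0l addr0. Qed.

Lemma brZr k x w : br w (k *: x) = k *: br w x.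
Proof. by rewrite -[k *: x]addr0 brPr br0r addr0. Qed.

Lemma brDl x y w : br (x + y) w = br x w + br y w.
Proof. by rewrite -{1}[x]scale1r brPl scale1r. Qed.

Lemma brDr x y w : br w (x + y) = br w x + br w y.
Proof. by rewrite -{1}[x]scale1r brPr scale1r. Qed.

Lemma brNl x w : br (- x) w = - br x w.
Proof. by rewrite -scaleN1r brZl scaleN1r. Qed.

Lemma brNr x w : br w (- x) = - br w x.
Proof. by rewrite -scaleN1r brZr scaleN1r. Qed.

Variables (t a1 a2 E s11 s12 s22 s111 s112 s122 s222 m1 m2 : V).

Definition Vm : seq V := [:: a1; a2].
Definition V0 : seq V := [:: E; s11; s12; s22].
Definition V1 : seq V := [:: s111; s112; s122; s222; m1; m2].

Fixpoint crow n (Ti : seq (seq K)) (ls : seq K) : seq K :=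
  match Ti, ls with
  | u :: Ti', l :: ls' => ladd [seq l * x | x <- u] (crow n Ti' ls')
  | _, _ => nseq n 0
  end.

(** Bilinear extension of a table of structure constants; [n] is the length of the zero list
    returned when the table or a coefficient list is exhausted. *)
Fixpoint ctab n (T : seq (seq (seq K))) (ks ls : seq K) : seq K :=
  match T, ks with
  | Ti :: T', k :: ks' => ladd [seq k * x | x <- crow n Ti ls] (ctab n T' ks' ls)
  | _, _ => nseq n 0
  end.

Fixpoint trow (v : V) (ws us : seq V) (Ti : seq (seq K)) : Prop :=
  match ws, Ti with
  | w :: ws', u :: Ti' => [/\ br v w = lc us u, size u = size us & trow v ws' us Ti']
  | [::], [::] => True
  | _, _ => False
  end.

(* [table br vs ws us T]: the brackets of the elements of [vs] with those of [ws] are the linear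
  combinations of [us] with the coefficients in [T]. *)
Fixpoint table (vs ws us : seq V) (T : seq (seq (seq K))) : Prop :=
  match vs, T with
  | v :: vs', Ti :: T' => trow v ws us Ti /\ table vs' ws us T'
  | [::], [::] => True
  | _, _ => False
  end.

Lemma size_ladd (ks ls : seq K) : size ks = size ls -> size (ladd ks ls) = size ls.
Proof. by elim: ks ls => [|k ks IH] [|l ls] //= [/IH ->]. Qed.

Lemma crowP v ws us Ti ls : trow v ws us Ti ->
  size (crow (size us) Ti ls) = size us /\
  br v (lc ws ls) = lc us (crow (size us) Ti ls).
Proof.
elim: ws Ti ls => [|w ws IH] [|u Ti] [|l ls] //=;
  rewrite ?size_nseq ?lc_nseq0 ?br0r // => -[e su /IH -/(_ ls) [sc {}IH]].
rewrite size_ladd ?size_map ?sc //; split=> //.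
by rewrite brPr IH e lcZ lcD // size_map sc.
Qed.

Lemma br_lc vs ws us T ks ls : table vs ws us T ->
  br (lc vs ks) (lc ws ls) = lc us (ctab (size us) T ks ls).
Proof.
suff H : table vs ws us T -> size (ctab (size us) T ks ls) = size us /\
    br (lc vs ks) (lc ws ls) = lc us (ctab (size us) T ks ls) by case/H.
elim: vs T ks => [|v vs IH] [|Ti T] [|k ks] //=;
  rewrite ?size_nseq ?lc_nseq0 ?br0l // => -[/(crowP ls) [sc e] /IH -/(_ ks) [st {}IH]].
rewrite size_ladd ?size_map ?sc ?st //; split=> //.
by rewrite brPl IH e lcZ lcD // size_map sc st.
Qed.

Lemma ctab_size vs ws us T ks ls : table vs ws us T -> size (ctab (size us) T ks ls) = size us.
Proof.
elim: vs T ks => [|v vs IH] [|Ti T] [|k ks] //=; rewrite ?size_nseq // => -[/(crowP ls) [sc _] /IH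
  -/(_ ks) st].
by rewrite size_ladd ?size_map ?sc ?st.
Qed.

(* Structure constants; the suffix gives the degrees of the two factors, [m] standing for [-1]. *)
Definition T0m : seq (seq (seq K)) :=
  [:: [:: [:: -1; 0]; [:: 0; -1]]; [:: [:: 0; 0]; [:: 2; 0]];
      [:: [:: -1; 0]; [:: 0; 1]]; [:: [:: 0; - 2]; [:: 0; 0]]].

Definition inv2 : K := 2^-1.

Definition T1m : seq (seq (seq K)) :=
  [:: [:: [:: 0; 0; 0; 0]; [:: 0; 3; 0; 0]];
      [:: [:: 0; -1; 0; 0]; [:: 0; 0; 2; 0]];
      [:: [:: 0; 0; - 2; 0]; [:: 0; 0; 0; 1]];
      [:: [:: 0; 0; 0; - 3]; [:: 0; 0; 0; 0]];
      [:: [:: 0; inv2; 0; 0]; [:: - inv2; 0; inv2; 0]];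
      [:: [:: inv2; 0; inv2; 0]; [:: 0; 0; 0; inv2]]].

Definition T00 : seq (seq (seq K)) :=
  let z := [:: 0; 0; 0; 0] in
  [:: [:: z; z; z; z];
      [:: z; z; [:: 0; 2; 0; 0]; [:: 0; 0; 4; 0]];
      [:: z; [:: 0; - 2; 0; 0]; z; [:: 0; 0; 0; 2]];
      [:: z; [:: 0; 0; - 4; 0]; [:: 0; 0; 0; - 2]; z]].

Definition T01 : seq (seq (seq K)) :=
  [:: [:: [:: 1; 0; 0; 0; 0; 0]; [:: 0; 1; 0; 0; 0; 0]; [:: 0; 0; 1; 0; 0; 0];
          [:: 0; 0; 0; 1; 0; 0]; [:: 0; 0; 0; 0; 1; 0]; [:: 0; 0; 0; 0; 0; 1]];
      [:: [:: 0; 0; 0; 0; 0; 0]; [:: 2; 0; 0; 0; 0; 0]; [:: 0; 4; 0; 0; 0; 0];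
          [:: 0; 0; 6; 0; 0; 0]; [:: 0; 0; 0; 0; 0; 0]; [:: 0; 0; 0; 0; 2; 0]];
      [:: [:: - 3; 0; 0; 0; 0; 0]; [:: 0; -1; 0; 0; 0; 0]; [:: 0; 0; 1; 0; 0; 0];
          [:: 0; 0; 0; 3; 0; 0]; [:: 0; 0; 0; 0; -1; 0]; [:: 0; 0; 0; 0; 0; 1]];
      [:: [:: 0; - 6; 0; 0; 0; 0]; [:: 0; 0; - 4; 0; 0; 0]; [:: 0; 0; 0; - 2; 0; 0];
          [:: 0; 0; 0; 0; 0; 0]; [:: 0; 0; 0; 0; 0; - 2]; [:: 0; 0; 0; 0; 0; 0]]].

Lemma br_0m x a b d p q : table V0 Vm Vm T0m ->
  br (lc V0 [:: x; a; b; d]) (lc Vm [:: p; q]) =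
  lc Vm [:: - x * p - b * p + 2 * a * q; - x * q + b * q - 2 * d * p].
Proof. by move=> /br_lc ->; congr lc; congr [:: _; _]; rewrite /=; ring. Qed.

Lemma br_1m k0 k1 k2 k3 m l p q : table V1 Vm V0 T1m ->
  br (lc V1 [:: k0; k1; k2; k3; m; l]) (lc Vm [:: p; q]) =
  lc V0 [:: inv2 * (l * p - m * q); 3 * k0 * q - k1 * p + inv2 * m * p;
    2 * k1 * q - 2 * k2 * p + inv2 * (m * q + l * p); k2 * q - 3 * k3 * p + inv2 * l * q].
Proof. by move=> /br_lc ->; congr lc; congr [:: _; _; _; _]; rewrite /=; ring. Qed.

Lemma br_00 x a b d x' a' b' d' : table V0 V0 V0 T00 ->
  br (lc V0 [:: x; a; b; d]) (lc V0 [:: x'; a'; b'; d']) =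
  lc V0 [:: 0; 2 * (a * b' - a' * b); 4 * (a * d' - a' * d); 2 * (b * d' - b' * d)].
Proof. by move=> /br_lc ->; congr lc; congr [:: _; _; _; _]; rewrite /=; ring. Qed.

Lemma br_01 x a b d k0 k1 k2 k3 m l : table V0 V1 V1 T01 ->
  br (lc V0 [:: x; a; b; d]) (lc V1 [:: k0; k1; k2; k3; m; l]) =
  lc V1 [:: x * k0 + 2 * a * k1 - 3 * b * k0;
    x * k1 + 4 * a * k2 - b * k1 - 6 * d * k0;
    x * k2 + 6 * a * k3 + b * k2 - 4 * d * k1;
    x * k3 + 3 * b * k3 - 2 * d * k2;
    x * m + 2 * a * l - b * m; x * l + b * l - 2 * d * m].
Proof. by move=> /br_lc ->; congr lc; congr [:: _; _; _; _; _; _]; rewrite /=; ring. Qed.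

End Blocks.

Lemma lspan_ind (K : nzRingType) (V : lmodType K) (S' P : set V) :
  P 0 -> (forall k x y, P x -> P y -> P (k *: x + y)) -> S' `<=` P -> lspan S' `<=` P.
Proof.
move=> P0 PD SP _ [n [k [x [xS ->]]]].
elim/big_rec: _ => // i y _ Py; apply: PD => //; exact/SP.
Qed.

Lemma lspanP (K : nzRingType) (V : lmodType K) (S' : set V) :
  [/\ lspan S' 0, forall k x y, lspan S' x -> lspan S' y -> lspan S' (k *: x + y) &
      S' `<=` lspan S'].
Proof.
split.
- by exists 0%N, (fun=> 0), (fun=> 0); split; [case | rewrite big_ord0].
- move=> k _ _ [n [a [x [xS ->]]]] [m [b [y [yS ->]]]].
  exists (n + m)%N, (fun i => match fintype.split i with inl j => k * a j | inr j => b j end),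
    (fun i => match fintype.split i with inl j => x j | inr j => y j end); split.
    by move=> i; case: fintype.split.
  rewrite big_split_ord scaler_sumr; congr (_ + _); apply: eq_bigr => i _.
    by case: split_ordP => j; [move/lshift_inj <-; rewrite scalerA | move/eqP; rewrite eq_lrshift].
  by case: split_ordP => j; [move/esym/eqP; rewrite eq_lrshift | move/rshift_inj <-].
- move=> x Sx; exists 1%N, (fun=> 1), (fun=> x); split => //.
  by rewrite big_ord_recl big_ord0 scale1r addr0.
Qed.

(* Apply the product of the [T - m] over the eigenvalues [m] of the summands. *)
Lemma eig_indep (K : fieldType) (V : lmodType K) (T : V -> V) (m0 : K) (v : V) :
  (forall k x y, T (k *: x + y) = k *: T x + T y) ->
  T v = m0 *: v -> lspan [set x | exists2 m, m <> m0 & T x = m *: x] v -> v = 0.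
Proof.
move=> TP Tv [n [k [x [xP ev]]]].
have [m mP] : exists m : 'I_n -> K, forall i, m i <> m0 /\ T (x i) = m i *: x i.
  exists (fun i => s2val (cid2 (xP i))) => i.
  by split; [exact: (s2valP (cid2 (xP i))) | exact: (s2valP' (cid2 (xP i)))].
pose P (l : seq K) (w : V) : V := foldr (fun a w => T w - a *: w) w l.
have PD l a u w : P l (a *: u + w) = a *: P l u + P l w.
  elim: l => //= b l ->; rewrite TP scalerDr scalerA mulrC opprD addrACA.
  by rewrite -scalerA -scalerBr.
have P0 l : P l 0 = 0.
  by have := PD l 1 0 0; rewrite !scale1r addr0 -[X in X = _]addr0 => /addrI.
have TZ a u : T (a *: u) = a *: T u.
  have T0 : T 0 = 0 by have := TP 1 0 0; rewrite !scale1r addr0 -[X in X = _]addr0 => /addrI.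
  by rewrite -[a *: u]addr0 TP T0 addr0.
have Pe l a u : T u = a *: u -> P l u = (\prod_(b <- l) (a - b)) *: u.
  move=> eu; elim: l => [|b l IH] /=; first by rewrite big_nil scale1r.
  by rewrite IH TZ eu big_cons !scalerA -scalerBl mulrBl [in LHS]mulrC.
pose l := [seq m i | i <- enum 'I_n].
have : P l v = 0.
  rewrite {1}ev; elim/big_rec: _ => // i y _ Py; rewrite PD Py (Pe _ _ _ (mP i).2) addr0.
  rewrite (big_rem (m i)) /=; last by apply: map_f; rewrite mem_enum.
  by rewrite subrr mul0r scale0r scaler0.
rewrite (Pe _ _ _ Tv) => /eqP; rewrite scaler_eq0 => /orP [|/eqP //].
rewrite prodf_seq_eq0 => /hasP [_ /mapP [i _ ->]] /=; rewrite subr_eq0 => /eqP e.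
by case: ((mP i).1 (esym e)).
Qed.

(** * Complexified brackets *)

Section Complexification.
Variables (R : realType) (c : contactAlgebra R).
Local Notation C := R[i].
Local Notation ch := (cplx c).
Implicit Types (X Y Z W : ch) (x y w : c) (k : C).

Local Notation lD := (brDl (@lbrDl R c)).
Local Notation rD := (brDr (@lbrDr R c)).
Local Notation lZ := (brZl (@lbrDl R c)).
Local Notation rZ := (brZr (@lbrDr R c)).
Local Notation lN := (brNl (@lbrDl R c)).
Local Notation rN := (brNr (@lbrDr R c)).

Lemma cscE k X : k *: X = ((complex.Re k *: X.1 - complex.Im k *: X.2 : c), (complex.Re k *: X.2 +
  complex.Im k *: X.1 : c)) :> ch.
Proof. by []. Qed.

Lemma cbrPl k X Y W : cbr (k *: X + Y) W = k *: cbr X W + cbr Y W.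
Proof.
have D X' Y' : cbr (X' + Y') W = cbr X' W + cbr Y' W.
  by congr pair; rewrite /= !lD ?opprD addrACA.
rewrite D; congr (_ + _); rewrite !cscE; congr pair => /=.
  rewrite !(lD, lN, lZ) scalerBr scalerDr !opprD addrACA; congr (_ + _).
  by rewrite addrC.
by rewrite !(lD, lN, lZ) scalerBr scalerDr addrACA; congr (_ + _); rewrite addrC.
Qed.

Lemma cbrPr k X Y W : cbr W (k *: X + Y) = k *: cbr W X + cbr W Y.
Proof.
have D X' Y' : cbr W (X' + Y') = cbr W X' + cbr W Y'.
  by congr pair; rewrite /= !rD ?opprD addrACA.
rewrite D; congr (_ + _); rewrite !cscE; congr pair => /=.
  by rewrite !(rD, rN, rZ) scalerBr scalerDr !opprD addrACA.
by rewrite !(rD, rN, rZ) scalerBr scalerDr addrACA.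
Qed.

Lemma cbr_anti X Y : cbr Y X = - cbr X Y.
Proof.
have anti x y : lbr y x = - lbr x y.
  have := @lbrxx R c (x + y); rewrite lD !rD !lbrxx add0r addr0 addrC.
  by move/eqP; rewrite addr_eq0 => /eqP.
congr pair => /=; first by rewrite (anti X.1) (anti X.2) opprB opprK addrC.
by rewrite (anti X.1) (anti X.2) opprD addrC.
Qed.

Lemma cinclD x y : cincl (x + y) = cincl x + cincl y :> ch.
Proof. by congr pair; rewrite addr0. Qed.

Lemma cinclN x : cincl (- x) = - cincl x :> ch.
Proof. by congr pair; rewrite oppr0. Qed.

Lemma cinclZ (a : R) x : cincl (a *: x) = a%:C%C *: cincl x :> ch.
Proof. by rewrite cscE /= !scaler0 scale0r subr0 addr0. Qed.

Lemma cincl_inj x y : cincl x = cincl y :> ch -> x = y.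
Proof. by case. Qed.

Lemma cplxE X : X = cincl X.1 + ci *: cincl X.2.
Proof.
by case: X => x y; rewrite cscE; congr pair; rewrite /= ?scale0r ?scale1r ?subr0 ?addr0 ?oppr0
  ?add0r.
Qed.

Lemma cbr_cincl x y : cbr (cincl x) (cincl y) = cincl (lbr x y) :> ch.
Proof. by congr pair => /=; rewrite ?(br0l (@lbrDl R c)) ?(br0r (@lbrDr R c)) ?subr0 ?addr0. Qed.

(** Multilinear identities such as Jacobi's pass from real vectors to complex ones by this
    induction. *)
Lemma ch_ind (P : ch -> Prop) : (forall k X Y, P X -> P Y -> P (k *: X + Y)) ->
  (forall x, P (cincl x)) -> forall X, P X.
Proof. by move=> PD Px X; rewrite (cplxE X) addrC; exact: PD. Qed.

Lemma cbr_jacobi X Y W : cbr X (cbr Y W) = cbr (cbr X Y) W + cbr Y (cbr X W).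
Proof.
elim/ch_ind: X => [k X X' IH IH'|x].
  by rewrite !cbrPl IH IH' !cbrPr scalerDr addrACA.
elim/ch_ind: Y => [k Y Y' IH IH'|y].
  by rewrite !cbrPr !cbrPl !cbrPr IH IH' scalerDr addrACA.
elim/ch_ind: W => [k W W' IH IH'|w].
  by rewrite !cbrPr IH IH' scalerDr addrACA.
rewrite !cbr_cincl -cinclD; congr cincl.
have := @lbrJ R c x y w.
have anti u v : lbr v u = - @lbr R c u v by apply: cincl_inj; rewrite cinclN -!cbr_cincl cbr_anti.
rewrite (anti x w) rN (anti (lbr x y) w) -addrA -opprD => /eqP.
by rewrite subr_eq0 addrC => /eqP.
Qed.

Lemma cbrZl k X W : cbr (k *: X) W = k *: cbr X W.
Proof. exact: (brZl cbrPl). Qed.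
Lemma cbrZr k X W : cbr W (k *: X) = k *: cbr W X.
Proof. exact: (brZr cbrPr). Qed.
Lemma cbrDl X Y W : cbr (X + Y) W = cbr X W + cbr Y W.
Proof. exact: (brDl cbrPl). Qed.
Lemma cbrDr X Y W : cbr W (X + Y) = cbr W X + cbr W Y.
Proof. exact: (brDr cbrPr). Qed.
Lemma cbrNr X W : cbr W (- X) = - cbr W X.
Proof. exact: (brNr cbrPr). Qed.
Lemma cbr0r W : cbr W 0 = 0.
Proof. exact: (br0r cbrPr). Qed.

Local Notation rc := (real_complex R).

Lemma cincl_lc (vs : seq c) (ks : seq R) :
  cincl (lc vs ks) = lc (map (@cincl R c) vs) (map rc ks).
Proof. by elim: vs ks => [|v vs IH] [|k ks] //=; rewrite cinclD cinclZ IH. Qed.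

Definition czip (ks ls : seq R) : seq C := [seq Complex p.1 p.2 | p <- zip ks ls].

Lemma lc_pair (vs : seq c) (ks ls : seq R) : size ks = size ls ->
  (lc vs ks, lc vs ls) = lc (map (@cincl R c) vs) (czip ks ls) :> ch.
Proof.
elim: vs ks ls => [|v vs IH] [|k ks] [|l ls] //= [/IH <-].
by rewrite cscE; congr pair; rewrite /= ?scaler0 ?subr0 ?add0r.
Qed.

Lemma lc_cplx (vs : seq c) (ks : seq C) :
  lc (map (@cincl R c) vs) ks = (lc vs [seq complex.Re k | k <- ks], lc vs [seq complex.Im k | k
    <- ks]) :> ch.
Proof.
elim: vs ks => [|v vs IH] [|k ks] //=; rewrite IH cscE; congr pair => /=.
  by rewrite scaler0 subr0.
by rewrite scaler0 add0r.
Qed.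

Lemma table_cplx vs ws us T : table (@lbr R c) vs ws us T ->
  table (@cbr R c) (map (@cincl R c) vs) (map (@cincl R c) ws) (map (@cincl R c) us)
    [seq [seq [seq rc q | q <- r] | r <- t] | t <- T].
Proof.
elim: vs T => [|v vs IH] [|Ti T] //= -[H /IH HT]; split=> // {IH HT}.
elim: ws Ti H => [|w ws IH] [|u Ti] //= [e su /IH ?]; split=> //.
  by rewrite cbr_cincl e cincl_lc.
by rewrite !size_map.
Qed.

End Complexification.

(** * The contact algebra in low degrees *)

Section Contact.
Variables (R : realType) (c : contactAlgebra R).

Local Notation cm v := (gcomp c (-1) v).
Local Notation kc := (@Defs.kcomp R c).

Lemma lbrDlr (x y w : c) : lbr (x + y) w = lbr x w + lbr y w.
Proof. exact: (brDl (@lbrDl R c)). Qed.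
Lemma lbrDrr (x y w : c) : lbr w (x + y) = lbr w x + lbr w y.
Proof. exact: (brDr (@lbrDr R c)). Qed.
Lemma lbrZlr (a : R) (x w : c) : lbr (a *: x) w = a *: lbr x w.
Proof. exact: (brZl (@lbrDl R c)). Qed.
Lemma lbrZrr (a : R) (x w : c) : lbr w (a *: x) = a *: lbr w x.
Proof. exact: (brZr (@lbrDr R c)). Qed.
Lemma lbrNlr (x w : c) : lbr (- x) w = - lbr x w.
Proof. exact: (brNl (@lbrDl R c)). Qed.
Lemma lbrNrr (x w : c) : lbr w (- x) = - lbr w x.
Proof. exact: (brNr (@lbrDr R c)). Qed.
Lemma lbr0l (w : c) : lbr 0 w = 0.
Proof. exact: (br0l (@lbrDl R c)). Qed.
Lemma lbr0r (w : c) : lbr w 0 = 0.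
Proof. exact: (br0r (@lbrDr R c)). Qed.

Lemma lbr_anti (x y : c) : lbr y x = - lbr x y.
Proof.
have := @lbrxx R c (x + y); rewrite lbrDlr !lbrDrr !lbrxx add0r addr0 addrC.
by move/eqP; rewrite addr_eq0 => /eqP.
Qed.

Lemma lbr_jacobi (x y w : c) : lbr (lbr x y) w = lbr x (lbr y w) - lbr y (lbr x w).
Proof.
have := @lbrJ R c x y w.
rewrite (lbr_anti x w) lbrNrr (lbr_anti (lbr x y) w) => /eqP.
by rewrite addr_eq0 opprK => /eqP <-.
Qed.

Lemma gcompD p (x y : c) : gcomp c p x -> gcomp c p y -> gcomp c p (x + y).
Proof. by move=> hx hy; rewrite -[x]scale1r; apply: (gcomp_sub c p).2. Qed.
Lemma gcomp0 p : gcomp c p 0.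
Proof. exact: (gcomp_sub c p).1. Qed.
Lemma gcompZ p (a : R) (x : c) : gcomp c p x -> gcomp c p (a *: x).
Proof. by move=> hx; rewrite -[_ *: _]addr0; apply: (gcomp_sub c p).2 => //; exact: gcomp0. Qed.
Lemma gcompN p (x : c) : gcomp c p x -> gcomp c p (- x).
Proof. by move=> hx; rewrite -scaleN1r; exact: gcompZ. Qed.
Lemma gcomp_lc p (vs : seq c) (ks : seq R) :
  (forall v, v \in vs -> gcomp c p v) -> gcomp c p (lc vs ks).
Proof.
elim: vs ks => [|v vs IH] [|k ks] H /=; try exact: gcomp0.
apply: gcompD; first by apply: gcompZ; apply: H; rewrite mem_head.
by apply: IH => w ws; apply: H; rewrite inE ws orbT.
Qed.

Lemma em2_neq0 : em2 c != 0.
Proof.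
have [_ [_ H] _ _] := ca_neg c; apply/eqP => e0.
have := H (fun=> 1); rewrite big_ord_recl big_ord0 e0 scaler0 addr0 => /(_ erefl ord0).
by move/eqP; rewrite oner_eq0.
Qed.

Lemma gcomp_em2 v : gcomp c (-2) v -> exists k : R, v = k *: em2 c.
Proof.
have [_ [<- _] _ _] := ca_neg c => -[n [a [x [xP ->]]]].
exists (\sum_i a i); rewrite scaler_suml; apply: eq_bigr => i _.
by have [j _ <-] := xP i.
Qed.

Lemma em2_gcomp : gcomp c (-2) (em2 c).
Proof.
have [_ [<- _] _ _] := ca_neg c.
exists 1%N, (fun=> 1), (fun=> em2 c); split; first by move=> i; exists ord0.
by rewrite big_ord_recl big_ord0 scale1r addr0.
Qed.

Lemma gcomp_low (p : int) v : p < -2 -> gcomp c p v -> v = 0.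
Proof. by have [H _ _ _] := ca_neg c => /H ->. Qed.

Lemma e1_gcomp : cm (e1 c).
Proof.
have [_ _ [<- _] _] := ca_neg c.
exists 1%N, (fun=> 1), (fun=> e1 c); split; first by move=> i; exists ord0.
by rewrite big_ord_recl big_ord0 scale1r addr0.
Qed.

Lemma e2_gcomp : cm (e2 c).
Proof.
have [_ _ [<- _] _] := ca_neg c.
exists 1%N, (fun=> 1), (fun=> e2 c); split; first by move=> i; exists ord_max.
by rewrite big_ord_recl big_ord0 scale1r addr0.
Qed.

Lemma cm_span v : cm v -> exists p q : R, v = p *: e1 c + q *: e2 c.
Proof.
have [_ _ [<- _] _] := ca_neg c => -[n [a [x [xP ->]]]].
elim/big_ind: _ => [||i _].
- by exists 0, 0; rewrite !scale0r addr0.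
- move=> _ _ [p [q ->]] [p' [q' ->]]; exists (p + p'), (q + q').
  by rewrite !scalerDl addrACA.
have [j _ <-] := xP i; case: ifP => _.
  by exists (a i), 0; rewrite scale0r addr0.
by exists 0, (a i); rewrite scale0r add0r.
Qed.

Section Data.
Variables (E J : c) (B : c -> c -> R) (S : seq c -> c) (mu : c -> c).
Hypotheses (hE : grading_element E) (hJ : is_complex_structure J)
  (hB : is_symplectic_form B) (hS : symmetric_product B S)
  (hmu : is_mu1 B S E mu).

(* All the computations are made in a rotated basis [(a1, a2)] of [c^-1]. *)
Record adapted (a1 a2 : c) : Prop := Adapted {
  ad1 : cm a1; ad2 : cm a2; ad_br : lbr a1 a2 = em2 c;
  ad_J1 : lbr J a1 = - a2; ad_J2 : lbr J a2 = a1;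
  ad_span : forall v, cm v -> exists p q : R, v = p *: a1 + q *: a2 }.

Lemma adapted_e : adapted (e1 c) (e2 c).
Proof.
have [_ J1 J2] := hJ; have [_ _ _ e12] := ca_neg c.
split => //; [exact: e1_gcomp | exact: e2_gcomp | exact: cm_span].
Qed.

Lemma adapted_rot (p q : R) : p * p + q * q = 1 ->
  adapted (p *: e1 c + q *: e2 c) (- q *: e1 c + p *: e2 c).
Proof.
move=> pq; have [_ J1 J2] := hJ; have [_ _ _ e12] := ca_neg c.
split.
- by apply: gcompD; apply: gcompZ; [exact: e1_gcomp | exact: e2_gcomp].
- by apply: gcompD; apply: gcompZ; [exact: e1_gcomp | exact: e2_gcomp].
- rewrite lbrDlr !lbrDrr !lbrZlr !lbrZrr !lbrxx (lbr_anti (e1 c) (e2 c)) e12.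
  rewrite !scaler0 add0r addr0 !scalerN !scalerA -scaleNr -scalerDl -[RHS]scale1r -pq.
  by congr (_ *: _); ring.
- rewrite lbrDrr !lbrZrr J1 J2 opprD -scaleNr opprK addrC.
  by rewrite scalerN -scaleNr.
- by rewrite lbrDrr !lbrZrr J1 J2 scalerN scaleNr opprK addrC.
- move=> v /cm_span [k [l ->]]; exists (k * p + l * q), (- k * q + l * p).
  rewrite !scalerDr !scalerA addrACA -!scalerDl.
  by congr (_ *: _ + _ *: _); [rewrite -[LHS]mulr1 -pq | rewrite -[LHS]mulr1 -pq]; ring.
Qed.

Lemma S_swap v w vs : in_cm1 (v :: w :: vs) -> S (v :: w :: vs) = S (w :: v :: vs).
Proof.
move=> H; apply: (symp_perm hS H).
by apply/permPl; exact: (perm_catCA [:: v] [:: w] vs).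
Qed.

Lemma S_swap2 u v w : in_cm1 [:: u; v; w] -> S [:: u; v; w] = S [:: u; w; v].
Proof.
move=> H; apply: (symp_perm hS H); rewrite perm_cons.
by apply/permPl; exact: (perm_catC [:: v] [:: w]).
Qed.

Lemma in_cm1_2 v w : cm v -> cm w -> in_cm1 [:: v; w].
Proof. by move=> hv hw x; rewrite !inE => /orP [] /eqP ->. Qed.

Lemma in_cm1_3 u v w : cm u -> cm v -> cm w -> in_cm1 [:: u; v; w].
Proof. by move=> hu hv hw x; rewrite !inE => /or3P [] /eqP ->. Qed.

Lemma S_comb (k l : R) x y vs : in_cm1 (x :: y :: vs) ->
  S ((k *: x + l *: y) :: vs) = k *: S (x :: vs) + l *: S (y :: vs).
Proof.
move=> H.
have hx : cm x by apply: H; rewrite mem_head.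
have hy : cm y by apply: H; rewrite !inE eqxx orbT.
have hvs v : v \in vs -> cm v by move=> vv; apply: H; rewrite !inE vv !orbT.
have cons2 a b : cm a -> cm b -> in_cm1 (a :: b :: vs).
  by move=> ha hb v; rewrite !inE => /or3P [/eqP ->|/eqP ->|/hvs].
have S0 : S (0 :: vs) = 0.
  have := symp_lin hS 1 (cons2 0 0 (gcomp0 _) (gcomp0 _)).
  by rewrite !scale1r addr0 -[X in X = _]addr0 => /addrI.
rewrite (symp_lin hS); last by apply: cons2 => //; exact: gcompZ.
congr (_ + _); rewrite -[l *: y]addr0 (symp_lin hS); last by apply: cons2 => //; exact: gcomp0.
by rewrite S0 addr0.
Qed.

Section Span.
Variables (a1 a2 : c) (P : c -> Prop).
Hypothesis sp : forall v, cm v -> exists p q : R, v = p *: a1 + q *: a2.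
Hypotheses (h1 : cm a1) (h2 : cm a2).
Hypothesis comb : forall (k l : R) x y, P x -> P y -> P (k *: x + l *: y).

(** Symmetry and multilinearity reduce a property stable under combinations to the monomials in
    [a1], [a2]. It is used for membership in k^0 and for being a combination of these monomials. *)
Lemma S2_ind : P (S [:: a1; a1]) -> P (S [:: a1; a2]) -> P (S [:: a2; a2]) ->
  forall v w, cm v -> cm w -> P (S [:: v; w]).
Proof.
move=> P11 P12 P22.
have P21 : P (S [:: a2; a1]) by rewrite S_swap //; exact: in_cm1_2.
have H v w : cm v -> P (S [:: a1; w]) -> P (S [:: a2; w]) -> cm w -> P (S [:: v; w]).
  move=> /sp [p [q ->]] H1 H2 hw; rewrite S_comb; first exact: comb.
  exact: in_cm1_3.
have H2 v : cm v -> P (S [:: v; a1]) by move=> hv; exact: H.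
have H3 v : cm v -> P (S [:: v; a2]) by move=> hv; exact: H.
move=> v w hv hw; apply: H => //.
  by rewrite S_swap; [exact: H2 | exact: in_cm1_2].
by rewrite S_swap; [apply: H3 => // | exact: in_cm1_2].
Qed.

Lemma S3_ind : P (S [:: a1; a1; a1]) -> P (S [:: a1; a1; a2]) ->
  P (S [:: a1; a2; a2]) -> P (S [:: a2; a2; a2]) ->
  forall u v w, cm u -> cm v -> cm w -> P (S [:: u; v; w]).
Proof.
move=> P111 P112 P122 P222.
have perm3 u v w : cm u -> cm v -> cm w ->
    (S [:: u; v; w] = S [:: v; u; w]) /\ (S [:: u; v; w] = S [:: u; w; v]).
  by move=> hu hv hw; split; [apply: S_swap | apply: S_swap2]; exact: in_cm1_3.
have H u v w : P (S [:: a1; v; w]) -> P (S [:: a2; v; w]) -> cm u -> cm v -> cm w ->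
    P (S [:: u; v; w]).
  move=> H1 H2 /sp [p [q ->]] hv hw; rewrite S_comb; first exact: comb.
  by move=> x; rewrite !inE => /or4P [] /eqP ->.
have H11 u : cm u -> P (S [:: u; a1; a1]).
  move=> hu; apply: H => //.
  by rewrite (perm3 _ _ _ h2 h1 h1).1 (perm3 _ _ _ h1 h2 h1).2.
have H12 u : cm u -> P (S [:: u; a1; a2]).
  by move=> hu; apply: H => //; rewrite (perm3 _ _ _ h2 h1 h2).1.
have H22 u : cm u -> P (S [:: u; a2; a2]) by move=> hu; exact: H.
have G1 u v : cm u -> cm v -> P (S [:: u; v; a1]).
  move=> hu hv; apply: H => //.
    by rewrite (perm3 _ _ _ h1 hv h1).1; exact: H11.
  by rewrite (perm3 _ _ _ h2 hv h1).1 (perm3 _ _ _ hv h2 h1).2; exact: H12.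
have G2 u v : cm u -> cm v -> P (S [:: u; v; a2]).
  move=> hu hv; apply: H => //.
    by rewrite (perm3 _ _ _ h1 hv h2).1; exact: H12.
  by rewrite (perm3 _ _ _ h2 hv h2).1; exact: H22.
move=> u v w hu hv hw; apply: H => //.
  by rewrite (perm3 _ _ _ h1 hv hw).1 (perm3 _ _ _ hv h1 hw).2; exact: G1.
by rewrite (perm3 _ _ _ h2 hv hw).1 (perm3 _ _ _ hv h2 hw).2; exact: G2.
Qed.

End Span.

Lemma kcomp_comb p (k l : R) (x y : c) : kc p x -> kc p y -> kc p (k *: x + l *: y).
Proof.
move=> [hx kx] [hy ky]; split; first by apply: gcompD; exact: gcompZ.
by move=> Y hY; rewrite lbrDlr !lbrZlr kx // ky // !scaler0 addr0.
Qed.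

Lemma S_basis_mem k (j : 'I_k.+1) :
  kc (k%:Z - 2) (S (nseq (k - j) (e1 c) ++ nseq j (e2 c))).
Proof.
have [<- _] := symp_basis hS k.
exists 1%N, (fun=> 1), (fun=> S (nseq (k - j) (e1 c) ++ nseq j (e2 c))); split.
  by move=> i; exists j.
by rewrite big_ord_recl big_ord0 scale1r addr0.
Qed.

Lemma S2_kcomp v w : cm v -> cm w -> kc 0 (S [:: v; w]).
Proof.
have H := @S_basis_mem 2.
apply: (S2_ind cm_span e1_gcomp e2_gcomp); first by move=> *; exact: kcomp_comb.
- exact: (H (@Ordinal 3 0 isT)).
- exact: (H (@Ordinal 3 1 isT)).
- exact: (H (@Ordinal 3 2 isT)).
Qed.

Lemma S3_kcomp u v w : cm u -> cm v -> cm w -> kc 1 (S [:: u; v; w]).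
Proof.
have H := @S_basis_mem 3.
apply: (S3_ind cm_span e1_gcomp e2_gcomp); first by move=> *; exact: kcomp_comb.
- exact: (H (@Ordinal 4 0 isT)).
- exact: (H (@Ordinal 4 1 isT)).
- exact: (H (@Ordinal 4 2 isT)).
- exact: (H (@Ordinal 4 3 isT)).
Qed.

Section Adapted.
Variables (a1 a2 : c).
Hypothesis had : adapted a1 a2.

Let h1 : cm a1 := ad1 had.
Let h2 : cm a2 := ad2 had.

Definition s11 := S [:: a1; a1].
Definition s12 := S [:: a1; a2].
Definition s22 := S [:: a2; a2].
Definition s111 := S [:: a1; a1; a1].
Definition s112 := S [:: a1; a1; a2].
Definition s122 := S [:: a1; a2; a2].
Definition s222 := S [:: a2; a2; a2].

Definition W0 := V0 E s11 s12 s22.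
Definition W1 := V1 s111 s112 s122 s222 (mu a1) (mu a2).

Lemma W0E : [/\ E = lc W0 [:: 1; 0; 0; 0], s11 = lc W0 [:: 0; 1; 0; 0],
  s12 = lc W0 [:: 0; 0; 1; 0] & s22 = lc W0 [:: 0; 0; 0; 1]].
Proof. by split; rewrite /= !scale0r scale1r !addr0 ?add0r. Qed.

Lemma W1E : [/\ [/\ s111 = lc W1 [:: 1; 0; 0; 0; 0; 0], s112 = lc W1 [:: 0; 1; 0; 0; 0; 0] &
    s122 = lc W1 [:: 0; 0; 1; 0; 0; 0]], s222 = lc W1 [:: 0; 0; 0; 1; 0; 0],
  mu a1 = lc W1 [:: 0; 0; 0; 0; 1; 0] & mu a2 = lc W1 [:: 0; 0; 0; 0; 0; 1]].
Proof. by do !split; rewrite /= !scale0r scale1r !addr0 ?add0r. Qed.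

Lemma s11E : s11 = lc W0 [:: 0; 1; 0; 0]. Proof. by case: W0E. Qed.
Lemma s12E : s12 = lc W0 [:: 0; 0; 1; 0]. Proof. by case: W0E. Qed.
Lemma s22E : s22 = lc W0 [:: 0; 0; 0; 1]. Proof. by case: W0E. Qed.
Lemma s111E : s111 = lc W1 [:: 1; 0; 0; 0; 0; 0]. Proof. by case: W1E => -[]. Qed.

(** The given basis of k^0 consists of monomials in e_1, e_2; these are rewritten as combinations of
    the monomials in the rotated basis. *)
Lemma kcomp0_lc X : kc 0 X -> exists a b d : R, X = lc W0 [:: 0; a; b; d].
Proof.
have [e _] := symp_basis hS 2; rewrite (_ : kc 0 = kc (2%:Z - 2)) // -e.
move=> [n [k [x [xP ->]]]].
pose P (X : c) := exists a b d : R, X = lc W0 [:: 0; a; b; d].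
have comb (r l : R) x' y : P x' -> P y -> P (r *: x' + l *: y).
  move=> [a [b [d ->]]] [a' [b' [d' ->]]].
  exists (r * a + l * a'), (r * b + l * b'), (r * d + l * d').
  by rewrite !lcZ lcD //; congr lc; rewrite /= !mulr0 addr0.
have PS v w : cm v -> cm w -> P (S [:: v; w]).
  apply: (S2_ind (ad_span had) h1 h2) => //.
  - by exists 1, 0, 0; rewrite /= !scale0r scale1r !addr0 add0r.
  - by exists 0, 1, 0; rewrite /= !scale0r scale1r !addr0 !add0r.
  - by exists 0, 0, 1; rewrite /= !scale0r scale1r !addr0 !add0r.
elim/big_ind: _ => [||i _].
- by exists 0, 0, 0; rewrite /= !scale0r !addr0.
- by move=> x' y' Px Py; rewrite -[x']scale1r -[y']scale1r; exact: comb.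
rewrite -[_ *: _]addr0 -(scale0r (x i)); have [j _ <-] := xP i.
suff PP : P (S (nseq (2 - j) (e1 c) ++ nseq j (e2 c))) by apply: comb.
have c1 := e1_gcomp; have c2 := e2_gcomp.
by case: j => [[|[|[|j]]] //= _]; exact: PS.
Qed.

Lemma kcomp1_lc X : kc 1 X ->
  exists k0 k1 k2 k3 : R, X = lc W1 [:: k0; k1; k2; k3; 0; 0].
Proof.
have [e _] := symp_basis hS 3; rewrite (_ : kc 1 = kc (3%:Z - 2)) // -e.
move=> [n [k [x [xP ->]]]].
pose P (X : c) := exists k0 k1 k2 k3 : R, X = lc W1 [:: k0; k1; k2; k3; 0; 0].
have comb (r l : R) x' y : P x' -> P y -> P (r *: x' + l *: y).
  move=> [a [b [d [g ->]]]] [a' [b' [d' [g' ->]]]].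
  exists (r * a + l * a'), (r * b + l * b'), (r * d + l * d'), (r * g + l * g').
  by rewrite !lcZ lcD //; congr lc; rewrite /= !mulr0 addr0.
have PS u v w : cm u -> cm v -> cm w -> P (S [:: u; v; w]).
  apply: (S3_ind (ad_span had) h1 h2) => //.
  - by exists 1, 0, 0, 0; rewrite /= !scale0r scale1r !addr0.
  - by exists 0, 1, 0, 0; rewrite /= !scale0r scale1r !addr0 !add0r.
  - by exists 0, 0, 1, 0; rewrite /= !scale0r scale1r !addr0 !add0r.
  - by exists 0, 0, 0, 1; rewrite /= !scale0r scale1r !addr0 !add0r.
elim/big_ind: _ => [||i _].
- by exists 0, 0, 0, 0; rewrite /= !scale0r !addr0.
- by move=> x' y' Px Py; rewrite -[x']scale1r -[y']scale1r; exact: comb.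
rewrite -[_ *: _]addr0 -(scale0r (x i)); have [j _ <-] := xP i.
suff PP : P (S (nseq (3 - j) (e1 c) ++ nseq j (e2 c))) by apply: comb.
have c1 := e1_gcomp; have c2 := e2_gcomp.
by case: j => [[|[|[|[|j]]]] //= _]; exact: PS.
Qed.

Lemma B_ad : [/\ B a1 a1 = 0, B a1 a2 = 1, B a2 a1 = -1 & B a2 a2 = 0].
Proof.
have inj (k l : R) : k *: em2 c = l *: em2 c -> k = l.
  by move/eqP; rewrite -subr_eq0 -scalerBl scaler_eq0 (negPf em2_neq0) orbF subr_eq0 => /eqP.
split; apply: inj; rewrite -hB ?lbrxx ?scale0r ?(ad_br had) ?scale1r //.
by rewrite lbr_anti (ad_br had) scaleN1r.
Qed.

Lemma br_S2 v w x : cm v -> cm w -> cm x ->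
  lbr (S [:: v; w]) x = B v x *: w + B w x *: v.
Proof.
move=> hv hw hx; rewrite -{1}(symp1 hS hx) (symp_br hS) //; last first.
- by move=> y; rewrite inE => /eqP ->.
- exact: in_cm1_2.
by rewrite !big_ord_recl !big_ord0 /= /omit /= !addr0 !(symp1 hS).
Qed.

Lemma br_S3 u v w x : cm u -> cm v -> cm w -> cm x ->
  lbr (S [:: u; v; w]) x = B u x *: S [:: v; w] + B v x *: S [:: u; w] + B w x *: S [:: u; v].
Proof.
move=> hu hv hw hx; rewrite -{1}(symp1 hS hx) (symp_br hS) //; last first.
- by move=> y; rewrite inE => /eqP ->.
- exact: in_cm1_3.
by rewrite !big_ord_recl !big_ord0 /= /omit /= !addr0 addrA.
Qed.

Lemma table_0m : table (@lbr R c) W0 (Vm a1 a2) (Vm a1 a2) (T0m R).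
Proof.
have [B11 B12 B21 B22] := B_ad; have [_ HE] := hE.
have eE v : cm v -> lbr E v = - v by move=> /HE ->; rewrite scaleN1r.
by rewrite /table /trow /=; do !split => //;
  rewrite ?eE ?br_S2 // ?B11 ?B12 ?B21 ?B22 ?(scaleNr, scale0r, scale1r, addr0, add0r,
   scaler_nat, mulr2n, opprD).
Qed.

(** Transitivity in its working form. Identities in degree p are proved by bracketing both sides
    with [a1] and [a2], which descends to degree p - 1 through the Jacobi identity. *)
Lemma trans_p p X Y : 0 <= p -> gcomp c p X -> gcomp c p Y ->
  lbr X a1 = lbr Y a1 -> lbr X a2 = lbr Y a2 -> X = Y.
Proof.
move=> p0 hX hY e1 e2; apply/eqP; rewrite -subr_eq0; apply/eqP.
apply: (@ca_trans R c p) => //; first by apply: gcompD => //; exact: gcompN.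
move=> v /(ad_span had) [k [q ->]].
by rewrite lbrDrr !lbrZrr !lbrDlr !lbrNlr e1 e2 !subrr !scaler0 addr0.
Qed.

Lemma table_1m : table (@lbr R c) W1 (Vm a1 a2) W0 (T1m R).
Proof.
have [B11 B12 B21 B22] := B_ad.
have [_ _ M1] := hmu h1; have [_ _ M2] := hmu h2.
by rewrite /table /trow /=; do !split => //;
  rewrite ?M1 ?M2 ?br_S3 // ?B11 ?B12 ?B21 ?B22 -/s11 -/s12 -/s22 ?(S_swap (in_cm1_2 h2 h1))
   ?(mulr0, mulr1, mulrN1, scaleNr, scale0r, scale1r, addr0, add0r,
   scaler_nat, mulr2n, mulrS, opprD, opprK, oppr0, addrA).
Qed.

Lemma W0_gcomp ks : gcomp c 0 (lc W0 ks).
Proof.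
apply: gcomp_lc => v; rewrite !inE => /or4P [] /eqP ->; first exact: hE.1;
  by apply: (S2_kcomp _ _).1.
Qed.

Lemma W1_gcomp ks : gcomp c 1 (lc W1 ks).
Proof.
apply: gcomp_lc => v; rewrite !inE.
case/or4P => [/eqP ->|/eqP ->|/eqP ->|]; try by apply: (S3_kcomp _ _ _).1.
case/or3P => /eqP ->; first by apply: (S3_kcomp _ _ _).1.
  by have [] := hmu h1.
by have [] := hmu h2.
Qed.

Lemma Wm_gcomp ks : cm (lc (Vm a1 a2) ks).
Proof. by apply: gcomp_lc => v; rewrite !inE => /orP [] /eqP ->. Qed.

Let a1E : a1 = lc (Vm a1 a2) [:: 1; 0].
Proof. by rewrite /= scale1r scale0r !addr0. Qed.
Let a2E : a2 = lc (Vm a1 a2) [:: 0; 1].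
Proof. by rewrite /= scale1r scale0r !addr0 add0r. Qed.

Lemma W_br_0m x a b d p q :
  lbr (lc W0 [:: x; a; b; d]) (lc (Vm a1 a2) [:: p; q]) =
  lc (Vm a1 a2) [:: - x * p - b * p + 2 * a * q; - x * q + b * q - 2 * d * p].
Proof. exact: (br_0m (@lbrDl R c) (@lbrDr R c) _ _ _ _ _ _ table_0m). Qed.

Lemma W_br_1m k0 k1 k2 k3 m l p q :
  lbr (lc W1 [:: k0; k1; k2; k3; m; l]) (lc (Vm a1 a2) [:: p; q]) =
  lc W0 [:: inv2 R * (l * p - m * q); 3 * k0 * q - k1 * p + inv2 R * m * p;
    2 * k1 * q - 2 * k2 * p + inv2 R * (m * q + l * p); k2 * q - 3 * k3 * p + inv2 R * l * q].
Proof. exact: (br_1m (@lbrDl R c) (@lbrDr R c) _ _ _ _ _ _ _ _ table_1m). Qed.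

Lemma lc_m_inj p q p' q' :
  lc (Vm a1 a2) [:: p; q] = lc (Vm a1 a2) [:: p'; q'] :> c -> p = p' /\ q = q'.
Proof.
have H (k l : R) : lbr a1 (lc (Vm a1 a2) [:: k; l]) = l *: em2 c /\
    lbr a2 (lc (Vm a1 a2) [:: k; l]) = - k *: em2 c.
  rewrite /= !lbrDrr !lbrZrr !lbrxx lbr0r !scaler0 !addr0 add0r (lbr_anti a1 a2).
  by rewrite (ad_br had) scalerN scaleNr !lbr0r !addr0.
have inj (k l : R) : k *: em2 c = l *: em2 c -> k = l.
  by move/eqP; rewrite -subr_eq0 -scalerBl scaler_eq0 (negPf em2_neq0) orbF subr_eq0 => /eqP.
move=> e; have [e1 e2] := H p q; rewrite e in e1 e2; have [f1 f2] := H p' q'.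
split; last by apply: inj; rewrite -e1 f1.
by apply: oppr_inj; apply: inj; rewrite -e2 f2.
Qed.

(** The coefficients are recovered from the brackets with [a1] and [a2]. *)
Lemma lc_0_inj x a b d x' a' b' d' :
  lc W0 [:: x; a; b; d] = lc W0 [:: x'; a'; b'; d'] -> [/\ x = x', a = a', b = b' & d = d'].
Proof.
move=> e; have := W_br_0m x a b d 1 0; rewrite e W_br_0m => /lc_m_inj [e1 e2].
have := W_br_0m x a b d 0 1; rewrite e W_br_0m => /lc_m_inj [e3 e4].
by split; lra.
Qed.

Lemma lc_1_inj k0 k1 k2 k3 m l k0' k1' k2' k3' m' l' :
  lc W1 [:: k0; k1; k2; k3; m; l] = lc W1 [:: k0'; k1'; k2'; k3'; m'; l'] ->
  [/\ [/\ k0 = k0', k1 = k1' & k2 = k2'], k3 = k3', m = m' & l = l'].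
Proof.
move=> e; have := W_br_1m k0 k1 k2 k3 m l 1 0; rewrite e W_br_1m => /lc_0_inj [e1 e2 e3 e4].
have := W_br_1m k0 k1 k2 k3 m l 0 1; rewrite e W_br_1m => /lc_0_inj [e5 e6 e7 e8].
move: e1 e2 e3 e4 e5 e6 e7 e8; rewrite /inv2 => *.
by do !split; lra.
Qed.

Lemma gcompm_lc v : cm v -> exists p q : R, v = lc (Vm a1 a2) [:: p; q].
Proof. by move=> /(ad_span had) [p [q ->]]; exists p, q; rewrite /= addr0. Qed.

Lemma E_em2 : lbr E (em2 c) = - 2 *: em2 c.
Proof. by have [_ /(_ _ _ em2_gcomp) ->] := hE. Qed.

Lemma gcomp0_lc X : gcomp c 0 X -> exists x a b d : R, X = lc W0 [:: x; a; b; d].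
Proof.
move=> hX; have [t Xt] : exists t, lbr X (em2 c) = t *: em2 c.
  by apply: gcomp_em2; exact: (gcomp_br hX em2_gcomp).
(* Since E acts by -2 on e^-2, this sum commutes with e^-2, hence lies in k^0. *)
have [|a [b [d e]]] := @kcomp0_lc (X + (2^-1 * t) *: E).
  split; first by apply: gcompD => //; apply: gcompZ; exact: hE.1.
  move=> Y /gcomp_em2 [k ->]; rewrite lbrZrr lbrDlr lbrZlr Xt E_em2 scalerA -scalerDl.
  by rewrite (_ : _ + _ = 0) ?scale0r ?scaler0 //; field.
exists (- (2^-1 * t)), a, b, d.
rewrite -[LHS](addrK ((2^-1 * t) *: E)) e /= scale0r add0r.
by rewrite scaleNr addrC.
Qed.

Lemma gcomp1_lc X : gcomp c 1 X ->
  exists k0 k1 k2 k3 m l : R, X = lc W1 [:: k0; k1; k2; k3; m; l].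
Proof.
move=> hX; have [m [l e]] : exists m l, lbr X (em2 c) = m *: a1 + l *: a2.
  by apply: (ad_span had); exact: (gcomp_br hX em2_gcomp).
have [g1 M1 _] := hmu h1; have [g2 M2 _] := hmu h2.
(* [mu] is a section of the bracket with e^-2; subtracting it leaves an element of k^1. *)
have [|k0 [k1 [k2 [k3 e']]]] := @kcomp1_lc (X - (m *: mu a1 + l *: mu a2)).
  split; first by apply: gcompD => //; apply: gcompN; apply: gcompD; exact: gcompZ.
  move=> Y /gcomp_em2 [k ->].
  by rewrite lbrZrr lbrDlr lbrNlr lbrDlr !lbrZlr M1 M2 e subrr scaler0.
exists k0, k1, k2, k3, m, l.
rewrite -[LHS](subrK (m *: mu a1 + l *: mu a2)) e' /= !scale0r !addr0 !addrA.
by [].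
Qed.

Lemma table_00 : table (@lbr R c) W0 W0 W0 (T00 R).
Proof.
have H x a b d x' a' b' d' : lbr (lc W0 [:: x; a; b; d]) (lc W0 [:: x'; a'; b'; d']) =
  lc W0 [:: 0; 2 * (a * b' - a' * b); 4 * (a * d' - a' * d); 2 * (b * d' - b' * d)].
  apply: (@trans_p 0) => //; [exact: (gcomp_br (W0_gcomp _) (W0_gcomp _)) | exact: W0_gcomp | |].
    rewrite a1E lbr_jacobi !W_br_0m lcN lcD //; congr lc.
    by congr [:: _; _]; ring.
  rewrite a2E lbr_jacobi !W_br_0m lcN lcD //; congr lc.
  by congr [:: _; _]; ring.
have [e0 e1 e2 e3] := W0E.
rewrite /table /trow /T00 {1}/W0 /V0 {1}/W0 /V0.
by do !split => //; rewrite ?e0 ?e1 ?e2 ?e3 H; congr lc; congr [:: _; _; _; _]; ring.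
Qed.

Lemma W_br_00 x a b d x' a' b' d' :
  lbr (lc W0 [:: x; a; b; d]) (lc W0 [:: x'; a'; b'; d']) =
  lc W0 [:: 0; 2 * (a * b' - a' * b); 4 * (a * d' - a' * d); 2 * (b * d' - b' * d)].
Proof. exact: (br_00 (@lbrDl R c) (@lbrDr R c) _ _ _ _ _ _ _ _ table_00). Qed.

Lemma W_br_01 x a b d k0 k1 k2 k3 m l :
  lbr (lc W0 [:: x; a; b; d]) (lc W1 [:: k0; k1; k2; k3; m; l]) =
  lc W1 [:: x * k0 + 2 * a * k1 - 3 * b * k0;
    x * k1 + 4 * a * k2 - b * k1 - 6 * d * k0;
    x * k2 + 6 * a * k3 + b * k2 - 4 * d * k1;
    x * k3 + 3 * b * k3 - 2 * d * k2;
    x * m + 2 * a * l - b * m; x * l + b * l - 2 * d * m].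
Proof.
apply: (@trans_p 1) => //; [exact: (gcomp_br (W0_gcomp _) (W1_gcomp _)) | exact: W1_gcomp | |].
  rewrite a1E lbr_jacobi W_br_0m !W_br_1m W_br_00 lcN lcD //; congr lc.
  by congr [:: _; _; _; _]; rewrite /inv2; field.
rewrite a2E lbr_jacobi W_br_0m !W_br_1m W_br_00 lcN lcD //; congr lc.
by congr [:: _; _; _; _]; rewrite /inv2; field.
Qed.

Lemma table_01 : table (@lbr R c) W0 W1 W1 (T01 R).
Proof.
have [e0 e1 e2 e3] := W0E.
have [[f0 f1 f2] f3 f4 f5] := W1E.
rewrite /table /trow /T01 {1}/W0 /V0 {1}/W1 /V1.
by do !split => //; rewrite ?e0 ?e1 ?e2 ?e3 ?f0 ?f1 ?f2 ?f3 ?f4 ?f5 W_br_01; congr lc;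
  congr [:: _; _; _; _; _; _]; ring.
Qed.

Lemma W_br_1em2 k0 k1 k2 k3 m l :
  lbr (lc W1 [:: k0; k1; k2; k3; m; l]) (em2 c) = lc (Vm a1 a2) [:: m; l].
Proof.
have z u v w : cm u -> cm v -> cm w -> lbr (S [:: u; v; w]) (em2 c) = 0.
  by move=> hu hv hw; apply: (S3_kcomp hu hv hw).2; exact: em2_gcomp.
have [_ M1 _] := hmu h1; have [_ M2 _] := hmu h2.
by rewrite /= !lbrDlr !lbrZlr !z // M1 M2 lbr0l !scaler0 !add0r.
Qed.

Lemma W_br_0em2 x a b d :
  lbr (lc W0 [:: x; a; b; d]) (em2 c) = (- 2 * x) *: em2 c.
Proof.
have z u v : cm u -> cm v -> lbr (S [:: u; v]) (em2 c) = 0.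
  by move=> hu hv; apply: (S2_kcomp hu hv).2; exact: em2_gcomp.
by rewrite /= !lbrDlr !lbrZlr !z // E_em2 lbr0l !scaler0 !addr0 scalerA mulrC.
Qed.

Lemma W_br_mem2 v : cm v -> lbr v (em2 c) = 0.
Proof.
by move=> hv; apply: (@gcomp_low (-1 + -2)) => //; exact: (gcomp_br hv em2_gcomp).
Qed.

(** [(a_1^2 + a_2^2)/2] acts on [a1], [a2] as the complex structure does, and transitivity applies:
    the same formula holds in every adapted basis. *)
Lemma J_lc : J = lc W0 [:: 0; inv2 R; 0; inv2 R].
Proof.
have [[hJ0 _] _ _] := hJ.
apply: (@trans_p 0) => //; [exact: W0_gcomp | |].
  rewrite (ad_J1 had) a1E W_br_0m /= !addr0 /inv2.
  rewrite (_ : _ + _ * 0 = 0) ?scale0r ?add0r; last by ring.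
  by rewrite -scaleN1r; congr (_ *: _); field.
rewrite (ad_J2 had) a2E W_br_0m /= !addr0 /inv2.
rewrite [X in _ = _ + X *: _](_ : _ = 0) ?scale0r ?addr0; last by ring.
by rewrite -[LHS]scale1r; congr (_ *: _); field.
Qed.

(* [N = (e_1^3 + i n) / 2]. *)
Definition gn : c := lc W1 [:: 0; 1; 0; 0; - 6; 0].

Definition G8 : seq c := [:: em2 c; a1; a2; E; s11; s12; s111; gn].

Definition T8 (K : numFieldType) : seq (seq (seq K)) :=
  let z := [:: 0; 0; 0; 0; 0; 0; 0; 0] in
  [:: [:: z; z; z; [:: 2; 0; 0; 0; 0; 0; 0; 0]; z; z; z; [:: 0; 6; 0; 0; 0; 0; 0; 0]];
      [:: z; z; [:: 1; 0; 0; 0; 0; 0; 0; 0]; [:: 0; 1; 0; 0; 0; 0; 0; 0]; z;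
          [:: 0; 1; 0; 0; 0; 0; 0; 0]; z; [:: 0; 0; 0; 0; 4; 0; 0; 0]];
      [:: z; [:: -1; 0; 0; 0; 0; 0; 0; 0]; z; [:: 0; 0; 1; 0; 0; 0; 0; 0];
          [:: 0; - 2; 0; 0; 0; 0; 0; 0]; [:: 0; 0; -1; 0; 0; 0; 0; 0];
          [:: 0; 0; 0; 0; - 3; 0; 0; 0]; [:: 0; 0; 0; - 3; 0; 1; 0; 0]];
      [:: [:: - 2; 0; 0; 0; 0; 0; 0; 0]; [:: 0; -1; 0; 0; 0; 0; 0; 0];
          [:: 0; 0; -1; 0; 0; 0; 0; 0]; z; z; z; [:: 0; 0; 0; 0; 0; 0; 1; 0];
          [:: 0; 0; 0; 0; 0; 0; 0; 1]];
      [:: z; z; [:: 0; 2; 0; 0; 0; 0; 0; 0]; z; z; [:: 0; 0; 0; 0; 2; 0; 0; 0]; z;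
          [:: 0; 0; 0; 0; 0; 0; 2; 0]];
      [:: z; [:: 0; -1; 0; 0; 0; 0; 0; 0]; [:: 0; 0; 1; 0; 0; 0; 0; 0]; z;
          [:: 0; 0; 0; 0; - 2; 0; 0; 0]; z; [:: 0; 0; 0; 0; 0; 0; - 3; 0];
          [:: 0; 0; 0; 0; 0; 0; 0; -1]];
      [:: z; z; [:: 0; 0; 0; 0; 3; 0; 0; 0]; [:: 0; 0; 0; 0; 0; 0; -1; 0]; z;
          [:: 0; 0; 0; 0; 0; 0; 3; 0]; z; z];
      [:: [:: 0; - 6; 0; 0; 0; 0; 0; 0]; [:: 0; 0; 0; 0; - 4; 0; 0; 0];
          [:: 0; 0; 0; 3; 0; -1; 0; 0]; [:: 0; 0; 0; 0; 0; 0; 0; -1];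
          [:: 0; 0; 0; 0; 0; 0; - 2; 0]; [:: 0; 0; 0; 0; 0; 0; 0; 1]; z; z]].

Lemma table_8 : table (@lbr R c) G8 G8 G8 (T8 R).
Proof.
have [e0 e1 e2 _] := W0E.
have [[f0 _ _] _ _ _] := W1E.
have t01 : lbr a1 (em2 c) = 0 by exact: W_br_mem2.
have t02 : lbr a2 (em2 c) = 0 by exact: W_br_mem2.
have t03 := E_em2.
have t04 : lbr s11 (em2 c) = 0 by rewrite e1 W_br_0em2 mulr0 scale0r.
have t05 : lbr s12 (em2 c) = 0 by rewrite e2 W_br_0em2 mulr0 scale0r.
have t06 : lbr s111 (em2 c) = 0 by rewrite f0 W_br_1em2 /= !scale0r !addr0.
have t07 : lbr gn (em2 c) = - 6 *: a1 by rewrite /gn W_br_1em2 /= scale0r !addr0.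
have t12 : lbr a1 a2 = em2 c := ad_br had.
have lm p q : lc (Vm a1 a2) [:: p; q] = p *: a1 + q *: a2 by rewrite /= addr0.
have l0 x a b : lc W0 [:: x; a; b; 0] = x *: E + a *: s11 + b *: s12.
  by rewrite /= scale0r !addr0 addrA.
have t13 : lbr E a1 = - a1 by rewrite e0 a1E W_br_0m lcN; congr lc; congr [:: _; _]; ring.
have t23 : lbr E a2 = - a2 by rewrite e0 a2E W_br_0m lcN; congr lc; congr [:: _; _]; ring.
have t14 : lbr s11 a1 = 0.
  by rewrite e1 a1E W_br_0m -[RHS](lc_nseq0 (Vm a1 a2) 2); congr lc; congr [:: _; _]; ring.
have t24 : lbr s11 a2 = 2 *: a1.
  by rewrite e1 [X in lbr _ X]a2E [X in _ *: X]a1E W_br_0m lcZ; congr lc; congr [:: _; _]; ring.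
have t15 : lbr s12 a1 = - a1 by rewrite e2 a1E W_br_0m lcN; congr lc; congr [:: _; _]; ring.
have t25 : lbr s12 a2 = a2 by rewrite e2 a2E W_br_0m; congr lc; congr [:: _; _]; ring.
have t16 : lbr s111 a1 = 0.
  rewrite f0 a1E W_br_1m -[RHS](lc_nseq0 W0 4); congr lc.
  by congr [:: _; _; _; _]; ring.
have t26 : lbr s111 a2 = 3 *: s11.
  by rewrite f0 a2E W_br_1m e1 lcZ; congr lc; congr [:: _; _; _; _]; ring.
have t17 : lbr gn a1 = - 4 *: s11.
  by rewrite /gn a1E W_br_1m e1 lcZ; congr lc; congr [:: _; _; _; _]; rewrite /inv2; field.
have t27 : lbr gn a2 = 3 *: E - s12.
  rewrite /gn a2E W_br_1m e0 e2 lcZ lcN lcD //; congr lc.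
  by congr [:: _; _; _; _]; rewrite /inv2; field.
have t34 : lbr E s11 = 0.
  by rewrite e0 e1 W_br_00 -[RHS](lc_nseq0 W0 4); congr lc; congr [:: _; _; _; _]; ring.
have t35 : lbr E s12 = 0.
  by rewrite e0 e2 W_br_00 -[RHS](lc_nseq0 W0 4); congr lc; congr [:: _; _; _; _]; ring.
have t45 : lbr s11 s12 = 2 *: s11.
  by rewrite e1 e2 W_br_00 lcZ; congr lc; congr [:: _; _; _; _]; ring.
have t36 : lbr E s111 = s111.
  by rewrite e0 f0 W_br_01; congr lc; congr [:: _; _; _; _; _; _]; ring.
have t37 : lbr E gn = gn.
  by rewrite e0 /gn W_br_01; congr lc; congr [:: _; _; _; _; _; _]; ring.
have t46 : lbr s11 s111 = 0.
  rewrite e1 f0 W_br_01 -[RHS](lc_nseq0 W1 6); congr lc.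
  by congr [:: _; _; _; _; _; _]; ring.
have t47 : lbr s11 gn = 2 *: s111.
  by rewrite e1 f0 /gn W_br_01 lcZ; congr lc; congr [:: _; _; _; _; _; _]; ring.
have t56 : lbr s12 s111 = - 3 *: s111.
  by rewrite e2 f0 W_br_01 lcZ; congr lc; congr [:: _; _; _; _; _; _]; ring.
have t57 : lbr s12 gn = - gn.
  by rewrite e2 /gn W_br_01 lcN; congr lc; congr [:: _; _; _; _; _; _]; ring.
(* This bracket has degree 2, where no basis is available; it is zero because its brackets with [a1]
   and [a2] are. *)
have t67 : lbr s111 gn = 0.
  apply: (@trans_p 2) => //; first by rewrite f0; apply: gcomp_br; exact: W1_gcomp.
  - exact: gcomp0.
  - rewrite lbr_jacobi t16 t17 lbrZrr (lbr_anti s11) t46 oppr0 scaler0 lbr0l.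
    by rewrite (lbr_anti 0) lbr0l oppr0 subr0.
  - have u1 : lbr s111 E = -1 *: s111 by rewrite lbr_anti t36 scaleN1r.
    have u2 : lbr s111 s12 = 3 *: s111 by rewrite lbr_anti t56 scaleNr opprK.
    have u3 : lbr gn s11 = - 2 *: s111 by rewrite lbr_anti t47 scaleNr.
    rewrite lbr_jacobi t26 t27 lbrDrr lbrZrr lbrNrr u1 u2 lbrZrr u3 lbr0l.
    rewrite !scalerA -!scaleNr -!scalerDl.
    change ((3 * -1 - 3 + - 3 * - 2) *: s111 = 0).
    by rewrite [X in X *: _](_ : _ = 0) ?scale0r //; ring.
rewrite /table /trow /T8 /G8.
split; first by do !split => //; rewrite ?lbrxx  ?(lbr_anti _ (em2 c)) ?t01 ?t02 ?t03 ?t04 ?t05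
  ?t06 ?t07 /=
  !(scale0r, scale1r, scaleN1r, scaleNr, opprD, opprK, oppr0, addr0, add0r).
split; first by do !split => //; rewrite ?lbrxx ?t01 ?t12 ?(lbr_anti _ a1) ?t13 ?t14 ?t15 ?t16
  ?t17 /=
  !(scale0r, scale1r, scaleN1r, scaleNr, opprD, opprK, oppr0, addr0, add0r).
split; first by do !split => //; rewrite ?lbrxx ?t02 ?(lbr_anti _ a2) ?t12 ?t23 ?t24 ?t25 ?t26
  ?t27 /=
  !(scale0r, scale1r, scaleN1r, scaleNr, opprD, opprK, oppr0, addr0, add0r).
split; first by do !split => //; rewrite ?lbrxx ?t03 ?t13 ?t23 ?t34 ?t35 ?t36 ?t37  /=
  !(scale0r, scale1r, scaleN1r, scaleNr, opprD, opprK, oppr0, addr0, add0r).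
split; first by do !split => //; rewrite ?lbrxx ?t04 ?t14 ?t24 ?t45 ?t46 ?t47 ?(lbr_anti _ s11)
  ?t34 /=
  !(scale0r, scale1r, scaleN1r, scaleNr, opprD, opprK, oppr0, addr0, add0r).
split; first by do !split => //; rewrite ?lbrxx ?t05 ?t15 ?t25 ?t56 ?t57 ?(lbr_anti _ s12) ?t35
  ?t45 /=
  !(scale0r, scale1r, scaleN1r, scaleNr, opprD, opprK, oppr0, addr0, add0r).
split; first by do !split => //; rewrite ?lbrxx ?t06 ?t16 ?t26 ?t67 ?(lbr_anti _ s111) ?t36 ?t46
  ?t56 /=
  !(scale0r, scale1r, scaleN1r, scaleNr, opprD, opprK, oppr0, addr0, add0r).
split; first by do !split => //; rewrite ?lbrxx ?t07 ?t17 ?t27 ?(lbr_anti _ gn) ?t37 ?t47 ?t57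
  ?t67 /=
  !(scale0r, scale1r, scaleN1r, scaleNr, opprD, opprK, oppr0, addr0, add0r).
by [].
Qed.

(** * Complexified tables and iterated brackets with z and its conjugate *)

Local Notation C := R[i].
Local Notation ch := (cplx c).
Local Notation rc := (real_complex R).
Local Notation mc := (map (@cincl R c)).
Local Notation cinc := (@cincl R c).

Lemma cbr_0m (x a b d p q : C) :
  cbr (lc (mc W0) [:: x; a; b; d]) (lc (mc (Vm a1 a2)) [:: p; q]) =
  lc (mc (Vm a1 a2)) [:: - x * p - b * p + 2 * a * q; - x * q + b * q - 2 * d * p].
Proof.
apply: (@br_0m C ch (@cbr R c) (@cbrPl R c) (@cbrPr R c) (cinc a1) (cinc a2) (cinc E)
  (cinc s11) (cinc s12) (cinc s22)).
have := table_cplx table_0m; rewrite /T0m /= !(rmorphN, rmorph0, rmorph1, rmorph_nat).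
by [].
Qed.

Lemma cbr_1m (k0 k1 k2 k3 m l p q : C) :
  cbr (lc (mc W1) [:: k0; k1; k2; k3; m; l]) (lc (mc (Vm a1 a2)) [:: p; q]) =
  lc (mc W0) [:: inv2 C * (l * p - m * q); 3 * k0 * q - k1 * p + inv2 C * m * p;
    2 * k1 * q - 2 * k2 * p + inv2 C * (m * q + l * p); k2 * q - 3 * k3 * p + inv2 C * l * q].
Proof.
apply: (@br_1m C ch (@cbr R c) (@cbrPl R c) (@cbrPr R c) (cinc a1) (cinc a2) (cinc E)
  (cinc s11) (cinc s12) (cinc s22) (cinc s111) (cinc s112) (cinc s122) (cinc s222)
  (cinc (mu a1)) (cinc (mu a2))).
have := table_cplx table_1m.
rewrite /T1m /inv2 /= !(rmorphN, rmorph0, rmorph1, rmorph_nat, fmorphV).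
by [].
Qed.

Lemma cbr_00 (x a b d x' a' b' d' : C) :
  cbr (lc (mc W0) [:: x; a; b; d]) (lc (mc W0) [:: x'; a'; b'; d']) =
  lc (mc W0) [:: 0; 2 * (a * b' - a' * b); 4 * (a * d' - a' * d); 2 * (b * d' - b' * d)].
Proof.
apply: (@br_00 C ch (@cbr R c) (@cbrPl R c) (@cbrPr R c) (cinc E)
  (cinc s11) (cinc s12) (cinc s22)).
have := table_cplx table_00.
rewrite /T00 /= !(rmorphN, rmorph0, rmorph1, rmorph_nat).
by [].
Qed.

Lemma cbr_01 (x a b d k0 k1 k2 k3 m l : C) :
  cbr (lc (mc W0) [:: x; a; b; d]) (lc (mc W1) [:: k0; k1; k2; k3; m; l]) =
  lc (mc W1) [:: x * k0 + 2 * a * k1 - 3 * b * k0;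
    x * k1 + 4 * a * k2 - b * k1 - 6 * d * k0;
    x * k2 + 6 * a * k3 + b * k2 - 4 * d * k1;
    x * k3 + 3 * b * k3 - 2 * d * k2;
    x * m + 2 * a * l - b * m; x * l + b * l - 2 * d * m].
Proof.
apply: (@br_01 C ch (@cbr R c) (@cbrPl R c) (@cbrPr R c) (cinc E)
  (cinc s11) (cinc s12) (cinc s22) (cinc s111) (cinc s112) (cinc s122) (cinc s222)
  (cinc (mu a1)) (cinc (mu a2))).
have := table_cplx table_01.
rewrite /T01 /= !(rmorphN, rmorph0, rmorph1, rmorph_nat).
by [].
Qed.

Lemma cbr_mm (p q p' q' : C) :
  cbr (lc (mc (Vm a1 a2)) [:: p; q]) (lc (mc (Vm a1 a2)) [:: p'; q']) =
  (p * q' - p' * q) *: cinc (em2 c).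
Proof.
rewrite /= !addr0 cbrDl !cbrDr !cbrZl !cbrZr !cbr_cincl !lbrxx (lbr_anti a1 a2) (ad_br had).
rewrite cinclN -[cincl 0]/(0 : ch) !scaler0 addr0 add0r !scalerN !scalerA -scaleNr -scalerDl.
by congr (_ *: _); ring.
Qed.

Lemma cJ_lc : cinc J = lc (mc W0) [:: 0; inv2 C; 0; inv2 C].
Proof. by rewrite J_lc cincl_lc /= /inv2 !(rmorph0, rmorph_nat, fmorphV). Qed.

(* [zv 1 = 2 z] and [zv (-1) = 2 zbar]. *)
Definition zv (ep : C) : ch := lc (mc (Vm a1 a2)) [:: 1; ep * ci].

Lemma cbr_J_zv (ep : C) : ep * ep = 1 -> cbr (cinc J) (zv ep) = (ep * ci) *: zv ep.
Proof.
move=> e; rewrite cJ_lc /zv cbr_0m lcZ; congr lc; rewrite /= /inv2.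
have ii : ci * ci = -1 :> C by rewrite -expr2 sqr_i.
congr [:: _; _]; first by field.
by rewrite mulrACA e ii; field.
Qed.

Lemma zv_m (ep : C) : hat (gcomp c (-1)) (zv ep).
Proof. by rewrite /zv lc_cplx; split; exact: Wm_gcomp. Qed.

Lemma ci_sq1 (ep : C) : ep * ep = 1 -> (ep * ci) ^+ 2 + 1 = 0.
Proof.
move=> e; have ii : ci * ci = -1 :> C by rewrite -expr2 sqr_i.
by rewrite expr2 mulrACA e ii mul1r addNr.
Qed.

Lemma iter_zv_0 (ep x a b d : C) : ep * ep = 1 ->
  cbr (zv ep) (cbr (zv ep) (lc (mc W0) [:: x; a; b; d])) =
  (- 2 * (a - d + ep * ci * b)) *: cinc (em2 c).
Proof.
move=> e; rewrite (cbr_anti (lc _ _)) cbr_0m cbrNr /zv cbr_mm -scaleNr; congr (_ *: _).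
(* A multiple of [(ep i)^2 + 1 = 0] is added, after which the two sides agree as polynomials. *)
rewrite -[RHS]add0r -[X in _ = X + _](mul0r (2 * a)) -(ci_sq1 e); ring.
Qed.

Lemma iter_zv_1 (ep k0 k1 k2 k3 m l : C) : ep * ep = 1 ->
  cbr (zv ep) (cbr (zv ep) (cbr (zv ep) (lc (mc W1) [:: k0; k1; k2; k3; m; l]))) =
  (6 * (ep * ci * (k0 - k2) - k1 + k3)) *: cinc (em2 c).
Proof.
move=> e; rewrite (cbr_anti (lc _ _)) cbr_1m !cbrNr iter_zv_0 // -scaleNr; congr (_ *: _).
rewrite -[RHS]add0r -[X in _ = X + _](mul0r (4 * k1 + 2 * inv2 C * m)) -(ci_sq1 e); ring.
Qed.

Lemma gcomp_hatP p : [/\ hat (gcomp c p) (0 : ch),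
  forall (k : C) X Y, hat (gcomp c p) X -> hat (gcomp c p) Y -> hat (gcomp c p) (k *: X + Y) &
  forall q X Y, hat (gcomp c p) X -> hat (gcomp c q) Y -> hat (gcomp c (p + q)) (cbr X Y)].
Proof.
have N r x : gcomp c r x -> gcomp c r (- x) := @gcompN r x.
split.
- by split; exact: gcomp0.
- move=> k X Y [x1 x2] [y1 y2]; split; apply: gcompD => //; apply: gcompD;
    do ?apply: N; exact: gcompZ.
- move=> q X Y [x1 x2] [y1 y2]; split; apply: gcompD; do ?apply: N; exact: gcomp_br.
Qed.

(** [zv ep] has degree -1 and eigenvalue [ep i]; degrees and eigenvalues add under brackets. *)
Lemma adeigen_iter (ep m : C) (p : int) n X : ep * ep = 1 -> adeigen J p m X ->
  adeigen J (p - n%:Z) (m + ep * ci * n%:R) (iter n (cbr (zv ep)) X).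
Proof.
move=> e; elim: n => [|n IH] hX; first by rewrite subr0 mulr0 addr0.
have [h3 h4] := IH hX; split=> /=.
  rewrite (_ : p - n.+1%:Z = -1 + (p - n%:Z)); last by rewrite intS; ring.
  by have [_ _] := gcomp_hatP (-1); apply => //; exact: zv_m.
rewrite cbr_jacobi cbr_J_zv // h4 cbrZl cbrZr -scalerDl; congr (_ *: _).
by rewrite -addn1 natrD; ring.
Qed.

Lemma cJ_em2 X : hat (gcomp c (-2)) X -> cbr (cinc J) X = 0.
Proof.
have [[_ hJ0] _ _] := hJ; case=> [/hJ0 e3 /hJ0 e4].
by congr pair; rewrite /= lbr0l ?e3 ?e4 ?subr0 ?addr0.
Qed.

Lemma iter_zv_other (ep : C) (p : int) n X : ep * ep = 1 -> p = n%:Z - 2 ->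
  adeigen_other J p (- (ep * ci * n%:R)) X -> iter n (cbr (zv ep)) X = 0.
Proof.
move=> e -> hX.
have iter0 k : iter k (cbr (zv ep)) 0 = 0 by elim: k => //= k ->; rewrite cbr0r.
have iterD k j (Y Z : ch) : iter k (cbr (zv ep)) (j *: Y + Z) =
    j *: iter k (cbr (zv ep)) Y + iter k (cbr (zv ep)) Z.
  by elim: k => //= k ->; rewrite cbrPr.
move: X hX; apply: lspan_ind => [|k Y Z|Y [m mn hY]].
- exact: iter0.
- by move=> /= Y0 Z0; rewrite iterD Y0 Z0 scaler0 addr0.
- have [h3 h4] := adeigen_iter n e hY; move: h4; rewrite /= cJ_em2 //; last first.
    by move: h3; rewrite addrAC subrr add0r.
  move/esym/eqP; rewrite scaler_eq0 => /orP [|/eqP //].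
  by rewrite addr_eq0 => /eqP /mn.
Qed.

Lemma cem2_eq0 (k : C) : k *: cinc (em2 c) = 0 -> k = 0.
Proof.
move=> /eqP; rewrite scaler_eq0 => /orP [/eqP //|/eqP /(congr1 fst) /= e0].
by move: em2_neq0; rewrite e0 eqxx.
Qed.

Lemma iter_up (p : int) n X : p = n%:Z - 2 -> up J p X -> iter n (cbr (zv 1)) X = 0.
Proof.
move=> pn uX; apply: (iter_zv_other (mulr1 _) pn); move: uX.
by rewrite /up mul1r pn subrK.
Qed.

Lemma iter_low (p : int) n X : p = n%:Z - 2 ->
  adeigen_other J p (ci * (p + 2)%:~R) X -> iter n (cbr (zv (-1))) X = 0.
Proof.
move=> pn oX; apply: (iter_zv_other _ pn); first by rewrite mulrNN mulr1.
by move: oX; rewrite pn subrK mulN1r mulNr opprK.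
Qed.

(** The vector is [(a_1 + i a_2)^2], that is [4 z^2] in the basis e_1, e_2. *)
Lemma zsq_M10 : M10 J 0 (lc (mc W0) [:: 0; 1; 2 * ci; -1]).
Proof.
split; first by rewrite lc_cplx; split; exact: W0_gcomp.
have ii : ci * ci = -1 :> C by rewrite -expr2 sqr_i.
change (cbr (cinc J) (lc (mc W0) [:: 0; 1; 2 * ci; -1]) = (ci * (0 + 2)%:~R) *: lc (mc W0) [:: 0;
  1; 2 * ci; -1]).
rewrite cJ_lc cbr_00 lcZ; congr lc.
rewrite /inv2 /= add0r.
by congr [:: _; _; _; _]; rewrite ?mulr0 //; field: ii.
Qed.

(** Likewise [(a_1 + i a_2)^3], that is [8 z^3]. *)
Lemma zcu_M10 : M10 J 1 (lc (mc W1) [:: 1; 3 * ci; - 3; - ci; 0; 0]).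
Proof.
split; first by rewrite lc_cplx; split; exact: W1_gcomp.
have ii : ci * ci = -1 :> C by rewrite -expr2 sqr_i.
change (cbr (cinc J) (lc (mc W1) [:: 1; 3 * ci; - 3; - ci; 0; 0]) =
  (ci * (1 + 2)%:~R) *: lc (mc W1) [:: 1; 3 * ci; - 3; - ci; 0; 0]).
rewrite cJ_lc cbr_01 lcZ; congr lc.
rewrite /inv2 /= (_ : (1 + 2)%:~R = 3 :> C) //.
by congr [:: _; _; _; _; _; _]; rewrite ?mulr0 //; field: ii.
Qed.

(** * Models *)

Section Models.
Variable g : set c.
Hypothesis hg : model J E (core_m J) g.

Lemma model_comb (k l : R) x y : g x -> g y -> g (k *: x + l *: y).
Proof.
move=> gx gy; have [[g0 gD] _ _] := model_sub hg.
by apply: (gD) => //; rewrite -[_ *: _]addr0; exact: (gD).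
Qed.

Lemma model_scale (k : R) x : g x -> g (k *: x).
Proof. by move=> gx; have := model_comb k 0 gx gx; rewrite scale0r addr0. Qed.

Lemma model_hasE : g E. Proof. by case: (model_E hg). Qed.

Lemma model_lbr x y : g x -> g y -> g (lbr x y).
Proof. by have [_ H _] := model_sub hg; exact: H. Qed.

(** By (iv), [(a_1 + i a_2)^2] is the projection of some X of the model in u^0. The two annihilation
    conditions read [a - d + i b = 0] and [a - d - i b = 4], so [a - d = 2] and [b = 2i]; the two
    elements are the real and imaginary parts of X. *)
Lemma model_deg0 : exists a a' : R,
  g (lc W0 [:: 0; a; 0; a - 2]) /\ g (lc W0 [:: 0; a'; 2; a']).
Proof.
have pr : projM10 J 0 (hat (gpart g 0) `&` up J 0) (lc (mc W0) [:: 0; 1; 2 * ci; -1]).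
  by rewrite (model_proj hg) // /core_m /=; exact: zsq_M10.
have [_ [X [[[gX1 hX1] [gX2 hX2]] uX] oX]] := pr.
have [x1 [a1' [b1 [d1 e1']]]] := gcomp0_lc hX1.
have [x2 [a2' [b2 [d2 e2']]]] := gcomp0_lc hX2.
have XE : X = lc (mc W0) (czip [:: x1; a1'; b1; d1] [:: x2; a2'; b2; d2]).
  by rewrite -lc_pair // -e1' -e2'; case: (X).
have := iter_up (n := 2) erefl uX; rewrite XE [iter _ _ _]/= iter_zv_0 ?mulr1 // => /cem2_eq0.
have := iter_low (n := 2) erefl oX; rewrite XE lcN lcD // [iter _ _ _]/= iter_zv_0 ?mulrNN ?mulr1
  // => /cem2_eq0.
move=> /eqP; rewrite eq_complex => /andP [/eqP E1 /eqP E2].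
move=> /eqP; rewrite eq_complex => /andP [/eqP E3 /eqP E4].
rewrite /= in E1 E2 E3 E4.
(* E lies in the model by (ii), so its coefficient can be removed. *)
have noE x a b d : g (lc W0 [:: x; a; b; d]) -> g (lc W0 [:: 0; a; b; d]).
  move=> gX; have := model_comb 1 (- x) gX model_hasE; congr g.
  have [-> _ _ _] := W0E.
  by rewrite !lcZ lcD //; congr lc; congr [:: _; _; _; _]; ring.
exists a1', a2'; split.
  move: gX1; rewrite e1' => /noE; congr g. congr lc.
  by congr [:: _; _; _; _]; lra.
move: gX2; rewrite e2' => /noE; congr g; congr lc.
by congr [:: _; _; _; _]; lra.
Qed.

Lemma model_deg1 : exists k0 k1 m l k0' k1' k2' m' l' : R,
  g (lc W1 [:: k0; k1; k0 - 4; k1; m; l]) /\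
  g (lc W1 [:: k2'; k1'; k2'; k1' - 4; m'; l']).
Proof.
have pr : projM10 J 1 (hat (gpart g 1) `&` up J 1)
    (lc (mc W1) [:: 1; 3 * ci; - 3; - ci; 0; 0]).
  by rewrite (model_proj hg) // /core_m /=; exact: zcu_M10.
have [_ [X [[[gX1 hX1] [gX2 hX2]] uX] oX]] := pr.
have [k0 [k1 [k2 [k3 [m [l e1']]]]]] := gcomp1_lc hX1.
have [l0 [l1 [l2 [l3 [m' [l' e2']]]]]] := gcomp1_lc hX2.
have XE : X = lc (mc W1) (czip [:: k0; k1; k2; k3; m; l] [:: l0; l1; l2; l3; m'; l']).
  by rewrite -lc_pair // -e1' -e2'; case: (X).
have := iter_up (n := 3) erefl uX; rewrite XE [iter _ _ _]/= iter_zv_1 ?mulr1 // => /cem2_eq0.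
have := iter_low (n := 3) erefl oX; rewrite XE lcN lcD // [iter _ _ _]/= iter_zv_1 ?mulrNN ?mulr1
  // => /cem2_eq0.
move=> /eqP; rewrite eq_complex => /andP [/eqP E1 /eqP E2].
move=> /eqP; rewrite eq_complex => /andP [/eqP E3 /eqP E4].
rewrite /= in E1 E2 E3 E4.
exists k0, k1, m, l, l0, l1, l2, m', l'; split.
  by move: gX1; rewrite e1'; congr g; congr lc; congr [:: _; _; _; _; _; _]; lra.
by move: gX2; rewrite e2'; congr g; congr lc; congr [:: _; _; _; _; _; _]; lra.
Qed.

Lemma adeigen_comb p m (k : C) X Y : adeigen J p m X -> adeigen J p m Y ->
  adeigen J p m (k *: X + Y).
Proof.
have [_ HD _] := gcomp_hatP p; move=> [hX eX] [hY eY]; split; first exact: HD.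
change (cbr (cinc J) (k *: X + Y) = m *: (k *: X + Y)).
by rewrite cbrPr eX eY scalerDr !scalerA mulrC.
Qed.

Lemma adeigen0 p m : adeigen J p m 0.
Proof.
have [H0 _ _] := gcomp_hatP p; split=> //.
by change (cbr (cinc J) 0 = m *: 0); rewrite cbr0r scaler0.
Qed.

(** Each generating eigenvector goes either to the eigenspace of [l'] or to the sum of the others.
    This extracts the M^p(10) component that (iv) speaks of. *)
Lemma adeigen_other_split p l l' (X : ch) : adeigen_other J p l X ->
  exists2 Y, adeigen J p l' Y & adeigen_other J p l' (X - Y).
Proof.
have [z0 zD zS] := lspanP (\bigcup_(m in [set m | m <> l']) adeigen J p m).
move: X; apply: lspan_ind.
- by exists 0; [exact: adeigen0 | rewrite subrr].
- move=> k X Y [X' eX oX] [Y' eY oY]; exists (k *: X' + Y'); first exact: adeigen_comb.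
  by rewrite opprD addrACA -scalerBr; exact: zD.
- move=> X [m _ eX]; have [ml|/eqP mn] := eqVneq m l'.
    by exists X; [rewrite -ml | rewrite subrr].
  by exists 0; [exact: adeigen0 | rewrite subr0; apply: zS; exists m].
Qed.

Lemma cconj_cbr (X Y : ch) : cconj (cbr X Y) = cbr (cconj X) (cconj Y).
Proof.
by congr pair; rewrite /= ?lbrNlr ?lbrNrr ?lbrNlr ?opprK ?opprD.
Qed.

Lemma cconj_zv : cconj (zv 1) = zv (-1).
Proof.
rewrite /zv !lc_cplx /cconj; congr pair => /=.
  by congr (_ + (_ *: _ + _)); ring.
by rewrite !scale0r !add0r !addr0 -scaleNr; congr (_ *: _); ring.
Qed.

Lemma cconjK (X : ch) : cconj (cconj X) = X.
Proof. by case: X => x y; rewrite /cconj /= opprK. Qed.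

(** The core is zero in degree 2, so an element of the model in u^2 has no component in either
    extreme eigenspace. The same holds for the conjugates, and (iii) makes W a sum of the two
    kinds. *)
Lemma model_deg2_iter W : g W -> gcomp c 2 W -> iter 4 (cbr (zv 1)) (cinc W) = 0.
Proof.
move=> gW hW; have [[g0 gD] _ _] := model_sub hg.
have gN (x : c) : g x -> g (- x) by move=> gx; rewrite -scaleN1r; exact: model_scale.
have key (X : ch) : hat (gpart g 2) X -> up J 2 X ->
    iter 4 (cbr (zv 1)) X = 0 /\ iter 4 (cbr (zv (-1))) X = 0.
  move=> gX uX; split; first exact: iter_up uX.
  apply: (iter_low (p := 2)) => //.
  have [Y eY oY] := adeigen_other_split (ci * (2 + 2)%:~R) uX.
  have : projM10 J 2 (hat (gpart g 2) `&` up J 2) Y by split=> //; exists X.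
  by rewrite (model_proj hg) // /core_m /= => Y0; move: oY; rewrite Y0 subr0.
have : hat (gpart g 2) (cinc W) by split; split=> //; exact: gcomp0.
rewrite (model_sum hg) // => -[X [gX uX] [Y [gY [Z uZ ZY]] <-]].
have gZ : hat (gpart g 2) Z.
  rewrite -(cconjK Z) ZY; case: (gY) => [[gy1 hy1] [gy2 hy2]]; split; split => //=.
    exact: gN.
  exact: gcompN.
have iterD n X' Y' : iter n (cbr (zv 1)) (X' + Y') = iter n (cbr (zv 1)) X' + iter n (cbr (zv 1))
  Y'.
  by elim: n => //= n ->; rewrite cbrDr.
rewrite iterD (key _ gX uX).1 add0r -ZY.
have : cconj (iter 4 (cbr (zv (-1))) Z) = 0 by rewrite (key _ gZ uZ).2 /cconj oppr0.
by rewrite -cconj_zv /= !cconj_cbr !cconjK.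
Qed.

(** The first bracket with [a1 + i a2] leads to degree 1, where coordinates exist; the real and
    imaginary parts of [iter_zv_1] are the two equations. *)
Lemma model_deg2 W k0 k1 k2 k3 m l k0' k1' k2' k3' m' l' : g W -> gcomp c 2 W ->
  lbr W a1 = lc W1 [:: k0; k1; k2; k3; m; l] ->
  lbr W a2 = lc W1 [:: k0'; k1'; k2'; k3'; m'; l'] ->
  k0' + k1 - k2' - k3 = 0 /\ k0 - k1' - k2 + k3' = 0.
Proof.
move=> gW hW e1 e2; have := model_deg2_iter gW hW.
have -> : iter 4 (cbr (zv 1)) (cinc W) = iter 3 (cbr (zv 1)) (cbr (zv 1) (cinc W)) by [].
have -> : cbr (zv 1) (cinc W) =
    - lc (mc W1) (czip [:: k0; k1; k2; k3; m; l] [:: k0'; k1'; k2'; k3'; m'; l']).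
  rewrite -lc_pair // -e1 -e2 (cbr_anti _ (zv 1)); congr (- _).
  rewrite (_ : zv 1 = (a1, a2)) /cbr /cext2 /= ?lbr0l ?subr0 ?addr0 //.
  rewrite /zv lc_cplx; congr pair; rewrite /= ?scale0r ?addr0 ?add0r ?scale1r.
    by rewrite (_ : _ - _ = 0) ?scale0r ?addr0 ?scale1r //; ring.
  by rewrite (_ : _ + _ = 1) ?scale1r //; ring.
rewrite -[- lc _ _]scaleN1r [iter _ _ _]/= !cbrZr iter_zv_1 ?mulr1 // scalerA => /cem2_eq0.
move=> /eqP; rewrite eq_complex => /andP [/eqP E1 /eqP E2].
by rewrite /= in E1 E2; split; lra.
Qed.

Lemma lc_1_zero : lc W1 [:: 0; 0; 0; 0; 0; 0] = 0.
Proof. exact: (lc_nseq0 W1 6). Qed.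

Lemma model_subscale (k : R) x y : g x -> g y -> g (x + - k *: y).
Proof. by move=> gx gy; rewrite -[x]scale1r; exact: model_comb. Qed.

Lemma model_unscale (k : R) x : k != 0 -> g (k *: x) -> g x.
Proof. by move=> k0 /(model_scale k^-1); rewrite scalerA mulVf // scale1r. Qed.

Lemma model_negative : [/\ g a1, g a2 & g (em2 c)].
Proof.
by split; [have /seteqP [_ /(_ a1)] := model_neg hg (p := -1) isT
  | have /seteqP [_ /(_ a2)] := model_neg hg (p := -1) isT
  | have /seteqP [_ /(_ (em2 c))] := model_neg hg (p := -2) isT] => H; apply: (H _).1 => //;
  exact: em2_gcomp.
Qed.

(** The bracket of the two elements sends [a1] to 0 and [a2] to [(12 b + 2 k) a_1^3]; the equation
    in degree 2 makes this coefficient vanish. This is the origin of the coefficient -6 in [gn]. *)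
Lemma degree2_obstruction b k : g s111 -> g (lc W1 [:: 0; b; 0; 0; k; 0]) -> 6 * b + k = 0.
Proof.
rewrite s111E => gA gB.
have W_br_10 ks x a b' d : lbr (lc W1 ks) (lc W0 [:: x; a; b'; d]) =
  - lbr (lc W0 [:: x; a; b'; d]) (lc W1 ks) by exact: lbr_anti.
have gW := model_lbr gA gB.
have hW : gcomp c 2 (lbr (lc W1 [:: 1; 0; 0; 0; 0; 0]) (lc W1 [:: 0; b; 0; 0; k; 0])).
  exact: (gcomp_br (W1_gcomp _) (W1_gcomp _)).
have e1 : lbr (lbr (lc W1 [:: 1; 0; 0; 0; 0; 0]) (lc W1 [:: 0; b; 0; 0; k; 0])) a1 =
    lc W1 [:: 0; 0; 0; 0; 0; 0].
  rewrite [X in lbr _ X]a1E lbr_jacobi !W_br_1m !W_br_10 !W_br_01 !lcN lcD //; congr lc.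
  by congr [:: _; _; _; _; _; _]; rewrite /inv2 /=; field.
have e2 : lbr (lbr (lc W1 [:: 1; 0; 0; 0; 0; 0]) (lc W1 [:: 0; b; 0; 0; k; 0])) a2 =
    lc W1 [:: 12 * b + 2 * k; 0; 0; 0; 0; 0].
  rewrite [X in lbr _ X]a2E lbr_jacobi !W_br_1m !W_br_10 !W_br_01 !lcN lcD //; congr lc.
  by congr [:: _; _; _; _; _; _]; rewrite /inv2 /=; field.
by have [H _] := model_deg2 gW hW e1 e2; lra.
Qed.

Lemma J_notin : g (lc W0 [:: 0; 1; 0; 1]) -> False.
Proof.
move=> gJ; have [a [a' [r1 r2]]] := model_deg0.
have g22 : g s22.
  apply: (@model_unscale (- 2)); first by rewrite oppr_eq0 pnatr_eq0.
  have := model_subscale a r1 gJ; rewrite s22E !lcZ lcD //; congr g; congr lc.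
  by congr [:: _; _; _; _]; ring.
have g11 : g s11.
  have := model_subscale 1 gJ g22; rewrite s11E s22E !lcZ lcD //; congr g; congr lc.
  by congr [:: _; _; _; _]; ring.
have g12 : g s12.
  apply: (@model_unscale 2); first by rewrite pnatr_eq0.
  have := model_subscale a' r2 gJ; rewrite s12E !lcZ lcD //; congr g; congr lc.
  by congr [:: _; _; _; _]; ring.
have g111 : g s111.
  have [k0 [k1 [m [l [_ [_ [_ [_ [_ [gX _]]]]]]]]]] := model_deg1.
  (* ad(a_1^2) is nilpotent: its cube gives [48 k1 a_1^3], and its square [8 (k0 - 4) a_1^3] if
     [k1 = 0]. In the remaining case [k1 = 0], [k0 = 4], the square of ad(a_1 a_2) acts by 9 on
     a_1^3 and by 1 on the two [mu] terms, so subtracting X isolates [32 a_1^3]. *)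
  have gY := model_lbr g11 gX; have gZ := model_lbr g11 gY; have gT := model_lbr g11 gZ.
  have gU := model_lbr g12 (model_lbr g12 gX).
  have [k10|k1n0] := eqVneq k1 0; last first.
    apply: (@model_unscale (48 * k1)); first by rewrite mulf_neq0 ?pnatr_eq0.
    move: gT; rewrite s11E !W_br_01 s111E lcZ; congr g; congr lc.
    by congr [:: _; _; _; _; _; _]; rewrite /=; ring.
  have [k20|k2n0] := eqVneq k0 4.
    apply: (@model_unscale 32); first by rewrite pnatr_eq0.
    have := model_subscale 1 gU gX; rewrite s12E !W_br_01 s111E !lcZ lcD //; congr g; congr lc.
    by congr [:: _; _; _; _; _; _]; rewrite ?k10 ?k20; ring.
  apply: (@model_unscale (8 * (k0 - 4))); first by rewrite mulf_neq0 ?pnatr_eq0 // subr_eq0.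
  move: gZ; rewrite s11E !W_br_01 s111E lcZ; congr g; congr lc.
  by congr [:: _; _; _; _; _; _]; rewrite ?k10 /=; ring.
have g112 : g (lc W1 [:: 0; - 6; 0; 0; 0; 0]).
  have := model_lbr g22 g111; rewrite s111E s22E W_br_01; congr g; congr lc.
  by congr [:: _; _; _; _; _; _]; ring.
by have := degree2_obstruction g111 g112 => ?; lra.
Qed.

(* If [u^2 + v^2 <> 1] then the bracket of the two elements gives [J] modulo them. *)
Lemma model_circle : exists u v : R, [/\ u * u + v * v = 1,
  g (lc W0 [:: 0; 1 + u; 0; u - 1]) & g (lc W0 [:: 0; v; 2; v])].
Proof.
have [a [v [r1 r2]]] := model_deg0.
have gP := model_subscale (4 * (a - 1)) (model_subscale (4 * v) (model_lbr r1 r2) r2) r1.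
exists (a - 1), v; split => //; last first.
  by move: r1; congr g; congr lc; congr [:: _; _; _; _]; ring.
apply/eqP; rewrite -subr_eq0 -oppr_eq0; apply/negPn/negP => n0; apply: J_notin.
apply: (model_unscale (k := 4 * - ((a - 1) * (a - 1) + v * v - 1))).
  by rewrite mulf_neq0 ?pnatr_eq0.
move: gP; rewrite W_br_00 !lcZ !lcD //; congr g; congr lc.
by congr [:: _; _; _; _]; rewrite /=; ring.
Qed.

Section Normalised.
Hypotheses (g11 : g s11) (g12 : g s12).

Lemma normalised_deg0 x a b d : g (lc W0 [:: x; a; b; d]) -> d = 0.
Proof.
move=> gX; apply/eqP/negPn/negP => d0; apply: J_notin.
apply: (model_unscale d0).
have := model_comb 1 1 (model_comb 1 (- x) gX model_hasE) (model_comb (d - a) (- b) g11 g12).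
have [-> _ _ _] := W0E.
rewrite s11E s12E !(lcZ, lcD) //; congr g; congr lc.
by congr [:: _; _; _; _]; rewrite /=; ring.
Qed.

(** The brackets with [a1], [a2] have no [a_2^2] term, so [k3 = 0] and [l = - 2 k2]. A nonzero [k2]
    would bring [a_1^3] and [4 a_1^2 a_2 - 4 mu a_1] into the model, against
    [degree2_obstruction]. *)
Lemma normalised_deg1_tail k0 k1 k2 k3 m l : g (lc W1 [:: k0; k1; k2; k3; m; l]) ->
  [/\ k2 = 0, k3 = 0 & l = 0].
Proof.
have [ga1 ga2 _] := model_negative => gX.
have := model_lbr gX ga1; rewrite a1E W_br_1m => /normalised_deg0 E1.
have := model_lbr gX ga2; rewrite a2E W_br_1m => /normalised_deg0 E2.
have k30 : k3 = 0 by lra.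
have l2 : l = - 2 * k2 by rewrite /inv2 in E2; lra.
suff k20 : k2 = 0 by split=> //; lra.
apply/eqP/negPn/negP => k2n0.
have gw : g (lc W1 [:: 0; 0; 1; 0; 0; - 2]).
  apply: (@model_unscale (8 * k2)); first by rewrite mulf_neq0 ?pnatr_eq0.
  (* [(ad + 1)(ad + 3)] for ad(a_1 a_2) kills the eigenvalues -1 and -3 and is 8 on the eigenvalue
     1, that of [a_1 a_2^2] and [mu a_2]. *)
  have := model_comb 1 1 (model_comb 1 4 (model_lbr g12 (model_lbr g12 gX)) (model_lbr g12 gX))
    (model_scale 3 gX).
  rewrite s12E !W_br_01 !(lcZ, lcD) //; congr g; congr lc.
  by congr [:: _; _; _; _; _; _]; rewrite /= ?k30 ?l2; ring.
have gv := model_lbr g11 gw; have gs := model_lbr g11 gv.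
have gv' : g (lc W1 [:: 0; 4; 0; 0; - 4; 0]).
  move: gv; rewrite s11E W_br_01; congr g; congr lc.
  by congr [:: _; _; _; _; _; _]; ring.
have g111 : g s111.
  apply: (@model_unscale 8); first by rewrite pnatr_eq0.
  move: gs; rewrite s11E s111E !W_br_01 lcZ; congr g; congr lc.
  by congr [:: _; _; _; _; _; _]; rewrite /=; ring.
by have := degree2_obstruction g111 gv' => ?; lra.
Qed.

Lemma normalised_s111_gn : g s111 /\ g gn.
Proof.
have [k0 [k1 [m [l [k0' [k1' [k2' [m' [l' [gX gY]]]]]]]]]] := model_deg1.
have [e2 e3 e5] := normalised_deg1_tail gX; have [f2 f3 f5] := normalised_deg1_tail gY.
have g111 : g s111.
  apply: (@model_unscale (- 8)); first by rewrite oppr_eq0 pnatr_eq0.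
  (* X is [4 a_1^3 + m mu a_1]; ad(a_1 a_2) + 1 kills the second term and is -2 on the first. *)
  have := model_comb 1 1 (model_lbr g12 gX) gX; rewrite s12E s111E W_br_01 !(lcZ, lcD) //.
  congr g; congr lc.
  have k04 : k0 = 4 by lra.
  by congr [:: _; _; _; _; _; _]; rewrite /= ?e3 ?k04 ?e5; ring.
split=> //.
have gY' : g (lc W1 [:: 0; 4; 0; 0; m'; 0]).
  by move: gY; congr g; congr lc; congr [:: _; _; _; _; _; _]; lra.
have := degree2_obstruction g111 gY' => em; apply: (@model_unscale 4); first by rewrite pnatr_eq0.
move: gY'; rewrite /gn lcZ; congr g; congr lc.
by congr [:: _; _; _; _; _; _]; rewrite /=; lra.
Qed.

Lemma normalised_deg1 X : g X -> gcomp c 1 X -> exists p q : R, X = lc [:: s111; gn] [:: p; q].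
Proof.
move=> gX /gcomp1_lc [k0 [k1 [k2 [k3 [m [l e]]]]]].
move: gX; rewrite e => gX; have [-> -> ->] := normalised_deg1_tail gX.
move: (gX); have [-> -> ->] := normalised_deg1_tail gX => gX'.
have [g111 gg] := normalised_s111_gn.
have gZ : g (lc W1 [:: 0; k1; 0; 0; m; 0]).
  have := model_subscale k0 gX' g111; rewrite s111E !(lcZ, lcD) //; congr g; congr lc.
  by congr [:: _; _; _; _; _; _]; rewrite /=; ring.
have em : m = - 6 * k1 by have := degree2_obstruction g111 gZ => ?; lra.
exists k0, k1; rewrite [RHS]/= addr0 s111E /gn em !(lcZ, lcD) //; congr lc.
by congr [:: _; _; _; _; _; _]; rewrite /=; ring.
Qed.

(** The equation in degree 2 gives [p' = - q] and [p = q']. Writing e^-2 as [[a1, a2]], the Jacobi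
    identity and [[a_i, e^-2] = 0] give [q = 0] and [3 p + 7 q' = 0], so both brackets vanish. *)
Lemma normalised_deg2 X : g X -> gcomp c 2 X -> X = 0.
Proof.
move=> gX hX; have [ga1 ga2 _] := model_negative.
have [p [q e1]] := normalised_deg1 (model_lbr gX ga1) (gcomp_br hX h1).
have [p' [q' e2]] := normalised_deg1 (model_lbr gX ga2) (gcomp_br hX h2).
have lc2 r s : lc [:: s111; gn] [:: r; s] = lc W1 [:: r; s; 0; 0; - 6 * s; 0].
  rewrite [LHS]/= addr0 s111E /gn !(lcZ, lcD) //; congr lc.
  by congr [:: _; _; _; _; _; _]; rewrite /=; ring.
rewrite !lc2 in e1 e2.
have [F1 F2] := model_deg2 gX hX e1 e2.
have eZ : lbr X (em2 c) = lc W0 [:: 3 * q; 3 * p + 4 * q'; - q; 0].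
  have : lbr X (lbr a1 a2) = lbr (lbr X a1) a2 + lbr a1 (lbr X a2).
    by rewrite (lbr_jacobi X) subrK.
  rewrite (ad_br had) => ->; rewrite (lbr_anti (lbr X a2)) e1 e2.
  rewrite [X in lbr _ X + _]a2E [X in _ - lbr _ X]a1E !W_br_1m lcN lcD //; congr lc.
  by congr [:: _; _; _; _]; rewrite /inv2 /=; field.
have em v : cm v -> lbr (lbr X (em2 c)) v = lbr (lbr X v) (em2 c).
  move=> hv; rewrite lbr_jacobi (lbr_anti v) (W_br_mem2 hv) oppr0 lbr0r sub0r.
  by rewrite lbr_anti opprK.
have := em _ h1; rewrite e1 eZ W_br_1em2 [X in lbr _ X]a1E W_br_0m => /lc_m_inj [E1 _].
have := em _ h2; rewrite e2 eZ W_br_1em2 [X in lbr _ X]a2E W_br_0m => /lc_m_inj [E2 _].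
have z0 : p = 0 /\ q = 0 by split; lra.
have z1 : p' = 0 /\ q' = 0 by split; lra.
apply: (trans_p (p := 2)) => //; first exact: gcomp0.
  by rewrite e1 z0.1 z0.2 mulr0 lc_1_zero lbr0l.
by rewrite e2 z1.1 z1.2 mulr0 lc_1_zero lbr0l.
Qed.

Lemma normalised_high n X : g X -> gcomp c (n%:Z + 2) X -> X = 0.
Proof.
have [ga1 ga2 _] := model_negative; elim: n X => [|n IH] X gX hX; first exact: normalised_deg2.
have e : n.+1%:Z + 2 + -1 = n%:Z + 2 by rewrite intS; ring.
apply: (trans_p (p := n.+1%:Z + 2)) => //; first exact: gcomp0.
  by rewrite lbr0l; apply: IH; [exact: model_lbr | rewrite -e; exact: gcomp_br].
by rewrite lbr0l; apply: IH; [exact: model_lbr | rewrite -e; exact: gcomp_br].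
Qed.

Lemma normalised_eq : g = [set x | exists ks, size ks = 8 /\ x = lc G8 ks].
Proof.
have [_ _ gs] := model_sub hg; have [ga1 ga2 gt] := model_negative; have [g111 gg] :=
  normalised_s111_gn.
apply/seteqP; split=> [x|_ [ks [_ ->]]]; last first.
  suff H vs ls : (forall v, v \in vs -> g v) -> g (lc vs ls).
    apply: H => v; rewrite !inE => /or4P [/eqP ->|/eqP ->|/eqP ->|/or4P [/eqP ->|/eqP ->|/eqP
      ->|]] //.
      exact: model_hasE.
    by move=> /orP [] /eqP ->.
  elim: vs ls => [|v vs IH] [|l ls] H /=; try by have [[]] := model_sub hg.
  rewrite -[lc vs ls]scale1r; apply: model_comb; first by apply: H; rewrite mem_head.
  by apply: IH => w ws; apply: H; rewrite inE ws orbT.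
rewrite gs; move: x; apply: lspan_ind.
- by exists (nseq 8 0); rewrite lc_nseq0.
- move=> k _ _ [ks [sk ->]] [ls [sl ->]]; exists (ladd [seq k * z | z <- ks] ls).
  by rewrite size_ladd ?size_map ?sk // lcZ lcD // size_map sk.
move=> x [p _ [gx hx]].
have [p2|p2] := ltrP p (- 2).
  by exists (nseq 8 0); rewrite lc_nseq0 (gcomp_low p2 hx).
have pn : p = (absz (p + 2))%:Z - 2 by rewrite gez0_abs ?addrK // -lerBlDr sub0r.
move: pn hx; case: (absz (p + 2)) => [|[|[|[|n]]]] ->.
- move=> /gcomp_em2 [k ->]; exists [:: k; 0; 0; 0; 0; 0; 0; 0]; split=> //.
  by rewrite /= !scale0r !addr0.
- move=> /gcompm_lc [q [r ->]]; exists [:: 0; q; r; 0; 0; 0; 0; 0]; split=> //.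
  by rewrite /= !scale0r !addr0 add0r.
- move=> /gcomp0_lc [q [r [s [u e]]]]; exists [:: 0; 0; 0; q; r; s; 0; 0]; split=> //.
  have u0 : u = 0 by apply: (@normalised_deg0 q r s); rewrite -e.
  by rewrite e u0 /= !scale0r !addr0 !add0r.
- move=> /(normalised_deg1 gx) [q [r ->]]; exists [:: 0; 0; 0; 0; 0; 0; q; r]; split=> //.
  by rewrite /= !scale0r !addr0 !add0r.
- rewrite (_ : n.+4%:Z - 2 = n.+2%:Z); last by rewrite -[n.+4]addn2 PoszD addrK.
  rewrite -[n.+2]addn2 PoszD => /(normalised_high gx) ->.
  by exists (nseq 8 0); rewrite lc_nseq0.
Qed.

End Normalised.
End Models.

(** * The normal form is a model *)

Lemma adeigen_indep (p : int) (l : C) (Y : ch) : adeigen J p l Y -> adeigen_other J p l Y -> Y = 0.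
Proof.
move=> [_ eY] oY; apply: (@eig_indep C ch (cbr (cinc J)) l); [by move=> *; exact: cbrPr | exact:
  eY |].
have [z0 zD zS] := lspanP [set x : ch | exists2 m, m <> l & cbr (cinc J) x = m *: x].
move: Y oY {eY}; apply: lspan_ind => // X [m mn [_ eX]].
by apply: zS; exists m.
Qed.

(** The component of degree [p]; the shift by 2 makes the lowest degree -2 the natural number 0. *)
Definition G8f (ks : seq R) (p : int) : c :=
  match p + 2 with
  | Posz 0 => ks`_0 *: em2 c
  | Posz 1 => lc (Vm a1 a2) [:: ks`_1; ks`_2]
  | Posz 2 => lc W0 [:: ks`_3; ks`_4; ks`_5; 0]
  | Posz 3 => lc W1 [:: ks`_6; ks`_7; 0; 0; - 6 * ks`_7; 0]
  | _ => 0
  end.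

Lemma G8f_gcomp ks p : gcomp c p (G8f ks p).
Proof.
rewrite /G8f; case ep : (p + 2) => [[|[|[|[|n]]]]|n]; try exact: gcomp0.
- by rewrite (_ : p = -2); [apply: gcompZ; exact: em2_gcomp | rewrite -[p](addrK 2) ep].
- by rewrite (_ : p = -1); [exact: Wm_gcomp | rewrite -[p](addrK 2) ep].
- by rewrite (_ : p = 0); [exact: W0_gcomp | rewrite -[p](addrK 2) ep].
- by rewrite (_ : p = 1); [exact: W1_gcomp | rewrite -[p](addrK 2) ep].
Qed.

Lemma G8f_sum ks : size ks = 8 -> lc G8 ks = \sum_(p <- [:: -2; -1; 0; 1]) G8f ks p.
Proof.
case: ks => [|k0 [|k1 [|k2 [|k3 [|k4 [|k5 [|k6 [|k7 []]]]]]]]] // _.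
rewrite !big_cons big_nil /G8f /= /gn /= !scale0r scale1r !addr0 !add0r scalerDr scalerA.
by rewrite !addrA (mulrC k7).
Qed.

Lemma G8f_part ks p : size ks = 8 -> gcomp c p (lc G8 ks) -> lc G8 ks = G8f ks p.
Proof.
move=> sk hp; pose s : seq int := [:: -2; -1; 0; 1].
pose f q := G8f ks q - (if q == p then lc G8 ks else 0).
(* The four degrees of the decomposition, with [p] adjoined when it is a fifth one, so that
   independence of the components can be applied. *)
have us : uniq (if p \in s then s else p :: s) by case: ifP => //= ->.
suff : f p = 0 by rewrite /f eqxx => /eqP; rewrite subr_eq0 => /eqP.
apply: (gcomp_free us) => [q||].
- apply: gcompD; first exact: G8f_gcomp.
  by apply: gcompN; case: ifP => [/eqP ->|_] //; exact: gcomp0.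
- have fs : \sum_(q <- s) f q = lc G8 ks - (if p \in s then lc G8 ks else 0).
    rewrite sumrB -G8f_sum //; congr (_ - _).
    case: ifP => ps.
      by rewrite (bigD1_seq p) //= eqxx big1 ?addr0 // => i /negPf ->.
    by rewrite big1_seq // => i /= si; case: eqP => // ip; rewrite -ip si in ps.
  case: ifP fs => ps fs; first by rewrite fs subrr.
  rewrite big_cons fs subr0 /f eqxx subrK.
  move: ps; rewrite /s !inE /G8f => /negbT; rewrite !negb_or => /and4P [n1 n2 n3 n4].
  by case ep : (p + 2) => [[|[|[|[|n]]]]|n] //;
    rewrite -[p](addrK 2) ep in n1 n2 n3 n4.
- by case: ifP => // _; rewrite mem_head.
Qed.

Definition Gset : set c := [set x | exists ks, size ks = 8 /\ x = lc G8 ks].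

Lemma Gset_comb (k : R) x y : Gset x -> Gset y -> Gset (k *: x + y).
Proof.
move=> [ks [sk ->]] [ls [sl ->]]; exists (ladd [seq k * z | z <- ks] ls).
by rewrite size_ladd ?size_map ?sk // lcZ lcD // size_map sk.
Qed.

Lemma Gset0 : Gset 0.
Proof. by exists (nseq 8 0); rewrite lc_nseq0. Qed.

Lemma Gset_gen v : v \in G8 -> Gset v.
Proof.
move=> /(nthP 0) [i i8 <-]; exists [seq (j == i)%:R | j <- iota 0 8]; split=> //.
by case: i i8 => [|[|[|[|[|[|[|[|]]]]]]]] // _;
  rewrite /= !scale0r scale1r ?addr0 ?add0r.
Qed.

Lemma Gset_part p x : gpart Gset p x -> exists ks, size ks = 8 /\ x = G8f ks p.
Proof. by move=> [[ks [sk e]] hx]; exists ks; split=> //; rewrite e -G8f_part // -e. Qed.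

Lemma Gset_sub : graded_subalgebra Gset.
Proof.
split.
- by split; [exact: Gset0 | exact: Gset_comb].
- move=> _ _ [ks [sk ->]] [ls [sl ->]].
  exists (ctab 8 (T8 R) ks ls); rewrite (br_lc (@lbrDl R c) (@lbrDr R c) _ _ table_8); split=> //.
  by rewrite (ctab_size (@lbrDr R c) _ _ table_8).
apply/seteqP; split=> [_ [ks [sk ->]]|]; last first.
  apply: lspan_ind; [exact: Gset0 | exact: Gset_comb | by move=> x [p _ []]].
have [z0 zD zS] := lspanP (\bigcup_p gpart Gset p).
have gz v p : v \in G8 -> gcomp c p v -> lspan (\bigcup_p gpart Gset p) v.
  by move=> vG hv; apply: zS; exists p => //; split=> //; exact: Gset_gen.
have : forall v, v \in G8 -> lspan (\bigcup_p gpart Gset p) v.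
  move=> v vG; have : exists p, gcomp c p v.
    move: vG; rewrite !inE => /or4P [/eqP ->|/eqP ->|/eqP ->|/or4P [/eqP ->|/eqP ->|/eqP ->|]].
    - by exists (-2); exact: em2_gcomp.
    - by exists (-1).
    - by exists (-1).
    - by exists 0; case: hE.
    - by exists 0; rewrite s11E; exact: W0_gcomp.
    - by exists 0; rewrite s12E; exact: W0_gcomp.
    - by move=> /orP [] /eqP ->; exists 1; rewrite ?s111E; exact: W1_gcomp.
  by move=> [p]; exact: gz.
elim: G8 ks {sk} => [|v vs IH] [|k ks] H //=.
apply: zD; first by apply: H; rewrite mem_head.
by apply: IH => w ws; apply: H; rewrite inE ws orbT.
Qed.

Lemma Gset_neg p : p < 0 -> gpart Gset p = gcomp c p.
Proof.
move=> p0; apply/seteqP; split=> [x []//|x hx]; split=> //.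
have [p2|p2] := ltrP p (- 2); first by rewrite (gcomp_low p2 hx); exact: Gset0.
have : p = -2 \/ p = -1 by move: p2 p0; case: p {hx} => // -[|[|n]]; [right | left |].
case=> ep; rewrite ep in hx.
  have [k ->] := gcomp_em2 hx; exists [:: k; 0; 0; 0; 0; 0; 0; 0]; split=> //.
  by rewrite /= !scale0r !addr0.
have [q [r ->]] := gcompm_lc hx; exists [:: 0; q; r; 0; 0; 0; 0; 0]; split=> //.
by rewrite /= !scale0r !addr0 add0r.
Qed.

Lemma adeigen_0 (m x a b d : C) :
  cbr (cinc J) (lc (mc W0) [:: x; a; b; d]) = m *: lc (mc W0) [:: x; a; b; d] ->
  adeigen J 0 m (lc (mc W0) [:: x; a; b; d]).
Proof. by split=> //; rewrite lc_cplx; split; exact: W0_gcomp. Qed.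

Lemma adeigen_1 (m k0 k1 k2 k3 l1 l2 : C) :
  cbr (cinc J) (lc (mc W1) [:: k0; k1; k2; k3; l1; l2]) =
    m *: lc (mc W1) [:: k0; k1; k2; k3; l1; l2] ->
  adeigen J 1 m (lc (mc W1) [:: k0; k1; k2; k3; l1; l2]).
Proof. by split=> //; rewrite lc_cplx; split; exact: W1_gcomp. Qed.

(** The eigenvalues in use are purely imaginary, so they are separated by a real inequality. *)
Lemma ado_mem p (l m : C) (X : ch) : adeigen J p m X -> complex.Im m != complex.Im l ->
  adeigen_other J p l X.
Proof.
move=> eX /eqP n; have [_ _ zS] := lspanP (\bigcup_(m in [set m | m <> l]) adeigen J p m).
by apply: zS; exists m => //= e; apply: n; rewrite e.
Qed.

Lemma ado_comb p (l k : C) (X Y : ch) : adeigen_other J p l X -> adeigen_other J p l Y ->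
  adeigen_other J p l (k *: X + Y).
Proof.
by have [_ zD _] := lspanP (\bigcup_(m in [set m | m <> l]) adeigen J p m); exact: zD.
Qed.

Lemma ado0 p (l : C) : adeigen_other J p l 0.
Proof. by have [] := lspanP (\bigcup_(m in [set m | m <> l]) adeigen J p m). Qed.

Lemma eig_00 (x a : C) : adeigen J 0 0 (lc (mc W0) [:: x; a; 0; a]).
Proof.
apply: adeigen_0; rewrite cJ_lc cbr_00 lcZ; congr lc.
by congr [:: _; _; _; _]; rewrite /inv2 /=; field.
Qed.

Lemma eig_1 (ep a b : C) : ep * ep = 1 ->
  adeigen J 1 (ep * ci) (lc (mc W1) [:: a; ep * ci * a; a; ep * ci * a; b; ep * ci * b]).
Proof.
move=> e; have ee : (ep * ci) ^+ 2 = -1 by apply/eqP; rewrite -subr_eq0 opprK (ci_sq1 e).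
apply: adeigen_1; rewrite cJ_lc cbr_01 lcZ; congr lc.
by congr [:: _; _; _; _; _; _]; rewrite /inv2 /=; move: (ep * ci) ee => q ee; field: ee.
Qed.

Lemma ci2 : ci * ci = -1 :> C. Proof. by rewrite -expr2 sqr_i. Qed.

(** For [x = 0] and the basis e_1, e_2 this is [2mM], the sum of [2m z^2] of eigenvalue 2i and
    [2m z zbar] of eigenvalue 0; E also has eigenvalue 0. *)
Lemma up_0 (x m : C) : up J 0 (lc (mc W0) [:: x; m; ci * m; 0]).
Proof.
rewrite (_ : lc _ _ = (2^-1 * m) *: lc (mc W0) [:: 0; 1; 2 * ci; -1] +
    lc (mc W0) [:: x; 2^-1 * m; 0; 2^-1 * m]); last first.
  by rewrite lcZ lcD //; congr lc; congr [:: _; _; _; _]; rewrite /=; field.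
apply: ado_comb; [apply: (ado_mem zsq_M10) | apply: (ado_mem (eig_00 _ _))];
  by apply/eqP => /=; lra.
Qed.

(** In the basis e_1, e_2 this is [2mN]; its components have eigenvalues 3i, i and -i, and the
    linear terms of N share the last two. *)
Lemma up_1 (m : C) : up J 1 (lc (mc W1) [:: m; ci * m; 0; 0; - 6 * (ci * m); 0]).
Proof.
have N1 : -1 * -1 = 1 :> C by rewrite mulrNN mulr1.
rewrite (_ : lc _ _ = (4^-1 * m) *: lc (mc W1) [:: 1; 3 * ci; - 3; - ci; 0; 0] +
    (1 *: lc (mc W1) [:: 2^-1 * m; 1 * ci * (2^-1 * m); 2^-1 * m; 1 * ci * (2^-1 * m);
             - 3 * ci * m; 1 * ci * (- 3 * ci * m)] +
    lc (mc W1) [:: 4^-1 * m; -1 * ci * (4^-1 * m); 4^-1 * m; -1 * ci * (4^-1 * m);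
             - 3 * ci * m; -1 * ci * (- 3 * ci * m)])); last first.
  by rewrite !(lcZ, lcD) //; congr lc; congr [:: _; _; _; _; _; _]; rewrite /=; field.
apply: ado_comb; [apply: (ado_mem zcu_M10) | apply: ado_comb;
  [apply: (ado_mem (eig_1 _ _ (mulr1 1))) | apply: (ado_mem (eig_1 _ _ N1))]];
  by apply/eqP => /=; lra.
Qed.

Lemma low_1 (m : C) : adeigen_other J 1 (ci * (1 + 2)%:~R)
  (lc (mc W1) [:: m; ci * m; 0; 0; - 6 * (ci * m); 0] -
   (4^-1 * m) *: lc (mc W1) [:: 1; 3 * ci; - 3; - ci; 0; 0]).
Proof.
have N1 : -1 * -1 = 1 :> C by rewrite mulrNN mulr1.
rewrite (_ : _ - _ =
    (1 *: lc (mc W1) [:: 2^-1 * m; 1 * ci * (2^-1 * m); 2^-1 * m; 1 * ci * (2^-1 * m);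
             - 3 * ci * m; 1 * ci * (- 3 * ci * m)] +
    lc (mc W1) [:: 4^-1 * m; -1 * ci * (4^-1 * m); 4^-1 * m; -1 * ci * (4^-1 * m);
             - 3 * ci * m; -1 * ci * (- 3 * ci * m)])); last first.
  by rewrite !(lcZ, lcN, lcD) //; congr lc; congr [:: _; _; _; _; _; _]; rewrite /=; field.
apply: ado_comb;
  [apply: (ado_mem (eig_1 _ _ (mulr1 1))) | apply: (ado_mem (eig_1 _ _ N1))];
  by apply/eqP => /=; lra.
Qed.

Lemma low_0 (m : C) : adeigen_other J 0 (ci * (0 + 2)%:~R)
  (lc (mc W0) [:: 0; m; ci * m; 0] - (2^-1 * m) *: lc (mc W0) [:: 0; 1; 2 * ci; -1]).
Proof.
rewrite (_ : _ - _ = lc (mc W0) [:: 0; 2^-1 * m; 0; 2^-1 * m]); last first.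
  by rewrite !(lcZ, lcN, lcD) //; congr lc; congr [:: _; _; _; _]; rewrite /=; field.
by apply: (ado_mem (eig_00 _ _)); apply/eqP => /=; lra.
Qed.

Lemma clc_0_inj (x a b d x' a' b' d' : C) :
  lc (mc W0) [:: x; a; b; d] = lc (mc W0) [:: x'; a'; b'; d'] ->
  [/\ x = x', a = a', b = b' & d = d'].
Proof.
rewrite !lc_cplx => -[/lc_0_inj [r1 r2 r3 r4] /lc_0_inj [i1 i2 i3 i4]].
by split; apply/eqP; rewrite eq_complex; apply/andP; split; apply/eqP.
Qed.

Lemma clc_1_inj (k0 k1 k2 k3 m l k0' k1' k2' k3' m' l' : C) :
  lc (mc W1) [:: k0; k1; k2; k3; m; l] = lc (mc W1) [:: k0'; k1'; k2'; k3'; m'; l'] ->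
  [/\ [/\ k0 = k0', k1 = k1' & k2 = k2'], k3 = k3', m = m' & l = l'].
Proof.
rewrite !lc_cplx => -[/lc_1_inj [[r1 r2 r3] r4 r5 r6] /lc_1_inj [[i1 i2 i3] i4 i5 i6]].
by do !split; apply/eqP; rewrite eq_complex; apply/andP; split; apply/eqP.
Qed.

Lemma hat_gcomp0_lc (X : ch) : hat (gcomp c 0) X -> exists x a b d : C, X = lc (mc W0) [:: x; a;
  b; d].
Proof.
move=> [/gcomp0_lc [x [a [b [d e3]]]] /gcomp0_lc [x' [a' [b' [d' e4]]]]].
exists (Complex x x'), (Complex a a'), (Complex b b'), (Complex d d').
have -> : X = (X.1, X.2) by case: (X).
by rewrite e3 e4 lc_cplx.
Qed.

Lemma hat_gcomp1_lc (X : ch) : hat (gcomp c 1) X ->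
  exists k0 k1 k2 k3 m l : C, X = lc (mc W1) [:: k0; k1; k2; k3; m; l].
Proof.
move=> [/gcomp1_lc [k0 [k1 [k2 [k3 [m [l e3]]]]]] /gcomp1_lc [k0' [k1' [k2' [k3' [m' [l' e4]]]]]]].
exists (Complex k0 k0'), (Complex k1 k1'), (Complex k2 k2'), (Complex k3 k3'),
  (Complex m m'), (Complex l l').
have -> : X = (X.1, X.2) by case: (X).
by rewrite e3 e4 lc_cplx.
Qed.

Lemma M10_0 (Y : ch) : M10 J 0 Y -> exists k, Y = k *: lc (mc W0) [:: 0; 1; 2 * ci; -1].
Proof.
move=> [/hat_gcomp0_lc [x [a [b [d ->]]]] eY]; exists a.
have : cbr (cinc J) (lc (mc W0) [:: x; a; b; d]) = (ci * 2) *: lc (mc W0) [:: x; a; b; d] by [].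
rewrite cJ_lc cbr_00 lcZ => /clc_0_inj [q1 q2 q3 q4]; rewrite lcZ; congr lc.
have i2 := ci2; rewrite /inv2 in q1 q2 q3 q4.
have x0 : x = 0.
  have e : x = - ci * 2^-1 * (ci * 2 * x) by field: i2.
  by rewrite e -q1 mulr0.
have b2 : b = ci * 2 * a by rewrite -q2; field.
have d2 : d = a + 2^-1 * (ci * 2 * b) by rewrite -q3; field.
by congr [:: _; _; _; _]; rewrite /= ?d2 ?b2 ?x0; field: i2.
Qed.

Lemma M10_1 (Y : ch) : M10 J 1 Y -> exists k, Y = k *: lc (mc W1) [:: 1; 3 * ci; - 3; - ci; 0; 0].
Proof.
move=> [/hat_gcomp1_lc [k0 [k1 [k2 [k3 [m [l ->]]]]]] eY]; exists k0.
have : cbr (cinc J) (lc (mc W1) [:: k0; k1; k2; k3; m; l]) =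
  (ci * 3) *: lc (mc W1) [:: k0; k1; k2; k3; m; l] by [].
rewrite cJ_lc cbr_01 lcZ => /clc_1_inj [[q1 q2 q3] q4 q5 q6]; rewrite lcZ; congr lc.
have i2 := ci2; rewrite /inv2 in q1 q2 q3 q4 q5 q6.
have b1 : k1 = ci * 3 * k0 by rewrite -q1; field.
have b2 : k2 = 2^-1 * (ci * 3 * k1 + 3 * k0) by rewrite -q2; field.
have b3 : k3 = 3^-1 * (ci * 3 * k2 + 2 * k1) by rewrite -q3; field.
have l3 : l = ci * 3 * m by rewrite -q5; field.
have m0 : m = 0.
  have e : ci * 3 * l = - 9 * m by rewrite l3; field: i2.
  have : - m = - 9 * m by rewrite -e -q6; field.
  move/eqP; rewrite -subr_eq0 (_ : _ - _ = 8 * m); last by ring.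
  by rewrite mulf_eq0 pnatr_eq0 => /eqP.
by congr [:: _; _; _; _; _; _]; rewrite /= ?l3 ?m0 ?b3 ?b2 ?b1; field: i2.
Qed.

Lemma Gset_lc0 (x a b : R) : gpart Gset 0 (lc W0 [:: x; a; b; 0]).
Proof.
split; last exact: W0_gcomp.
exists [:: 0; 0; 0; x; a; b; 0; 0]; split=> //.
by rewrite /= !scale0r !addr0 !add0r.
Qed.

Lemma Gset_lc1 (p q : R) : gpart Gset 1 (lc W1 [:: p; q; 0; 0; - 6 * q; 0]).
Proof.
split; last exact: W1_gcomp.
exists [:: 0; 0; 0; 0; 0; 0; p; q]; split=> //.
rewrite /= /gn /= !scale0r !addr0 !add0r scale1r scalerDr scalerA.
by rewrite (mulrC q).
Qed.

Lemma hat_gset0 (X : ch) :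
  hat (gpart Gset 0) X <-> exists x a b : C, X = lc (mc W0) [:: x; a; b; 0].
Proof.
split=> [[/Gset_part [ks [_ e3]] /Gset_part [ls [_ e4]]]|[x [a [b ->]]]].
  exists (Complex ks`_3 ls`_3), (Complex ks`_4 ls`_4), (Complex ks`_5 ls`_5).
  have -> : X = (X.1, X.2) by case: (X).
  by rewrite e3 e4 lc_cplx.
by rewrite lc_cplx; split; exact: Gset_lc0.
Qed.

Lemma hat_gset1 (X : ch) :
  hat (gpart Gset 1) X <-> exists p q : C, X = lc (mc W1) [:: p; q; 0; 0; - 6 * q; 0].
Proof.
split=> [[/Gset_part [ks [_ e3]] /Gset_part [ls [_ e4]]]|[p [q ->]]].
  exists (Complex ks`_6 ls`_6), (Complex ks`_7 ls`_7).
  have -> : X = (X.1, X.2) by case: (X).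
  rewrite e3 e4 lc_cplx; congr pair; congr lc; congr [:: _; _; _; _; _; _] => /=; ring.
rewrite lc_cplx; case: q => q q'.
have e r r' : 6 *+ 0 = 0 :> R by [].
rewrite (_ : [seq complex.Re k | k <- _] = [:: complex.Re p; q; 0; 0; - 6 * q; 0]).
  rewrite (_ : [seq complex.Im k | k <- _] = [:: complex.Im p; q'; 0; 0; - 6 * q'; 0]).
    by split; exact: Gset_lc1.
  by congr [:: _; _; _; _; _; _] => /=; ring.
by congr [:: _; _; _; _; _; _] => /=; ring.
Qed.

Lemma hat_gset2 p (X : ch) : 1 < p -> hat (gpart Gset p) X -> X = 0.
Proof.
have z ks : 1 < p -> G8f ks p = 0.
  by rewrite /G8f; case: p => [[|[|n]]|n] // _; rewrite -PoszD !addSn addn2.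
move=> p1 [/Gset_part [ks [_ e3]] /Gset_part [ls [_ e4]]].
have -> : X = (X.1, X.2) by case: (X).
by rewrite e3 e4 !z.
Qed.

Lemma cconj_lc (vs : seq c) (ks : seq C) :
  cconj (lc (mc vs) ks) = lc (mc vs) [seq (k^*)%C | k <- ks].
Proof.
rewrite !lc_cplx /cconj; congr pair => /=.
  by congr lc; rewrite -map_comp; apply: eq_map; case.
by rewrite lcN; congr lc; rewrite -!map_comp; apply: eq_map; case.
Qed.

Lemma hat_gset_sum p (X Y : ch) : hat (gpart Gset p) X -> hat (gpart Gset p) Y ->
  hat (gpart Gset p) (X + Y).
Proof.
have H x y : gpart Gset p x -> gpart Gset p y -> gpart Gset p (x + y).
  by move=> [gx hx] [gy hy]; split; [rewrite -[x]scale1r; exact: Gset_comb | exact: gcompD].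
by move=> [x1 x2] [y1 y2]; split; exact: H.
Qed.

Lemma degP (p : int) : 0 <= p -> [\/ p = 0, p = 1 | 1 < p].
Proof.
case: p => // -[|[|n]] _; [exact: Or31 | exact: Or32 | exact: Or33].
Qed.

Lemma Gset_sum p : 0 <= p -> hat (gpart Gset p) =
  setsum (hat (gpart Gset p) `&` up J p) (hat (gpart Gset p) `&` (@cconj R c @` up J p)).
Proof.
move=> p0; apply/seteqP; split=> [X|_ [X [gX _] [Y [gY _] <-]]]; last exact: hat_gset_sum.
case: (degP p0) => [->|->|p1].
- move=> /hat_gset0 [x [a [b ->]]].
  (* Coordinates of [a a_1^2 + b a_1 a_2] along [a_1^2 + i a_1 a_2] and its conjugate; E is put in
     the first summand. *)
  pose m := 2^-1 * (a - ci * b); pose m' := 2^-1 * (a + ci * b).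
  exists (lc (mc W0) [:: x; m; ci * m; 0]).
    by split; [apply/hat_gset0; do 3 eexists | exact: up_0].
  exists (lc (mc W0) [:: 0; m'; - ci * m'; 0]).
    split; first by apply/hat_gset0; do 3 eexists.
    exists (lc (mc W0) [:: 0; m'^*%C; ci * m'^*%C; 0]); first exact: up_0.
    rewrite cconj_lc; congr lc; case: (m') => r s; congr [:: _; _; _; _];
      by apply/eqP; rewrite eq_complex; apply/andP; split; apply/eqP => /=; ring.
  rewrite lcD //; congr lc; have i2 := ci2; rewrite /m /m'.
  by congr [:: _; _; _; _]; rewrite /=; field: i2.
- move=> /hat_gset1 [p1 [q1 ->]].
  pose m := 2^-1 * (p1 - ci * q1); pose m' := 2^-1 * (p1 + ci * q1).
  exists (lc (mc W1) [:: m; ci * m; 0; 0; - 6 * (ci * m); 0]).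
    by split; [apply/hat_gset1; do 2 eexists | exact: up_1].
  exists (lc (mc W1) [:: m'; - ci * m'; 0; 0; - 6 * (- ci * m'); 0]).
    split; first by apply/hat_gset1; do 2 eexists.
    exists (lc (mc W1) [:: m'^*%C; ci * m'^*%C; 0; 0; - 6 * (ci * m'^*%C); 0]); first exact: up_1.
    rewrite cconj_lc; congr lc; case: (m') => r s; congr [:: _; _; _; _; _; _];
      by apply/eqP; rewrite eq_complex; apply/andP; split; apply/eqP => /=; ring.
  rewrite lcD //; congr lc; have i2 := ci2; rewrite /m /m'.
  by congr [:: _; _; _; _; _; _]; rewrite /=; field: i2.
- move=> /(hat_gset2 p1) ->; exists 0; last exists 0; rewrite ?addr0 //.
    split; last exact: ado0.
    by split; split; [exact: Gset0 | exact: gcomp0 | exact: Gset0 | exact: gcomp0].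
  split; last by exists 0; [exact: ado0 | rewrite /cconj oppr0].
  by split; split; [exact: Gset0 | exact: gcomp0 | exact: Gset0 | exact: gcomp0].
Qed.

Lemma Gset_proj p : 0 <= p -> projM10 J p (hat (gpart Gset p) `&` up J p) = core_m J p.
Proof.
move=> p0; rewrite /core_m; case: (degP p0) => [->|->|p1].
- apply/seteqP; split=> [Y []//|Y mY]; split=> //.
  have [k ->] := M10_0 mY.
  (* Its component of eigenvalue 2i is half the leading coefficient times the generator, hence the
     factor 2; in degree 1 the factor is 4. *)
  exists (lc (mc W0) [:: 0; 2 * k; ci * (2 * k); 0]).
    by split; [apply/hat_gset0; do 3 eexists | exact: up_0].
  by have := low_0 (2 * k); rewrite (_ : 2^-1 * (2 * k) = k) //; field.
- apply/seteqP; split=> [Y []//|Y mY]; split=> //.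
  have [k ->] := M10_1 mY.
  exists (lc (mc W1) [:: 4 * k; ci * (4 * k); 0; 0; - 6 * (ci * (4 * k)); 0]).
    by split; [apply/hat_gset1; do 2 eexists | exact: up_1].
  by have := low_1 (4 * k); rewrite (_ : 4^-1 * (4 * k) = k) //; field.
- rewrite leNgt p1 /=; apply/seteqP; split=> [Y [mY [X [/(hat_gset2 p1) -> _]]]|_ ->].
    rewrite sub0r => oY; apply: (adeigen_indep mY).
    have := ado_comb (-1) oY (ado0 p _).
    by rewrite addr0 scaleN1r opprK.
  split; first exact: adeigen0.
  exists 0; last by rewrite subrr; exact: ado0.
  by split; last exact: ado0; split; split;
    [exact: Gset0 | exact: gcomp0 | exact: Gset0 | exact: gcomp0].
Qed.

Lemma Gset_model : model J E (core_m J) Gset.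
Proof.
split; [exact: Gset_sub | exact: Gset_neg | | exact: Gset_sum | exact: Gset_proj].
have := Gset_lc0 1 0 0; congr (gpart Gset 0).
by rewrite /= !scale0r scale1r !addr0.
Qed.

End Adapted.

Local Notation Wme := (Vm (e1 c) (e2 c)).
Local Notation W0e := (W0 (e1 c) (e2 c)).
Local Notation W1e := (W1 (e1 c) (e2 c)).
Local Notation Ge := (G8 (e1 c) (e2 c)).

Lemma heis_adapted (a1 a2 : c) : adapted a1 a2 -> heisenberg_negative (em2 c) a1 a2.
Proof.
move=> had; have [H1 H2 _ _] := ca_neg c; split => //; last exact: ad_br had.
have [z0 zD zS] := lspanP (range (fun i : 'I_2 => if i == ord0 then a1 else a2)).
split.
  apply/seteqP; split.
    apply: lspan_ind; first exact: gcomp0.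
      by move=> k x y hx hy; apply: gcompD => //; exact: gcompZ.
    by move=> _ [i _ <-]; case: ifP => _; [exact: ad1 had | exact: ad2 had].
  move=> v /(ad_span had) [p [q ->]]; apply: (zD); first by apply: zS; exists ord0.
  by rewrite -[q *: a2]addr0; apply: (zD) => //; apply: zS; exists ord_max.
move=> k; rewrite !big_ord_recl big_ord0 addr0 /= => e.
have : lc (Vm a1 a2) [:: k ord0; k (lift ord0 ord0)] = lc (Vm a1 a2) [:: 0; 0] :> c.
  by rewrite /= !scale0r !addr0 e.
move=> /(lc_m_inj had) [k1 k2] i.
by have [->|->] : i = ord0 \/ i = lift ord0 ord0 by case: i => -[|[|]] // ?; [left|right]; apply:
  val_inj.
Qed.

(** By transitivity the negative part determines a graded morphism, by induction on the degree. In
    [fn] the index [n] stands for the degree n - 1. *)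
Lemma graded_hom_id (f : {linear c -> c}) : graded_hom f ->
  (forall v, cm v -> f v = v) -> f (em2 c) = em2 c -> forall x, f x = x.
Proof.
move=> [fg fb] f1 f2 x.
have fn n y : gcomp c (n%:Z - 1) y -> f y = y.
  elim: n y => [|n IH] y; first exact: f1.
  rewrite (_ : n.+1%:Z - 1 = n%:Z) => [hy|]; last by rewrite -addn1 PoszD addrK.
  apply: (trans_p adapted_e (p := n%:Z)) => //; first exact: fg.
    by rewrite -{1}(f1 _ e1_gcomp) -fb IH //; exact: (gcomp_br hy e1_gcomp).
  by rewrite -{1}(f1 _ e2_gcomp) -fb IH //; exact: (gcomp_br hy e2_gcomp).
have : lspan (\bigcup_p gcomp c p) x by rewrite gcomp_span.
move: x; apply: lspan_ind; first exact: linear0.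
  by move=> k x y /= ex ey; rewrite linearP ex ey.
move=> x [p _ hx] /=.
have [p2|p2] := ltrP p (- 2); first by rewrite (gcomp_low p2 hx) linear0.
have pn : p = (absz (p + 2))%:Z - 2 by rewrite gez0_abs ?addrK // -lerBlDr sub0r.
move: pn hx; case: (absz (p + 2)) => [|n] ->.
  by move=> /gcomp_em2 [k ->]; rewrite linearZ f2.
by rewrite -addn1 PoszD -[2]/(1 + 1) opprD addrA addrK; exact: fn.
Qed.

Lemma rot_hom (p q : R) : p * p + q * q = 1 -> exists f : {linear c -> c},
  [/\ graded_hom f, f (e1 c) = p *: e1 c + q *: e2 c, f (e2 c) = - q *: e1 c + p *: e2 c &
      f (em2 c) = em2 c].
Proof.
(* The universal property sends the chosen basis to e_1, e_2; the basis is rotated by the opposite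
   angle, so that e_1, e_2 go to the desired one. *)
move=> pq; have hb : adapted (p *: e1 c + (- q) *: e2 c) (- (- q) *: e1 c + p *: e2 c).
  by apply: adapted_rot; rewrite mulrNN.
have [f [fh _ f0 f1 f2]] := @ca_max R c c _ _ _ (heis_adapted hb) (@ca_trans R c).
have L (k l : R) : f (k *: (p *: e1 c + - q *: e2 c) + l *: (- - q *: e1 c + p *: e2 c)) =
    k *: e1 c + l *: e2 c by rewrite linearD !linearZ f1 f2.
exists f; split=> //.
  rewrite -L; congr (f _); rewrite !scalerDr !scalerA addrACA -!scalerDl.
  transitivity (1 *: e1 c + 0 *: e2 c); first by rewrite scale1r scale0r addr0.
  by congr (_ *: _ + _ *: _); [rewrite -pq | ]; ring.
rewrite -L; congr (f _); rewrite !scalerDr !scalerA addrACA -!scalerDl.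
transitivity (0 *: e1 c + 1 *: e2 c); first by rewrite scale1r scale0r add0r.
by congr (_ *: _ + _ *: _); [ | rewrite -pq]; ring.
Qed.

(** * Rotations and uniqueness *)

Section Uniqueness.
Variables (p q : R) (f : {linear c -> c}).
Hypotheses (pq : p * p + q * q = 1) (fh : graded_hom f)
  (f1 : f (e1 c) = p *: e1 c + q *: e2 c) (f2 : f (e2 c) = - q *: e1 c + p *: e2 c)
  (fem : f (em2 c) = em2 c).

Let b1 := p *: e1 c + q *: e2 c.
Let b2 := - q *: e1 c + p *: e2 c.
Let hb : adapted b1 b2 := adapted_rot pq.

Lemma rot_J : f J = J.
Proof.
have [[hJ0 _] _ _] := hJ; have [fg fb] := fh.
apply: (trans_p hb (p := 0)) => //; first exact: fg.
  by rewrite (ad_J1 hb) /b1 -f1 -fb (ad_J1 adapted_e) linearN f2.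
by rewrite (ad_J2 hb) /b2 -f2 -fb (ad_J2 adapted_e) f1.
Qed.

Lemma rot_m (k l : R) : f (lc Wme [:: k; l]) = lc (Vm b1 b2) [:: k; l].
Proof. by rewrite /= !addr0 linearD !linearZ /= f1 f2. Qed.

Let b10 : lc (Vm b1 b2) [:: 1; 0] = b1.
Proof. by rewrite /= scale1r scale0r !addr0. Qed.
Let b01 : lc (Vm b1 b2) [:: 0; 1] = b2.
Proof. by rewrite /= scale1r scale0r !addr0 add0r. Qed.

(** The structure constants are the same in the two adapted bases, so both sides have the same
    brackets with the rotated basis. *)
Lemma rot_0 (x a b d : R) :
  f (lc W0e [:: x; a; b; d]) = lc (W0 b1 b2) [:: x; a; b; d].
Proof.
have [fg fb] := fh; have he := adapted_e.
have L r s : lbr (f (lc W0e [:: x; a; b; d])) (lc (Vm b1 b2) [:: r; s]) =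
    lbr (lc (W0 b1 b2) [:: x; a; b; d]) (lc (Vm b1 b2) [:: r; s]).
  by rewrite (W_br_0m hb) -rot_m -fb (W_br_0m he) rot_m.
apply: (trans_p hb (p := 0)) => //; [exact/fg/W0_gcomp | exact: W0_gcomp | |].
  by have := L 1 0; rewrite b10.
by have := L 0 1; rewrite b01.
Qed.

Lemma rot_1 (k0 k1 k2 k3 m l : R) :
  f (lc W1e [:: k0; k1; k2; k3; m; l]) = lc (W1 b1 b2) [:: k0; k1; k2; k3; m; l].
Proof.
have [fg fb] := fh; have he := adapted_e.
have L r s : lbr (f (lc W1e [:: k0; k1; k2; k3; m; l])) (lc (Vm b1 b2) [:: r; s]) =
    lbr (lc (W1 b1 b2) [:: k0; k1; k2; k3; m; l]) (lc (Vm b1 b2) [:: r; s]).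
  by rewrite (W_br_1m hb) -rot_m -fb (W_br_1m he) rot_0.
apply: (trans_p hb (p := 1)) => //; [exact/fg/W1_gcomp | exact: W1_gcomp | |].
  by have := L 1 0; rewrite b10.
by have := L 0 1; rewrite b01.
Qed.

Lemma rot_G8 ks : size ks = 8 -> f (lc Ge ks) = lc (G8 b1 b2) ks.
Proof.
move=> sk; rewrite !G8f_sum // linear_sum; apply: eq_bigr => r _.
rewrite /G8f; case: (r + 2) => [[|[|[|[|n]]]]|n]; rewrite ?linear0 //.
- by rewrite linearZ fem.
- exact: rot_m.
- exact: rot_0.
- exact: rot_1.
Qed.

End Uniqueness.

Lemma model_rot g : model J E (core_m J) g -> exists p q : R, p * p + q * q = 1 /\
  g = Gset (p *: e1 c + q *: e2 c) (- q *: e1 c + p *: e2 c).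
Proof.
move=> hg; have he := adapted_e; have c1 := e1_gcomp; have c2 := e2_gcomp.
have [u [v [uv r1 r2]]] := model_circle he hg.
(* [p] and [q] are the cosine and sine of half the angle of [(u, v)]; at [u = -1], where the cosine
   vanishes, [(0, 1)] is taken. *)
have [p [q [pq pu pv]]] : exists p q : R, [/\ p * p + q * q = 1, p * p - q * q = u & 2 * p * q = v].
  have u1 : u ^+ 2 <= 1 by rewrite -uv expr2 lerDl -expr2 sqr_ge0.
  have /andP [lu uu] : -1 <= u <= 1 by rewrite -ler_norml -(@expr_le1 _ 2) // -normrX ger0_norm
    ?sqr_ge0.
  have [u0|u0] := eqVneq u (-1).
    exists 0, 1; rewrite u0 in uv *.
    have /eqP : v * v = 0 by lra.
    by rewrite mulf_eq0 orbb => /eqP ->; split; ring.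
  have pp : 0 < (1 + u) / 2 by rewrite divr_gt0 // -ltrBlDl sub0r lt_neqAle eq_sym u0.
  pose p := Num.sqrt ((1 + u) / 2); have p0 : p != 0 by rewrite gt_eqF // sqrtr_gt0.
  have p2 : p * p = (1 + u) / 2 by rewrite -expr2 sqr_sqrtr // ltW.
  have q2 : v / (2 * p) * (v / (2 * p)) = (1 - u) / 2.
    rewrite (_ : _ * _ = (v * v) / (4 * (p * p))); last by field.
    rewrite p2 (_ : v * v = (1 - u) * (1 + u)); last by lra.
    by field; rewrite addrC addr_eq0.
  by exists p, (v / (2 * p)); rewrite p2 q2; split; field.
exists p, q; split=> //; have hb := adapted_rot pq.
have Sv a1 a2 x y x' y' : cm a1 -> cm a2 -> S [:: x *: a1 + y *: a2; x' *: a1 + y' *: a2] =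
    lc (W0 a1 a2) [:: 0; x * x'; x * y' + y * x'; y * y'].
  move=> h1 h2; rewrite S_comb; last first.
    by apply: in_cm1_3 => //; apply: gcompD; exact: gcompZ.
  rewrite ![S [:: _; x' *: _ + _]]S_swap ?S_comb; try by [apply: in_cm1_3 | apply: in_cm1_2 => //;
    apply: gcompD; exact: gcompZ].
  rewrite (S_swap (in_cm1_2 h2 h1)).
  transitivity (x *: lc (W0 a1 a2) [:: 0; x'; y'; 0] + y *: lc (W0 a1 a2) [:: 0; 0; x'; y']).
    by rewrite /= !scale0r !addr0 !add0r.
  by rewrite !lcZ lcD //; congr lc; congr [:: _; _; _; _]; rewrite /=; ring.
have qq : q * q = 1 - p * p by rewrite -pq addrC addKr.
apply: (normalised_eq hb hg).
  (* The square of the rotated first vector has coefficients [(1 + u)/2], [v], [(1 - u)/2]; since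
     [u^2 + v^2 = 1], it is this combination of the two known elements. *)
  have := model_comb hg (p * q) (u / 2) r2 r1; rewrite /s11 Sv // !(lcZ, lcD) //.
  by congr g; congr lc; congr [:: _; _; _; _]; rewrite /= -?pv -?pu; field: qq.
have := model_comb hg (u / 2) (- v / 2) r2 r1; rewrite /s12 Sv // !(lcZ, lcD) //.
by congr g; congr lc; congr [:: _; _; _; _]; rewrite /= -?pv -?pu; field: qq.
Qed.

(** A larger model still contains e_1^2 and e_1 e_2, and [normalised_eq] determines it. *)
Lemma Gset_maximal : maximal_model J E (core_m J) (Gset (e1 c) (e2 c)).
Proof.
have he := adapted_e; split; first exact: Gset_model.
move=> g hg Gg; apply: (normalised_eq he hg); apply: Gg; apply: Gset_gen;
  by rewrite !inE eqxx ?orbT.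
Qed.

Lemma Gset_unique g : model J E (core_m J) g ->
  isomorphic_models J (Gset (e1 c) (e2 c)) g.
Proof.
move=> /model_rot [p [q [pq ->]]].
have [f [fh f1 f2 fem]] := rot_hom pq.
have pq' : p * p + - q * - q = 1 by rewrite mulrNN.
have [f' [fh' f1' f2' fem']] := rot_hom pq'.
(* Opposite rotations compose to a graded morphism that fixes the negative part, hence to the
   identity; this gives bijectivity. *)
have comp (f3 f4 : {linear c -> c}) (r s : R) : r * r + s * s = 1 ->
    graded_hom f3 -> graded_hom f4 ->
    f3 (e1 c) = r *: e1 c + s *: e2 c -> f3 (e2 c) = - s *: e1 c + r *: e2 c ->
    f4 (e1 c) = r *: e1 c + - s *: e2 c -> f4 (e2 c) = - - s *: e1 c + r *: e2 c ->
    f3 (em2 c) = em2 c -> f4 (em2 c) = em2 c -> cancel f3 f4.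
  move=> rs [g3 b3] [g4 b4] f31 f32 f41 f42 fe3 fe4 x.
  apply: (graded_hom_id (f := f4 \o f3)) => [|v hv|/=]; last by rewrite fe3.
    split=> [r' x' hx|x' y']; first exact/g4/g3.
    by rewrite /= b3 b4.
  have [k [l ->]] := cm_span hv.
  have A1 : f4 (f3 (e1 c)) = e1 c.
    rewrite f31 linearD !linearZ /= f41 f42 !scalerDr !scalerA addrACA -!scalerDl.
    transitivity (1 *: e1 c + 0 *: e2 c); last by rewrite scale1r scale0r addr0.
    by congr (_ *: _ + _ *: _); [rewrite -rs |]; ring.
  have A2 : f4 (f3 (e2 c)) = e2 c.
    rewrite f32 linearD !linearZ /= f41 f42 !scalerDr !scalerA addrACA -!scalerDl.
    transitivity (0 *: e1 c + 1 *: e2 c); last by rewrite scale1r scale0r add0r.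
    by congr (_ *: _ + _ *: _); [|rewrite -rs]; ring.
  change (f4 (f3 (k *: e1 c + l *: e2 c)) = k *: e1 c + l *: e2 c).
  rewrite (linearD f3) [f3 (k *: _)]linearZ [f3 (l *: _)]linearZ /= (linearD f4).
  by rewrite [f4 (k *: _)]linearZ [f4 (l *: _)]linearZ /= A1 A2.
have [fg fb] := fh.
exists f; split; last first.
  apply/seteqP; split=> [_ [ks [sk ->]]|_ [_ [ks [sk ->]] <-]].
    exists (lc Ge ks); first by exists ks.
    exact: rot_G8 fem _ sk.
  by exists ks; split=> //; exact: rot_G8 fem _ sk.
split=> //.
  by exists f'; [exact: (comp f f' p q) | apply: (comp f' f p (- q)) => //; rewrite opprK].
by move=> X; rewrite fb (rot_J pq fh f1 f2).
Qed.

(** * The CR algebra and its Freeman sequence *)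

Lemma br_88 (K : numFieldType) (V : lmodType K) (br : V -> V -> V) (G : seq V) z0 z1 z2 z3 z4 z5
  z6 z7 w0 w1 w2 w3 w4 w5 w6 w7 :
  (forall k x y w, br (k *: x + y) w = k *: br x w + br y w) ->
  (forall k x y w, br w (k *: x + y) = k *: br w x + br w y) ->
  size G = 8 -> table br G G G (T8 K) ->
  br (lc G [:: z0; z1; z2; z3; z4; z5; z6; z7]) (lc G [:: w0; w1; w2; w3; w4; w5; w6; w7]) =
  lc G [:: 2 * z0 * w3 - 2 * z3 * w0 + z1 * w2 - z2 * w1;
    6 * z0 * w7 - 6 * z7 * w0 + z1 * w3 - z3 * w1 + z1 * w5 - z5 * w1 - 2 * z2 * w4 + 2 * z4 * w2;
    z2 * w3 - z3 * w2 - z2 * w5 + z5 * w2;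
    3 * z7 * w2 - 3 * z2 * w7;
    4 * z1 * w7 - 4 * z7 * w1 - 3 * z2 * w6 + 3 * z6 * w2 + 2 * z4 * w5 - 2 * z5 * w4;
    z2 * w7 - z7 * w2;
    z3 * w6 - z6 * w3 + 2 * z4 * w7 - 2 * z7 * w4 - 3 * z5 * w6 + 3 * z6 * w5;
    z3 * w7 - z7 * w3 - z5 * w7 + z7 * w5].
Proof.
move=> bl bR sG t; rewrite (br_lc bl bR _ _ t) sG; congr lc.
by congr [:: _; _; _; _; _; _; _; _]; rewrite /=; ring.
Qed.

Local Notation C := R[i].
Local Notation ch := (cplx c).
Local Notation mc := (map (@cincl R c)).
Local Notation cinc := (@cincl R c).
Local Notation G := (mc Ge).
Local Notation g8 := (Gset (e1 c) (e2 c)).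
Let he := adapted_e.

(** The formula is proved for any bracket with the table [T8]: it serves here over C, and over R for
    the Lie algebra of the group. *)
Lemma br_G8 z0 z1 z2 z3 z4 z5 z6 z7 w0 w1 w2 w3 w4 w5 w6 w7 :
  cbr (lc G [:: z0; z1; z2; z3; z4; z5; z6; z7]) (lc G [:: w0; w1; w2; w3; w4; w5; w6; w7]) =
  lc G [:: 2 * z0 * w3 - 2 * z3 * w0 + z1 * w2 - z2 * w1;
    6 * z0 * w7 - 6 * z7 * w0 + z1 * w3 - z3 * w1 + z1 * w5 - z5 * w1 - 2 * z2 * w4 + 2 * z4 * w2;
    z2 * w3 - z3 * w2 - z2 * w5 + z5 * w2;
    3 * z7 * w2 - 3 * z2 * w7;
    4 * z1 * w7 - 4 * z7 * w1 - 3 * z2 * w6 + 3 * z6 * w2 + 2 * z4 * w5 - 2 * z5 * w4;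
    z2 * w7 - z7 * w2;
    z3 * w6 - z6 * w3 + 2 * z4 * w7 - 2 * z7 * w4 - 3 * z5 * w6 + 3 * z6 * w5;
    z3 * w7 - z7 * w3 - z5 * w7 + z7 * w5] :> ch.
Proof.
apply: (@br_88 C ch (@cbr R c)); [exact: cbrPl | exact: cbrPr | by [] |].
suff <- : [seq [seq [seq (x%:C)%C | x <- r] | r <- t] | t <- T8 R] = T8 C.
  exact: (table_cplx (table_8 he)).
by rewrite /T8 /= !(rmorphN, rmorph0, rmorph1, rmorph_nat).
Qed.

Lemma G8_inj ks ls : size ks = 8 -> size ls = 8 ->
  lc Ge ks = lc Ge ls -> ks = ls.
Proof.
move=> sk sl e.
have H p : G8f (e1 c) (e2 c) ks p = G8f (e1 c) (e2 c) ls p.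
  pose s : seq int := [:: -2; -1; 0; 1].
  have K : forall q, q \in s -> G8f (e1 c) (e2 c) ks q - G8f (e1 c) (e2 c) ls q = 0.
    apply: (@gcomp_free R c s (fun q => G8f (e1 c) (e2 c) ks q - G8f (e1 c) (e2 c) ls q)) => //
      [r|].
      by apply: gcompD; [|apply: gcompN]; exact: G8f_gcomp.
    by rewrite sumrB -!G8f_sum // e subrr.
  have [/K /eqP|ps] := boolP (p \in s); first by rewrite subr_eq0 => /eqP.
  have z ms : G8f (e1 c) (e2 c) ms p = 0.
    move: ps; rewrite /s !inE !negb_or => /and4P [n1 n2 n3 n4].
    by rewrite /G8f; case ep : (p + 2) => [[|[|[|[|n]]]]|n] //;
      rewrite -[p](addrK 2) ep in n1 n2 n3 n4.
  by rewrite !z.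
have := H (-2); rewrite /G8f /= => /eqP; rewrite -subr_eq0 -scalerBl scaler_eq0 (negPf em2_neq0).
rewrite orbF subr_eq0 => /eqP q0.
have /(lc_m_inj he) [q1 q2] := H (-1).
have /(lc_0_inj he) [q3 q4 q5 _] := H 0.
have /(lc_1_inj he) [[q6 q7 _] _ _ _] := H 1.
apply: (@eq_from_nth _ 0); first by rewrite sk sl.
by move=> i; rewrite sk; case: i => [|[|[|[|[|[|[|[|]]]]]]]].
Qed.

Lemma cG8_inj (ks ls : seq C) : size ks = 8 -> size ls = 8 -> lc G ks = lc G ls -> ks = ls.
Proof.
move=> sk sl; rewrite !lc_cplx => -[/G8_inj r /G8_inj i].
have {r}r : map (@complex.Re R) ks = map (@complex.Re R) ls by apply: r; rewrite size_map.
have {i}i : map (@complex.Im R) ks = map (@complex.Im R) ls by apply: i; rewrite size_map.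
apply: (@eq_from_nth _ 0); first by rewrite sk sl.
rewrite sk => j j8; apply/eqP; rewrite eq_complex; apply/andP; split; apply/eqP.
  by have := congr1 (nth 0 ^~ j) r; rewrite !(nth_map 0) ?sk ?sl.
by have := congr1 (nth 0 ^~ j) i; rewrite !(nth_map 0) ?sk ?sl.
Qed.

Lemma hat_g8 (X : ch) : hat g8 X <-> exists ks, size ks = 8 /\ X = lc G ks.
Proof.
split=> [[[ks [sk e3]] [ls [sl e4]]]|[ks [sk ->]]].
  exists (czip ks ls); split; first by rewrite size_map size_zip sk sl.
  by rewrite -lc_pair ?sk ?sl // -e3 -e4; case: (X).
by rewrite lc_cplx; split; [exists (map (@complex.Re R) ks) | exists (map (@complex.Im R) ks)];
  rewrite size_map.
Qed.

Lemma cG8_split (z0 z1 z2 z3 z4 z5 z6 z7 : C) :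
  lc G [:: z0; z1; z2; z3; z4; z5; z6; z7] = z0 *: cinc (em2 c) +
    (lc (mc Wme) [:: z1; z2] +
    (lc (mc W0e) [:: z3; z4; z5; 0] +
     lc (mc W1e) [:: z6; z7; 0; 0; - 6 * z7; 0])).
Proof.
have eg : cinc (gn (e1 c) (e2 c)) = cinc (s112 (e1 c) (e2 c)) + (- 6) *: cinc (mu (e1 c)).
  rewrite /gn cincl_lc /= !scale0r !addr0 !add0r scale1r.
  by rewrite (_ : (- 6)%:C%C = - 6) // rmorphN rmorph_nat.
by rewrite /= eg scalerDr scalerA !scale0r !addr0 !add0r -!addrA (mulrC z7).
Qed.

(* The coordinates, in the complexified basis [G8], of the elements of [q] and of its conjugate. *)
Definition Q (p t m n : C) : ch := lc G [:: 0; p; ci * p; t; m; ci * m; n; ci * n].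
Definition Qb (p t m n : C) : ch := lc G [:: 0; p; - ci * p; t; m; - ci * m; n; - ci * n].

Definition Gc (ks : seq C) (p : int) : ch :=
  match p + 2 with
  | Posz 0 => ks`_0 *: cinc (em2 c)
  | Posz 1 => lc (mc Wme) [:: ks`_1; ks`_2]
  | Posz 2 => lc (mc W0e) [:: ks`_3; ks`_4; ks`_5; 0]
  | Posz 3 => lc (mc W1e) [:: ks`_6; ks`_7; 0; 0; - 6 * ks`_7; 0]
  | _ => 0
  end.

Lemma lc_hat p vs (ks : seq C) : (forall v, v \in vs -> gcomp c p v) ->
  hat (gcomp c p) (lc (mc vs) ks).
Proof. by move=> H; rewrite lc_cplx; split; exact: gcomp_lc. Qed.

Lemma Gc_hat ks p : hat (gcomp c p) (Gc ks p).
Proof.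
have H0 q : hat (gcomp c q) (0 : ch) by split; exact: gcomp0.
rewrite /Gc; case ep : (p + 2) => [[|[|[|[|n]]]]|n] //.
- rewrite (_ : p = -2); last by rewrite -[p](addrK 2) ep.
  have := lc_hat (p := -2) (vs := [:: em2 c]) [:: ks`_0]; rewrite /= addr0; apply.
  by move=> v; rewrite inE => /eqP ->; exact: em2_gcomp.
- rewrite (_ : p = -1); last by rewrite -[p](addrK 2) ep.
  by rewrite lc_cplx; split; exact: Wm_gcomp.
- rewrite (_ : p = 0); last by rewrite -[p](addrK 2) ep.
  by rewrite lc_cplx; split; exact: W0_gcomp.
- rewrite (_ : p = 1); last by rewrite -[p](addrK 2) ep.
  by rewrite lc_cplx; split; exact: W1_gcomp.
Qed.

Lemma cE_eig p (X : ch) : hat (gcomp c p) X -> cbr (cinc E) X = p%:~R *: X.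
Proof.
move=> [h1 h2]; have [_ HE] := hE; rewrite (_ : p%:~R = (p%:~R : R)%:C%C); last by rewrite
  rmorph_int.
rewrite cscE; congr pair; rewrite /= ?(HE _ _ h1) ?(HE _ _ h2) !lbr0l !scale0r ?subr0 ?addr0 //.
Qed.

(** The degrees are the eigenvalues of ad E, so [eig_indep] for ad E identifies the component of
    degree p of an element of u with its term in u^p, or with 0 when p = -2. *)
Lemma utot_part ks p : size ks = 8 -> utot J (lc G ks) -> -2 <= p ->
  if -1 <= p then up J p (Gc ks p) else Gc ks p = 0.
Proof.
move=> sk uX p2.
pose O := [set x : ch | exists2 m, m <> p%:~R & cbr (cinc E) x = m *: x].
have [z0 zD zS] := lspanP O.
have PP X : utot J X -> exists2 Y, hat (gcomp c p) Y /\ (if -1 <= p then up J p Y else Y = 0) &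
  lspan O (X - Y).
  have [HP0 HPD _] := gcomp_hatP p.
  move: X; apply: lspan_ind.
  - exists 0; [split=> // | by rewrite subrr].
    by case: ifP => // _; exact: ado0.
  - move=> k X Y [X' [hX uX'] oX] [Y' [hY uY'] oY]; exists (k *: X' + Y').
      split; first exact: HPD.
      move: uX' uY'; case: ifP => _; first exact: ado_comb.
      by move=> -> ->; rewrite scaler0 addr0.
    by rewrite opprD addrACA -scalerBr; exact: zD.
  - move=> X [q q1 uq].
    have hX : hat (gcomp c q) X.
      have [HQ0 HQD _] := gcomp_hatP q.
      by move: X uq; apply: lspan_ind => // X [m _ []].
    have [qp|qp] := eqVneq q p.
      exists X; last by rewrite subrr.
      by rewrite -qp; split=> //; rewrite q1.
    exists 0; first by split=> //; case: ifP => // _; exact: ado0.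
    rewrite subr0; apply: zS; exists q%:~R; last exact: cE_eig.
    by move/eqP; rewrite eqr_int (negPf qp).
have [Y [hY uY] oY] := PP _ uX.
suff -> : Gc ks p = Y by [].
apply/eqP; rewrite -subr_eq0; apply/eqP.
have [HP0 HPD _] := gcomp_hatP p.
apply: (@eig_indep C ch (cbr (cinc E)) p%:~R); [by move=> *; exact: cbrPr | |].
  apply: cE_eig; rewrite -[_ - _]addrC -scaleN1r; apply: HPD => //; exact: Gc_hat.
rewrite -/O (_ : _ - Y = -1 *: (lc G ks - Gc ks p) + (lc G ks - Y)); last first.
  by rewrite scaleN1r opprB addrA subrK.
apply: (zD) oY.
have Os q : q != p -> lspan O (Gc ks q).
  move=> qp; apply: zS; exists q%:~R; last exact: cE_eig (Gc_hat ks q).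
  by move/eqP; rewrite eqr_int (negPf qp).
have -> : lc G ks = \sum_(q <- [:: -2; -1; 0; 1]) Gc ks q.
  case: ks sk {uX Os} => [|k0 [|k1 [|k2 [|k3 [|k4 [|k5 [|k6 [|k7 []]]]]]]]] // _.
  by rewrite cG8_split !big_cons big_nil addr0.
have -> : \sum_(q <- [:: -2; -1; 0; 1]) Gc ks q - Gc ks p =
    \sum_(q <- [:: -2; -1; 0; 1] | q != p) Gc ks q.
  have [ps|ps] := boolP (p \in [:: -2; -1; 0; 1]).
    by rewrite (bigD1_seq p) //= addrAC subrr add0r.
  have -> : Gc ks p = 0.
    move: ps; rewrite !inE !negb_or => /and4P [n1 n2 n3 n4].
    by rewrite /Gc; case ep : (p + 2) => [[|[|[|[|n]]]]|n] //;
      rewrite -[p](addrK 2) ep in n1 n2 n3 n4.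
  rewrite subr0 big_seq_cond [RHS]big_seq_cond; apply: eq_bigl => q.
  by have [->|_] := eqVneq q p; rewrite ?andbT // (negPf ps).
elim/big_ind: _ => // x y hx hy; rewrite -[x]scale1r; exact: zD.
Qed.

Lemma qalgE : qalg J g8 = [set X | exists p t m n, X = Q p t m n].
Proof.
apply/seteqP; split=> [X [/hat_g8 [ks [sk ->]] uX]|_ [p [t [m [n ->]]]]].
  have U := utot_part sk uX.
  case: ks sk uX U => [|k0 [|k1 [|k2 [|k3 [|k4 [|k5 [|k6 [|k7 []]]]]]]]] // _ uX U.
  (* u has no part in degree -2. In degrees -1, 0, 1 the annihilation by powers of ad zbar gives one
     linear equation each: the second coordinate is i times the first. *)
  have /(_ isT) /= := U (-2); rewrite /Gc /= => /cem2_eq0 z0.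
  have /(_ isT) /= := U (-1); rewrite /Gc => /(iter_up he (n := 1) erefl).
  rewrite [iter _ _ _]/= /zv (cbr_mm he) => /cem2_eq0 z2.
  have /(_ isT) /= := U 0; rewrite /Gc => /(iter_up he (n := 2) erefl).
  rewrite [iter _ _ _]/= (iter_zv_0 he) ?mulr1 // => /cem2_eq0 z5.
  have /(_ isT) /= := U 1; rewrite /Gc => /(iter_up he (n := 3) erefl).
  rewrite [iter _ _ _]/= (iter_zv_1 he) ?mulr1 // => /cem2_eq0 z7.
  rewrite /= in z0 z2 z5 z7.
  exists k1, k3, k4, k6; rewrite /Q z0.
  have e2 : k2 = ci * k1 by apply/eqP; rewrite -subr_eq0 -z2; apply/eqP; ring.
  have e7 : k7 = ci * k6.
    move/eqP: z7; rewrite mulf_eq0 pnatr_eq0 /= => /eqP z7.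
    by apply/eqP; rewrite -subr_eq0 -[X in _ == X]oppr0 -z7; apply/eqP; ring.
  have e5 : k5 = ci * k4.
    have /eqP : k4 - 0 + 1 * ci * k5 = 0 by move/eqP: z5; rewrite mulf_eq0 oppr_eq0 pnatr_eq0 /=
      => /eqP.
    rewrite subr0 mul1r addr_eq0 => /eqP ->; have i2 := ci2; ring: i2.
  by rewrite e2 e5 e7.
split; first by apply/hat_g8; eexists; split; last by [].
have [z0 zD zS] := lspanP (\bigcup_(p in [set p : int | -1 <= p]) up J p).
rewrite /Q cG8_split scale0r add0r -[X in utot _ (X + _)]scale1r; apply: (zD).
  apply: zS; exists (-1) => //.
  rewrite (_ : lc _ _ = p *: zv (e1 c) (e2 c) 1 + 0); last first.
    by rewrite addr0 /zv lcZ; congr lc; rewrite /= mulr1 mul1r mulrC.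
  apply: ado_comb; last exact: ado0.
  apply: (ado_mem (m := 1 * ci)); last by apply/eqP => /=; lra.
  by split; [exact: zv_m | exact: (cbr_J_zv he (mulr1 1))].
rewrite -[lc (mc (W0 _ _)) _]scale1r; apply: (zD); apply: zS.
  by exists 0 => //; exact: up_0.
by exists 1 => //; exact: up_1.
Qed.

Local Notation z := (zel J).
Local Notation Eh := (cincl E).
Local Notation M := (Mel J S).
Local Notation N := (Nel J S mu).

Lemma Q_comb (k p t m n p' t' m' n' : C) : k *: Q p t m n + Q p' t' m' n' =
  Q (k * p + p') (k * t + t') (k * m + m') (k * n + n').
Proof.
by rewrite /Q lcZ lcD //; congr lc; congr [:: _; _; _; _; _; _; _; _]; rewrite /=; ring.
Qed.

Lemma Q_0 : Q 0 0 0 0 = 0.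
Proof. by rewrite /Q mulr0 -(lc_nseq0 G 8). Qed.

Lemma E_Q : Eh = Q 0 1 0 0.
Proof. by rewrite /Q mulr0 /= !scale0r scale1r !addr0 !add0r. Qed.

Local Notation hf := (2^-1 : R).

Lemma zE : z = (hf *: e1 c, hf *: e2 c).
Proof.
have [_ J1 _] := hJ; rewrite /zel J1.
rewrite (_ : cincl (e1 c) - ci *: cincl (- e2 c) = ((e1 c, e2 c) : ch)).
  rewrite (_ : 2^-1 = (2^-1)%:C%C); last by rewrite fmorphV rmorph_nat.
  by rewrite cscE /= !scale0r subr0 addr0.
rewrite cscE.
by congr pair => /=; rewrite !(scale0r, scale1r, scaler0, subr0, addr0, opprK, oppr0, add0r).
Qed.

Lemma z_Q : z = Q 2^-1 0 0 0.
Proof.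
rewrite zE /Q lc_cplx (_ : 2^-1 = (2^-1)%:C%C :> C); last by rewrite fmorphV rmorph_nat.
by congr pair; rewrite /= !(mul0r, mul1r, mulr0, subr0, addr0, add0r, scale0r, oppr0).
Qed.

Lemma cext_2 (x y x' y' : c) : cextseq S [:: ((x, y) : ch); (x', y')] =
  (S [:: x; x'] - S [:: y; y'], S [:: x; y'] + S [:: y; x']).
Proof.
rewrite /cextseq /= !cscE; congr pair => /=; rewrite !(scale0r, scale1r, scaler0, subr0, addr0,
  add0r, sub0r) //.
Qed.

Lemma cext_3 (x y x' y' x2 y2 : c) : cextseq S [:: ((x, y) : ch); (x', y'); (x2, y2)] =
  (S [:: x; x'; x2] - S [:: x; y'; y2] - (S [:: y; x'; y2] + S [:: y; y'; x2]),
   S [:: x; x'; y2] + S [:: x; y'; x2] + (S [:: y; x'; x2] - S [:: y; y'; y2])).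
Proof.
rewrite /cextseq /= !cscE; congr pair => /=; rewrite !(scale0r, scale1r, scaler0, subr0, addr0,
  add0r, sub0r) //.
Qed.

Lemma S_Z (k : R) v vs : in_cm1 (v :: vs) -> S ((k *: v) :: vs) = k *: S (v :: vs).
Proof.
move=> H; rewrite -[k *: v]addr0 -(scale0r v) S_comb ?scale0r ?addr0 //.
by move=> w; rewrite !inE orbA orbb -in_cons; exact: H.
Qed.

Lemma S2_Z (k l : R) v w : cm v -> cm w -> S [:: k *: v; l *: w] = (k * l) *: S [:: v; w].
Proof.
move=> hv hw; have hlw : cm (l *: w) by exact: gcompZ.
rewrite S_Z; last exact: in_cm1_2.
rewrite (S_swap (in_cm1_2 hv hlw)) S_Z; last exact: in_cm1_2.
by rewrite scalerA (S_swap (in_cm1_2 hw hv)).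
Qed.

Lemma S3_Z (k l m : R) u v w : cm u -> cm v -> cm w ->
  S [:: k *: u; l *: v; m *: w] = (k * l * m) *: S [:: u; v; w].
Proof.
move=> hu hv hw; have hlv : cm (l *: v) by exact: gcompZ.
have hmw : cm (m *: w) by exact: gcompZ.
rewrite S_Z; last exact: in_cm1_3.
rewrite (S_swap (in_cm1_3 hu hlv hmw)) S_Z; last exact: in_cm1_3.
rewrite (S_swap2 (in_cm1_3 hv hu hmw)) (S_swap (in_cm1_3 hv hmw hu)) S_Z; last exact: in_cm1_3.
rewrite !scalerA (S_swap (in_cm1_3 hw hv hu)) (S_swap2 (in_cm1_3 hv hw hu)).
by rewrite (S_swap (in_cm1_3 hv hu hw)).
Qed.

Lemma mu_Z (k : R) v : cm v -> mu (k *: v) = k *: mu v.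
Proof.
move=> hv; have hkv : cm (k *: v) by exact: gcompZ.
have [g1 _ m1] := hmu hv; have [g2 _ m2] := hmu hkv.
have Bk w : cm w -> B (k *: v) w = k * B v w.
  move=> hw; apply/eqP; rewrite -subr_eq0; apply: contraT => n0.
  move: (hB hkv hw); rewrite lbrZlr (hB hv hw) scalerA => /eqP.
  by rewrite eq_sym -subr_eq0 -scalerBl scaler_eq0 (negPf n0) (negPf em2_neq0).
have H w : cm w -> lbr (mu (k *: v)) w = lbr (k *: mu v) w.
  move=> hw; rewrite lbrZlr m2 // m1 // Bk // S_Z; last exact: in_cm1_2.
  by rewrite scalerDr !scalerA; congr (_ *: _ + _ *: _); ring.
apply: (trans_p he (p := 1)) => //; first exact: gcompZ.
  by apply: H; exact: e1_gcomp.
by apply: H; exact: e2_gcomp.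
Qed.

Lemma chD (x y x' y' : c) : ((x, y) : ch) + (x', y') = (x + x', y + y').
Proof. by []. Qed.
Lemma chN (x y : c) : - ((x, y) : ch) = (- x, - y).
Proof. by []. Qed.
Lemma chZ (k : C) (x y : c) : k *: ((x, y) : ch) =
  (complex.Re k *: x - complex.Im k *: y, complex.Re k *: y + complex.Im k *: x).
Proof. by []. Qed.

(** As [z + zbar = e_1], M is the product [z e_1 = (e_1^2 + i e_1 e_2)/2]. *)
Lemma M_Q : M = Q 0 0 2^-1 0.
Proof.
have c1 := e1_gcomp; have c2 := e2_gcomp.
have e12 := S_swap (in_cm1_2 c2 c1).
rewrite /Mel /zbel zE /cconj /= -!scaleNr !cext_2 !S2_Z // !e12.
rewrite -/(s11 (e1 c)) -/(s12 (e1 c) (e2 c)) -/(s22 (e2 c)).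
rewrite (s11E _ (e2 c)) (s12E (e1 c)) (s22E (e1 c)).
rewrite (_ : Q 0 0 2^-1 0 = lc (mc W0e) [:: 0; hf%:C%C; ci * hf%:C%C; 0]); last first.
  rewrite /Q cG8_split (_ : 2^-1 = hf%:C%C :> C); last by rewrite fmorphV rmorph_nat.
  have -> : lc (mc Wme) [:: 0; ci * 0] = 0 :> ch.
    by rewrite mulr0 -(lc_nseq0 (mc Wme) 2).
  have -> : lc (mc W1e) [:: 0; ci * 0; 0; 0; - 6 * (ci * 0); 0] = 0 :> ch.
    by rewrite !mulr0 -(lc_nseq0 (mc W1e) 6).
  by rewrite scale0r add0r addr0 add0r.
rewrite chD lc_cplx; congr pair; rewrite !(lcZ, lcN, lcD) //; congr lc;
  by congr [:: _; _; _; _]; rewrite /=; field.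
Qed.

(** The cubic part factors as [z (z + zbar)^2 = z e_1^2] and the linear terms add up to
    [- 3i mu e_1], so N is [(e_1^3 + i n)/2]. *)
Lemma N_Q : N = Q 0 0 0 2^-1.
Proof.
have c1 := e1_gcomp; have c2 := e2_gcomp.
have e121 := S_swap2 (in_cm1_3 c1 c2 c1); have e211 := S_swap (in_cm1_3 c2 c1 c1).
have e212 := S_swap (in_cm1_3 c2 c1 c2); have e221 := S_swap2 (in_cm1_3 c2 c2 c1).
rewrite /Nel /zbel zE /cconj /cmap [(_, _).1]/= [(_, _).2]/= -!scaleNr !cext_3 !S3_Z //.
rewrite !mu_Z // !(e121, e221) !(e211, e212) !(e121).
rewrite -/(s111 (e1 c)) -/(s112 (e1 c) (e2 c)) -/(s122 (e1 c) (e2 c)) -/(s222 (e2 c)).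
rewrite (_ : Q 0 0 0 2^-1 = lc (mc W1e)
  [:: hf%:C%C; ci * hf%:C%C; 0; 0; - 6 * (ci * hf%:C%C); 0]); last first.
  rewrite /Q cG8_split (_ : 2^-1 = hf%:C%C :> C); last by rewrite fmorphV rmorph_nat.
  have -> : lc (mc Wme) [:: 0; ci * 0] = 0 :> ch.
    by rewrite mulr0 -(lc_nseq0 (mc Wme) 2).
  have -> : lc (mc W0e) [:: 0; 0; ci * 0; 0] = 0 :> ch.
    by rewrite !mulr0 -(lc_nseq0 (mc W0e) 4).
  by rewrite scale0r !add0r.
have [[f0 f1 f2] f3 f4 f5] := W1E (e1 c) (e2 c).
rewrite f0 f1 f2 f3 f4 f5 lc_cplx !(chZ, chN, chD).
congr pair; rewrite !(lcZ, lcN, lcD) //; congr lc;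
  by congr [:: _; _; _; _; _; _]; rewrite /=; field.
Qed.

Lemma span_E : cspan [set Eh] = [set X | exists t, X = Q 0 t 0 0].
Proof.
apply/seteqP; split.
  apply: lspan_ind; first by exists 0; rewrite Q_0.
    by move=> k _ _ [t ->] [t' ->]; exists (k * t + t'); rewrite Q_comb !mulr0 !addr0.
  by move=> _ ->; exists 1; exact: E_Q.
move=> _ [t ->]; have [z0 zD zS] := lspanP [set Eh].
rewrite (_ : Q 0 t 0 0 = t *: Eh + 0); first by apply: zD => //; exact: zS.
by rewrite E_Q -[in RHS]Q_0 Q_comb; congr Q; ring.
Qed.

Lemma span_EN : cspan [set Eh; N] = [set X | exists t n, X = Q 0 t 0 n].
Proof.
apply/seteqP; split.
  apply: lspan_ind; first by exists 0, 0; rewrite Q_0.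
    move=> k _ _ [t [n ->]] [t' [n' ->]]; exists (k * t + t'), (k * n + n').
    by rewrite Q_comb !mulr0 !addr0.
  by move=> _ [->|->]; [exists 1, 0; exact: E_Q | exists 0, 2^-1; exact: N_Q].
move=> _ [t [n ->]]; have [z0 zD zS] := lspanP [set Eh; N].
rewrite (_ : Q 0 t 0 n = t *: Eh + ((2 * n) *: N + 0)).
  by apply: (zD); [apply: zS; left | apply: (zD); [apply: zS; right |]].
by rewrite E_Q N_Q -Q_0 !Q_comb; congr Q; field.
Qed.

Lemma span_EMN : cspan [set Eh; M; N] = [set X | exists t m n, X = Q 0 t m n].
Proof.
apply/seteqP; split.
  apply: lspan_ind; first by exists 0, 0, 0; rewrite Q_0.
    move=> k _ _ [t [m [n ->]]] [t' [m' [n' ->]]].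
    by exists (k * t + t'), (k * m + m'), (k * n + n'); rewrite Q_comb !mulr0 !addr0.
  by move=> _ [[->|->]|->]; [exists 1, 0, 0; exact: E_Q | exists 0, 2^-1, 0; exact: M_Q
    | exists 0, 0, 2^-1; exact: N_Q].
move=> _ [t [m [n ->]]]; have [z0 zD zS] := lspanP [set Eh; M; N].
rewrite (_ : Q 0 t m n = t *: Eh + ((2 * m) *: M + ((2 * n) *: N + 0))).
  apply: (zD); [by apply: zS; left; left | apply: (zD); [by apply: zS; left; right |]].
  by apply: (zD); [apply: zS; right |].
by rewrite E_Q M_Q N_Q -Q_0 !Q_comb; congr Q; field.
Qed.

Lemma span_zEMN : cspan [set z; Eh; M; N] = [set X | exists p t m n, X = Q p t m n].
Proof.
apply/seteqP; split.
  apply: lspan_ind; first by exists 0, 0, 0, 0; rewrite Q_0.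
    move=> k _ _ [p [t [m [n ->]]]] [p' [t' [m' [n' ->]]]].
    by exists (k * p + p'), (k * t + t'), (k * m + m'), (k * n + n'); rewrite Q_comb.
  by move=> _ [[[->|->]|->]|->]; [exists 2^-1, 0, 0, 0; exact: z_Q | exists 0, 1, 0, 0; exact: E_Q
    | exists 0, 0, 2^-1, 0; exact: M_Q | exists 0, 0, 0, 2^-1; exact: N_Q].
move=> _ [p [t [m [n ->]]]]; have [z0 zD zS] := lspanP [set z; Eh; M; N].
rewrite (_ : Q p t m n = (2 * p) *: z + (t *: Eh + ((2 * m) *: M + ((2 * n) *: N + 0)))).
  apply: (zD); first by apply: zS; left; left; left.
  apply: (zD); [by apply: zS; left; left; right | apply: (zD); [by apply: zS; left; right |]].
  by apply: (zD); [apply: zS; right |].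
by rewrite z_Q E_Q M_Q N_Q -Q_0 !Q_comb; congr Q; field.
Qed.

Lemma conj_Q p t m n : cconj (Q p t m n) = Qb (p^*)%C (t^*)%C (m^*)%C (n^*)%C.
Proof.
rewrite /Q /Qb cconj_lc; congr lc.
case: p t m n => [p p'] [t t'] [m m'] [n n'].
congr [:: _; _; _; _; _; _; _; _];
  by apply/eqP; rewrite eq_complex; apply/andP; split; apply/eqP => /=; ring.
Qed.

Lemma conj_Qb p t m n : cconj (Q (p^*)%C (t^*)%C (m^*)%C (n^*)%C) = Qb p t m n.
Proof. by rewrite conj_Q !conjcK. Qed.

Lemma qbarE : @cconj R c @` qalg J g8 = [set X | exists p t m n, X = Qb p t m n].
Proof.
rewrite qalgE; apply/seteqP; split=> [_ [_ [p [t [m [n ->]]]] <-]|_ [p [t [m [n ->]]]]].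
  by do 4 eexists; exact: conj_Q.
exists (Q (p^*)%C (t^*)%C (m^*)%C (n^*)%C); last exact: conj_Qb.
by do 4 eexists.
Qed.

Lemma q_meet : qalg J g8 `&` (@cconj R c @` qalg J g8) = [set X | exists t, X = Q 0 t 0 0].
Proof.
have dbl (x : C) : ci * x = - ci * x -> x = 0.
  move=> e; have : x = - 2^-1 * ci * (ci * x - - ci * x) by have i2 := ci2; field: i2.
  by rewrite e subrr mulr0.
rewrite qbarE qalgE; apply/seteqP; split.
  move=> _ [[p [t [m [n ->]]]] [p' [t' [m' [n' /cG8_inj]]]]].
  move=> /(_ erefl erefl) [e0 e1' e2' e3 e4 e5 e6].
  have p0 : p = 0 by apply: dbl; rewrite e1' e0.
  have m0 : m = 0 by apply: dbl; rewrite e4 e3.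
  have n0 : n = 0 by apply: dbl; rewrite e6 e5.
  by exists t; rewrite p0 m0 n0.
move=> _ [t ->]; split; first by do 4 eexists.
by exists 0, t, 0, 0; rewrite /Qb !mulr0 /Q !mulr0.
Qed.

(** Only what the Freeman conditions test is made explicit: the coordinates of degrees -2 and -1,
    and the combination of [z4], [z5] that measures the M component. *)
Lemma br_QQb p t m n p' t' m' n' : exists z3 z4 z5 z6 z7,
  [/\ cbr (Q p t m n) (Qb p' t' m' n') =
      lc G [:: - 2 * ci * p * p'; p * t' - t * p' - 3 * ci * p * m' - 3 * ci * m * p';
           ci * p * t' + ci * t * p' + p * m' - m * p' - 2 * p * m' + 2 * m * p'; z3; z4; z5; z6;
             z7] &
      p = 0 -> m = 0 -> z5 + ci * z4 = 6 * n * p'].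
Proof.
do 5 eexists; split.
  rewrite /Q /Qb br_G8; congr lc; have i2 := ci2.
  congr [:: _; _; _; _; _; _; _; _]; try reflexivity.
  all: try by ring: i2.
by have i2 := ci2; move=> -> ->; ring: i2.
Qed.

Lemma sum_q (z1 z2 z3 z4 z5 z6 z7 : C) : setsum [set X | exists p t m n, X = Q p t m n]
  [set X | exists p t m n, X = Qb p t m n] (lc G [:: 0; z1; z2; z3; z4; z5; z6; z7]).
Proof.
exists (Q (2^-1 * (z1 - ci * z2)) z3 (2^-1 * (z4 - ci * z5)) (2^-1 * (z6 - ci * z7))).
  by do 4 eexists.
exists (Qb (2^-1 * (z1 + ci * z2)) 0 (2^-1 * (z4 + ci * z5)) (2^-1 * (z6 + ci * z7))).
  by do 4 eexists.
rewrite /Q /Qb lcD //; congr lc; have i2 := ci2.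
by congr [:: _; _; _; _; _; _; _; _]; rewrite /=; field: i2.
Qed.

(** Without z, degree -1 contains only multiples of zbar, whence the second equation. *)
Lemma sum_q0 (z0 z1 z2 z3 z4 z5 z6 z7 : C) : setsum [set X | exists t m n, X = Q 0 t m n]
  [set X | exists p t m n, X = Qb p t m n] (lc G [:: z0; z1; z2; z3; z4; z5; z6; z7]) <->
  z0 = 0 /\ z2 = - ci * z1.
Proof.
split=> [[_ [t [m [n ->]]] [_ [p' [t' [m' [n' ->]]]]]]|[-> ->]].
  rewrite /Q /Qb lcD // => /cG8_inj -/(_ erefl erefl) [<- <- <- _ _ _ _ _].
  by split; ring.
exists (Q 0 z3 (2^-1 * (z4 - ci * z5)) (2^-1 * (z6 - ci * z7))); first by do 3 eexists.
exists (Qb z1 0 (2^-1 * (z4 + ci * z5)) (2^-1 * (z6 + ci * z7))); first by do 4 eexists.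
rewrite /Q /Qb lcD //; congr lc; have i2 := ci2.
by congr [:: _; _; _; _; _; _; _; _]; rewrite /=; field: i2.
Qed.

Lemma sum_q1 (z0 z1 z2 z3 z4 z5 z6 z7 : C) : setsum [set X | exists t n, X = Q 0 t 0 n]
  [set X | exists p t m n, X = Qb p t m n] (lc G [:: z0; z1; z2; z3; z4; z5; z6; z7]) <->
  [/\ z0 = 0, z2 = - ci * z1 & z5 = - ci * z4].
Proof.
split=> [[_ [t [n ->]] [_ [p' [t' [m' [n' ->]]]]]]|[-> -> ->]].
  rewrite /Q /Qb lcD // => /cG8_inj -/(_ erefl erefl) [<- <- <- _ <- <- _ _].
  by split; ring.
exists (Q 0 z3 0 (2^-1 * (z6 - ci * z7))); first by do 2 eexists.
exists (Qb z1 0 z4 (2^-1 * (z6 + ci * z7))); first by do 4 eexists.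
rewrite /Q /Qb lcD //; congr lc; have i2 := ci2.
by congr [:: _; _; _; _; _; _; _; _]; rewrite /=; field: i2.
Qed.

Let ci_n0 : ci != 0 :> C.
Proof.
apply/eqP => e; have := @ci2; rewrite e mul0r => /eqP.
by rewrite eq_sym oppr_eq0 oner_eq0.
Qed.

(** Bracketing with [Q 1 0 0 0 = 2z] conjugated detects one coordinate at each step: z produces
    e^-2, then M produces z (the condition [4 m = 0]), then N produces M (the condition
    [6 n = 0]). *)
Lemma freeman1 : freeman (qalg J g8) 1 = [set X | exists t m n, X = Q 0 t m n].
Proof.
rewrite /= qbarE qalgE; apply/seteqP; split.
  move=> _ [[p [t [m [n ->]]]] H].
  have /H : exists p t m n, Q 1 0 0 0 = Q p t m n by do 4 eexists.
  have [z3 [z4 [z5 [z6 [z7 [e _]]]]]] := br_QQb p t m n 1 0 0 0.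
  rewrite conj_Q conjc1 !conjc0 e => -[_ [p1 [t1 [m1 [n1 ->]]]] [_ [p2 [t2 [m2 [n2 ->]]]]]].
  rewrite /Q /Qb lcD // => /cG8_inj -/(_ erefl erefl) [e0 _ _ _ _ _ _ _].
  move/esym/eqP: e0; rewrite addr0 mulr1 !mulf_eq0 oppr_eq0 pnatr_eq0 (negPf ci_n0) /= => /eqP ->.
  by do 3 eexists.
move=> _ [t [m [n ->]]]; split; first by do 4 eexists.
move=> _ [p' [t' [m' [n' ->]]]]; rewrite conj_Q.
have [z3 [z4 [z5 [z6 [z7 [-> _]]]]]] := br_QQb 0 t m n (p'^*)%C (t'^*)%C (m'^*)%C (n'^*)%C.
by rewrite mulr0 !mul0r; exact: sum_q.
Qed.

Lemma freeman2 : freeman (qalg J g8) 2 = [set X | exists t n, X = Q 0 t 0 n].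
Proof.
(* Only the outer step of [freeman] is unfolded, so that the previous term can be rewritten. *)
rewrite -[LHS]/([set Z | freeman (qalg J g8) 1 Z /\ forall W, qalg J g8 W ->
  setsum (freeman (qalg J g8) 1) (@cconj R c @` qalg J g8) (cbr Z (cconj W))]).
rewrite freeman1 qbarE qalgE; apply/seteqP; split.
  move=> _ [[t [m [n ->]]] H].
  have /H : exists p t m n, Q 1 0 0 0 = Q p t m n by do 4 eexists.
  have [z3 [z4 [z5 [z6 [z7 [e _]]]]]] := br_QQb 0 t m n 1 0 0 0.
  rewrite conj_Q conjc1 !conjc0 e => /sum_q0 [_ e2].
  have i2 := @ci2; have m0 : 4 * m = 0.
    by move/eqP: e2; rewrite -subr_eq0 => /eqP <-; ring: i2.
  by move/eqP: m0; rewrite mulf_eq0 pnatr_eq0 /= => /eqP ->; do 2 eexists.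
move=> _ [t [n ->]]; split; first by do 3 eexists.
move=> _ [p' [t' [m' [n' ->]]]]; rewrite conj_Q.
have [z3 [z4 [z5 [z6 [z7 [-> _]]]]]] := br_QQb 0 t 0 n (p'^*)%C (t'^*)%C (m'^*)%C (n'^*)%C.
by apply/sum_q0; split; ring.
Qed.

Lemma freeman3 : freeman (qalg J g8) 3 = [set X | exists t, X = Q 0 t 0 0].
Proof.
rewrite -[LHS]/([set Z | freeman (qalg J g8) 2 Z /\ forall W, qalg J g8 W ->
  setsum (freeman (qalg J g8) 2) (@cconj R c @` qalg J g8) (cbr Z (cconj W))]).
rewrite freeman2 qbarE qalgE; apply/seteqP; split.
  move=> _ [[t [n ->]] H].
  have /H : exists p t m n, Q 1 0 0 0 = Q p t m n by do 4 eexists.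
  have [z3 [z4 [z5 [z6 [z7 [e /(_ erefl erefl) e']]]]]] := br_QQb 0 t 0 n 1 0 0 0.
  rewrite conj_Q conjc1 !conjc0 e => /sum_q1 [_ _ e5].
  move/esym/eqP: e'; rewrite e5 mulNr addNr mulr1 mulf_eq0 pnatr_eq0 /= => /eqP ->.
  by eexists.
move=> _ [t ->]; split; first by do 2 eexists.
move=> _ [p' [t' [m' [n' ->]]]]; rewrite conj_Q.
have [z3 [z4 [z5 [z6 [z7 [-> /(_ erefl erefl)]]]]]] := br_QQb 0 t 0 0 (p'^*)%C (t'^*)%C (m'^*)%C
  (n'^*)%C.
rewrite mulr0 mul0r => /eqP; rewrite addr_eq0 -mulNr => /eqP e5.
by apply/sum_q1; split=> //; ring.
Qed.

Lemma up_M : up J 0 M.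
Proof.
rewrite M_Q /Q cG8_split scale0r add0r.
have -> : lc (mc Wme) [:: 0; ci * 0] = 0 :> ch.
  by rewrite mulr0 -(lc_nseq0 (mc Wme) 2).
have -> : lc (mc W1e) [:: 0; ci * 0; 0; 0; - 6 * (ci * 0); 0] = 0 :> ch.
  by rewrite !mulr0 -(lc_nseq0 (mc W1e) 6).
by rewrite addr0 add0r; exact: up_0.
Qed.

Lemma up_N : up J 1 N.
Proof.
rewrite N_Q /Q cG8_split scale0r add0r.
have -> : lc (mc Wme) [:: 0; ci * 0] = 0 :> ch.
  by rewrite mulr0 -(lc_nseq0 (mc Wme) 2).
have -> : lc (mc W0e) [:: 0; 0; ci * 0; 0] = 0 :> ch.
  by rewrite !mulr0 -(lc_nseq0 (mc W0e) 4).
by rewrite !add0r; exact: up_1.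
Qed.

Lemma span_EMM : cspan [set Eh; M; cconj M] =
  [set X | exists t m n, X = lc G [:: 0; 0; 0; t; m; n; 0; 0]].
Proof.
have EG : Eh = lc G [:: 0; 0; 0; 1; 0; 0; 0; 0] by rewrite E_Q /Q mulr0.
have MG : M = lc G [:: 0; 0; 0; 0; 2^-1; ci * 2^-1; 0; 0] by rewrite M_Q /Q mulr0.
have MbG : cconj M = lc G [:: 0; 0; 0; 0; 2^-1; - ci * 2^-1; 0; 0].
  by rewrite M_Q conj_Q /Qb fmorphV rmorph_nat !rmorph0 mulr0.
apply/seteqP; split.
  apply: lspan_ind; first by exists 0, 0, 0; rewrite -(lc_nseq0 G 8).
    move=> k _ _ [t [m [n ->]]] [t' [m' [n' ->]]].
    exists (k * t + t'), (k * m + m'), (k * n + n'); rewrite lcZ lcD //; congr lc.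
    by rewrite /= mulr0 addr0.
  by move=> _ [[->|->]|->]; do 3 eexists; [exact: EG | exact: MG | exact: MbG].
move=> _ [t [m [n ->]]]; have [z0 zD zS] := lspanP [set Eh; M; cconj M].
rewrite (_ : lc _ _ = t *: Eh + ((m - ci * n) *: M + ((m + ci * n) *: cconj M + 0))).
  apply: (zD); [by apply: zS; left; left | apply: (zD); [by apply: zS; left; right |]].
  by apply: (zD); [apply: zS; right |].
rewrite addr0 EG MbG MG !(lcZ, lcD) //; congr lc; have i2 := ci2.
by congr [:: _; _; _; _; _; _; _; _]; rewrite /=; field: i2.
Qed.

Lemma span_NN : cspan [set N; cconj N] =
  [set X | exists m n, X = lc G [:: 0; 0; 0; 0; 0; 0; m; n]].
Proof.
have NG : N = lc G [:: 0; 0; 0; 0; 0; 0; 2^-1; ci * 2^-1] by rewrite N_Q /Q mulr0.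
have NbG : cconj N = lc G [:: 0; 0; 0; 0; 0; 0; 2^-1; - ci * 2^-1].
  by rewrite N_Q conj_Q /Qb fmorphV rmorph_nat !rmorph0 mulr0.
apply/seteqP; split.
  apply: lspan_ind; first by exists 0, 0; rewrite -(lc_nseq0 G 8).
    move=> k _ _ [m [n ->]] [m' [n' ->]].
    exists (k * m + m'), (k * n + n'); rewrite lcZ lcD //; congr lc.
    by rewrite /= mulr0 addr0.
  by move=> _ [->|->]; do 2 eexists; [exact: NG | exact: NbG].
move=> _ [m [n ->]]; have [z0 zD zS] := lspanP [set N; cconj N].
rewrite (_ : lc _ _ = (m - ci * n) *: N + ((m + ci * n) *: cconj N + 0)).
  apply: (zD); first by apply: zS; left.
  by apply: (zD) => //; apply: zS; right.
rewrite addr0 NbG NG !(lcZ, lcD) //; congr lc; have i2 := ci2.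
by congr [:: _; _; _; _; _; _; _; _]; rewrite /=; field: i2.
Qed.

Lemma gpart_0 : gpart g8 0 = Repart (cspan [set Eh; M; cconj M]).
Proof.
have eW x a b : lc W0e [:: x; a; b; 0] =
    lc Ge [:: 0; 0; 0; x; a; b; 0; 0].
  by rewrite /= !scale0r !addr0 !add0r.
rewrite span_EMM; apply/seteqP; split=> [_ /(Gset_part he) [ks [sk ->]]|x [t [m [n]]]].
  have -> : G8f (e1 c) (e2 c) ks 0 = lc W0e [:: ks`_3; ks`_4; ks`_5; 0] by [].
  rewrite eW; exists ((ks`_3)%:C%C), ((ks`_4)%:C%C), ((ks`_5)%:C%C).
  exact: cincl_lc.
rewrite lc_cplx => -[-> _].
by have := Gset_lc0 he (complex.Re t) (complex.Re m) (complex.Re n); rewrite eW.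
Qed.

Lemma gpart_1 : gpart g8 1 = Repart (cspan [set N; cconj N]).
Proof.
have eW p q : lc W1e [:: p; q; 0; 0; - 6 * q; 0] =
    lc Ge [:: 0; 0; 0; 0; 0; 0; p; q].
  rewrite /= /gn /= !scale0r !addr0 !add0r scale1r scalerDr scalerA.
  by rewrite (mulrC q).
rewrite span_NN; apply/seteqP; split=> [_ /(Gset_part he) [ks [sk ->]]|x [m [n]]].
  have -> : G8f (e1 c) (e2 c) ks 1 = lc W1e [:: ks`_6; ks`_7; 0; 0; - 6 * ks`_7; 0] by [].
  rewrite eW; exists ((ks`_6)%:C%C), ((ks`_7)%:C%C).
  exact: cincl_lc.
rewrite lc_cplx => -[-> _].
by have := Gset_lc1 he (complex.Re m) (complex.Re n); rewrite eW.
Qed.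

Lemma gpart_out (p : int) : p < -2 \/ 1 < p -> gpart g8 p = [set 0].
Proof.
move=> hp; apply/seteqP; split=> [x|_ ->]; last by split; [exact: Gset0 | exact: gcomp0].
case: hp => hp [gx hx]; first by rewrite (gcomp_low hp hx).
have : hat (gpart g8 p) (cinc x).
  by split; split=> //; [exact: Gset0 | exact: gcomp0].
by move=> /(hat_gset2 he hp) [].
Qed.

Lemma dim_g8 : has_dim g8 8.
Proof.
exists (fun i : 'I_8 => Ge`_i); split.
  apply/seteqP; split.
    apply: lspan_ind; [exact: Gset0 | exact: Gset_comb | ].
    by move=> _ [i _ <-]; apply: Gset_gen; apply: mem_nth.
  move=> _ [ks [sk ->]].
  exists 8, (fun i : 'I_8 => ks`_i), (fun i : 'I_8 => Ge`_i).
  by split; [move=> i; exists i | exact: lc_sum].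
move=> a; pose ks := [seq a i | i <- enum 'I_8].
have sk : size ks = 8 by rewrite size_map size_enum_ord.
have kE (i : 'I_8) : ks`_i = a i by rewrite (nth_map i) ?size_enum_ord // nth_ord_enum.
under eq_bigr => i _ do rewrite -kE.
rewrite -(lc_sum (vs := G8 (e1 c) (e2 c)) sk) -(lc_nseq0 Ge 8).
move=> /(G8_inj sk) -/(_ erefl) e i.
by rewrite -kE e nth_nseq ltn_ord.
Qed.

(** * Identification with the Lie algebra and the CR structure of the group quotient *)

Definition G8crd (x : c) : seq R := xget [::] [set ks | size ks = 8 /\ x = lc Ge ks].

Lemma G8crdK ks : size ks = 8 -> G8crd (lc Ge ks) = ks.
Proof.
move=> sk; rewrite /G8crd; case: xgetP => [ls _ [sl e]|/(_ ks)]; first exact: (G8_inj sl sk).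
by case.
Qed.

(* [e_2 = - E_21], [e_1 e_2 = - E_11], [n = - 2 E_12] and [E = (E_11 - 2 E_22) / 3] in [gl_2]. *)
Definition phi (x : c) : 'rV[R]_8 := let k := G8crd x in
  mk 7 [:: 3^-1 * k`_3 - k`_5; - 2 * k`_7; - k`_2; - (2 / 3) * k`_3; k`_0; k`_1; k`_4; k`_6].

Lemma g8_lc ks : size ks = 8 -> g8 (lc Ge ks).
Proof. by exists ks. Qed.

Lemma phiE ks : size ks = 8 -> phi (lc Ge ks) =
  mk 7 [:: 3^-1 * ks`_3 - ks`_5; - 2 * ks`_7; - ks`_2; - (2 / 3) * ks`_3; ks`_0; ks`_1; ks`_4;
    ks`_6].
Proof. by move=> sk; rewrite /phi G8crdK. Qed.

Lemma phi_inj0 ks : size ks = 8 -> phi (lc Ge ks) = 0 -> ks = nseq 8 0.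
Proof.
move=> sk; rewrite phiE // => e; have H k : (k <= 7)%N -> co k (0 : 'rV[R]_8) = 0 by rewrite co0.
case: ks sk e => [|k0 [|k1 [|k2 [|k3 [|k4 [|k5 [|k6 [|k7 []]]]]]]]] // _ e.
have K k : (k <= 7)%N -> [:: 3^-1 * k3 - k5; - 2 * k7; - k2; - (2 / 3) * k3; k0; k1; k4; k6]`_k = 0.
  by move=> k7'; rewrite -(@co_mk R 7) // e; exact: H.
have q0 := K 0 isT; have q1 := K 1 isT; have q2 := K 2 isT; have q3 := K 3 isT.
have q4 := K 4 isT; have q5 := K 5 isT; have q6 := K 6 isT; have q7 := K 7 isT.
rewrite /= in q0 q1 q2 q3 q4 q5 q6 q7.
by congr [:: _; _; _; _; _; _; _; _]; lra.
Qed.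

Lemma phi_Lie : Lie_identification g8 (GLG R) phi.
Proof.
split.
- move=> a _ _ [ks [sk ->]] [ls [sl ->]]; rewrite lcZ lcD ?size_map ?sk // !phiE //; last first.
    by rewrite size_ladd ?size_map ?sk.
  case: ks sk => [|k0 [|k1 [|k2 [|k3 [|k4 [|k5 [|k6 [|k7 []]]]]]]]] // _.
  case: ls sl => [|l0 [|l1 [|l2 [|l3 [|l4 [|l5 [|l6 [|l7 []]]]]]]]] // _.
  apply: co_eq => k kn; rewrite coZD !(co_mk _ (n := 7)) //.
  by move: kn; ord_cases k => _ /=; ring.
- by move=> _ [ks [sk ->]] /(phi_inj0 sk) ->; rewrite lc_nseq0.
- apply/seteqP; split=> // v _.
  exists (lc Ge [:: co 4 v; co 5 v; - co 2 v; - (3 / 2) * co 3 v; co 6 v;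
     - (1 / 2) * co 3 v - co 0 v; co 7 v; - (1 / 2) * co 1 v]); first exact: g8_lc.
  rewrite phiE //; apply: co_eq => k kn; rewrite !(co_mk _ (n := 7)) //.
  by move: kn; ord_cases k => _ /=; field.
- move=> _ _ [ks [sk ->]] [ls [sl ->]]; rewrite lie_brE !phiE //.
  case: ks sk => [|k0 [|k1 [|k2 [|k3 [|k4 [|k5 [|k6 [|k7 []]]]]]]]] // _.
  case: ls sl => [|l0 [|l1 [|l2 [|l3 [|l4 [|l5 [|l6 [|l7 []]]]]]]]] // _.
  rewrite (br_88 _ _ _ _ _ _ _ _ _ _ _ _ _ _ _ _ (@lbrDl R c) (@lbrDr R c) _ (table_8 he)) // phiE
    //.
  apply: co_eq => k kn; rewrite /glb !(co_mk _ (n := 7)) //.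
  by move: kn; ord_cases k => _ /=; field.
Qed.

Lemma phi_E : Lie_of (@Hs R) = phi @` [set t *: E | t in setT].
Proof.
have eE t : t *: E = lc Ge [:: 0; 0; 0; t; 0; 0; 0; 0].
  by rewrite /= !scale0r !addr0 !add0r.
have pE t : phi (t *: E) = (3^-1 * t) *: hvec R.
  rewrite eE phiE //; apply: co_eq => k kn; rewrite coZ /hvec !(co_mk _ (n := 7)) //.
  by move: kn; ord_cases k => _ /=; field.
rewrite lie_Hs; apply/seteqP; split=> [_ [s _ <-]|_ [_ [t _ <-] <-]].
  exists ((3 * s) *: E); first by exists (3 * s).
  by rewrite pE mulrA mulVf ?mul1r // pnatr_eq0.
by exists (3^-1 * t) => //; rewrite pE.
Qed.

(** The coordinates of the frame are adapted to g: the orbit map only forgets the coefficient of E,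
    that of index 3. *)
Lemma ev_phi ks : size ks = 8 ->
  tmap ((@actS R)^~ (xoS R)) (lone (GLG R)) (phi (lc Ge ks)) =
  Fr (xo R) (mk 6 [:: ks`_0; ks`_1; ks`_2; ks`_4; ks`_5; ks`_6; ks`_7]).
Proof.
move=> sk; rewrite tmap_orbit phiE //; congr Fr.
apply: co_eq => k kn; rewrite /evY !(co_mk _ (n := 6)) // !(co_mk _ (n := 7)) //.
by move: kn; ord_cases k => _ /=; field.
Qed.

Lemma CR_alg : CR_algebra_is J g8 (@actS R) (xoS R) (@XD R) (@XJ R) phi.
Proof.
have oX : OmX (xo R) := @xo_subproof R.
have xE : val (xoS R) = xo R by [].
split.
- apply/seteqP; split=> // V _; set Y := Th (xo R) V.
  exists (lc Ge [:: co 0 Y; co 1 Y; co 2 Y; 0; co 3 Y; co 4 Y; co 5 Y; co 6 Y]).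
    exact: g8_lc.
  rewrite ev_phi // -[RHS](ThK _ oX); congr Fr; apply: co_eq => k kn; rewrite (co_mk _ (n := 6)) //.
  by move: kn; nat_cases k.
- move=> _ [ks [sk ->]]; rewrite ev_phi // /go_alg.
  case: ks sk => [|k0 [|k1 [|k2 [|k3 [|k4 [|k5 [|k6 [|k7 []]]]]]]]] // _.
  split=> [|[_]].
    rewrite -[RHS](Fr0 (xo R)) => /(Fr_inj oX) e.
    have K k : (k <= 6)%N -> [:: k0; k1; k2; k4; k5; k6; k7]`_k = 0.
      by move=> kn; rewrite -(@co_mk R 6) // e co0.
    have q0 := K 0 isT; have q1 := K 1 isT; have q2 := K 2 isT; have q3 := K 3 isT.
    have q4 := K 4 isT; have q5 := K 5 isT; have q6 := K 6 isT.
    rewrite /= in q0 q1 q2 q3 q4 q5 q6.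
    split; first exact: g8_lc.
    rewrite q0 q1 q2 q3 q4 q5 q6 qalgE; exists 0, (k3%:C%C), 0, 0.
    rewrite /Q !mulr0; exact: (cincl_lc Ge [:: 0; 0; 0; k3; 0; 0; 0; 0]).
  rewrite qalgE => -[p [t [m [n]]]]; rewrite cincl_lc => /cG8_inj -/(_ erefl erefl).
  move=> e; have L j := congr1 (fun l => l`_j) e.
  have z0 := congr1 (@complex.Re R) (L 0).
  (* A real vector of q has real coordinates [x] and [y = i x] along each pair, so both vanish and
     only E is left. *)
  have K (x y : R) q : x%:C%C = q -> y%:C%C = ci * q -> x = 0 /\ y = 0.
    move=> <- /eqP; rewrite eq_complex /= => /andP [/eqP r1 /eqP r2].
    by split; lra.
  have [-> ->] := K _ _ _ (L 1) (L 2).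
  have [-> ->] := K _ _ _ (L 4) (L 5).
  have [-> ->] := K _ _ _ (L 6) (L 7).
  rewrite -[RHS](Fr0 (xo R)); congr Fr; apply: co_eq => k kn.
  rewrite (co_mk _ (n := 6)) // co0; move: z0 => /= ->.
  by move: kn; nat_cases k.
- apply/seteqP; split=> [[V W]|_ [X + <-]].
    rewrite -[V](ThK _ oX) -[W](ThK _ oX) -xE => /D10P [Y0 ->]; rewrite xE.
    move: (Th (xo R) V) Y0 => Y Y0.
    (* The real part of [(p, ip)] is [(Re p, - Im p)], which has to be a pair of coordinates of
       [Y]. *)
    exists (Q (Complex (co 1 Y) (- co 2 Y)) 0 (Complex (co 3 Y) (- co 4 Y)) (Complex (co 5 Y) (-
      co 6 Y))).
      by rewrite qalgE; do 4 eexists.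
    rewrite /Q lc_cplx; congr pair; rewrite [LHS]ev_phi //; congr Fr;
      apply: co_eq => k kn; rewrite ?coN /J0 !(co_mk _ (n := 6)) //.
      by move: kn; ord_cases k => _ /=; rewrite ?Y0; ring.
    by move: kn; ord_cases k => _ /=; ring.
  rewrite qalgE => -[[p p'] [[t t'] [[m m'] [[n n'] ->]]]].
  rewrite /Q lc_cplx.
  suff D ks ls : size ks = 8 -> size ls = 8 ->
      D10 (@XD R) (@XJ R) (xoS R)
        (Fr (xo R) (mk 6 [:: ks`_0; ks`_1; ks`_2; ks`_4; ks`_5; ks`_6; ks`_7]),
         Fr (xo R) (mk 6 [:: ls`_0; ls`_1; ls`_2; ls`_4; ls`_5; ls`_6; ls`_7])) ->
      D10 (@XD R) (@XJ R) (xoS R) (cmap (fun Y => tmap ((@actS R)^~ (xoS R)) (lone (GLG R)) (phi Y))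
        (lc Ge ks, lc Ge ls)).
    apply: D => //; rewrite -xE; apply/D10P.
    split; first by rewrite co_mk.
    apply: co_eq => k kn; rewrite coN /J0 !(co_mk _ (n := 6)) //.
    by move: kn; ord_cases k => _ /=; ring.
  by move=> sk sl; rewrite -(ev_phi sk) -(ev_phi sl).
Qed.

Lemma g8_CR : globally_defined_CR J g8 8 7 3 [set t *: E | t in setT].
Proof.
exists (GLG R), (@Hs R), (Xm R), (@actS R), (xoS R), phi, (@XD R), (@XJ R).
split; first exact: GLG_homogeneous.
split; [exact: phi_Lie | exact: phi_E | split | exact: CR_alg | exact: Xm_nondegenerate].
  exact: Xm_CR_structure.
exact: Xm_invariant.
Qed.

End Data.
End Contact.

Theorem theorem6p1 (R : realType) (c : contactAlgebra R)
    (E J : c) (B : c -> c -> R) (S : seq c -> c) (mu : c -> c)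
    (hE : grading_element E) (hJ : is_complex_structure J)
    (hB : is_symplectic_form B) (hS : symmetric_product B S)
    (hmu : is_mu1 B S E mu) :
  let z := zel J in
  let Eh := cincl E in
  let M := Mel J S in
  let N := Nel J S mu in
  exists g : set c,
    (maximal_model J E (core_m J) g /\
     forall g', maximal_model J E (core_m J) g' -> isomorphic_models J g g') /\
    [/\ forall p : int, p < -2 \/ 1 < p -> gpart g p = [set 0],
        forall p : int, p = -2 \/ p = -1 -> gpart g p = gcomp c p,
        gpart g 0 = Repart (cspan [set Eh; M; cconj M]),
        gpart g 1 = Repart (cspan [set N; cconj N]) &
        [/\ has_dim g 8, up J 0 M & up J 1 N]] /\
    [/\ freeman (qalg J g) 0 = qalg J g /\
        qalg J g = cspan [set z; Eh; M; N],
        freeman (qalg J g) 1 = cspan [set Eh; M; N],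
        freeman (qalg J g) 2 = cspan [set Eh; N],
        freeman (qalg J g) 3 = qalg J g `&` (@cconj R c @` qalg J g) &
        qalg J g `&` (@cconj R c @` qalg J g) = cspan [set Eh]] /\
    globally_defined_CR J g 8 7 3 [set t *: E | t in setT].
Proof.
move=> z Eh M N; exists (Gset E S mu (e1 c) (e2 c)); split; [|split; [|split]].
- split; first exact: (Gset_maximal hE hJ hB hS hmu).
  by move=> g' [hg' _]; exact: (Gset_unique hE hJ hB hS hmu).
- split; [exact: (gpart_out hE hJ hS hmu) | | exact: (gpart_0 hE hJ hS hmu)
    | exact: (gpart_1 hE hJ hB hS hmu) |].
    by move=> p [->|->]; apply: (Gset_neg _ _ _ (adapted_e hJ)).
  split; [exact: (dim_g8 hE hJ hB hS hmu) | exact: (up_M mu hE hJ hB hS)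
    | exact: (up_N hE hJ hB hS hmu)].
- have qE := qalgE hE hJ hB hS hmu; have qm := q_meet hE hJ hB hS hmu.
  split.
  + by split=> //; rewrite qE (span_zEMN hJ hB hS hmu).
  + by rewrite (freeman1 hE hJ hB hS hmu) (span_EMN hJ hB hS hmu).
  + by rewrite (freeman2 hE hJ hB hS hmu) (span_EN hJ hB hS hmu).
  + by rewrite (freeman3 hE hJ hB hS hmu) qm.
  + by rewrite qm (span_E E S mu).
- exact: (g8_CR hE hJ hB hS hmu).
Qed.
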